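(* Let $n\ge1$ and $\alpha>-1$. The $C^*$-algebra generated by the Toeplitz operators $T_a$ on $\mathcal{H}^2_\alpha(\mathbb{B}^n)$ with symmetric separately radial symbols $a\in L^\infty(\mathbb{B}^n)$ is commutative. More precisely, for every symmetric separately radial $a\in L^\infty(\mathbb{B}^n)$, $T_a$ is unitarily equivalent to $$RT_aR^*=\bigoplus_{\iota\in\mathcal{I}}\gamma_a(\iota)\,I|_{\ell^2(\mathcal{I}_\iota)}\quad\text{acting on}\quad \ell^2(\mathbb{Z}_+^n)=\bigoplus_{\iota\in\mathcal{I}}\ell^2(\mathcal{I}_\iota),$$ where $R:\mathcal{H}^2_\alpha(\mathbb{B}^n)\to\ell^2(\mathbb{Z}_+^n)$ is the unitary map $R(f)=(\langle f,e_m\rangle)_{m\in\mathbb{Z}_+^n}$ and, for $\iota\in\mathcal{I}$, $$\gamma_a(\iota)=\frac{2^n\,\Gamma(n+|\iota|+\alpha+1)}{\iota!\,\Gamma(\alpha+1)}\int_{\tau(\mathbb{B}^n)}a(r)\,r^{2\iota}(1-|r|^2)^\alpha\prod_{k=1}^n r_k\,dr_k .$$ In particular, $RT_aR^*$ is the operator of multiplication on $\ell^2(\mathbb{Z}_+^n)$ by the function $$\gamma_a(m)=\frac{2^n\,\Gamma(n+|m|+\alpha+1)}{m!\,\Gamma(\alpha+1)}\int_{\tau(\mathbb{B}^n)}a(r)\,r^{2m}(1-|r|^2)^\alpha\prod_{k=1}^n r_k\,dr_k,\qquad m\in\mathbb{Z}_+^n,$$ and this function satisfies $\gamma_a(m)=\gamma_a(\iota)$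 for all $\iota\in\mathcal{I}$ and all $m\in\mathcal{I}_\iota$.
   Context: $\mathbb{Z}_+=\{0,1,2,\dots\}$; for $m\in\mathbb{Z}_+^n$, $|m|=m_1+\cdots+m_n$, $m!=m_1!\cdots m_n!$, $z^m=z_1^{m_1}\cdots z_n^{m_n}$, and $r^{2m}=r_1^{2m_1}\cdots r_n^{2m_n}$ for $r\in\mathbb{R}^n$; $|r|^2=r_1^2+\cdots+r_n^2$. $\mathbb{B}^n=\{z\in\mathbb{C}^n:|z|<1\}$ is the open unit ball and $\tau(\mathbb{B}^n)=\{r=(|z_1|,\dots,|z_n|):z\in\mathbb{B}^n\}$. For $\alpha>-1$, $dv_\alpha(z)=c_\alpha(1-|z|^2)^\alpha\,dv(z)$ with $c_\alpha=\frac{\Gamma(n+\alpha+1)}{n!\,\Gamma(\alpha+1)}$ and $dv$ Lebesgue measure normalized by $v(\mathbb{B}^n)=1$ (so $v_\alpha$ is a probability measure). $\mathcal{H}^2_\alpha(\mathbb{B}^n)$ is the weighted Bergman space of holomorphic functions in $L^2(\mathbb{B}^n,v_\alpha)$, with the $L^2$ inner product $\langle\cdot,\cdot\rangle$. It has the orthonormal basis $(e_m)_{m\in\mathbb{Z}_+^n}$, $e_m(z)=\sqrt{\frac{\Gamma(n+|m|+\alpha+1)}{m!\,\Gamma(n+\alpha+1)}}\,z^m$. For $a\in L^\infty(\mathbb{B}^n)$ the Toeplitz operator $T_a$ on $\mathcal{H}^2_\alpha(\mathbb{B}^n)$ is $T_a(f)(z)=\int_{\mathbb{B}^n}a(w)f(w)(1-z\cdot\overline{w})^{-(n+\alpha+1)}\,dv_\alpha(w)$.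 A function $a\in L^\infty(\mathbb{B}^n)$ is symmetric separately radial if $a(z)=a(|z_1|,\dots,|z_n|)$ and $a(\sigma(z))=a(z)$ for every $\sigma\in S_n$, for almost every $z\in\mathbb{B}^n$, where $\sigma(z)=(z_{\sigma(1)},\dots,z_{\sigma(n)})$ and $S_n$ is the symmetric group of $\{1,\dots,n\}$. Such $a$ is regarded as a function $a(r)$ on $\tau(\mathbb{B}^n)$. $\mathcal{I}=\{\iota\in\mathbb{Z}_+^n:\iota_1\ge\cdots\ge\iota_n\ge0\}$, and for $\iota\in\mathcal{I}$, $\mathcal{I}_\iota=\{(\iota_{\sigma(1)},\dots,\iota_{\sigma(n)}):\sigma\in S_n\}$. *)

(* Defs.v *)
From HB Require Import structures.
From mathcomp Require Import all_boot all_order all_algebra all_fingroup.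
From mathcomp Require Import finmap complex.
From mathcomp Require Import all_classical all_reals all_analysis.
From mathcomp Require Import measurable_realfun.
From mathcomp Require Import ring lra.

Set Implicit Arguments.
Unset Strict Implicit.
Unset Printing Implicit Defensive.

Import Order.TTheory GRing.Theory Num.Theory numFieldNormedType.Exports.
Local Open Scope classical_set_scope.
Local Open Scope ring_scope.
Local Open Scope complex_scope.

Notation normc := ComplexField.Normc.normc.

Section sigma_finite_product.
Context d1 d2 (T1 : measurableType d1) (T2 : measurableType d2) (R : realType).
Variables (m1 : {sigma_finite_measure set T1 -> \bar R})
          (m2 : {sigma_finite_measure set T2 -> \bar R}).

(* Restates [\x] so that the sigma-finite structure is found by inference: on
   [\x] itself the library only provides it for finite factors. *)
Definition prod_measure := (m1 \x m2)%E.

HB.instance Definition _ := Measure.copy prod_measure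
  (lebesgue_integral_fubini_product_measure1__canonical__measure_function_Measure
    m1 m2).

Let prod_measure_sigma_finite : sigma_finite setT prod_measure.
Proof.
have /sigma_finiteP[F [FT ndF Foo]] := sigma_finiteT m1.
have /sigma_finiteP[G [GT ndG Goo]] := sigma_finiteT m2.
exists (fun k => F k `*` G k).
  apply/esym/seteqP; split=> // -[x y] _.
  have [i _ Fi] : (\bigcup_i F i) x by rewrite -FT.
  have [j _ Gj] : (\bigcup_i G i) y by rewrite -GT.
  exists (maxn i j) => //; split => /=.
    by move: Fi; exact/subsetPset/ndF/leq_maxl.
  by move: Gj; exact/subsetPset/ndG/leq_maxr.
move=> k; have [mF Fkoo] := Foo k; have [mG Gkoo] := Goo k.
split; first exact: measurableX.
by rewrite [ltLHS]product_measure1E// lte_mul_pinfty// ge0_fin_numE.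
Qed.

HB.instance Definition _ := @Measure_isSigmaFinite.Build _ _ _ prod_measure
  prod_measure_sigma_finite.

End sigma_finite_product.

Section power_measure.
Context d (T : measurableType d) (R : realType).
Variable mu : {sigma_finite_measure set T -> \bar R}.

Definition tcons n (p : T * n.-tuple T) : n.+1.-tuple T := [tuple of p.1 :: p.2].

Definition tuncons n (t : n.+1.-tuple T) : T * n.-tuple T :=
  (thead t, [tuple of behead t]).

Lemma measurable_tcons n : measurable_fun setT (@tcons n).
Proof.
exact: measurable_cons.
Qed.

Lemma measurable_tuncons n : measurable_fun setT (@tuncons n).
Proof.
apply/measurable_fun_pairP; split => /=.
- exact: measurable_tnth.
- exact: measurable_behead.
Qed.

Section step.
Variables (n : nat) (nu : {sigma_finite_measure set (n.-tuple T) -> \bar R}).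

Definition pow_step := pushforward (prod_measure mu nu) (@tcons n).

HB.instance Definition _ := Measure.copy pow_step
  (measure_function_pushforward__canonical__measure_function_Measure
    (prod_measure mu nu) (@measurable_tcons n)).

Let pow_step_sigma_finite : sigma_finite setT pow_step.
Proof.
have [F FT Foo] := sigma_finiteT (prod_measure mu nu).
exists (fun k => @tuncons n @^-1` F k).
  by rewrite -preimage_bigcup -FT preimage_setT.
move=> k; have [mFk Fkoo] := Foo k.
split; first by rewrite -[X in measurable X]setTI; exact: measurable_tuncons.
rewrite /pow_step /pushforward -comp_preimage.
have -> : @tuncons n \o @tcons n = id.
  by apply/funext => -[x t]; congr (_, _); apply/val_inj.
by rewrite preimage_id.
Qed.

HB.instance Definition _ := @Measure_isSigmaFinite.Build _ _ _ pow_step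
  pow_step_sigma_finite.

End step.

Fixpoint pow_measure (n : nat) :
    {sigma_finite_measure set (n.-tuple T) -> \bar R} :=
  match n with
  | 0 => \d_([tuple] : 0.-tuple T)
  | k.+1 => pow_step (pow_measure k)
  end.

End power_measure.

Section complex_functions.
Context {R : realType}.

Definition complex_measurable d (T : measurableType d) (D : set T)
    (f : T -> R[i]) :=
  measurable_fun D (fun x => complex.Re (f x)) /\
  measurable_fun D (fun x => complex.Im (f x)).

Definition complex_integral d (T : measurableType d)
    (mu : {measure set T -> \bar R}) (D : set T) (f : T -> R[i]) : R[i] :=
  (\int[mu]_(x in D) complex.Re (f x)) +i* (\int[mu]_(x in D) complex.Im (f x)).

(* The unordered sum of an absolutely summable family. *)
Definition real_sum (I : choiceType) (x : I -> R) : R :=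
  fine (\esum_(i in [set: I]) (Num.max (x i) 0)%:E) -
  fine (\esum_(i in [set: I]) (Num.max (- x i) 0)%:E).

Definition complex_sum (I : choiceType) (x : I -> R[i]) : R[i] :=
  real_sum (fun i => complex.Re (x i)) +i* real_sum (fun i => complex.Im (x i)).

(* Principal branch, with argument in ]-pi, pi]. *)
Definition complex_arg (u : R[i]) : R :=
  if 0 <= complex.Im u then acos (complex.Re u / normc u)
  else - acos (complex.Re u / normc u).

Definition complex_powR (u : R[i]) (s : R) : R[i] :=
  (normc u `^ s)%:C * (cos (s * complex_arg u) +i* sin (s * complex_arg u)).

Definition Gamma (x : R) : R :=
  \int[lebesgue_measure]_(t in `]0, +oo[) (t `^ (x - 1) * expR (- t)).

End complex_functions.

Section operators.
Context {R : realType}.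
Implicit Types H K : lmodType R[i].

Definition hnorm H (ip : H -> H -> R[i]) (x : H) : R :=
  Num.sqrt (complex.Re (ip x x)).

Definition bounded_operator H K (ipH : H -> H -> R[i]) (ipK : K -> K -> R[i])
    (T : H -> K) :=
  linear T /\ exists M : R, forall x, hnorm ipK (T x) <= M * hnorm ipH x.

Definition opnorm H K (ipH : H -> H -> R[i]) (ipK : K -> K -> R[i])
    (T : H -> K) : R :=
  sup [set hnorm ipK (T x) | x in [set x | hnorm ipH x <= 1]].

Definition adjoint H K (ipH : H -> H -> R[i]) (ipK : K -> K -> R[i])
    (T : H -> K) (S : K -> H) :=
  forall x y, ipK (T x) y = ipH x (S y).

Definition unitary H K (ipH : H -> H -> R[i]) (ipK : K -> K -> R[i])
    (U : H -> K) :=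
  [/\ linear U, bijective U & forall x y, ipK (U x) (U y) = ipH x y].

Definition cstar_subalgebra H (ip : H -> H -> R[i]) (A : set (H -> H)) :=
  [/\ A `<=` bounded_operator ip ip, A (fun=> 0)
    & [/\ forall c S T, A S -> A T -> A (fun x => c *: S x + T x),
          forall S T, A S -> A T -> A (S \o T),
          forall S T, A S -> bounded_operator ip ip T -> adjoint ip ip S T -> A T
        & forall T, bounded_operator ip ip T ->
            (forall e : R, 0 < e ->
               exists2 S, A S & opnorm ip ip (fun x => T x - S x) < e) ->
            A T]].

Definition cstar_generated H (ip : H -> H -> R[i]) (G : set (H -> H)) :=
  smallest (cstar_subalgebra ip) G.

Definition closed_subspace H (ip : H -> H -> R[i]) (V : set H) :=
  [/\ V 0, forall c x y, V x -> V y -> V (c *: x + y)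
    & forall x, (forall e : R, 0 < e -> exists2 y, V y & hnorm ip (x - y) < e) ->
        V x].

(* [x] is the norm-convergent unordered sum of the [y i], [i] in [P]. *)
Definition sums_to H (ip : H -> H -> R[i]) (I : choiceType) (P : set I)
    (y : I -> H) (x : H) :=
  forall e : R, 0 < e -> exists F0 : {fset I}, (forall i, i \in F0 -> P i) /\
    forall F : {fset I}, (forall i, i \in F -> P i) -> (F0 `<=` F)%fset ->
      hnorm ip (x - \sum_(i <- F) y i) < e.

Definition hilbert_direct_sum H (ip : H -> H -> R[i]) (I : choiceType)
    (P : set I) (V : I -> set H) :=
  [/\ forall i, P i -> closed_subspace ip (V i),
      forall i j x y, P i -> P j -> i <> j -> V i x -> V j y -> ip x y = 0
    & forall x, exists2 y, forall i, P i -> V i (y i) & sums_to ip P y x].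

(* [S] is the direct sum of the operators [T i] acting on the [V i]. *)
Definition direct_sum_operator H (ip : H -> H -> R[i]) (I : choiceType)
    (P : set I) (V : I -> set H) (T : I -> H -> H) (S : H -> H) :=
  [/\ bounded_operator ip ip S, forall i x, P i -> V i x -> V i (T i x)
    & forall x y, (forall i, P i -> V i (y i)) -> sums_to ip P y x ->
        sums_to ip P (fun i => T i (y i)) (S x)].

End operators.

Section ell2.
Context (R : realType) (I : choiceType).

Definition ell2_fun : {pred I -> R[i]^o} := mem [set x : I -> R[i]^o |
  (\esum_(i in [set: I]) (normc (x i) ^+ 2)%:E < +oo)%E].

Lemma normc2E (z : R[i]) : normc z ^+ 2 = complex.Re z ^+ 2 + complex.Im z ^+ 2.
Proof. by case: z => a b; rewrite /= sqr_sqrtr// addr_ge0 ?sqr_ge0. Qed.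

Lemma normc2_lin (a z w : R[i]) : normc (a * z + w) ^+ 2 <=
  2 * normc a ^+ 2 * normc z ^+ 2 + 2 * normc w ^+ 2.
Proof.
rewrite !normc2E; case: a z w => [a b] [c d] [e f] /=.
have H (x y : R) : (x + y) ^+ 2 <= 2 * x ^+ 2 + 2 * y ^+ 2.
  rewrite -subr_ge0; apply: le_trans (sqr_ge0 (x - y)) _.
  by rewrite le_eqVlt; apply/orP; left; apply/eqP; ring.
apply: le_trans (lerD (H _ _) (H _ _)) _.
by rewrite le_eqVlt; apply/orP; left; apply/eqP; ring.
Qed.

Lemma ge0_normc2 (c : R) (z : R[i]) : 0 <= c -> 0 <= c * normc z ^+ 2.
Proof. by move=> c0; rewrite mulr_ge0 ?sqr_ge0. Qed.

Lemma ell2_submod_closed : submod_closed ell2_fun.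
Proof.
split=> [|a x y]; rewrite !inE /=.
  rewrite esum1 ?ltry// => i _; congr EFin.
  by rewrite expr0n addr0 sqrtr0 expr0n.
move=> hx hy.
apply: (@le_lt_trans _ _ (\esum_(i in [set: I])
   ((2 * normc a ^+ 2 * normc (x i) ^+ 2)%:E + (2 * normc (y i) ^+ 2)%:E))%E).
  by apply: le_esum => i _; rewrite -EFinD lee_fin; exact: normc2_lin.
rewrite esumD; last 2 first.
  by move=> i _; rewrite lee_fin !ge0_normc2 ?ler0n.
  by move=> i _; rewrite lee_fin !ge0_normc2 ?ler0n.
have h c (z : I -> R[i]^o) : 0 <= c ->
    (\esum_(i in [set: I]) (normc (z i) ^+ 2)%:E < +oo ->
     \esum_(i in [set: I]) (c * normc (z i) ^+ 2)%:E < +oo)%E.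
  move=> c0 hz; apply: (@le_lt_trans _ _
    (c%:E * \esum_(i in [set: I]) (normc (z i) ^+ 2)%:E)%E).
    apply: ge_ereal_sup => _ [A fA <-].
    under eq_fsbigr do rewrite EFinM.
    rewrite -ge0_mule_fsumr; last by move=> i; rewrite lee_fin sqr_ge0.
    by rewrite lee_wpmul2l ?lee_fin// esum_ge//; exists A.
  by rewrite lte_mul_pinfty.
by rewrite lte_add_pinfty// h// ge0_normc2 ?ler0n.
Qed.

HB.instance Definition _ := GRing.isSubmodClosed.Build _ _ ell2_fun
  ell2_submod_closed.

Record ell2 := Ell2 { ell2_val :> I -> R[i]^o; _ : ell2_val \in ell2_fun }.

HB.instance Definition _ := [isSub for ell2_val].
HB.instance Definition _ := [Choice of ell2 by <:].
HB.instance Definition _ := [SubChoice_isSubLmodule of ell2 by <:].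

Definition ell2_ip (x y : ell2) : R[i] :=
  complex_sum (fun i => x i * (y i)^*).

End ell2.

Section ball.
Context {R : realType} {n : nat}.
Implicit Type z w : 'rV[R[i]]_n.

Definition norm2 z : R := \sum_(j < n) normc (z 0 j) ^+ 2.

Definition ball1 : set 'rV[R[i]]_n := [set z | norm2 z < 1].

Definition dotc z w : R[i] := \sum_(j < n) z 0 j * (w 0 j)^*.

(* C^n is measured through its real coordinates, as n-tuples of pairs (Re, Im). *)
Definition of_coords
    (t : n.-tuple (measurableTypeR R * measurableTypeR R)%type) : 'rV[R[i]]_n :=
  \row_j ((tnth t j).1 +i* (tnth t j).2).

Definition lebesgue_C : {sigma_finite_measure set _ -> \bar R} :=
  pow_measure (prod_measure (@lebesgue_measure R) (@lebesgue_measure R)) n.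

Definition lebesgue_R : {sigma_finite_measure set _ -> \bar R} :=
  pow_measure (@lebesgue_measure R) n.

Definition ball_coords := of_coords @^-1` ball1.

Definition ball_measurable (f : 'rV[R[i]]_n -> R[i]) :=
  complex_measurable ball_coords (f \o of_coords).

End ball.

Section bergman.
Context {R : realType} {n : nat} (alpha : R).
Implicit Type f g : 'rV[R[i]]_n -> R[i]^o.

Definition c_alpha : R :=
  Gamma (n%:R + alpha + 1) / (n`!%:R * Gamma (alpha + 1)).

(* The density of v_alpha with respect to (unnormalized) Lebesgue measure. *)
Definition dv_alpha (z : 'rV[R[i]]_n) : R :=
  c_alpha * (1 - norm2 z) `^ alpha / fine (@lebesgue_C R n ball_coords).

Definition int_alpha f : R[i] :=
  complex_integral (@lebesgue_C R n) ball_coords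
    (fun t => f (of_coords t) * (dv_alpha (of_coords t))%:C).

Definition ip_alpha f g : R[i] := int_alpha (fun z => f z * (g z)^*).

Definition L2_alpha f := ball_measurable f /\
  (\int[@lebesgue_C R n]_(t in ball_coords)
    (normc (f (of_coords t)) ^+ 2 * dv_alpha (of_coords t))%:E < +oo)%E.

Definition holomorphic f := forall z : 'rV[R[i]]_n, ball1 z ->
  differentiable f (z : ('rV[R[i]]_n : normedModType R[i])).


Lemma norm2_coords t : @norm2 R n (of_coords t) =
  \sum_(j < n) ((tnth t j).1 ^+ 2 + (tnth t j).2 ^+ 2).
Proof. by apply: eq_bigr => j _; rewrite normc2E mxE. Qed.

Lemma measurable_norm2_coords : measurable_fun setT (norm2 \o @of_coords R n).
Proof.
rewrite (_ : _ \o _ = fun t => \sum_(j < n)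
    ((tnth t j).1 ^+ 2 + (tnth t j).2 ^+ 2)); last first.
  by apply/funext => t; rewrite /= norm2_coords.
apply: measurable_sum => j; apply: measurable_funD; apply: measurable_funX.
- exact: (measurableT_comp measurable_fst (measurable_tnth j)).
- exact: (measurableT_comp measurable_snd (measurable_tnth j)).
Qed.

Lemma measurable_ball_coords : measurable (@ball_coords R n).
Proof.
rewrite (_ : ball_coords = (norm2 \o @of_coords R n) @^-1` `]-oo, 1[%classic).
  rewrite -[X in measurable X]setTI; apply: measurable_norm2_coords => //.
by apply/seteqP; split => t; rewrite /ball_coords /ball1 /= in_itv.
Qed.

Lemma measurable_dv_alpha : measurable_fun setT (dv_alpha \o @of_coords R n).
Proof.
apply: measurable_funM => //; apply: measurable_funM => //.
apply: (measurableT_comp (measurable_powR alpha)).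
by apply: measurable_funB => //; exact: measurable_norm2_coords.
Qed.

Lemma Gamma_ge0 (x : R) : 0 <= Gamma x.
Proof.
apply: fine_ge0; apply: integral_ge0 => t _.
by rewrite lee_fin mulr_ge0 ?powR_ge0 ?expR_ge0.
Qed.

Lemma dv_alpha_ge0 z : 0 <= dv_alpha z.
Proof.
rewrite /dv_alpha !mulr_ge0 ?powR_ge0 ?invr_ge0 ?mulr_ge0 ?Gamma_ge0 ?ler0n//.
by rewrite fine_ge0// measure_ge0.
Qed.

Lemma ball_measurable_lin (a : R[i]) f g :
  ball_measurable f -> ball_measurable g -> ball_measurable (a *: f + g).
Proof.
move=> [mfr mfi] [mgr mgi]; split.
- apply: (eq_measurable_fun (fun t => complex.Re a * complex.Re (f (of_coords t))
    - complex.Im a * complex.Im (f (of_coords t)) + complex.Re (g (of_coords t)))).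
    move=> t _ /=; rewrite -[(a *: f + g) _]/(a * f _ + g _).
    by case: a (f _) (g _) => [? ?] [? ?] [].
  by apply: measurable_funD => //; apply: measurable_funB; exact: measurable_funM.
- apply: (eq_measurable_fun (fun t => complex.Re a * complex.Im (f (of_coords t))
    + complex.Im a * complex.Re (f (of_coords t)) + complex.Im (g (of_coords t)))).
    move=> t _ /=; rewrite -[(a *: f + g) _]/(a * f _ + g _).
    by case: a (f _) (g _) => [? ?] [? ?] [].
  by apply: measurable_funD => //; apply: measurable_funD; exact: measurable_funM.
Qed.

Lemma L2_alpha_lin (a : R[i]) f g :
  L2_alpha f -> L2_alpha g -> L2_alpha (a *: f + g).
Proof.
move=> [mf fI] [mg gI]; split; first exact: ball_measurable_lin.
have mB := measurable_ball_coords.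
have mh (h : 'rV[R[i]]_n -> R[i]^o) : ball_measurable h ->
    measurable_fun ball_coords (fun t =>
      (normc (h (of_coords t)) ^+ 2 * dv_alpha (of_coords t))%:E).
  move=> [hr hi]; apply/measurable_EFinP; apply: measurable_funM; last first.
    exact: measurable_funTS measurable_dv_alpha.
  under eq_fun do rewrite normc2E.
  by apply: measurable_funD; exact: measurable_funX.
have h0 (h : 'rV[R[i]]_n -> R[i]^o) t :
    (0 <= (normc (h (of_coords t)) ^+ 2 * dv_alpha (of_coords t))%:E)%E.
  by rewrite lee_fin mulr_ge0 ?sqr_ge0 ?dv_alpha_ge0.
have c0 : 0 <= 2 * normc a ^+ 2 by rewrite ge0_normc2 ?ler0n.
apply: (@le_lt_trans _ _ (\int[@lebesgue_C R n]_(t in ball_coords)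
  ((2 * normc a ^+ 2)%:E * (normc (f (of_coords t)) ^+ 2 * dv_alpha (of_coords t))%:E
   + 2%:E * (normc (g (of_coords t)) ^+ 2 * dv_alpha (of_coords t))%:E))%E).
  apply: ge0_le_integral => //.
  - by apply: mh; exact: ball_measurable_lin.
  - apply: emeasurable_funD; apply: measurable_funeM; exact: mh.
  - move=> t _; rewrite -!EFinM -EFinD lee_fin.
    move: (dv_alpha_ge0 (of_coords t)); set w := dv_alpha _ => w0.
    rewrite [in leRHS]mulrA [X in _ <= _ + X]mulrA -mulrDl.
    by rewrite ler_wpM2r//; exact: normc2_lin.
rewrite ge0_integralD//; last 4 first.
- by move=> t _; apply: mule_ge0; [rewrite lee_fin|exact: h0].
- by apply: measurable_funeM; exact: mh.
- by move=> t _; apply: mule_ge0; [rewrite lee_fin ler0n|exact: h0].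
- by apply: measurable_funeM; exact: mh.
rewrite !ge0_integralZl ?lee_fin//; do ?exact: mh.
by rewrite lte_add_pinfty// lte_mul_pinfty// lee_fin.
Qed.

(* Functions on the ball are represented by their extension by zero. *)
Definition bergman_fun : {pred 'rV[R[i]]_n -> R[i]^o} := mem [set f |
  [/\ forall z, ~ ball1 z -> f z = 0, holomorphic f & L2_alpha f]].

Lemma bergman_submod_closed : submod_closed bergman_fun.
Proof.
split=> [|a f g]; rewrite !inE /=.
  split=> //; split; first by split; rewrite /complex_measurable; exact: measurable_cst.
  rewrite integral0_eq ?ltry// => t _.
  by rewrite /= expr0n addr0 sqrtr0 expr0n mul0r.
move=> [f0 hf Lf] [g0 hg Lg]; split; last exact: L2_alpha_lin.
- by move=> z Bz; rewrite -[LHS]/(a *: f z + g z) f0// g0// scaler0 addr0.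
- move=> z Bz; apply: differentiableD; last exact: hg.
  by apply: differentiableZ; exact: hf.
Qed.

HB.instance Definition _ := GRing.isSubmodClosed.Build _ _ bergman_fun
  bergman_submod_closed.

Record bergman := Bergman {
  bergman_val :> 'rV[R[i]]_n -> R[i]^o;
  _ : bergman_val \in bergman_fun }.

HB.instance Definition _ := [isSub for bergman_val].
HB.instance Definition _ := [Choice of bergman by <:].
HB.instance Definition _ := [SubChoice_isSubLmodule of bergman by <:].

End bergman.

Arguments bergman {R} n alpha.

Section toeplitz.
Context {R : realType} {n : nat} (alpha : R).

Local Notation multi_index := {ffun 'I_n -> nat}.
Implicit Types (z w : 'rV[R[i]]_n) (m iota : multi_index)
  (a : 'rV[R[i]]_n -> R[i]).

Definition bergman_ip (f g : bergman n alpha) : R[i] := ip_alpha alpha f g.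

Definition mdeg m : nat := (\sum_(j < n) m j)%N.

Definition mfact m : nat := (\prod_(j < n) (m j)`!)%N.

Definition monomial m : 'rV[R[i]]_n -> R[i]^o := fun z =>
  (Num.sqrt (Gamma (n%:R + (mdeg m)%:R + alpha + 1) /
             ((mfact m)%:R * Gamma (n%:R + alpha + 1))))%:C *
  \prod_(j < n) z 0 j ^+ m j.

(* The default 0 of [insubd] is only reached when the sequence of coefficients
   is not square summable. *)
Definition coefficients (f : bergman n alpha) : ell2 R multi_index :=
  insubd 0 (fun m => ip_alpha alpha f (monomial m)).

(* Borel representatives: every class of L^infty (for Lebesgue-measurable
   functions) contains one. *)
Definition Linfty a := ball_measurable a /\ exists M : R,
  {ae @lebesgue_C R n, forall t, ball_coords t -> normc (a (of_coords t)) <= M}.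

Definition toeplitz_fun a (f : 'rV[R[i]]_n -> R[i]^o) : 'rV[R[i]]_n -> R[i]^o :=
  fun z => if z \in ball1 then
    int_alpha alpha (fun w =>
      a w * f w * complex_powR (1 - dotc z w) (- (n%:R + alpha + 1)))
  else 0.

(* As in [coefficients], the default 0 is for functions outside the space. *)
Definition toeplitz a (f : bergman n alpha) : bergman n alpha :=
  insubd 0 (toeplitz_fun a f).

Definition modulus z : 'rV[R[i]]_n := map_mx (fun x => (normc x)%:C) z.

Definition symmetric_separately_radial a := Linfty a /\
  {ae @lebesgue_C R n, forall t, let z := of_coords t in ball1 z ->
    a z = a (modulus z) /\ forall s : 'S_n, a (col_perm s z) = a z}.

Definition toeplitz_algebra :
    set (bergman n alpha -> bergman n alpha) :=
  cstar_generated bergman_ip [set toeplitz a | a in symmetric_separately_radial].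

(* [a] is regarded as a function on [tau_ball] through its values at the points
   with real nonnegative coordinates. *)
Definition tau_ball : set (n.-tuple (measurableTypeR R)) :=
  [set r | exists2 z, ball1 z & forall j, tnth r j = normc (z 0 j)].

Definition gamma a m : R[i] :=
  (2 ^+ n * Gamma (n%:R + (mdeg m)%:R + alpha + 1) /
    ((mfact m)%:R * Gamma (alpha + 1)))%:C *
  complex_integral (@lebesgue_R R n) tau_ball (fun r =>
    a (\row_j (tnth r j)%:C) *
    (\prod_(j < n) tnth r j ^+ (2 * m j) *
     (1 - \sum_(j < n) tnth r j ^+ 2) `^ alpha *
     \prod_(j < n) tnth r j)%:C).

Definition decreasing_indices : set multi_index :=
  [set iota | forall j k : 'I_n, (j <= k)%N -> (iota k <= iota j)%N].

Definition rearrangements iota : set multi_index :=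
  [set m | exists s : 'S_n, m = [ffun j => iota (s j)]].

(* ell^2(I_iota), as the sequences that vanish off I_iota. *)
Definition ell2_rearrangements iota : set (ell2 R multi_index) :=
  [set x | forall m, ~ rearrangements iota m -> x m = 0].

End toeplitz.

Arguments bergman_ip {R n} alpha f g.
Arguments coefficients {R n} alpha f.
Arguments toeplitz {R n} alpha a f.
Arguments toeplitz_algebra {R n} alpha _.
Arguments decreasing_indices n _ : clear implicits.
Arguments ell2_rearrangements R {n} iota _.

(* Main.v *)
Require Import Defs.
From HB Require Import structures.
From mathcomp Require Import all_boot all_order all_algebra all_fingroup.
From mathcomp Require Import finmap complex.
From mathcomp Require Import all_classical all_reals all_analysis.
From mathcomp Require Import measurable_realfun.
From mathcomp Require Import ring lra.
Set Implicit Arguments.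
Unset Strict Implicit.
Unset Printing Implicit Defensive.

Import Order.TTheory GRing.Theory Num.Theory numFieldNormedType.Exports.
Local Open Scope classical_set_scope.
Local Open Scope ring_scope.
Local Open Scope complex_scope.

Local Notation "z ^*" := (Num.conj z) : complex_scope.

(** The monomials are orthonormal because the weight is invariant under the rotations of
    each coordinate, and Dirichlet's integral gives their norms.  They are complete: if all
    coefficients of a holomorphic function vanish, its Fourier components under these
    rotations are multiples of monomials (Cauchy's theorem on annuli rules out the other
    frequencies), hence vanish.  So [R] is unitary, with inverse [x |-> sum_m x_m e_m].
    The multinomial and binomial series give
    [(1 - <z, w>)^(-s) = sum_m e_m(z) conj(e_m(w))], uniformly in [w] on the ball, so that
    [T_a f = sum_m <a f, e_m> e_m].  When [a] depends only on the moduli, rotation invariance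
    gives [<a e_k, e_m> = 0] for [k <> m]; the diagonal entries become [gamma_a(m)] in polar
    coordinates, and invariance under permutations makes them constant on rearrangements.
    Finally the operators that are diagonal in the basis [e_m] form a commutative
    C*-algebra, which contains the one generated by these Toeplitz operators. *)

(** * Complex-valued functions and integrals *)

(** Two obstacles shape the proof. Holomorphy is given as complex differentiability at every point,
    so the analytic input is Goursat's theorem on a rectangle, carried to an annulus by the
    exponential; it relates the Fourier components on the circles of radius [t] and [1]. This
    scaling relation, rather than differentiability, is what is propagated through averages in the
    other coordinates: Fubini transports it, and no derivative of an average is ever taken.
    Secondly, [coefficients] and [toeplitz] fall back to 0 outside their target space, and symbols
    are radial and symmetric only almost everywhere. Bessel's inequality excludes the first default,
    the series of [T_a f] the second, and [a] is replaced by [a \o modulus] where invariance is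
    required at every point. Estimates of complex integrals carry a harmless factor 2, since each
    serves only to make an error tend to 0 or a bound finite. *)

Section complex_modulus.
Context {R : realType}.
Implicit Types (x y z w : R[i]) (r : R).

Lemma normcE z : `|z| = (normc z)%:C.
Proof. by case: z. Qed.

Lemma normc_ge0 z : 0 <= normc z.
Proof. by case: z => a b; exact: sqrtr_ge0. Qed.

Lemma normcD z w : normc (z + w) <= normc z + normc w.
Proof. by rewrite -lecR [X in _ <= X]rmorphD /= -!normcE ler_normD. Qed.

Lemma normcM z w : normc (z * w) = normc z * normc w.
Proof. by rewrite ComplexField.Normc.normcM. Qed.

Lemma normcN z : normc (- z) = normc z.
Proof. by apply: complexI; rewrite -!normcE normrN. Qed.

Lemma normcB z w : normc (z - w) <= normc z + normc w.
Proof. by rewrite -(normcN w) normcD. Qed.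

Lemma normc_sub z w : normc (z - w) = normc (w - z).
Proof. by rewrite -normcN opprB. Qed.

Lemma normc_tri x y z : normc (x - z) <= normc (x - y) + normc (y - z).
Proof. by rewrite -(subrK y x) -addrA addrK normcD. Qed.

Lemma normcX z n : normc (z ^+ n) = normc z ^+ n.
Proof. by apply: complexI; rewrite rmorphXn -!normcE normrX. Qed.

Lemma normcV z : normc z^-1 = (normc z)^-1.
Proof. by apply: complexI; rewrite fmorphV -!normcE normfV. Qed.

Lemma normc0 : normc (0 : R[i]) = 0.
Proof. by rewrite ComplexField.Normc.normc0. Qed.

Lemma normc1 : normc (1 : R[i]) = 1.
Proof. by rewrite ComplexField.Normc.normc1. Qed.

Lemma normc_real r : normc r%:C = `|r|.
Proof. by rewrite /= expr0n addr0 sqrtr_sqr. Qed.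

Lemma normcJ z : normc z^* = normc z.
Proof. by case: z => a b; rewrite /= sqrrN. Qed.

Lemma normc_eq0 z : (normc z == 0) = (z == 0).
Proof. by rewrite -(inj_eq (@complexI R)) -normcE normr_eq0. Qed.

Lemma normc_gt0 z : (0 < normc z) = (z != 0).
Proof. by rewrite lt0r normc_eq0 normc_ge0 andbT. Qed.

Lemma normc_prod (I : Type) (s : seq I) (P : pred I) (F : I -> R[i]) :
  normc (\prod_(i <- s | P i) F i) = \prod_(i <- s | P i) normc (F i).
Proof. by apply: (big_morph _ normcM normc1). Qed.

Lemma normc_sum (I : Type) (s : seq I) (P : pred I) (F : I -> R[i]) :
  normc (\sum_(i <- s | P i) F i) <= \sum_(i <- s | P i) normc (F i).
Proof.
elim/big_ind2: _ => [|z a w b za wb|//]; first by rewrite normc0.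
exact: le_trans (normcD _ _) (lerD za wb).
Qed.

Lemma conjcM z w : (z * w)^* = z^* * w^*. Proof. exact: rmorphM. Qed.
Lemma conjcD z w : (z + w)^* = z^* + w^*. Proof. exact: rmorphD. Qed.
Lemma conjcB z w : (z - w)^* = z^* - w^*. Proof. exact: rmorphB. Qed.
Lemma conjcX z n : (z ^+ n)^* = z^* ^+ n. Proof. exact: rmorphXn. Qed.
Lemma real_complexV r : (r^-1)%:C = (r%:C)^-1 :> R[i].
Proof. exact: (fmorphV (real_complex R)). Qed.
Lemma real_complexM r (r' : R) : (r * r')%:C = r%:C * r'%:C :> R[i].
Proof. exact: (rmorphM (real_complex R)). Qed.
Lemma real_complexX r n : (r ^+ n)%:C = r%:C ^+ n :> R[i].
Proof. exact: (rmorphXn (real_complex R)). Qed.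
Lemma real_complex_nat n : n%:R%:C = n%:R :> R[i].
Proof. exact: (rmorph_nat (real_complex R)). Qed.

Lemma conjc_prod (I : Type) (s : seq I) (P : pred I) (F : I -> R[i]) :
  (\prod_(i <- s | P i) F i)^* = \prod_(i <- s | P i) (F i)^*.
Proof. exact: rmorph_prod. Qed.
Lemma conjc_sum (I : Type) (s : seq I) (P : pred I) (F : I -> R[i]) :
  (\sum_(i <- s | P i) F i)^* = \sum_(i <- s | P i) (F i)^*.
Proof. exact: rmorph_sum. Qed.

Lemma mulcJ z : z * z^* = (normc z ^+ 2)%:C.
Proof.
by rewrite normc2E; case: z => a b /=; congr (_ +i* _); rewrite /=; ring.
Qed.

Lemma ReD z w : complex.Re (z + w) = complex.Re z + complex.Re w.
Proof. by case: z w => [? ?] [? ?]. Qed.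
Lemma ImD z w : complex.Im (z + w) = complex.Im z + complex.Im w.
Proof. by case: z w => [? ?] [? ?]. Qed.
Lemma ReN z : complex.Re (- z) = - complex.Re z. Proof. by case: z. Qed.
Lemma ImN z : complex.Im (- z) = - complex.Im z. Proof. by case: z. Qed.
Lemma ReB z w : complex.Re (z - w) = complex.Re z - complex.Re w.
Proof. by rewrite ReD ReN. Qed.
Lemma ImB z w : complex.Im (z - w) = complex.Im z - complex.Im w.
Proof. by rewrite ImD ImN. Qed.
Lemma ReM z w : complex.Re (z * w) =
  complex.Re z * complex.Re w - complex.Im z * complex.Im w.
Proof. by case: z w => [? ?] [? ?]. Qed.
Lemma ImM z w : complex.Im (z * w) =
  complex.Re z * complex.Im w + complex.Im z * complex.Re w.
Proof. by case: z w => [? ?] [? ?]. Qed.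
Lemma ReJ z : complex.Re z^* = complex.Re z. Proof. by case: z. Qed.
Lemma ImJ z : complex.Im z^* = - complex.Im z. Proof. by case: z. Qed.
Lemma Re_sum (I : Type) (s : seq I) (P : pred I) (F : I -> R[i]) :
  complex.Re (\sum_(i <- s | P i) F i) = \sum_(i <- s | P i) complex.Re (F i).
Proof. by apply: (big_morph _ ReD). Qed.
Lemma Im_sum (I : Type) (s : seq I) (P : pred I) (F : I -> R[i]) :
  complex.Im (\sum_(i <- s | P i) F i) = \sum_(i <- s | P i) complex.Im (F i).
Proof. by apply: (big_morph _ ImD). Qed.

Lemma normc_Re z : `|complex.Re z| <= normc z.
Proof.
rewrite -ler_sqr ?nnegrE ?normc_ge0 ?normr_ge0// normc2E real_normK ?num_real//.
by rewrite lerDl sqr_ge0.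
Qed.

Lemma normc_Im z : `|complex.Im z| <= normc z.
Proof.
rewrite -ler_sqr ?nnegrE ?normc_ge0 ?normr_ge0// normc2E real_normK ?num_real//.
by rewrite lerDr sqr_ge0.
Qed.

Lemma normc_le_ReIm z : normc z <= `|complex.Re z| + `|complex.Im z|.
Proof.
rewrite -ler_sqr ?nnegrE ?normc_ge0 ?addr_ge0// normc2E sqrrD.
rewrite !real_normK ?num_real// -addrA lerD2l lerDr.
by rewrite mulrn_wge0// mulr_ge0.
Qed.

End complex_modulus.

Section complex_measurable_theory.
Context {R : realType} d (T : measurableType d) (D : set T).
Implicit Types f g : T -> R[i].

Lemma cmeas_cst (c : R[i]) : complex_measurable D (fun=> c).
Proof. by split; exact: measurable_cst. Qed.

Lemma cmeasD f g : complex_measurable D f -> complex_measurable D g ->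
  complex_measurable D (fun x => f x + g x).
Proof.
move=> [f1 f2] [g1 g2]; split.
  by under eq_fun do rewrite ReD; exact: measurable_funD.
by under eq_fun do rewrite ImD; exact: measurable_funD.
Qed.

Lemma cmeasM f g : complex_measurable D f -> complex_measurable D g ->
  complex_measurable D (fun x => f x * g x).
Proof.
move=> [f1 f2] [g1 g2]; split.
  by under eq_fun do rewrite ReM; apply: measurable_funB; exact: measurable_funM.
by under eq_fun do rewrite ImM; apply: measurable_funD; exact: measurable_funM.
Qed.

Lemma cmeasJ f : complex_measurable D f -> complex_measurable D (fun x => (f x)^*).
Proof.
move=> [f1 f2]; split.
  by under eq_fun do rewrite ReJ.
by under eq_fun do rewrite ImJ; exact: measurable_funN.
Qed.

Lemma cmeasX f n : complex_measurable D f -> complex_measurable D (fun x => f x ^+ n).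
Proof.
move=> mf; elim: n => [|n ih]; first exact: cmeas_cst.
by under eq_fun do rewrite exprS; exact: cmeasM.
Qed.

Lemma cmeas_sum (I : Type) (s : seq I) (P : pred I) (F : I -> T -> R[i]) :
  (forall i, complex_measurable D (F i)) ->
  complex_measurable D (fun x => \sum_(i <- s | P i) F i x).
Proof.
move=> mF; elim: s => [|i s ih].
  by under eq_fun do rewrite big_nil; exact: cmeas_cst.
under eq_fun do rewrite big_cons; case: (P i) => //; exact: cmeasD.
Qed.

Lemma cmeas_prod (I : Type) (s : seq I) (P : pred I) (F : I -> T -> R[i]) :
  (forall i, complex_measurable D (F i)) ->
  complex_measurable D (fun x => \prod_(i <- s | P i) F i x).
Proof.
move=> mF; elim: s => [|i s ih].
  by under eq_fun do rewrite big_nil; exact: cmeas_cst.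
under eq_fun do rewrite big_cons; case: (P i) => //; exact: cmeasM.
Qed.

Lemma cmeas_real (h : T -> R) : measurable_fun D h ->
  complex_measurable D (fun x => (h x)%:C).
Proof. by move=> mh; split => //=; exact: measurable_cst. Qed.

Lemma measurable_normc2 f : complex_measurable D f ->
  measurable_fun D (fun x => normc (f x) ^+ 2).
Proof.
by move=> [f1 f2]; under eq_fun do rewrite normc2E;
  apply: measurable_funD; exact: measurable_funX.
Qed.

(** Writing the square root as a real power reduces measurability of the modulus to that of
    [powR]. *)
Lemma normc_powR (z : R[i]) : normc z = (normc z ^+ 2) `^ 2^-1.
Proof. by rewrite powR12_sqrt ?sqr_ge0// sqrtr_sqr ger0_norm ?normc_ge0. Qed.

Lemma measurable_normc f : complex_measurable D f ->
  measurable_fun D (fun x => normc (f x)).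
Proof.
move=> mf; under eq_fun do rewrite normc_powR.
apply: (measurableT_comp (measurable_powR _)); exact: measurable_normc2.
Qed.

Lemma eq_cmeas f g : {in D, f =1 g} ->
  complex_measurable D f -> complex_measurable D g.
Proof.
move=> fg [f1 f2]; split.
  by apply: eq_measurable_fun f1 => x xD /=; rewrite fg.
by apply: eq_measurable_fun f2 => x xD /=; rewrite fg.
Qed.

End complex_measurable_theory.

Lemma cmeas_comp {R : realType} d d' (T : measurableType d) (T' : measurableType d')
    (D : set T) (E : set T') (f : T -> R[i]) (h : T' -> T) : measurable D ->
  (forall x, E x -> D (h x)) -> complex_measurable D f -> measurable_fun E h ->
  complex_measurable E (fun x => f (h x)).
Proof.
move=> mD ED [f1 f2] mh; have hE : h @` E `<=` D by move=> _ [x Ex <-]; exact: ED.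
by split; [exact: (measurable_comp mD hE f1 mh)|exact: (measurable_comp mD hE f2 mh)].
Qed.

Lemma cmeasS {R : realType} d (T : measurableType d) (D E : set T) (f : T -> R[i]) :
  measurable D -> E `<=` D -> complex_measurable D f -> complex_measurable E f.
Proof.
by move=> mD ED [f1 f2]; split;
  [exact: (measurable_funS mD ED f1)|exact: (measurable_funS mD ED f2)].
Qed.

Section absolutely_integrable.
Context {R : realType} d (T : measurableType d) (mu : {measure set T -> \bar R})
  (D : set T) (mD : measurable D).
Implicit Types f g : T -> R[i].

(** [complex_integral] takes [fine] of two real integrals, so it is additive only on functions whose
    modulus has a finite integral; this predicate is carried along for that reason. *)
Definition cL1 f := complex_measurable D f /\
  (\int[mu]_(x in D) (normc (f x))%:E < +oo)%E.

Lemma integrableZ_fin (r : R) (h : T -> R) : mu.-integrable D (EFin \o h) ->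
  mu.-integrable D (EFin \o (fun x => r * h x)).
Proof. exact: integrableZl. Qed.

Lemma cL1_le f (g : T -> R) : complex_measurable D f ->
  mu.-integrable D (EFin \o g) -> (forall x, D x -> normc (f x) <= g x) -> cL1 f.
Proof.
move=> mf /integrableP[mg goo] fg; split=> //.
apply: le_lt_trans goo; apply: ge0_le_integral => //.
- by move=> x Dx; rewrite lee_fin normc_ge0.
- by apply/measurable_EFinP; exact: measurable_normc.
- exact: measurableT_comp.
- by move=> x Dx; rewrite lee_fin (le_trans (fg _ Dx))// ler_norm.
Qed.

Lemma cL1_normc f : cL1 f -> mu.-integrable D (EFin \o (fun x => normc (f x))).
Proof.
move=> [mf foo]; apply/integrableP; split.
  by apply/measurable_EFinP; exact: measurable_normc.
under eq_integral do rewrite /= ger0_norm ?normc_ge0//.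
exact: foo.
Qed.

Lemma cL1_Re f : cL1 f -> mu.-integrable D (EFin \o (fun x => complex.Re (f x))).
Proof.
move=> fL; apply: le_integrable (cL1_normc fL) => //.
  by case: fL => [[? _] _]; apply/measurable_EFinP.
by move=> x Dx /=; rewrite lee_fin (ger0_norm (normc_ge0 _)) normc_Re.
Qed.

Lemma cL1_Im f : cL1 f -> mu.-integrable D (EFin \o (fun x => complex.Im (f x))).
Proof.
move=> fL; apply: le_integrable (cL1_normc fL) => //.
  by case: fL => [[_ ?] _]; apply/measurable_EFinP.
by move=> x Dx /=; rewrite lee_fin (ger0_norm (normc_ge0 _)) normc_Im.
Qed.

Lemma cL1D f g : cL1 f -> cL1 g -> cL1 (fun x => f x + g x).
Proof.
move=> fL gL; apply: (@cL1_le _ (fun x => normc (f x) + normc (g x))).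
- by apply: cmeasD; [case: fL|case: gL].
- exact: integrableD (cL1_normc fL) (cL1_normc gL).
- by move=> x _; exact: normcD.
Qed.

Lemma cL1Z (c : R[i]) f : cL1 f -> cL1 (fun x => c * f x).
Proof.
move=> fL; apply: (@cL1_le _ (fun x => normc c * normc (f x))).
- by apply: cmeasM; [exact: cmeas_cst|case: fL].
- exact: integrableZl (cL1_normc fL).
- by move=> x _; rewrite normcM.
Qed.

Lemma cL1Zr (c : R[i]) f : cL1 f -> cL1 (fun x => f x * c).
Proof. by move/(cL1Z c); under eq_fun do rewrite mulrC. Qed.

Lemma cL10 : cL1 (fun=> 0).
Proof.
by split; [exact: cmeas_cst|]; rewrite integral0_eq ?ltry// => x _; rewrite normc0.
Qed.

Lemma cL1_sum (I : Type) (s : seq I) (P : pred I) (F : I -> T -> R[i]) :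
  (forall i, cL1 (F i)) -> cL1 (fun x => \sum_(i <- s | P i) F i x).
Proof.
move=> mF; elim: s => [|i s ih].
  by under eq_fun do rewrite big_nil; exact: cL10.
under eq_fun do rewrite big_cons; case: (P i) => //; exact: cL1D.
Qed.

Lemma cL1N f : cL1 f -> cL1 (fun x => - f x).
Proof. by move/(cL1Z (-1)); under eq_fun do rewrite mulN1r. Qed.

Lemma cL1B f g : cL1 f -> cL1 g -> cL1 (fun x => f x - g x).
Proof. by move=> fL gL; apply: cL1D => //; exact: cL1N. Qed.

Lemma eq_cL1 f g : {in D, f =1 g} -> cL1 f -> cL1 g.
Proof.
move=> fg [mf foo]; split; first exact: eq_cmeas mf.
by under eq_integral do rewrite -fg//.
Qed.

Local Notation cint := (complex_integral mu D).

Lemma eq_cint f g : {in D, f =1 g} -> cint f = cint g.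
Proof.
by move=> fg; congr (_ +i* _); apply: eq_Rintegral => x xD; rewrite fg.
Qed.

Lemma cintD f g : cL1 f -> cL1 g -> cint (fun x => f x + g x) = cint f + cint g.
Proof.
move=> fL gL; rewrite /complex_integral; apply/eqP; rewrite eq_complex /=.
apply/andP; split; apply/eqP.
  under eq_Rintegral do rewrite ReD.
  by rewrite RintegralD//; [exact: cL1_Re|exact: cL1_Re].
under eq_Rintegral do rewrite ImD.
by rewrite RintegralD//; [exact: cL1_Im|exact: cL1_Im].
Qed.

Lemma cintZ c f : cL1 f -> cint (fun x => c * f x) = c * cint f.
Proof.
move=> fL; rewrite /complex_integral; apply/eqP; rewrite eq_complex.
have fR := cL1_Re fL; have fI := cL1_Im fL.
rewrite ReM ImM /=; apply/andP; split; apply/eqP.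
  under eq_Rintegral do rewrite ReM.
  by rewrite RintegralB ?RintegralZl//; exact: integrableZ_fin.
under eq_Rintegral do rewrite ImM.
by rewrite RintegralD ?RintegralZl//; exact: integrableZ_fin.
Qed.

Lemma cintZr c f : cL1 f -> cint (fun x => f x * c) = cint f * c.
Proof. by move=> fL; under eq_fun do rewrite mulrC; rewrite cintZ// mulrC. Qed.

Lemma cintN f : cL1 f -> cint (fun x => - f x) = - cint f.
Proof. by move=> fL; under eq_fun do rewrite -mulN1r; rewrite cintZ// mulN1r. Qed.

Lemma cintB f g : cL1 f -> cL1 g -> cint (fun x => f x - g x) = cint f - cint g.
Proof. by move=> fL gL; rewrite cintD ?cintN//; exact: cL1N. Qed.

Lemma cint0 : cint (fun=> 0) = 0.
Proof. by congr (_ +i* _); rewrite /= Rintegral_cst// mul0r. Qed.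

Lemma cint_sum (I : Type) (s : seq I) (P : pred I) (F : I -> T -> R[i]) :
  (forall i, cL1 (F i)) ->
  cint (fun x => \sum_(i <- s | P i) F i x) = \sum_(i <- s | P i) cint (F i).
Proof.
move=> mF; elim: s => [|i s ih].
  by under eq_fun do rewrite big_nil; rewrite big_nil cint0.
under eq_fun do rewrite big_cons; rewrite big_cons.
by case: (P i) => //; rewrite cintD ?ih//; exact: cL1_sum.
Qed.

Lemma cintJ f : cL1 f -> cint (fun x => (f x)^*) = (cint f)^*.
Proof.
move=> fL; rewrite /complex_integral /=; congr (_ +i* _).
  by under eq_Rintegral do rewrite ReJ.
under eq_Rintegral do rewrite ImJ -mulN1r.
by rewrite RintegralZl ?mulN1r//; exact: cL1_Im.
Qed.

Lemma cint_real (h : T -> R) : cint (fun x => (h x)%:C) = (\int[mu]_(x in D) h x)%:C.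
Proof. by rewrite /complex_integral /= Rintegral_cst// mul0r. Qed.

(* The constant 2 avoids the polar decomposition of the integral. *)
Lemma cint_le f (g : T -> R) : cL1 f -> mu.-integrable D (EFin \o g) ->
  (forall x, D x -> normc (f x) <= g x) ->
  normc (cint f) <= 2 * \int[mu]_(x in D) g x.
Proof.
move=> fL gI fg; apply: le_trans (normc_le_ReIm _) _.
rewrite /= mulr_natl mulr2n; apply: lerD.
  apply: le_trans (le_normr_Rintegral mD (cL1_Re fL)) _.
  apply: le_Rintegral => //; first exact: integrable_norm (cL1_Re fL).
  by move=> x Dx; apply: le_trans (normc_Re _) (fg _ Dx).
apply: le_trans (le_normr_Rintegral mD (cL1_Im fL)) _.
apply: le_Rintegral => //; first exact: integrable_norm (cL1_Im fL).
by move=> x Dx; apply: le_trans (normc_Im _) (fg _ Dx).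
Qed.

Lemma cint_le_cst f (M : R) : (mu D < +oo)%E -> cL1 f ->
  (forall x, D x -> normc (f x) <= M) -> normc (cint f) <= 2 * (M * fine (mu D)).
Proof.
move=> Doo fL fM; rewrite -(Rintegral_cst mu mD M); apply: cint_le => //.
apply: measurable_bounded_integrable => //.
by exists `|M|; split; [exact: num_real|move=> x Mx y _ /=; exact: ltW].
Qed.

End absolutely_integrable.

(** * Tonelli and Fubini for iterated integrals over measurable subsets *)

Section fubini_on_rectangles.
Context {R : realType} d1 d2 (T1 : measurableType d1) (T2 : measurableType d2).
Variables (m1 : {sigma_finite_measure set T1 -> \bar R})
          (m2 : {sigma_finite_measure set T2 -> \bar R}).
Variables (D1 : set T1) (D2 : set T2).
Hypotheses (mD1 : measurable D1) (mD2 : measurable D2).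

(** Extension by zero off the rectangle turns iterated integrals over sets into iterated integrals
    over the whole spaces. *)
Lemma integral_rect (h : T1 * T2 -> \bar R) x :
  (\int[m2]_y (h \_ (D1 `*` D2)) (x, y) =
   ((fun x => \int[m2]_(y in D2) h (x, y)) \_ D1) x)%E.
Proof.
rewrite patchE; case: ifPn => xD1.
  rewrite [RHS]integral_mkcond; apply: eq_integral => y _; rewrite !patchE.
  by congr (if _ then _ else _); apply/idP/idP;
    rewrite !inE /=; [case|split=> //; rewrite -in_setE].
rewrite integral0_eq// => y _; rewrite patchE ifF//.
by apply/negbTE; rewrite notin_setE => -[/=]; rewrite -in_setE (negbTE xD1).
Qed.

Lemma integral_rect' (h : T1 * T2 -> \bar R) y :
  (\int[m1]_x (h \_ (D1 `*` D2)) (x, y) =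
   ((fun y => \int[m1]_(x in D1) h (x, y)) \_ D2) y)%E.
Proof.
rewrite patchE; case: ifPn => yD2.
  rewrite [RHS]integral_mkcond; apply: eq_integral => x _; rewrite !patchE.
  by congr (if _ then _ else _); apply/idP/idP;
    rewrite !inE /=; [case|split=> //; rewrite -in_setE].
rewrite integral0_eq// => x _; rewrite patchE ifF//.
by apply/negbTE; rewrite notin_setE => -[_ /=]; rewrite -in_setE (negbTE yD2).
Qed.

Lemma measurable_rect (h : T1 * T2 -> \bar R) :
  measurable_fun (D1 `*` D2) h -> measurable_fun setT (h \_ (D1 `*` D2)).
Proof. by move/measurable_restrictT; apply; exact: measurableX. Qed.

Lemma tonelli_rect (h : T1 * T2 -> \bar R) : measurable_fun (D1 `*` D2) h ->
  (forall z, (D1 `*` D2) z -> 0 <= h z)%E ->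
  (\int[m1]_(x in D1) \int[m2]_(y in D2) h (x, y) =
   \int[m2]_(y in D2) \int[m1]_(x in D1) h (x, y))%E.
Proof.
move=> mh h0.
transitivity (\int[m1]_x \int[m2]_y (h \_ (D1 `*` D2)) (x, y))%E.
  by rewrite integral_mkcond; apply: eq_integral => x _; rewrite integral_rect.
rewrite (@fubini_tonelli _ _ _ _ _ m1 m2 _ (measurable_rect mh)); last first.
  by move=> z; rewrite patchE; case: ifPn => // /set_mem /h0.
by rewrite [RHS]integral_mkcond; apply: eq_integral => y _; rewrite integral_rect'.
Qed.

Lemma measurable_tonelli_rect (h : T1 * T2 -> \bar R) :
  measurable_fun (D1 `*` D2) h -> (forall z, (D1 `*` D2) z -> 0 <= h z)%E ->
  measurable_fun D1 (fun x => \int[m2]_(y in D2) h (x, y))%E.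
Proof.
move=> mh h0; apply/(measurable_restrictT _ mD1).
rewrite -(funext (integral_rect h)).
apply: (measurable_fun_fubini_tonelli_F _ (measurable_rect mh)).
by move=> z; rewrite patchE; case: ifPn => // /set_mem /h0.
Qed.

Section real_valued.
Variable f : T1 * T2 -> R.
Hypothesis mf : measurable_fun (D1 `*` D2) f.
Hypothesis foo :
  (\int[m1]_(x in D1) \int[m2]_(y in D2) `|f (x, y)|%:E < +oo)%E.

Let h : T1 * T2 -> \bar R := (EFin \o f) \_ (D1 `*` D2).

Let mh : measurable_fun setT h.
Proof. by apply: measurable_rect; exact/measurable_EFinP. Qed.

Let ih : (m1 \x m2)%E.-integrable setT h.
Proof.
apply/(integrable12ltyP _ _ mh).
apply: le_lt_trans foo; rewrite le_eqVlt; apply/orP; left; apply/eqP.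
rewrite [RHS]integral_mkcond; apply: eq_integral => x _.
rewrite -(integral_rect (fun z => `|f z|%:E)%E); apply: eq_integral => y _.
by rewrite /h !patchE; case: ifPn => //; rewrite abse0.
Qed.

Lemma integrable_Rintegral_rect :
  (forall x, D1 x -> m2.-integrable D2 (fun y => (f (x, y))%:E)) ->
  m1.-integrable D1 (EFin \o (fun x => \int[m2]_(y in D2) f (x, y))).
Proof.
move=> if2; have := integrable_fubini_F ih.
rewrite /fubini_F; under eq_fun do rewrite integral_rect.
rewrite -integrable_mkcond//; apply: eq_integrable => // x; rewrite inE => Dx /=.
by rewrite /Rintegral fineK//; apply: integrable_fin_num => //; exact: if2.
Qed.

(** Every section is assumed integrable, not almost every one: then [fine] loses nothing at any
    point, and the real and extended iterated integrals agree. *)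
Lemma Fubini_Rintegral :
  (forall x, D1 x -> m2.-integrable D2 (fun y => (f (x, y))%:E)) ->
  (forall y, D2 y -> m1.-integrable D1 (fun x => (f (x, y))%:E)) ->
  \int[m1]_(x in D1) \int[m2]_(y in D2) f (x, y) =
  \int[m2]_(y in D2) \int[m1]_(x in D1) f (x, y).
Proof.
move=> if2 if1; congr fine.
transitivity (\int[m1]_(x in D1) \int[m2]_(y in D2) (f (x, y))%:E)%E.
  apply: eq_integral => x; rewrite inE => Dx.
  by rewrite /Rintegral fineK//; apply: integrable_fin_num => //; exact: if2.
transitivity (\int[m1]_x \int[m2]_y h (x, y))%E.
  by rewrite integral_mkcond; apply: eq_integral => x _; rewrite integral_rect.
rewrite (Fubini ih) [RHS]integral_mkcond; apply: eq_integral => y _.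
rewrite integral_rect' !patchE; case: ifPn => // /set_mem Dy.
by rewrite /Rintegral fineK//; apply: integrable_fin_num => //; exact: if1.
Qed.

End real_valued.

Section complex_valued.
Variable f : T1 * T2 -> R[i].
Hypothesis mf : complex_measurable (D1 `*` D2) f.
Hypothesis foo :
  (\int[m1]_(x in D1) \int[m2]_(y in D2) (normc (f (x, y)))%:E < +oo)%E.
Hypothesis f2 : forall x, D1 x -> cL1 m2 D2 (fun y => f (x, y)).
Hypothesis f1 : forall y, D2 y -> cL1 m1 D1 (fun x => f (x, y)).

Let part_oo (h : R[i] -> R) : measurable_fun (D1 `*` D2) (h \o f) ->
  (forall z, `|h z| <= normc z) ->
  (\int[m1]_(x in D1) \int[m2]_(y in D2) `|(h \o f) (x, y)|%:E < +oo)%E.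
Proof.
move=> mh hz; apply: le_lt_trans foo.
have mah : measurable_fun (D1 `*` D2) (fun z => (`|(h \o f) z|)%:E).
  by apply/measurable_EFinP; exact: measurableT_comp.
have mnf : measurable_fun (D1 `*` D2) (fun z => (normc (f z))%:E).
  by apply/measurable_EFinP; exact: measurable_normc.
apply: ge0_le_integral => //.
- by move=> x Dx; exact: integral_ge0.
- exact: (measurable_tonelli_rect mah).
- by apply: (measurable_tonelli_rect mnf) => z _; rewrite lee_fin normc_ge0.
- move=> x Dx; apply: ge0_le_integral => //.
  + apply/measurable_EFinP; apply: measurableT_comp => //.
    apply: (measurable_comp _ _ mh); first exact: measurableX.
      by move=> _ [y Dy <-].
    exact: measurable_funTS (pair1_measurable x).
  + by apply/measurable_EFinP; apply: measurable_normc; case: (f2 Dx).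
  + by move=> y Dy; rewrite lee_fin; exact: hz.
Qed.

Lemma cL1_cint_rect : cL1 m1 D1 (fun x => complex_integral m2 D2 (fun y => f (x, y))).
Proof.
have iR := @integrable_Rintegral_rect _ mf.1 (part_oo mf.1 (@normc_Re R))
  (fun x Dx => cL1_Re mD2 (f2 Dx)).
have iI := @integrable_Rintegral_rect _ mf.2 (part_oo mf.2 (@normc_Im R))
  (fun x Dx => cL1_Im mD2 (f2 Dx)).
apply: (@cL1_le _ _ _ _ _ mD1 _ (fun x => `|\int[m2]_(y in D2) complex.Re (f (x, y))|
    + `|\int[m2]_(y in D2) complex.Im (f (x, y))|)).
  by split; apply/measurable_EFinP; [exact: measurable_int iR|exact: measurable_int iI].
  by have := integrableD mD1 (integrable_norm iR) (integrable_norm iI).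
by move=> x Dx; exact: normc_le_ReIm.
Qed.

Lemma cFubini :
  complex_integral m1 D1 (fun x => complex_integral m2 D2 (fun y => f (x, y))) =
  complex_integral m2 D2 (fun y => complex_integral m1 D1 (fun x => f (x, y))).
Proof.
congr (_ +i* _).
  apply: (@Fubini_Rintegral (fun z => complex.Re (f z))).
  - exact: mf.1.
  - exact: (part_oo mf.1 (@normc_Re R)).
  - by move=> x /f2; exact: cL1_Re.
  - by move=> y /f1; exact: cL1_Re.
apply: (@Fubini_Rintegral (fun z => complex.Im (f z))).
- exact: mf.2.
- exact: (part_oo mf.2 (@normc_Im R)).
- by move=> x /f2; exact: cL1_Im.
- by move=> y /f1; exact: cL1_Im.
Qed.

End complex_valued.

End fubini_on_rectangles.

(** * Product measures and polar coordinates *)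

Section density_measure.
Local Open Scope ereal_scope.
Context {R : realType} d (T : measurableType d) (nu : {measure set T -> \bar R}).

(** The two proofs are parameters so that the measure structure can be attached to the term
    itself. *)
Definition density (rho : T -> R) (rho0 : forall x, (0 <= rho x)%R)
  (mrho : measurable_fun setT rho) (A : set T) : \bar R :=
  \int[nu]_(x in A) (rho x)%:E.

Variables (rho : T -> R) (rho0 : forall x, (0 <= rho x)%R)
  (mrho : measurable_fun setT rho).

Let mErho (A : set T) : measurable_fun A (fun x => (rho x)%:E).
Proof. by apply/measurable_EFinP; exact: measurable_funTS. Qed.

Let density0 : density rho0 mrho set0 = 0.
Proof. by rewrite /density integral_set0. Qed.

Let density_ge0 A : 0 <= density rho0 mrho A.
Proof. by apply: integral_ge0 => x _; rewrite lee_fin. Qed.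

Let density_sigma_additive : semi_sigma_additive (density rho0 mrho).
Proof.
move=> /= F mF tF mUF; rewrite /density ge0_integral_bigcup//; last first.
  by move=> x _; rewrite lee_fin.
apply: is_cvg_ereal_nneg_natsum_cond => n _ _.
by apply: integral_ge0 => x _; rewrite lee_fin.
Qed.

HB.instance Definition _ := isMeasure.Build _ _ _ (density rho0 mrho)
  density0 density_ge0 density_sigma_additive.

Import HBNNSimple.

(** True for indicators by definition of the measure, then for simple functions by linearity, then
    in general by monotone convergence. *)
Lemma ge0_integral_density (f : T -> \bar R) : measurable_fun setT f ->
  (forall x, 0 <= f x) ->
  \int[density rho0 mrho]_x f x = \int[nu]_x (f x * (rho x)%:E).
Proof.
move=> mf f0; pose f_ := nnsfun_approx measurableT mf.
transitivity (limn (fun n => \int[density rho0 mrho]_x (f_ n x)%:E)).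
  rewrite -monotone_convergence//.
  - apply: eq_integral => y _; apply/esym/cvg_lim => //.
    by apply: cvg_nnsfun_approx => // *; exact: f0.
  - by move=> n; exact/measurable_EFinP/measurable_funP.
  - by move=> n y _; rewrite lee_fin.
  - by move=> y _ m n mn; rewrite lee_fin; exact/lefP/nd_nnsfun_approx.
rewrite [X in limn X](_ : _ = (fun n => \int[nu]_x ((f_ n x)%:E * (rho x)%:E))).
  rewrite -monotone_convergence//; last 3 first.
  - move=> n; apply: emeasurable_funM => //.
    by apply/measurable_EFinP; exact: measurable_funP.
  - by move=> n x _; rewrite mule_ge0// lee_fin.
  - move=> x _ m n mn; rewrite lee_wpmul2r// ?lee_fin//.
    exact/lefP/nd_nnsfun_approx.
  apply: eq_integral => x _; apply/cvg_lim => //.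
  apply: cvgeZr => //.
  by apply: cvg_nnsfun_approx => // *; exact: f0.
apply/funext => n.
under [LHS]eq_integral do rewrite fimfunE -fsumEFin//.
rewrite [LHS]ge0_integral_fsum//; last 2 first.
  - by move=> r; exact/measurable_EFinP/measurableT_comp.
  - by move=> y x _; rewrite EFinM nnfun_muleindic_ge0.
under [RHS]eq_integral.
  move=> x xD; rewrite fimfunE -fsumEFin// ge0_mule_fsuml; last first.
    by move=> r; rewrite EFinM nnfun_muleindic_ge0.
  over.
rewrite [RHS]ge0_integral_fsum//; last 2 first.
  - move=> r; apply: emeasurable_funM => //.
    by apply/measurable_EFinP; apply: measurableT_comp.
  - move=> y x _; rewrite EFinM mule_ge0//; last by rewrite lee_fin.
    by rewrite nnfun_muleindic_ge0.
apply: eq_fsbigr => r _.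
rewrite integralZl_indic_nnsfun//.
transitivity (r%:E * \int[nu]_x ((\1_(f_ n @^-1` [set r]) x)%:E * (rho x)%:E)).
  congr (_ * _); rewrite integral_indic//= setIT /density integral_mkcond.
  apply: eq_integral => x _; rewrite patchE indicE.
  by case: ifPn => xr; rewrite (mul1e, mul0e).
(* A nonnegative simple function does not take the value [r < 0]: its preimage is empty and both
   sides vanish. *)
have [r0|r0] := leP 0%R r.
  rewrite -ge0_integralZl//.
  - by under eq_integral do rewrite muleA -EFinM.
  - by apply: emeasurable_funM => //; apply/measurable_EFinP.
  - by move=> x _; rewrite mule_ge0// lee_fin.
rewrite preimage_nnfun0// !integral0_eq ?mule0//.
  by move=> x _; rewrite indic0 mulr0 mul0e.
by move=> x _; rewrite indic0 mul0e.
Qed.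

End density_measure.

Local Notation pushforward_measure := measure_function_pushforward__canonical__measure_function_Measure.

Section lebesgue_affine.
Context {R : realType}.
Local Notation leb := (@lebesgue_measure R).

(** By uniqueness of Lebesgue measure: its image under [x |-> a x + b], multiplied by [a], gives
    half-open intervals their length. *)
Lemma ge0_integral_affine (a b : R) (F : measurableTypeR R -> \bar R) : 0 < a ->
  measurable_fun setT F -> (forall x, 0 <= F x)%E ->
  (a%:E * \int[leb]_x F (a * x + b)%R = \int[leb]_x F x)%E.
Proof.
move=> a0 mF F0.
pose phi (x : measurableTypeR R) : measurableTypeR R := a * x + b.
have mphi : measurable_fun setT phi.
  by apply: measurable_funD => //; exact: measurable_funM.
pose m := mscale (NngNum (ltW a0)) (pushforward_measure leb mphi).
have lebE A : measurable A -> leb A = m A.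
  move=> mA; apply: lebesgue_measure_unique => // _ [[c e]] _ <-.
  change (leb `]c, e]%classic = a%:E * leb (phi @^-1` `]c, e]%classic))%E.
  have -> : phi @^-1` `]c, e]%classic = `](c - b) / a, (e - b) / a]%classic.
    apply/seteqP; split=> x; rewrite /phi /= !in_itv /=;
      by rewrite ltr_pdivrMr// ler_pdivlMr// ltrBlDr lerBrDr mulrC.
  rewrite !lebesgue_measure_itv /= !lte_fin ltr_pM2r ?invr_gt0// ltrD2r.
  case: ifPn => ce; last by rewrite mule0.
  rewrite -!EFinB -EFinM; congr EFin; field.
  by rewrite gt_eqF.
transitivity (\int[m]_x F x)%E; last by apply/esym/eq_measure_integral => A mA _; exact: lebE.
rewrite /m ge0_integral_mscale//=; congr (_ * _)%E.
by rewrite ge0_integral_pushforward.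
Qed.

End lebesgue_affine.

Section plane.
Context {R : realType}.
Local Notation leb := (@lebesgue_measure R).
Local Notation RR := (measurableTypeR R * measurableTypeR R)%type.
Definition plane_measure : {sigma_finite_measure set RR -> \bar R} :=
  prod_measure leb leb.

Lemma plane_tonelli1 (F : RR -> \bar R) : measurable_fun setT F ->
  (forall x, 0 <= F x)%E ->
  (\int[plane_measure]_z F z = \int[leb]_x \int[leb]_y F (x, y))%E.
Proof. by move=> mF F0; exact: (@fubini_tonelli1 _ _ _ _ _ leb leb). Qed.

Lemma plane_tonelli2 (F : RR -> \bar R) : measurable_fun setT F ->
  (forall x, 0 <= F x)%E ->
  (\int[plane_measure]_z F z = \int[leb]_y \int[leb]_x F (x, y))%E.
Proof. by move=> mF F0; exact: (@fubini_tonelli2 _ _ _ _ _ leb leb). Qed.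

Lemma measurable_plane (f g : RR -> measurableTypeR R) : measurable_fun setT f ->
  measurable_fun setT g -> measurable_fun setT (fun z => (f z, g z)).
Proof. by move=> mf mg; exact: measurable_fun_pair. Qed.

(** For a fixed second coordinate the shear is a translation of the first one, so that coordinate is
    integrated first. *)
Lemma ge0_integral_shear1 (t : R) (F : RR -> \bar R) : measurable_fun setT F ->
  (forall x, 0 <= F x)%E ->
  (\int[plane_measure]_z F (z.1 + t * z.2, z.2)%R = \int[plane_measure]_z F z)%E.
Proof.
move=> mF F0.
have mFs : measurable_fun setT (fun z : RR => F (z.1 + t * z.2, z.2)%R).
  apply: measurableT_comp mF _; apply: measurable_plane => //.
  by apply: measurable_funD => //; exact: measurable_funM.
rewrite (plane_tonelli2 mFs (fun z => F0 _)) (plane_tonelli2 mF F0); apply: eq_integral => y _ /=.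
have mFy : measurable_fun setT (fun x : measurableTypeR R => F (x, y)).
  by apply: measurableT_comp mF _; exact: measurable_fun_pair.
rewrite -(ge0_integral_affine (t * y) ltr01 mFy)// mul1e.
by apply: eq_integral => x _; rewrite mul1r.
Qed.

Lemma ge0_integral_shear2 (t : R) (F : RR -> \bar R) : measurable_fun setT F ->
  (forall x, 0 <= F x)%E ->
  (\int[plane_measure]_z F (z.1, z.2 + t * z.1)%R = \int[plane_measure]_z F z)%E.
Proof.
move=> mF F0.
have mFs : measurable_fun setT (fun z : RR => F (z.1, z.2 + t * z.1)%R).
  apply: measurableT_comp mF _; apply: measurable_plane => //.
  by apply: measurable_funD => //; exact: measurable_funM.
rewrite (plane_tonelli1 mFs (fun z => F0 _)) (plane_tonelli1 mF F0); apply: eq_integral => x _ /=.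
have mFy : measurable_fun setT (fun y : measurableTypeR R => F (x, y)).
  by apply: measurableT_comp mF _; exact: measurable_fun_pair.
rewrite -(ge0_integral_affine (t * x) ltr01 mFy)// mul1e.
by apply: eq_integral => y _; rewrite mul1r.
Qed.

(** Multiplication by [u] in real coordinates; it is a rotation when [normc u = 1]. *)
Definition rot (u : R[i]) (z : RR) : RR :=
  let: c +i* s := u in (c * z.1 - s * z.2, s * z.1 + c * z.2).

Lemma measurable_rot u : measurable_fun setT (rot u).
Proof.
case: u => c s; apply: measurable_plane.
  by apply: measurable_funB; exact: measurable_funM.
by apply: measurable_funD; exact: measurable_funM.
Qed.

(* A rotation of angle other than pi is a product of three shears. *)
Lemma ge0_integral_rot (u : R[i]) (F : RR -> \bar R) : normc u = 1 ->
  measurable_fun setT F -> (forall x, 0 <= F x)%E ->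
  (\int[plane_measure]_z F (rot u z) = \int[plane_measure]_z F z)%E.
Proof.
have gen (c s : R) (G : RR -> \bar R) : c ^+ 2 + s ^+ 2 = 1 -> c != -1 ->
    measurable_fun setT G -> (forall x, 0 <= G x)%E ->
    (\int[plane_measure]_z G (rot (c +i* s) z) = \int[plane_measure]_z G z)%E.
  move=> cs c1 mG G0; have c10 : 1 + c != 0 by rewrite addrC addr_eq0.
  (* Minus the tangent of half the angle: the shears of slopes [t], [s], [t] compose to the
     rotation. *)
  pose t := - (s / (1 + c)).
  rewrite -(ge0_integral_shear1 t mG G0).
  pose G1 z := G (z.1 + t * z.2, z.2)%R.
  have mG1 : measurable_fun setT G1.
    apply: measurableT_comp mG _; apply: measurable_plane => //.
    by apply: measurable_funD => //; exact: measurable_funM.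
  rewrite -[RHS](ge0_integral_shear2 s mG1 (fun z => G0 _)).
  pose G2 z := G1 (z.1, z.2 + s * z.1)%R.
  have mG2 : measurable_fun setT G2.
    apply: measurableT_comp mG1 _; apply: measurable_plane => //.
    by apply: measurable_funD => //; exact: measurable_funM.
  rewrite -[RHS](ge0_integral_shear1 t mG2 (fun z => G0 _)).
  apply: eq_integral => -[x y] _; rewrite /G2 /G1 /=.
  have st : 1 + s * t = c.
    rewrite /t; apply: (mulIf c10); rewrite mulrDl mulrN mulNr mulrA divfK//.
    have -> : s * s = 1 - c * c by rewrite -cs; ring.
    by ring.
  have tt : t * (1 + c) = - s by rewrite /t mulNr divfK.
  have e1 : y + s * (x + t * y) = s * x + c * y by rewrite -st; ring.
  have e2 : x + t * y + t * (s * x + c * y) = c * x - s * y.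
    by rewrite -[in RHS]st -[X in _ - X * y]opprK -tt; ring.
  by rewrite e1 e2.
move=> u1 mF F0; case: u u1 => c s u1.
have cs : c ^+ 2 + s ^+ 2 = 1 by move: (congr1 (fun x => x ^+ 2) u1); rewrite normc2E expr1n.
(* For the half-turn that slope would be infinite; it is the square of the quarter-turn, which the
   general case covers. *)
have [c1|] := eqVneq c (-1); last by move=> ?; exact: gen.
have s0 : s = 0.
  by move/eqP: cs; rewrite c1 sqrrN expr1n eq_sym -subr_eq0 opprD addNKr oppr_eq0 expf_eq0 => /eqP.
have h0 : (0 : R) ^+ 2 + 1 ^+ 2 = 1 by rewrite expr0n add0r expr1n.
have h1 : (0 : R) != -1 by rewrite eq_sym oppr_eq0 oner_eq0.
rewrite -(gen _ _ _ h0 h1 mF F0).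
pose G z := F (rot (0 +i* 1) z).
have mG : measurable_fun setT G by apply: measurableT_comp mF _; exact: measurable_rot.
rewrite -[RHS](gen _ _ G h0 h1 mG)//; last by move=> z; exact: F0.
apply: eq_integral => -[x y] _; rewrite /G /= c1 s0; congr F.
by congr (_, _) => /=; ring.
Qed.

End plane.

(** * Integration against the n-fold product measure *)

Section power_measure_integral.
Context {R : realType} d d' (T : measurableType d) (T' : measurableType d').
Variables (mu : {sigma_finite_measure set T -> \bar R})
          (nu : {sigma_finite_measure set T' -> \bar R}).

Lemma ge0_integral_pow_step k (F : k.+1.-tuple T -> \bar R) :
  measurable_fun setT F -> (forall t, 0 <= F t)%E ->
  (\int[pow_measure mu k.+1]_t F t =
   \int[mu]_x \int[pow_measure mu k]_t F (tcons (x, t)))%E.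
Proof.
move=> mF F0.
transitivity (\int[prod_measure mu (pow_measure mu k)]_z F (tcons z))%E.
  have := @ge0_integral_pushforward _ _ _ _ R (@tcons _ T k) (@measurable_tcons _ T k)
    (prod_measure mu (pow_measure mu k)) setT F measurableT mF (fun z _ => F0 z).
  by rewrite preimage_setT.
apply: (@fubini_tonelli1 _ _ _ _ _ mu (pow_measure mu k) (fun z => F (tcons z))).
  exact: measurableT_comp mF (@measurable_tcons _ T k).
by move=> z; exact: F0.
Qed.

Lemma measurable_tcons_section k (F : k.+1.-tuple T -> \bar R) x :
  measurable_fun setT F -> measurable_fun setT (fun t : k.-tuple T => F (tcons (x, t))).
Proof.
move=> mF; apply: measurableT_comp mF _.
by apply: (measurableT_comp (@measurable_tcons _ T k)); exact: measurable_fun_pair.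
Qed.

End power_measure_integral.

Section coordinatewise_map.
Context {R : realType} d d' (T : measurableType d) (T' : measurableType d').
Variables (mu : {sigma_finite_measure set T -> \bar R})
          (nu : {sigma_finite_measure set T' -> \bar R}).

(** The maps are indexed by [nat] rather than ['I_n], so that induction on [n] passes to the tail by
    shifting [phi]. *)
Definition tmap (phi : nat -> T -> T') n (t : n.-tuple T) : n.-tuple T' :=
  [tuple phi i (tnth t i) | i < n].

Lemma tmap_tcons (phi : nat -> T -> T') n x (t : n.-tuple T) :
  tmap phi (tcons (x, t)) = tcons (phi 0%N x, tmap (fun i => phi i.+1) t).
Proof.
apply: eq_from_tnth => i; rewrite tnth_mktuple.
by have [j ->|->] := unliftP ord0 i; rewrite ?tnthS ?tnth0 ?tnth_mktuple.
Qed.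

Lemma measurable_tmap (phi : nat -> T -> T') n :
  (forall i, measurable_fun setT (phi i)) -> measurable_fun setT (@tmap phi n).
Proof.
move=> mphi; apply/measurable_fun_tnthP => i.
rewrite (_ : _ \o _ = phi i \o (@tnth n T ^~ i)); last first.
  by apply/funext => t /=; rewrite tnth_mktuple.
by apply: measurableT_comp => //; exact: measurable_tnth.
Qed.

(** One change of variable per coordinate, performed by Tonelli. It serves rotations, with
    [rho = 1], as well as passage to the moduli, with [rho = radial_density]. *)
Lemma ge0_integral_tmap (rho : T' -> R) n (phi : nat -> T -> T') :
  (forall y, 0 <= rho y) -> measurable_fun setT rho ->
  (forall i, measurable_fun setT (phi i)) ->
  (forall i (F : T' -> \bar R), measurable_fun setT F -> (forall y, 0 <= F y)%E ->
    (\int[mu]_x F (phi i x) = \int[nu]_y (F y * (rho y)%:E))%E) ->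
  forall F : n.-tuple T' -> \bar R, measurable_fun setT F -> (forall t, 0 <= F t)%E ->
  (\int[pow_measure mu n]_t F (tmap phi t) =
   \int[pow_measure nu n]_s (F s * (\prod_(j < n) rho (tnth s j))%:E))%E.
Proof.
move=> rho0 mrho.
have mrhoP k : measurable_fun setT
    (fun s : k.-tuple T' => (\prod_(j < k) rho (tnth s j))%:E : \bar R).
  apply/measurable_EFinP; apply: measurable_prod => j _.
  by apply: measurableT_comp => //; exact: measurable_tnth.
elim: n phi => [|n ih] phi mphi H F mF F0.
  rewrite /= !integral_dirac//.
  - by rewrite !diracT !mul1e big_ord0 mule1; congr F; exact: tuple0.
  - by apply: emeasurable_funM => //; exact: mrhoP.
  - exact: measurableT_comp mF (measurable_tmap mphi).
have rhoP0 k (s : k.-tuple T') : (0 <= (\prod_(j < k) rho (tnth s j))%:E)%E.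
  by rewrite lee_fin prodr_ge0.
rewrite (ge0_integral_pow_step mu (F := fun t => F (tmap phi t))); last 2 first.
- exact: measurableT_comp mF (measurable_tmap mphi).
- by move=> t; exact: F0.
rewrite (ge0_integral_pow_step nu (F := fun s => F s * (\prod_(j < n.+1) rho (tnth s j))%:E)%E); last 2 first.
- by apply: emeasurable_funM => //; exact: mrhoP.
- by move=> t; rewrite mule_ge0.
pose G y := (\int[pow_measure nu n]_s
  (F (tcons (y, s)) * (\prod_(j < n) rho (tnth s j))%:E))%E.
have mGi : measurable_fun setT (fun z : T' * n.-tuple T' =>
    F (tcons z) * (\prod_(j < n) rho (tnth z.2 j))%:E)%E.
  apply: emeasurable_funM; first exact: measurableT_comp mF (@measurable_tcons _ T' n).
  exact: (measurableT_comp (mrhoP n) measurable_snd).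
have mG : measurable_fun setT G.
  apply: (@measurable_fun_fubini_tonelli_F _ _ _ _ _ (pow_measure nu n) _ mGi).
  by move=> z; rewrite mule_ge0.
have G0 y : (0 <= G y)%E by apply: integral_ge0 => s _; rewrite mule_ge0.
transitivity (\int[mu]_x G (phi 0%N x))%E.
  apply: eq_integral => x _.
  under eq_integral do rewrite tmap_tcons.
  rewrite (ih _ _ _ (fun s => F (tcons (phi 0%N x, s))))//.
    by move=> i; exact: (H i.+1).
  exact: measurable_tcons_section.
rewrite H//; apply: eq_integral => y _.
rewrite /G -ge0_integralZr//.
- by apply: eq_integral => s _; rewrite big_ord_recl tnth0 EFinM;
    under [in RHS]eq_bigr do rewrite tnthS; rewrite -muleA [X in (_ * X)%E]muleC.
- by apply: emeasurable_funM; [exact: measurable_tcons_section|exact: mrhoP].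
- by move=> s _; rewrite mule_ge0.
- by rewrite lee_fin.
Qed.

End coordinatewise_map.

Section coordinate_permutation.
Context {R : realType} d (T : measurableType d).
Variable mu : {sigma_finite_measure set T -> \bar R}.

Definition box n (A : 'I_n -> set T) : set (n.-tuple T) :=
  [set t | forall i, A i (tnth t i)].

Definition measurable_boxes n : set (set (n.-tuple T)) :=
  [set B | exists2 A : 'I_n -> set T, (forall i, measurable (A i)) & B = box A].

Lemma measurable_box n (A : 'I_n -> set T) :
  (forall i, measurable (A i)) -> measurable (box A).
Proof.
move=> mA; rewrite (_ : box A = \bigcap_(i in [set: 'I_n]) ((@tnth n T)^~ i @^-1` A i)).
  apply: fin_bigcap_measurable => // i _.
  by rewrite -[X in measurable X]setTI; exact: measurable_tnth.
by apply/seteqP; split => [t At i _|t At i]; exact: At.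
Qed.

(** The cylinders over one coordinate, which define this sigma-algebra, are not stable under
    intersection. Boxes are, as uniqueness of measures requires. *)
Lemma measurable_tupleE n :
  measurable = <<s @measurable_boxes n >> :> set (set (n.-tuple T)).
Proof.
apply/seteqP; split; last first.
  apply: smallest_sub; first exact: sigma_algebra_measurable.
  by move=> _ [A mA ->]; exact: measurable_box.
apply: smallest_sub; first exact: smallest_sigma_algebra.
apply: (big_ind (fun X => X `<=` <<s @measurable_boxes n >>)) => [|X Y sX sY|i _ _ [A mA <-]].
- exact: sub0set.
- by rewrite subUset.
apply: sub_sigma_algebra; exists (fun j => if j == i then A else setT).
  by move=> j; case: ifP.
rewrite setTI; apply/seteqP; split=> t /=.
  by move=> At j; case: eqP => // ->.
by move/(_ i); rewrite eqxx.
Qed.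

Lemma pow_measure_box n (A : 'I_n -> set T) : (forall i, measurable (A i)) ->
  pow_measure mu n (box A) = (\prod_(i < n) mu (A i))%E.
Proof.
elim: n A => [|n ih] A mA.
  by rewrite big_ord0 /= diracE mem_set//= => -[].
have -> : box A = @tuncons _ T n @^-1` (A ord0 `*` box (fun i => A (lift ord0 i))).
  apply/seteqP; split=> t /=; case/tupleP: t => x u.
    move=> At; split=> /= [|i]; first by have := At ord0; rewrite tnth0.
    by have := At (lift ord0 i); rewrite tnthS; congr (A _ (tnth _ _)); exact: val_inj.
  move=> [/= A0 As] i; have [j ->|->] := unliftP ord0 i; last by rewrite tnth0.
  by rewrite tnthS; have := As j; congr (A _ (tnth _ _)); exact: val_inj.
rewrite big_ord_recl -ih//.
rewrite [LHS]/= /pow_step /pushforward -comp_preimage.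
have -> : @tuncons _ T n \o @tcons _ T n = id.
  by apply/funext => -[x t]; congr (_, _); apply/val_inj.
rewrite preimage_id [LHS]product_measure1E//.
exact: measurable_box.
Qed.

Definition permute n (s : 'S_n) (t : n.-tuple T) : n.-tuple T :=
  [tuple tnth t (s i) | i < n].

Lemma measurable_permute n (s : 'S_n) : measurable_fun setT (permute s).
Proof.
apply/measurable_fun_tnthP => i.
rewrite (_ : _ \o _ = (@tnth n T ^~ (s i))); first exact: measurable_tnth.
by apply/funext => t /=; rewrite tnth_mktuple.
Qed.

(** The measure and its image under the permutation agree on boxes, being products of the same
    factors in another order. Boxes are stable under intersection, and boxes of finite measure
    exhaust the space. *)
Lemma ge0_integral_permute n (s : 'S_n) (F : n.-tuple T -> \bar R) :
  measurable_fun setT F -> (forall t, 0 <= F t)%E ->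
  (\int[pow_measure mu n]_t F (permute s t) = \int[pow_measure mu n]_t F t)%E.
Proof.
move=> mF F0.
have <- : (\int[pushforward (pow_measure mu n) (permute s)]_t F t =
    \int[pow_measure mu n]_t F (permute s t))%E.
  by rewrite ge0_integral_pushforward//; exact: measurable_permute.
apply: (@eq_measure_integral _ _ _ _ (pow_measure mu n) (pushforward_measure
  (pow_measure mu n) (measurable_permute s))) => B mB _.
have /sigma_finiteP[K [KT ndK Koo]] := sigma_finiteT mu.
have mK k : measurable (K k) by case: (Koo k).
have permbox (A : 'I_n -> set T) :
    permute s @^-1` box A = box (fun i => A ((s^-1)%g i)).
  apply/seteqP; split=> t /= At i.
    by have := At ((s^-1)%g i); rewrite tnth_mktuple permKV.
  by rewrite tnth_mktuple; have := At (s i); rewrite permK.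
have boxE (A : 'I_n -> set T) : (forall i, measurable (A i)) ->
    pow_measure mu n (permute s @^-1` box A) = pow_measure mu n (box A).
  move=> mA; rewrite permbox !pow_measure_box//.
  by rewrite (reindex_inj (@perm_inj _ s)) /=; apply: eq_bigr => i _; rewrite permK.
apply: (measure_unique (@measurable_boxes n) (fun k => box (fun=> K k))) => //.
- exact: measurable_tupleE.
- move=> _ _ [A1 mA1 ->] [A2 mA2 ->]; exists (fun i => A1 i `&` A2 i).
    by move=> i; exact: measurableI.
  apply/seteqP; split => [t /= [H1 H2] i|t /= H].
    by split; [exact: H1|exact: H2].
  by split => i; case: (H i).
- by move=> k; exists (fun=> K k).
- apply/seteqP; split=> // t _.
  have cov i : exists k, K k (tnth t i).
    by have : setT (tnth t i) by []; rewrite KT => -[k _ Kk]; exists k.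
  (* The sets [K k] increase, so the largest of the indices found for the single coordinates serves
     all of them. *)
  exists (\max_(i < n) (projT1 (cid (cov i)))) => // i /=.
  move: (projT2 (cid (cov i))); apply/subsetPset/ndK.
  exact: (@leq_bigmax _ (fun i => sval (cid (cov i))) i).
- by move=> _ [A mA ->]; exact: boxE.
- move=> k; rewrite [ltLHS](boxE (fun=> K k))// pow_measure_box//.
  elim: n {s F mF F0 permbox boxE B mB} => [|m ihm]; first by rewrite big_ord0 ltry.
  by rewrite big_ord_recl lte_mul_pinfty// ge0_fin_numE//; case: (Koo k).
Qed.

End coordinate_permutation.

(** * Composable rules for derivatives of real functions *)

Section real_derivative.
Context {R : realType}.
Implicit Types f g : R -> R.

(** Separates computing a derivative by composition of the rules below from simplifying its value
    algebraically. *)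
Lemma drv_eq f (x df df' : R) : is_derive x (1 : R) f df -> df = df' ->
  is_derive x (1 : R) f df'.
Proof. by move=> + <-. Qed.

Lemma drv_cst (c x : R) : is_derive x (1 : R) (fun=> c) 0.
Proof. exact: is_derive_cst. Qed.

Lemma drv_id (x : R) : is_derive x (1 : R) (fun t => t) 1.
Proof. exact: is_derive_id. Qed.

Lemma drvD f g (x df dg : R) : is_derive x (1 : R) f df ->
  is_derive x (1 : R) g dg -> is_derive x (1 : R) (fun t => f t + g t) (df + dg).
Proof. exact: is_deriveD. Qed.

Lemma drvN f (x df : R) : is_derive x (1 : R) f df ->
  is_derive x (1 : R) (fun t => - f t) (- df).
Proof. exact: is_deriveN. Qed.

Lemma drvB f g (x df dg : R) : is_derive x (1 : R) f df ->
  is_derive x (1 : R) g dg -> is_derive x (1 : R) (fun t => f t - g t) (df - dg).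
Proof. exact: is_deriveB. Qed.

Lemma drvM f g (x df dg : R) : is_derive x (1 : R) f df ->
  is_derive x (1 : R) g dg ->
  is_derive x (1 : R) (fun t => f t * g t) (df * g x + f x * dg).
Proof.
move=> Df Dg; apply: drv_eq (is_deriveM Df Dg) _.
by rewrite addrC /GRing.scale /= (mulrC (g x)).
Qed.

Lemma drvZ f (c x df : R) : is_derive x (1 : R) f df ->
  is_derive x (1 : R) (fun t => c * f t) (c * df).
Proof. by move=> Df; apply: drv_eq (drvM (drv_cst c x) Df) _; rewrite mul0r add0r. Qed.

Lemma drvX f n (x df : R) : is_derive x (1 : R) f df ->
  is_derive x (1 : R) (fun t => f t ^+ n) (n%:R * f x ^+ n.-1 * df).
Proof.
move=> Df; elim: n => [|n ih].
  by apply: drv_eq (drv_cst 1 x) _; rewrite !mul0r.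
rewrite (_ : (fun _ => _) = (fun t => f t * f t ^+ n)); last first.
  by apply/funext => t; rewrite exprS.
apply: drv_eq (drvM Df ih) _; case: n {ih} => [|n] /=; first by rewrite expr0; ring.
by rewrite exprS -natr1; ring.
Qed.

Lemma drv_comp f g (x df dg : R) : is_derive x (1 : R) g dg ->
  is_derive (g x) (1 : R) f df -> is_derive x (1 : R) (fun t => f (g t)) (df * dg).
Proof. by move=> Dg Df; apply: drv_eq (is_derive1_comp Df Dg) _; rewrite mulrC. Qed.

Lemma drv_continuous f (x df : R) : is_derive x (1 : R) f df -> {for x, continuous f}.
Proof. by case=> Df _; apply/differentiable_continuous/derivable1_diffP. Qed.

End real_derivative.

(** * Polar coordinates in the plane, for functions of the modulus *)

Section radial.
Context {R : realType}.
Local Notation leb := (@lebesgue_measure R).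
Local Notation RR := (measurableTypeR R * measurableTypeR R)%type.

Definition plane_norm (z : RR) : measurableTypeR R :=
  Num.sqrt (z.1 ^+ 2 + z.2 ^+ 2).

Lemma measurable_plane_norm : measurable_fun setT plane_norm.
Proof.
rewrite (_ : plane_norm = (fun x : R => x `^ 2^-1) \o
  (fun z : RR => z.1 ^+ 2 + z.2 ^+ 2)).
  apply: (measurableT_comp (measurable_powR _)).
  by apply: measurable_funD; exact: measurable_funX.
by apply/funext => z /=; rewrite powR12_sqrt// addr_ge0// sqr_ge0.
Qed.

Definition disc (r : R) : set RR := [set z | plane_norm z < r].

Lemma measurable_disc r : measurable (disc r).
Proof.
rewrite (_ : disc r = plane_norm @^-1` `]-oo, r[%classic).
  by rewrite -[X in measurable X]setTI; apply: measurable_plane_norm.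
by apply/seteqP; split=> z /=; rewrite in_itv.
Qed.

(** The number pi, kept as an unevaluated area: it cancels against the volume of the ball in the
    normalized integrals. *)
Definition disc_area : R := fine (@plane_measure R (disc 1)).

Lemma disc1_finite : (@plane_measure R (disc 1) < +oo)%E.
Proof.
apply: (@le_lt_trans _ _ (@plane_measure R (`[-1, 1]%classic `*` `[-1, 1]%classic))).
  apply: le_measure; rewrite ?inE; [exact: measurable_disc|exact: measurableX|].
  move=> [x y]; rewrite /disc /plane_norm /= !in_itv /= => xy.
  have {}xy : x ^+ 2 + y ^+ 2 < 1.
    rewrite -[ltLHS]sqr_sqrtr ?addr_ge0 ?sqr_ge0// expr_lt1// sqrtr_ge0//.
  rewrite -!ler_norml -!(@ler_sqr _ _ 1) ?nnegrE// !real_normK ?num_real// expr1n.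
  by split; apply: ltW; apply: le_lt_trans xy; rewrite ?lerDl ?lerDr sqr_ge0.
rewrite [ltLHS]product_measure1E//= !lebesgue_measure_itv /=.
by case: ifP => _; rewrite ?mul0e ?ltry// -[1%E]/(1%:E) -EFinD -EFinM ltry.
Qed.

Lemma disc_area_gt0 : 0 < disc_area.
Proof.
apply: fine_gt0; rewrite disc1_finite andbT.
apply: (@lt_le_trans _ _ (@plane_measure R (`[0, 2^-1]%classic `*` `[0, 2^-1]%classic))).
  rewrite [ltRHS]product_measure1E//= !lebesgue_measure_itv /=.
  by rewrite lte_fin invr_gt0 ltr0n oppr0 adde0 -EFinM lte_fin mulr_gt0 ?invr_gt0.
apply: le_measure; rewrite ?inE; [exact: measurableX|exact: measurable_disc|].
move=> [x y]; rewrite /disc /plane_norm /= !in_itv /= => -[/andP[x0 x2] /andP[y0 y2]].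
rewrite -[ltRHS]sqrtr1 ltr_sqrt//.
by nra.
Qed.

(** A scaling by [r] in each of the two coordinates contributes one factor [r] each. *)
Lemma disc_scale r : 0 < r -> @plane_measure R (disc r) = (disc_area * r ^+ 2)%:E.
Proof.
move=> r0.
have ind (A : set RR) : measurable A -> measurable_fun setT (fun z => (\1_A z)%:E : \bar R).
  by move=> mA; apply/measurable_EFinP.
have ind0 (A : set RR) z : (0 <= (\1_A z)%:E :> \bar R)%E by rewrite lee_fin.
have sc (F : RR -> \bar R) : measurable_fun setT F -> (forall z, 0 <= F z)%E ->
    ((r ^+ 2)%:E * \int[plane_measure]_z F (r * z.1, r * z.2)%R = \int[plane_measure]_z F z)%E.
  move=> mF F0.
  have mF1 : measurable_fun setT (fun z : RR => F (r * z.1, r * z.2)%R).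
    by apply: measurableT_comp mF _; apply: measurable_plane; exact: measurable_funM.
  have mF2 : measurable_fun setT (fun z : RR => F (z.1, r * z.2)%R).
    by apply: measurableT_comp mF _; apply: measurable_plane => //; exact: measurable_funM.
  transitivity (r%:E * \int[plane_measure]_z F (z.1, r * z.2)%R)%E.
    rewrite expr2 EFinM -muleA; congr (_ * _)%E.
    rewrite (plane_tonelli2 mF1 (fun z => F0 _)) (plane_tonelli2 mF2 (fun z => F0 _)).
    rewrite -ge0_integralZl//; last 3 first.
    - exact: (@measurable_fun_fubini_tonelli_G _ _ _ _ _ leb _ mF1).
    - by move=> y _; exact: integral_ge0.
    - by rewrite lee_fin ltW.
    apply: eq_integral => y _ /=.
    have mFy : measurable_fun setT (fun x : measurableTypeR R => F (x, r * y)).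
      by apply: measurableT_comp mF _; exact: measurable_fun_pair.
    rewrite -(ge0_integral_affine 0 r0 mFy)//; congr (_ * _)%E.
    by apply: eq_integral => x _; rewrite addr0.
  rewrite (plane_tonelli1 mF2 (fun z => F0 _)) (plane_tonelli1 mF F0).
  rewrite -ge0_integralZl//; last 3 first.
  - exact: (@measurable_fun_fubini_tonelli_F _ _ _ _ _ leb _ mF2).
  - by move=> y _; exact: integral_ge0.
  - by rewrite lee_fin ltW.
  apply: eq_integral => x _ /=.
  have mFy : measurable_fun setT (fun y : measurableTypeR R => F (x, y)).
    by apply: measurableT_comp mF _; exact: measurable_fun_pair.
  rewrite -(ge0_integral_affine 0 r0 mFy)//; congr (_ * _)%E.
  by apply: eq_integral => y _; rewrite addr0.
have mD := measurable_disc r.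
have := sc _ (ind _ mD) (ind0 _).
rewrite [in X in _ = X -> _]integral_indic// setIT => <-.
rewrite (_ : (\int[plane_measure]_z _)%E = @plane_measure R (disc 1)).
  by rewrite (mulrC disc_area) (EFinM (r ^+ 2)) /disc_area fineK// ge0_fin_numE// disc1_finite.
transitivity (\int[@plane_measure R]_z (\1_(disc 1) z)%:E)%E.
  apply: eq_integral => -[x y] _; rewrite !indicE; congr ((nat_of_bool _)%:R%:E).
  have e : plane_norm (r * x, r * y) = r * plane_norm (x, y).
    rewrite /plane_norm /= (_ : _ + _ = r ^+ 2 * (x ^+ 2 + y ^+ 2)); last by ring.
    by rewrite sqrtrM ?sqr_ge0// sqrtr_sqr gtr0_norm.
  by apply/idP/idP => /set_mem H; apply/mem_set; move: H;
    rewrite /disc /= e gtr_pMr.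
by rewrite integral_indic ?setIT//; exact: measurable_disc.
Qed.

Lemma continuous_FTC (f F : R -> R) (a b : R) : a < b ->
  (forall x, a <= x <= b -> is_derive x (1 : R) F (f x)) ->
  (forall x, a <= x <= b -> {for x, continuous f}) ->
  (\int[leb]_(x in `[a, b]) (f x)%:E = (F b - F a)%:E)%E.
Proof.
move=> ab dF cf; rewrite EFinB; apply: continuous_FTC2 => //.
- by apply: continuous_in_subspaceT => x; rewrite inE /= in_itv /=; exact: cf.
- have cF x : a <= x <= b -> {for x, continuous F} by move=> /dF /drv_continuous.
  split.
  + by move=> x; rewrite in_itv /= => /andP[/ltW ax /ltW xb]; case: (dF x) => //; rewrite ax.
  + by apply/cvg_at_right_filter/cF; rewrite lexx ltW.
  + by apply/cvg_at_left_filter/cF; rewrite lexx ltW.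
- move=> x; rewrite in_itv /= => /andP[/ltW ax /ltW xb].
  by rewrite derive1E; case: (dF x) => //; rewrite ax.
Qed.

(** The truncation at 0 gives a nonnegative density on the whole line that charges no negative
    radius. *)
Definition radial_density (r : measurableTypeR R) : R := 2 * disc_area * Num.max r 0.

Lemma radial_density_ge0 r : 0 <= radial_density r.
Proof.
by rewrite /radial_density mulr_ge0// ?le_max ?lexx ?orbT// mulr_ge0// ltW// disc_area_gt0.
Qed.

Lemma measurable_radial_density : measurable_fun setT radial_density.
Proof. by apply: measurable_funM => //; exact: measurable_maxr. Qed.

(** The image of the plane measure under the modulus agrees with the measure of density
    [radial_density] on the rays []-oo, r[], since both give the area of a disc there. *)
Lemma ge0_integral_plane_norm (F : measurableTypeR R -> \bar R) :
  measurable_fun setT F -> (forall x, 0 <= F x)%E ->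
  (\int[plane_measure]_z F (plane_norm z) =
   \int[leb]_r (F r * (radial_density r)%:E))%E.
Proof.
move=> mF F0.
have <- : (\int[pushforward plane_measure plane_norm]_r F r =
    \int[plane_measure]_z F (plane_norm z))%E.
  by rewrite ge0_integral_pushforward//; exact: measurable_plane_norm.
rewrite -(ge0_integral_density leb radial_density_ge0 measurable_radial_density mF F0).
apply: (@eq_measure_integral _ _ _ _ (density leb radial_density_ge0 measurable_radial_density)
  (pushforward_measure plane_measure measurable_plane_norm)) => B mB _.
have ray r : (plane_norm @^-1` `]-oo, r[%classic) = disc r.
  by apply/seteqP; split=> z /=; rewrite in_itv.
have rayE r : pushforward_measure (@plane_measure R) measurable_plane_norm `]-oo, r[%classic =
    (disc_area * Num.max r 0 ^+ 2)%:E.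
  rewrite [LHS]/= /pushforward ray; have [r0|r0] := leP r 0.
    rewrite expr0n mulr0 (_ : disc r = set0) ?measure0//.
    apply/seteqP; split=> z //=; rewrite /disc /= => /lt_le_trans /(_ r0).
    by rewrite ltNge sqrtr_ge0.
  exact: disc_scale.
apply: (@measure_unique _ R (measurableTypeR R) (@RGenInftyO.G R) (fun k => `]-oo, k%:R[%classic) _ _ _ _
  (pushforward_measure (@plane_measure R) measurable_plane_norm)
  [the measure _ _ of density leb radial_density_ge0 measurable_radial_density] _ _ B mB) => //.
- exact: RGenInftyO.measurableE.
- move=> _ _ [x ->] [y ->]; exists (Num.min x y).
  by apply/seteqP; split=> z /=; rewrite !in_itv /= lt_min => /andP.
- by move=> k; exists k%:R.
- apply/seteqP; split=> // x _; exists (Num.truncn `|x|).+1 => //=.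
  by rewrite in_itv /= (le_lt_trans (ler_norm x))// truncnS_gt.
- move=> _ [r ->]; rewrite rayE [RHS]/= /density.
  have [r0|r0] := leP r 0.
    rewrite expr0n mulr0 integral0_eq// => x /=; rewrite in_itv /= => xr.
    by rewrite /radial_density max_r ?mulr0// ltW// (lt_le_trans xr).
  transitivity (\int[leb]_(x in `[0%R, r]) (2 * disc_area * x)%:E)%E.
    have dF (x : R) : is_derive x (1 : R) (fun x => disc_area * x ^+ 2) (2 * disc_area * x).
      by apply: drv_eq (drvZ _ (drvX 2 (drv_id x))) _; ring.
    rewrite (continuous_FTC r0 (fun x _ => dF x)) ?expr0n ?mulr0 ?subr0//.
    by move=> x _; apply: cvgM; [exact: cvg_cst|exact: cvg_id].
  rewrite -integral_itv_bndo_bndc//; last first.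
    by apply/measurable_EFinP; apply: measurable_funTS; exact: measurable_funM.
  rewrite [LHS]integral_mkcond [RHS]integral_mkcond; apply: eq_integral => x _.
  rewrite !patchE !mem_setE !in_itv /= /radial_density.
  by have [x0|x0] := leP 0 x; case: ifP => //; rewrite mulr0.
- by move=> k; rewrite rayE ltry.
Qed.

End radial.

(** * The Gamma function and Dirichlet integrals *)

Section Gamma_function.
Context {R : realType}.
Local Notation leb := (@lebesgue_measure R).
Implicit Types (s t : R).

Lemma exhaustion_cvg (f : R -> R) (a b : nat -> R) (D : set (measurableTypeR R)) :
  measurable_fun setT f -> (forall x, D x -> 0 <= f x) ->
  nonincreasing_seq a -> nondecreasing_seq b ->
  D = \bigcup_k `[a k, b k]%classic ->
  (\int[leb]_(x in `[a k, b k]) (f x)%:E @[k --> \oo] -->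
   \int[leb]_(x in D) (f x)%:E)%E.
Proof.
move=> mf f0 na nb DE; rewrite DE.
apply: ge0_nondecreasing_set_cvg_integral.
- move=> i j ij; apply/subsetPset => x /=; rewrite !in_itv /= => /andP[ax xb].
  by rewrite (le_trans (na _ _ ij))// (le_trans xb)// nb.
- by move=> i; exact: measurable_itv.
- by move=> i; apply/measurable_EFinP; exact: measurable_funTS.
- by move=> i x xi; rewrite lee_fin f0// DE; exists i.
Qed.

Definition gamma_fun s t : R := t `^ (s - 1) * expR (- t).

Lemma gamma_fun_ge0 s t : 0 <= gamma_fun s t.
Proof. by rewrite mulr_ge0 ?powR_ge0 ?expR_ge0. Qed.

Lemma measurable_gamma_fun s : measurable_fun setT (gamma_fun s).
Proof.
apply: measurable_funM; first exact: measurable_powR.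
by apply: measurableT_comp; [exact: measurable_expR|exact: measurable_funN].
Qed.

(** The segments [[1/(k+1), k+2]] exhaust the open half-line while avoiding the origin, where the
    integrand may be singular; [k+2] makes even the initial one nondegenerate. *)
Let ak (k : nat) : R := k.+1%:R^-1.
Let bk (k : nat) : R := k.+2%:R.

Let ak_gt0 k : 0 < ak k. Proof. by rewrite invr_gt0 ltr0n. Qed.
Let ab k : ak k < bk k.
Proof.
rewrite /ak /bk (@le_lt_trans _ _ 1)// ?ltr1n//.
by rewrite invf_le1 ?ltr0n// ler1n.
Qed.
Let ni_ak : nonincreasing_seq ak.
Proof. by move=> i j ij; rewrite lef_pV2 ?posrE ?ltr0n// ler_nat. Qed.
Let nd_bk : nondecreasing_seq bk.
Proof. by move=> i j ij; rewrite ler_nat. Qed.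
Let DE : `]0, +oo[%classic = \bigcup_k `[ak k, bk k]%classic.
Proof.
apply/seteqP; split=> x /=; rewrite in_itv /= ?andbT.
  move=> x0; pose k := (Num.truncn (Num.max x x^-1)).
  have kP : Num.max x x^-1 < k.+1%:R by rewrite truncnS_gt.
  move: kP; rewrite gt_max => /andP[xk xVk].
  exists k => //=; rewrite in_itv /= /ak /bk; apply/andP; split.
    by rewrite -[x]invrK lef_pV2 ?posrE ?invr_gt0 ?ltr0n// ltW.
  by rewrite (le_trans (ltW xk))// ler_nat.
by move=> [k _ /=]; rewrite in_itv /= => /andP[+ _]; exact: lt_le_trans.
Qed.

Lemma gamma_fun_cvg s :
  (\int[leb]_(x in `[ak k, bk k]) (gamma_fun s x)%:E @[k --> \oo] -->
   \int[leb]_(x in `]0%R, +oo[) (gamma_fun s x)%:E)%E.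
Proof.
apply: exhaustion_cvg => //; first exact: measurable_gamma_fun.
by move=> x _; exact: gamma_fun_ge0.
Qed.

Lemma expR_ge_exprn n t : 0 <= t -> t ^+ n / n`!%:R <= expR t.
Proof.
move=> t0; case: n => [|n].
  by rewrite expr0 fact0 divr1 (le_trans _ (expR_ge1Dx t))// lerDl.
by apply: le_trans (expR_ge1Dxn n t0); rewrite lerDr.
Qed.

Lemma powR_le_expR s : 0 < s -> exists2 C : R, 0 < C &
  forall t, 0 <= t -> t `^ s <= C * expR t.
Proof.
(* From [t^s <= (1+t)^s <= (1+t)^N <= N! e^(1+t)] with [N > s]. *)
move=> s0; pose N := (Num.truncn s).+1; exists (N`!%:R * expR 1).
  by rewrite mulr_gt0 ?expR_gt0// ltr0n fact_gt0.
move=> t t0; have t1 : 0 <= 1 + t by rewrite addr_ge0.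
apply: (@le_trans _ _ ((1 + t) ^+ N)).
  apply: (@le_trans _ _ ((1 + t) `^ s)).
    by apply: ge0_ler_powR; rewrite ?nnegrE ?(ltW s0)// lerDr.
  by rewrite -powR_mulrn// ler_powR ?lerDl// ltW// truncnS_gt.
rewrite -mulrA -expRD mulrC -ler_pdivrMr ?ltr0n ?fact_gt0//.
exact: expR_ge_exprn.
Qed.

Lemma powR_le_expR2 s : 0 < s -> exists2 C : R, 0 < C &
  forall t, 0 <= t -> t `^ s <= C * expR (t / 2).
Proof.
move=> s0; have [C C0 HC] := powR_le_expR s0.
exists (2 `^ s * C); first by rewrite mulr_gt0// powR_gt0.
move=> t t0; rewrite -[in leLHS](divfK (_ : 2 != 0 :> R) t)// mulrC powRM ?divr_ge0//.
by rewrite -mulrA ler_wpM2l ?powR_ge0// HC// divr_ge0.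
Qed.

Lemma drv_powR (f : R -> R) s (x df : R) : 0 < f x ->
  is_derive x (1 : R) f df ->
  is_derive x (1 : R) (fun t => f t `^ s) (s * f x `^ (s - 1) * df).
Proof.
move=> fx0 Df; exact: (drv_comp (f := fun u => u `^ s) Df (is_derive1_powR s fx0)).
Qed.

Lemma drv_expR (f : R -> R) (x df : R) : is_derive x (1 : R) f df ->
  is_derive x (1 : R) (fun t => expR (f t)) (expR (f x) * df).
Proof. move=> Df; exact: (drv_comp (f := expR) Df (is_derive_expR (f x))). Qed.

Lemma continuous_gamma_fun s x : 0 < x -> {for x, continuous (gamma_fun s)}.
Proof.
move=> x0; apply: (@drv_continuous _ _ _ _ (drvM (drv_powR (s - 1) _ (drv_id x))
  (drv_expR (drvN (drv_id x))))).
exact: x0.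
Qed.

(** The boundary term of the integration by parts that gives the functional equation of Gamma. *)
Let P s t := t `^ s * expR (- t).

Let drvP s t : 0 < t ->
  is_derive t (1 : R) (P s) (s * gamma_fun s t - gamma_fun (s + 1) t).
Proof.
move=> t0; apply: drv_eq (drvM (drv_powR s _ (drv_id t)) (drv_expR (drvN (drv_id t)))) _ => //.
by rewrite /gamma_fun addrK; ring.
Qed.

Let I s k := \int[leb]_(x in `[ak k, bk k]) gamma_fun s x.

Let gamma_fun_int s k : leb.-integrable `[ak k, bk k] (EFin \o gamma_fun s).
Proof.
apply: continuous_compact_integrable; first exact: segment_compact.
apply: continuous_in_subspaceT => x; rewrite inE /= in_itv /= => /andP[ax _].
by apply: continuous_gamma_fun; exact: lt_le_trans ax.
Qed.

Let IE s k : (\int[leb]_(x in `[ak k, bk k]) (gamma_fun s x)%:E = (I s k)%:E)%E.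
Proof.
by rewrite /I /Rintegral fineK//; apply: integrable_fin_num => //; exact: gamma_fun_int.
Qed.

Let I_rec s k : s * I s k = I (s + 1) k + (P s (bk k) - P s (ak k)).
Proof.
have : (\int[leb]_(x in `[ak k, bk k]) (s * gamma_fun s x - gamma_fun (s + 1) x)%:E =
    (P s (bk k) - P s (ak k))%:E)%E.
  apply: continuous_FTC; first exact: ab.
    by move=> x /andP[ax _]; apply: drvP; exact: lt_le_trans ax.
  move=> x /andP[ax _]; have x0 : 0 < x by exact: lt_le_trans ax.
  apply: cvgB; last exact: continuous_gamma_fun.
  by apply: cvgM; [exact: cvg_cst|exact: continuous_gamma_fun].
move/(congr1 fine) => /= <-.
rewrite -[fine _]/(\int[leb]_(x in `[ak k, bk k]) (s * gamma_fun s x - gamma_fun (s + 1) x)).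
rewrite RintegralB//; last by apply: integrableZ_fin.
by rewrite RintegralZl// addrC subrK.
Qed.

Let P_bk s : 0 < s -> P s (bk k) @[k --> \oo] --> (0 : R).
Proof.
move=> s0; have [C C0 HC] := powR_le_expR2 s0.
apply: (@squeeze_cvgr _ _ _ _ (fun=> 0) (fun k => 2 * C * ak k)).
- near=> k; rewrite mulr_ge0 ?powR_ge0 ?expR_ge0//=.
  have b0 : 0 <= bk k by rewrite /bk.
  apply: (@le_trans _ _ (C * expR (bk k / 2) * expR (- bk k))).
    by rewrite ler_wpM2r ?expR_ge0// HC.
  rewrite -mulrA -expRD (_ : bk k / 2 - bk k = - (bk k / 2)); last by field.
  rewrite expRN mulrAC mulrC ler_wpM2r ?(ltW C0)//.
  have -> : 2 * ak k = (k.+1%:R / 2)^-1 by rewrite /ak invfM invrK mulrC.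
  rewrite lef_pV2 ?posrE ?expR_gt0 ?divr_gt0//.
  apply: le_trans (expR_ge1Dx _); rewrite /bk -[k.+2%:R]natr1.
  by lra.
- exact: cvg_cst.
- rewrite -[X in _ --> X](mulr0 (2 * C)); apply: cvgM; first exact: cvg_cst.
  exact: cvg_harmonic.
Unshelve. all: by end_near. Qed.

Let P_ak s : 0 < s -> P s (ak k) @[k --> \oo] --> (0 : R).
Proof.
move=> s0; apply: (@squeeze_cvgr _ _ _ _ (fun=> 0) (fun k => ak k `^ s)).
- near=> k; rewrite mulr_ge0 ?powR_ge0 ?expR_ge0//=.
  rewrite -[leRHS]mulr1 ler_wpM2l ?powR_ge0// expRN invf_le1 ?expR_gt0//.
  by rewrite (le_trans _ (expR_ge1Dx _))// lerDl ltW.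
- exact: cvg_cst.
- have /cvg_at_rightP := powR_cvg0 s0; apply; split => //.
  exact: cvg_harmonic.
Unshelve. all: by end_near. Qed.

(** The recurrence trades the possibly singular [t^(s-1)] for [t^s], which is bounded by a multiple
    of [e^(t/2)], so the origin requires no separate estimate. *)
Let I_bound s : 0 < s -> exists M, forall k, I s k <= M.
Proof.
move=> s0; have [C C0 HC] := powR_le_expR2 s0.
(* [C * 2] bounds the integral of [C e^(-t/2)], and the other [C] bounds the boundary term at
   [bk k]; the one at [ak k] is subtracted. *)
exists ((C * 2 + C) / s) => k; rewrite ler_pdivlMr// mulrC I_rec.
have P0 t : 0 <= P s t by rewrite mulr_ge0 ?powR_ge0 ?expR_ge0.
apply: lerD; last first.
  rewrite lerBlDr -[leLHS]addr0; apply: lerD => //.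
  apply: (@le_trans _ _ (C * expR (bk k / 2) * expR (- bk k))).
    by rewrite ler_wpM2r ?expR_ge0// HC// /bk.
  rewrite -mulrA -expRD -[leRHS]mulr1 ler_wpM2l ?(ltW C0)// expR_le1.
  by rewrite subr_le0 ler_pdivrMr// ler_peMr// /bk ?ler1n// ler0n.
pose Q t : R := - 2 * expR (- (t / 2)).
have dQ (t : R) : is_derive t (1 : R) Q (expR (- (t / 2))).
  apply: drv_eq (drvZ _ (drv_expR (drvN (drvM (drv_id t) (drv_cst 2^-1 t))))) _.
  by field.
have cQ : continuous (fun t : R => expR (- (t / 2))).
  move=> x; exact: (drv_continuous (drv_expR (drvN (drvM (drv_id x) (drv_cst 2^-1 x))))).
have QI := continuous_FTC (ab k) (fun x _ => dQ x) (fun x _ => cQ x).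
have iQ : leb.-integrable `[ak k, bk k] (EFin \o (fun t : R => expR (- (t / 2)))).
  apply: continuous_compact_integrable; first exact: segment_compact.
  exact: continuous_subspaceT.
apply: (@le_trans _ _ (\int[leb]_(x in `[ak k, bk k]) (C * expR (- (x / 2))))).
  apply: le_Rintegral => //; first by apply: integrableZ_fin.
  move=> x; rewrite /= in_itv /= => /andP[ax _].
  have x0 : 0 <= x by rewrite (le_trans _ ax)// ltW.
  rewrite /gamma_fun addrK.
  apply: (@le_trans _ _ (C * expR (x / 2) * expR (- x))).
    by rewrite ler_wpM2r ?expR_ge0// HC.
  by rewrite -mulrA -expRD (_ : x / 2 - x = - (x / 2)); last field.
rewrite RintegralZl// ler_wpM2l ?(ltW C0)// /Rintegral QI /= /Q.
have e0 := expR_ge0 (- (bk k / 2)).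
have e1 : expR (- (ak k / 2)) <= 1 by rewrite expR_le1 oppr_le0 divr_ge0// ltW.
lra.
Qed.

Lemma Gamma_fin s : 0 < s ->
  (\int[leb]_(x in `]0%R, +oo[) (gamma_fun s x)%:E < +oo)%E.
Proof.
move=> /I_bound[M HM]; apply: (@le_lt_trans _ _ M%:E); last exact: ltry.
rewrite -(cvg_lim _ (gamma_fun_cvg (s := s)))//; apply: lime_le.
  by apply/cvg_ex; eexists; exact: gamma_fun_cvg.
by apply: nearW => k; rewrite IE lee_fin.
Qed.

Let GammaE s : 0 < s ->
  (\int[leb]_(x in `]0%R, +oo[) (gamma_fun s x)%:E = (Gamma s)%:E)%E.
Proof.
move=> s0; rewrite /Gamma /Rintegral fineK// ge0_fin_numE ?Gamma_fin//.
by apply: integral_ge0 => t _; rewrite lee_fin gamma_fun_ge0.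
Qed.

Let I_cvg s : 0 < s -> I s k @[k --> \oo] --> Gamma s.
Proof.
move=> s0; have := @gamma_fun_cvg s; rewrite GammaE//.
under eq_fun do rewrite IE.
by move/fine_cvgP => [_].
Qed.

Lemma GammaS s : 0 < s -> Gamma (s + 1) = s * Gamma s.
Proof.
move=> s0; have s10 : 0 < s + 1 by rewrite addr_gt0.
have c1 : s * I s k @[k --> \oo] --> s * Gamma s.
  by apply: cvgM; [exact: cvg_cst|exact: I_cvg].
have c2 : (I (s + 1) k + (P s (bk k) - P s (ak k))) @[k --> \oo] --> Gamma (s + 1).
  rewrite -[X in _ --> X]addr0 -[X in _ --> _ + X](subr0 (0 : R)).
  by apply: cvgD; [exact: I_cvg|apply: cvgB; [exact: P_bk|exact: P_ak]].
move: c2; under eq_fun do rewrite -I_rec.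
by move=> /(cvg_unique _ c1) <-.
Qed.

Lemma Gamma_gt0 s : 0 < s -> 0 < Gamma s.
Proof.
move=> s0; rewrite -lte_fin -GammaE//.
(* On [[1, 2]] the power [t^(s-1)] is at least [t^(-1)], hence at least [1/2], because [s > 0]. *)
apply: (@lt_le_trans _ _ (\int[leb]_(x in `[1%R, 2%R]) (2^-1 * expR (- 2))%:E)%E).
  rewrite integral_cst//= lebesgue_measure_itv /= lte_fin ltr1n -EFinD -EFinM lte_fin.
  by rewrite !mulr_gt0 ?expR_gt0 ?invr_gt0// subr_gt0 ltr1n.
apply: (@le_trans _ _ (\int[leb]_(x in `[1%R, 2%R]) (gamma_fun s x)%:E)%E).
  apply: ge0_le_integral => //.
  - by apply/measurable_EFinP; apply: measurable_funTS; exact: measurable_gamma_fun.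
  move=> x; rewrite /= in_itv /= => /andP[x1 x2]; rewrite lee_fin.
  have x0 : 0 < x by rewrite (lt_le_trans _ x1).
  apply: ler_pM; rewrite ?invr_ge0 ?expR_ge0 ?ler_expR ?lerN2//.
  apply: (@le_trans _ _ (x `^ (-1))).
    by rewrite powR_inv1 ?(ltW x0)// lef_pV2 ?posrE.
  by rewrite ler_powR// lerBrDr addNr ltW.
apply: ge0_subset_integral => //.
- by apply/measurable_EFinP; apply: measurable_funTS; exact: measurable_gamma_fun.
- by move=> x _; rewrite lee_fin gamma_fun_ge0.
- move=> x; rewrite /= !in_itv /= => /andP[x1 _]; rewrite andbT.
  exact: lt_le_trans x1.
Qed.

End Gamma_function.

Section Dirichlet_integral.
Context {R : realType}.
Local Notation leb := (@lebesgue_measure R).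
Local Notation RR := (measurableTypeR R * measurableTypeR R)%type.

(* A primitive of [2 r^(2m+1) (S - r^2)^b], by integration by parts in [m]. *)
Fixpoint beta_prim (S : R) (m : nat) (b : R) (r : R) : R :=
  if m is m'.+1 then
    (m'.+1%:R * beta_prim S m' (b + 1) r - r ^+ (2 * m) * (S - r ^+ 2) `^ (b + 1)) / (b + 1)
  else - (S - r ^+ 2) `^ (b + 1) / (b + 1).

Definition beta_fun (S : R) (m : nat) (b : R) (r : R) : R :=
  2 * r ^+ (2 * m).+1 * (S - r ^+ 2) `^ b.

Lemma drv_sub_sqr_powR (S c r : R) : r ^+ 2 < S ->
  is_derive r (1 : R) (fun t => (S - t ^+ 2) `^ c)
    (c * (S - r ^+ 2) `^ (c - 1) * - (2 * r)).
Proof.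
move=> rS; have D := drvB (drv_cst S r) (drvX 2 (drv_id r)).
apply: drv_eq (@drv_powR _ (fun t => S - t ^+ 2) c r _ _ D) _.
  by rewrite subr_gt0.
by congr (_ * _); rewrite /= expr1; ring.
Qed.

Lemma drv_beta_prim (S : R) m (b r : R) : -1 < b -> r ^+ 2 < S ->
  is_derive r (1 : R) (beta_prim S m b) (beta_fun S m b r).
Proof.
move=> b1 rS; elim: m b b1 => [|m ih] b b1; have b0 : b + 1 != 0 by rewrite gt_eqF; lra.
  apply: drv_eq (drvM (drvN (drv_sub_sqr_powR (b + 1) rS)) (drv_cst (b + 1)^-1 r)) _.
  by rewrite /beta_fun addrK muln0 expr1 /=; field.
have D := drvM (drvX (2 * m.+1) (drv_id r)) (drv_sub_sqr_powR (b + 1) rS).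
have b11 : -1 < b + 1 by lra.
apply: drv_eq (drvM (drvB (drvZ m.+1%:R (ih _ b11)) D) (drv_cst (b + 1)^-1 r)) _.
rewrite /beta_fun addrK mulnS add2n /= !exprS -!natr1 natrM; field.
exact: b0.
Qed.

Lemma continuous_beta_fun (S : R) m (b r : R) : r ^+ 2 < S -> {for r, continuous (beta_fun S m b)}.
Proof.
move=> rS.
exact: (drv_continuous (drvM (drvZ 2 (drvX (2 * m).+1 (drv_id r))) (drv_sub_sqr_powR b rS))).
Qed.

Lemma measurable_beta_fun (S : R) m (b : R) : measurable_fun setT (beta_fun S m b).
Proof.
apply: measurable_funM.
  by apply: measurable_funM => //; exact: measurable_funX.
apply: (measurableT_comp (measurable_powR b)).
by apply: measurable_funB => //; exact: measurable_funX.
Qed.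

Lemma beta_prim0 (S : R) m (b : R) : -1 < b -> beta_prim S m b 0 =
  - (S `^ (b + 1 + m%:R) * m`!%:R * Gamma (b + 1) / Gamma (b + 1 + m.+1%:R)).
Proof.
elim: m b => [|m ih] b b1 /=; have b0 : 0 < b + 1 by lra.
  rewrite expr0n /= subr0 !addr0 fact0 mulr1 (GammaS b0).
  by field; rewrite !gt_eqF// Gamma_gt0.
rewrite ih; last by lra.
rewrite mulnS addSn expr0n /= mul0r subr0 (GammaS b0) factS natrM.
have -> : b + 1 + 1 + m%:R = b + 1 + m.+1%:R by rewrite -[m.+1%:R]natr1; ring.
have -> : b + 1 + 1 + m.+1%:R = b + 1 + m.+2%:R by rewrite -[m.+2%:R]natr1; ring.
field; rewrite !gt_eqF// Gamma_gt0//.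
by rewrite addr_gt0.
Qed.

(** For [b < 0] the integrand is unbounded at [rho], so the primitive is used on smaller segments.
    It tends to 0 at [rho] because [b + 1 > 0], which leaves only its value at 0. *)
Lemma ge0_integral_beta (rho : R) m (b : R) : 0 < rho -> -1 < b ->
  (\int[leb]_(r in `[0%R, rho[) (beta_fun (rho ^+ 2) m b r)%:E =
   ((rho ^+ 2) `^ (b + 1 + m%:R) * m`!%:R * Gamma (b + 1) / Gamma (b + 1 + m.+1%:R))%:E)%E.
Proof.
move=> rho0 b1; set S := rho ^+ 2.
(* The shift to [k+2] keeps every right endpoint positive. *)
pose bk k : R := rho * (1 - k.+2%:R^-1).
have ck k : 0 < 1 - k.+2%:R^-1 :> R.
  by rewrite subr_gt0 invf_lt1 ?ltr0n// ltr1n.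
have bk0 k : 0 < bk k by rewrite mulr_gt0.
have bkr k : bk k < rho by rewrite gtr_pMr// gtrDl oppr_lt0 invr_gt0 ltr0n.
have sqlt x : 0 <= x -> x < rho -> x ^+ 2 < S.
  by move=> x0 xr; rewrite ltr_sqr ?nnegrE// ltW.
have DE : `[0, rho[%classic = \bigcup_k `[0, bk k]%classic.
  apply/seteqP; split=> x /=; rewrite in_itv /=.
    move=> /andP[x0 xr]; exists (Num.truncn (rho / (rho - x))) => //=.
    rewrite in_itv /= x0 /= /bk.
    have := truncnS_gt (rho / (rho - x)); set N := (Num.truncn _).+1 => NP.
    rewrite mulrBr mulr1 lerBrDr addrC -lerBrDr ler_pdivrMr ?ltr0n//.
    rewrite ltr_pdivrMr ?subr_gt0// mulrC in NP.
    by rewrite (le_trans (ltW NP))// ler_wpM2l ?ler_nat// subr_ge0 ltW.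
  move=> [k _ /=]; rewrite in_itv /= => /andP[-> xb] /=.
  exact: le_lt_trans (bkr k).
have bge0 x : 0 <= x -> 0 <= beta_fun S m b x.
  by move=> x0; rewrite !mulr_ge0 ?powR_ge0 ?exprn_ge0.
have cv : (\int[leb]_(x in `[0%R, bk k]) (beta_fun S m b x)%:E @[k --> \oo] -->
    \int[leb]_(x in `[0%R, rho[) (beta_fun S m b x)%:E)%E.
  apply: (@exhaustion_cvg _ _ (fun=> 0)) => //.
  - exact: measurable_beta_fun.
  - by move=> x; rewrite /= in_itv /= => /andP[x0 _]; exact: bge0.
  - move=> i j ij; rewrite ler_wpM2l ?(ltW rho0)// lerD2l lerN2.
    by rewrite lef_pV2 ?posrE ?ltr0n// ler_nat.
have FTCk k : (\int[leb]_(x in `[0%R, bk k]) (beta_fun S m b x)%:E =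
    (beta_prim S m b (bk k) - beta_prim S m b 0)%:E)%E.
  apply: continuous_FTC => //.
    move=> x /andP[x0 xb]; apply: drv_beta_prim => //; apply: sqlt => //.
    exact: le_lt_trans (bkr k).
  move=> x /andP[x0 xb]; apply: continuous_beta_fun; apply: sqlt => //.
  exact: le_lt_trans (bkr k).
have bk_cvg : bk k @[k --> \oo] --> rho.
  have : bk k @[k --> \oo] --> rho * (1 - 0); last by rewrite subr0 mulr1.
  apply: cvgM; first exact: cvg_cst.
  apply: cvgB; first exact: cvg_cst.
  have := @cvg_harmonic R; rewrite -cvg_shiftS.
  exact.
have pw c : 0 < c -> (S - bk k ^+ 2) `^ c @[k --> \oo] --> (0 : R).
  move=> c0; have /cvg_at_rightP := powR_cvg0 c0; apply; split.
    by move=> k; rewrite subr_gt0 sqlt// ltW.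
  have : S - bk k ^+ 2 @[k --> \oo] --> S - S; last by rewrite subrr.
  by apply: cvgB; [exact: cvg_cst|exact: cvgM].
have cX N : bk k ^+ N @[k --> \oo] --> rho ^+ N.
  elim: N => [|N ihN]; first by under eq_fun do rewrite expr0; exact: cvg_cst.
  by rewrite exprS; under eq_fun do rewrite exprS; exact: cvgM.
have pc : beta_prim S m b (bk k) @[k --> \oo] --> (0 : R).
  elim: m b b1 {bge0 cv FTCk} => [|m' ih] b b1 /=; have b0 : 0 < b + 1 by lra.
    have : - (S - bk k ^+ 2) `^ (b + 1) / (b + 1) @[k --> \oo] --> - 0 / (b + 1).
      by apply: cvgM; [apply: cvgN; exact: pw|exact: cvg_cst].
    by rewrite oppr0 mul0r.
  have b11 : -1 < b + 1 by lra.
  have : (m'.+1%:R * beta_prim S m' (b + 1) (bk k) -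
     bk k ^+ (2 * m'.+1) * (S - bk k ^+ 2) `^ (b + 1)) / (b + 1) @[k --> \oo] -->
     (m'.+1%:R * 0 - rho ^+ (2 * m'.+1) * 0) / (b + 1).
    apply: cvgM; last exact: cvg_cst.
    apply: cvgB; apply: cvgM; [exact: cvg_cst|exact: ih|exact: cX|exact: pw].
  by rewrite !mulr0 subrr mul0r.
apply/esym; rewrite -[X in X%:E](opprK) -beta_prim0// -[- _]add0r.
move: cv; under eq_fun do rewrite FTCk.
move=> /(cvg_unique _ _) cvu; apply: cvu => //.
apply: cvg_EFin; first exact: nearW.
by apply: cvgB; [exact: pc|exact: cvg_cst].
Qed.

End Dirichlet_integral.

Section Dirichlet_integral_Cn.
Context {R : realType}.
Local Notation leb := (@lebesgue_measure R).
Local Notation CC := (measurableTypeR R * measurableTypeR R)%type.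
Local Notation lebC n := (@lebesgue_C R n).
Local Notation kappa := (@disc_area R).

Lemma tnth_tconsS d (T : measurableType d) n (x : T) (t : n.-tuple T) i : tnth (tcons (x, t)) (lift ord0 i) = tnth t i.
Proof. by rewrite tnthS. Qed.

Lemma tnth_tcons0 d (T : measurableType d) n (x : T) (t : n.-tuple T) : tnth (tcons (x, t)) ord0 = x.
Proof. by rewrite tnth0. Qed.

Definition sqnorm n (t : n.-tuple CC) : R := \sum_(j < n) plane_norm (tnth t j) ^+ 2.

Lemma measurable_plane_norm_tnth n (j : 'I_n) :
  measurable_fun setT (fun t : n.-tuple CC => plane_norm (tnth t j)).
Proof. exact: (measurableT_comp measurable_plane_norm (measurable_tnth j)). Qed.

Lemma measurable_sqnorm n : measurable_fun setT (@sqnorm n).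
Proof.
apply: measurable_sum => j; apply: measurable_funX.
exact: measurable_plane_norm_tnth.
Qed.

Lemma plane_norm_ge0 (z : CC) : 0 <= plane_norm z. Proof. exact: sqrtr_ge0. Qed.

(** The squared radius [S] is a parameter because fixing one coordinate [z] leaves an integrand of
    the same kind, on the ball of squared radius [S - |z|^2]. *)
Definition dirichlet_fun n (S b : R) (m : 'I_n -> nat) (t : n.-tuple CC) : R :=
  if sqnorm t < S then
    (S - sqnorm t) `^ b * \prod_(j < n) plane_norm (tnth t j) ^+ (2 * m j) else 0.

Lemma dirichlet_fun_ge0 n S b m (t : n.-tuple CC) : 0 <= dirichlet_fun S b m t.
Proof.
rewrite /dirichlet_fun; case: ifP => // _.
by rewrite mulr_ge0 ?powR_ge0// prodr_ge0// => j _; rewrite exprn_ge0// plane_norm_ge0.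
Qed.

Lemma measurable_dirichlet_fun n S b (m : 'I_n -> nat) :
  measurable_fun setT (dirichlet_fun S b m).
Proof.
apply: measurable_fun_ifT => //.
  by apply: measurable_fun_ltr => //; exact: measurable_sqnorm.
apply: measurable_funM.
  apply: (measurableT_comp (measurable_powR b)).
  by apply: measurable_funB => //; exact: measurable_sqnorm.
apply: measurable_prod => j _; apply: measurable_funX.
exact: measurable_plane_norm_tnth.
Qed.

Lemma dirichlet_fun_tcons n S b (m : 'I_n.+1 -> nat) z (t : n.-tuple CC) :
  dirichlet_fun S b m (tcons (z, t)) = plane_norm z ^+ (2 * m ord0) *
  dirichlet_fun (S - plane_norm z ^+ 2) b (fun j => m (lift ord0 j)) t.
Proof.
have sqE : sqnorm (tcons (z, t)) = plane_norm z ^+ 2 + sqnorm t.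
  rewrite /sqnorm big_ord_recl tnth_tcons0; congr (_ + _).
  by apply: eq_bigr => j _; rewrite tnth_tconsS.
rewrite /dirichlet_fun sqE ltrBrDl; case: ifP => _; last by rewrite mulr0.
rewrite big_ord_recl tnth_tcons0 opprD addrA.
under eq_bigr do rewrite tnth_tconsS.
by rewrite mulrCA.
Qed.

Definition dirichlet_cst n (b : R) (m : 'I_n -> nat) : R :=
  kappa ^+ n * (\prod_(j < n) (m j)`!%:R) * Gamma (b + 1) /
  Gamma (b + 1 + (n + \sum_(j < n) m j)%:R).

(** Induction on the dimension: the inner integral is a power of [S - |z|^2], which polar
    coordinates in [z] turn into the one-variable beta integral with exponent [b + N]. *)
Lemma ge0_integral_dirichlet n (S b : R) (m : 'I_n -> nat) : -1 < b ->
  (\int[lebC n]_t (dirichlet_fun S b m t)%:E =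
   (if 0 < S then dirichlet_cst b m * S `^ (b + (n + \sum_(j < n) m j)%:R) else 0)%:E)%E.
Proof.
move=> b1; elim: n S m => [|n ih] S m.
  rewrite /lebesgue_C /= integral_dirac//; last first.
    by apply/measurable_EFinP; exact: measurable_dirichlet_fun.
  rewrite diracT mul1e /dirichlet_fun /dirichlet_cst /sqnorm !big_ord0 subr0 !addr0.
  case: ifP => // _; congr EFin; rewrite expr0 !mulr1 mul1r.
  by rewrite divff ?mul1r// gt_eqF// Gamma_gt0//; lra.
rewrite /lebesgue_C ge0_integral_pow_step; last 2 first.
- by apply/measurable_EFinP; exact: measurable_dirichlet_fun.
- by move=> t; rewrite lee_fin dirichlet_fun_ge0.
pose N := (n + \sum_(j < n) m (lift ord0 j))%N.
pose C := dirichlet_cst b (fun j => m (lift ord0 j)).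
pose g (r : measurableTypeR R) : R := r ^+ (2 * m ord0) *
  (if 0 < S - r ^+ 2 then C * (S - r ^+ 2) `^ (b + N%:R) else 0).
have b10 : 0 < b + 1 by lra.
have C0 : 0 < C.
  rewrite /C /dirichlet_cst divr_gt0 ?mulr_gt0 ?Gamma_gt0 ?exprn_gt0 ?disc_area_gt0//.
    by apply: prodr_gt0 => j _; rewrite ltr0n fact_gt0.
  by rewrite ltr_wpDr.
have g0 r : 0 <= r -> 0 <= g r.
  by move=> r0; rewrite mulr_ge0 ?exprn_ge0//; case: ifP => // _; rewrite mulr_ge0 ?powR_ge0// ltW.
have mg : measurable_fun setT g.
  apply: measurable_funM; first exact: measurable_funX.
  have mS : measurable_fun setT (fun r : measurableTypeR R => S - r ^+ 2).
    by apply: measurable_funB => //; exact: measurable_funX.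
  apply: measurable_fun_ifT => //; first exact: measurable_fun_ltr.
  by apply: measurable_funM => //; exact: (measurableT_comp (measurable_powR _)).
transitivity (\int[@plane_measure R]_z (g (plane_norm z))%:E)%E.
  apply: eq_integral => z _; under eq_integral do rewrite dirichlet_fun_tcons EFinM.
  rewrite ge0_integralZl//; last 3 first.
  - by apply/measurable_EFinP; exact: measurable_dirichlet_fun.
  - by move=> t _; rewrite lee_fin dirichlet_fun_ge0.
  - by rewrite lee_fin exprn_ge0// plane_norm_ge0.
  by rewrite [X in (_ * X)%E]ih -EFinM.
have -> : (\int[@plane_measure R]_z (g (plane_norm z))%:E =
           \int[@plane_measure R]_z (g (Num.max (plane_norm z) 0))%:E)%E.
  by apply: eq_integral => z _; rewrite max_l// plane_norm_ge0.
rewrite (ge0_integral_plane_norm (F := fun r => (g (Num.max r 0))%:E)); last 2 first.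
- apply/measurable_EFinP; apply: measurableT_comp => //; exact: measurable_maxr.
- by move=> r; rewrite lee_fin g0// le_max lexx orbT.
case: ifPn => [S0|]; last first.
  rewrite -leNgt => S0; rewrite integral0_eq// => r _.
  rewrite /g ifF ?mulr0 ?mul0e//; apply/negbTE; rewrite -leNgt subr_le0 (le_trans S0)//.
  exact: sqr_ge0.
have rho0 : 0 < Num.sqrt S by rewrite sqrtr_gt0.
have SE : Num.sqrt S ^+ 2 = S by rewrite sqr_sqrtr// ltW.
have bN : -1 < b + N%:R by rewrite (lt_le_trans b1)// lerDl.
transitivity ((kappa * C)%:E * \int[leb]_(r in `[0%R, Num.sqrt S[)
   (beta_fun (Num.sqrt S ^+ 2) (m ord0) (b + N%:R) r)%:E)%E.
  rewrite -ge0_integralZl//; last 3 first.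
  - by apply/measurable_EFinP; apply: measurable_funTS; exact: measurable_beta_fun.
  - move=> r; rewrite /= in_itv /= => /andP[r0 _].
    by rewrite lee_fin !mulr_ge0 ?powR_ge0 ?exprn_ge0.
  - by rewrite lee_fin mulr_ge0// ltW// disc_area_gt0.
  rewrite [RHS]integral_mkcond; apply: eq_integral => r _.
  rewrite patchE mem_setE in_itv /= -EFinM /radial_density /g.
  have [r0|r0] := leP 0 r; last by rewrite !mulr0.
  rewrite subr_gt0 -{1}SE ltr_sqr ?nnegrE ?(ltW rho0)//=.
  case: ifP => _; last by rewrite mulr0 mul0r.
  by rewrite -EFinM; congr EFin; rewrite SE /beta_fun (exprS r (2 * m ord0)); ring.
rewrite (ge0_integral_beta _ rho0 bN) -EFinM SE; congr EFin.
have -> : b + N%:R + 1 + (m ord0)%:R = b + (n.+1 + \sum_(j < n.+1) m j)%:R.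
  by rewrite big_ord_recl addnCA natrD [in RHS]addSn -natr1 -/N; ring.
have -> : b + N%:R + 1 + (m ord0).+1%:R = b + 1 + (n.+1 + \sum_(j < n.+1) m j)%:R.
  by rewrite big_ord_recl addnCA natrD [in RHS]addSn -!natr1 -/N; ring.
rewrite /C /dirichlet_cst -/N exprS.
have -> : \prod_(j < n.+1) (m j)`!%:R =
  (m ord0)`!%:R * \prod_(j < n) (m (lift ord0 j))`!%:R :> R by rewrite big_ord_recl.
have -> : b + N%:R + 1 = b + 1 + N%:R by ring.
have : Gamma (b + 1 + (n.+1 + \sum_(j < n.+1) m j)%:R) != 0.
  by rewrite gt_eqF// Gamma_gt0// ltr_wpDr.
have : Gamma (b + 1 + N%:R) != 0 by rewrite gt_eqF// Gamma_gt0// ltr_wpDr.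
move: (Gamma (b + 1 + N%:R)) (Gamma (b + 1 + _)) (S `^ _) (\prod_(j < n) _) => G1 G2 P1 P2 h1 h2.
by field; rewrite h1 h2.
Qed.

Lemma ge0_integral_modulus n (F : n.-tuple (measurableTypeR R) -> \bar R) :
  measurable_fun setT F -> (forall s, 0 <= F s)%E ->
  (\int[lebC n]_t F (tmap (fun=> plane_norm) t) =
   \int[@lebesgue_R R n]_s (F s * (\prod_(j < n) radial_density (tnth s j))%:E))%E.
Proof.
move=> mF F0; apply: ge0_integral_tmap => //.
- exact: radial_density_ge0.
- exact: measurable_radial_density.
- by move=> i; exact: measurable_plane_norm.
- by move=> i G mG G0; exact: ge0_integral_plane_norm.
Qed.

Lemma ge0_integral_rotC n (u : nat -> R[i]) (F : n.-tuple CC -> \bar R) :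
  (forall j, normc (u j) = 1) -> measurable_fun setT F -> (forall s, 0 <= F s)%E ->
  (\int[lebC n]_t F (tmap (fun j => rot (u j)) t) = \int[lebC n]_t F t)%E.
Proof.
move=> u1 mF F0; rewrite /lebesgue_C.
rewrite (@ge0_integral_tmap _ _ _ _ _ _ (@plane_measure R) (fun=> 1))//.
- by apply: eq_integral => t _; rewrite big1 ?mule1.
- by move=> j; exact: measurable_rot.
- move=> j G mG G0; rewrite ge0_integral_rot//.
  by apply: eq_integral => z _; rewrite mule1.
Qed.

Lemma ge0_integral_permC n (s : 'S_n) (F : n.-tuple CC -> \bar R) :
  measurable_fun setT F -> (forall t, 0 <= F t)%E ->
  (\int[lebC n]_t F (permute s t) = \int[lebC n]_t F t)%E.
Proof. exact: ge0_integral_permute. Qed.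

End Dirichlet_integral_Cn.

(** * Holomorphy on annuli and circle averages *)

Section differentiability_epsilon.
Context {R : realType} (V : normedModType R[i]).
Implicit Types (f : V -> R[i]^o) (x h : V).

(** The norm of a normed module over [R[i]] takes values in [R[i]]; this is the same number in [R],
    where the estimates are made. *)
Definition rnorm h : R := complex.Re `|h|.

Lemma rnormE h : `|h| = (rnorm h)%:C.
Proof.
by rewrite /rnorm; have := normr_ge0 h; case: `|h| => a b; rewrite lecE /= => /andP[/eqP -> _].
Qed.

Lemma rnorm_ge0 h : 0 <= rnorm h.
Proof. by rewrite -lecR -rnormE normr_ge0. Qed.

Lemma rnorm_eq0 h : (rnorm h == 0) = (h == 0).
Proof. by rewrite -(inj_eq (@complexI R)) -rnormE normr_eq0. Qed.

Lemma rnormZ (c : R[i]) h : rnorm (c *: h) = normc c * rnorm h.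
Proof.
apply: complexI; rewrite -rnormE rmorphM /= -rnormE -normcE.
exact: normrZ.
Qed.

Lemma nbhs0_rnorm (P : V -> Prop) :
  (\forall h \near (0 : V), P h) <-> exists2 d : R, 0 < d & forall h, rnorm h < d -> P h.
Proof.
split=> [/nbhs_normP[d /= d0 H]|[d d0 H]].
  have dE : d = (complex.Re d)%:C by rewrite RRe_real// gtr0_real.
  exists (complex.Re d); first by rewrite -ltcR -dE.
  by move=> h hd; apply: H; rewrite /ball_ /= sub0r normrN rnormE dE ltcR.
apply/nbhs_normP; exists d%:C; first by rewrite /= ltcR.
by move=> h; rewrite /ball_ /= sub0r normrN rnormE ltcR; exact: H.
Qed.

Lemma differentiable_eps f x : differentiable f x -> exists L : {linear V -> R[i]^o},
  forall e : R, 0 < e -> exists2 d : R, 0 < d &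
    forall h, rnorm h < d -> normc (f (x + h) - f x - L h) <= e * rnorm h.
Proof.
move=> df; exists ('d f x) => e e0.
have /diff_locallyP[_ /eqaddoP /(_ e%:C)] := df.
rewrite ltcR => /(_ e0) /nbhs0_rnorm[d d0 H]; exists d => // h hd.
have := H _ hd; rewrite /= rnormE -rmorphM /=.
rewrite [X in X <= _](_ : _ = (normc (f (x + h) - f x - 'd f x h))%:C).
  by rewrite lecR.
rewrite -normcE; congr `|_|.
by rewrite -[LHS]/(f (h + x) - (f x + 'd f x h)) (addrC h) opprD addrA.
Qed.

(** The bound [K] supplies the continuity of [L] that a differential must have. *)
Lemma eps_differentiable f x (L : {linear V -> R[i]^o}) (K : R) :
  (forall h, normc (L h) <= K * rnorm h) ->
  (forall e : R, 0 < e -> exists2 d : R, 0 < d &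
    forall h, rnorm h < d -> normc (f (x + h) - f x - L h) <= e * rnorm h) ->
  differentiable f x.
Proof.
move=> LK H.
have cL : continuous L.
  apply/linear_bounded_continuous/linear_boundedP.
  exists (K%:C); split; first by apply/complex_realP; exists K.
  move=> M KM h; rewrite normcE rnormE.
  apply: (@le_trans _ _ (K%:C * (rnorm h)%:C)).
    by rewrite -rmorphM /= lecR.
  by apply: ler_wpM2r; [rewrite ler0c rnorm_ge0|exact: ltW].
have E : f \o shift x = cst (f x) + L +o_ (0 : V) id.
  apply/eqaddoP => e e0.
  have eE : e = (complex.Re e)%:C by rewrite RRe_real// gtr0_real.
  have re0 : 0 < complex.Re e by rewrite -ltcR -eE.
  have [d d0 Hd] := H _ re0.
  apply/nbhs0_rnorm; exists d => // h hd; rewrite /= eE rnormE -rmorphM /=.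
  rewrite [X in X <= _](_ : _ = (normc (f (x + h) - f x - L h))%:C).
    by rewrite lecR; exact: Hd.
  rewrite -normcE; congr `|_|.
  by rewrite -[LHS]/(f (h + x) - (f x + L h)) (addrC h) opprD addrA.
apply/diff_locallyP; rewrite (diff_unique cL E); split => //.
Qed.

End differentiability_epsilon.

Section one_variable.
Context {R : realType}.
Implicit Types (G : R[i]^o -> R[i]^o) (z h : R[i]^o).

Lemma rnorm_complex (h : R[i]^o) : rnorm h = normc h.
Proof. exact: (congr1 (@complex.Re R) (normcE h)). Qed.

Definition cdiff (G : R[i] -> R[i]) (a D : R[i]) := forall e : R, 0 < e ->
  exists2 d : R, 0 < d & forall h, normc h < d ->
    normc (G (a + h) - G a - h * D) <= e * normc h.

Lemma differentiable_cdiff G z : differentiable G z -> exists D, cdiff G z D.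
Proof.
move=> /differentiable_eps[L HL]; exists (L 1) => e /HL[d d0 H]; exists d => // h hd.
have := H h; rewrite rnorm_complex => /(_ hd).
suff -> : L h = h * L 1 by [].
by rewrite -[X in L X](mulr1 h); exact: linearZ.
Qed.

Lemma cdiff_differentiable G z D : cdiff G z D -> differentiable G z.
Proof.
move=> H; have lin : linear (fun h : R[i]^o => h * D : R[i]^o).
  by move=> a u v; rewrite mulrDl -[a *: u]/(a * u) -mulrA.
pose L : {linear R[i]^o -> R[i]^o} :=
  HB.pack (fun h : R[i]^o => h * D : R[i]^o) (GRing.isLinear.Build _ _ _ _ _ lin).
apply: (@eps_differentiable _ _ _ _ L (normc D)).
  by move=> h; rewrite rnorm_complex -[L h]/(h * D) normcM mulrC.
by move=> e /H[d d0 Hd]; exists d => // h; rewrite rnorm_complex; exact: Hd.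
Qed.

Lemma cdiff_continuous (G : R[i] -> R[i]) a D : cdiff G a D ->
  forall e : R, 0 < e -> exists2 d : R, 0 < d & forall h, normc h < d ->
    normc (G (a + h) - G a) <= e.
Proof.
move=> /(_ 1 ltr01)[d d0 H] e e0.
have K0 : 0 < 1 + normc D by rewrite ltr_wpDr// normc_ge0.
exists (Num.min d (e / (1 + normc D))); first by rewrite lt_min d0 divr_gt0.
move=> h; rewrite lt_min => /andP[hd he].
rewrite -(subrK (h * D) (_ - _)); apply: le_trans (normcD _ _) _.
rewrite normcM; apply: (@le_trans _ _ ((1 + normc D) * normc h)).
  by rewrite mulrDl; apply: lerD; [exact: H|rewrite mulrC].
by rewrite mulrC -ler_pdivlMr// ltW.
Qed.

End one_variable.

Section segment_integrals.
Context {R : realType}.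
Local Notation leb := (@lebesgue_measure R).

Definition ccont (F : R -> R[i]) (s : R) := forall e : R, 0 < e ->
  exists2 d : R, 0 < d & forall s', `|s' - s| < d -> normc (F s' - F s) <= e.

Lemma ccont_Re F s : ccont F s -> {for s, continuous (fun t => complex.Re (F t))}.
Proof.
move=> H; apply/cvgrPdist_le => e e0; have [d d0 Hd] := H e e0.
near=> t; rewrite -ReB; apply: le_trans (normc_Re _) _; rewrite normc_sub; apply: Hd.
rewrite distrC; near: t; exact: cvgr_dist_lt.
Unshelve. all: by end_near. Qed.

Lemma ccont_Im F s : ccont F s -> {for s, continuous (fun t => complex.Im (F t))}.
Proof.
move=> H; apply/cvgrPdist_le => e e0; have [d d0 Hd] := H e e0.
near=> t; rewrite -ImB; apply: le_trans (normc_Im _) _; rewrite normc_sub; apply: Hd.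
rewrite distrC; near: t; exact: cvgr_dist_lt.
Unshelve. all: by end_near. Qed.

Lemma ccont_cL1 F (a b : R) : (forall s, a <= s <= b -> ccont F s) ->
  cL1 leb `[a, b] F.
Proof.
move=> H.
have iR : leb.-integrable `[a, b] (EFin \o (fun s => complex.Re (F s))).
  apply: continuous_compact_integrable; first exact: segment_compact.
  by apply: continuous_in_subspaceT => s; rewrite inE /= in_itv /= => /H /ccont_Re.
have iI : leb.-integrable `[a, b] (EFin \o (fun s => complex.Im (F s))).
  apply: continuous_compact_integrable; first exact: segment_compact.
  by apply: continuous_in_subspaceT => s; rewrite inE /= in_itv /= => /H /ccont_Im.
have mI : measurable (`[a, b]%classic : set (measurableTypeR R)) by exact: measurable_itv.
apply: (@cL1_le _ _ _ leb _ mI F (fun s => `|complex.Re (F s)| + `|complex.Im (F s)|)).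
- by split; apply/measurable_EFinP; [exact: measurable_int iR|exact: measurable_int iI].
- by have := integrableD mI (integrable_norm iR) (integrable_norm iI).
- by move=> s _; exact: normc_le_ReIm.
Qed.

Lemma itv_split (a e b : R) : a <= e -> e <= b ->
  `[a, b]%classic = `[a, e]%classic `|` `]e, b]%classic.
Proof.
by move=> ae eb; rewrite -itv_bndbnd_setU// bnd_simp.
Qed.

Lemma cint_split F (a e b : R) : a <= e -> e <= b -> cL1 leb `[a, b] F ->
  complex_integral leb `[a, b] F =
  complex_integral leb `[a, e] F + complex_integral leb `[e, b] F.
Proof.
move=> ae eb FL.
have dis : [disjoint `[a, e]%classic & `]e, b]%classic].
  apply/disj_setPS => s [/=]; rewrite !in_itv /= => /andP[_ se] /andP[es _].
  by have := lt_le_trans es se; rewrite ltxx.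
have iR : leb.-integrable (`[a, e] `|` `]e, b]) (EFin \o (fun s => complex.Re (F s))).
  by rewrite -(itv_split ae eb); exact: cL1_Re.
have iI : leb.-integrable (`[a, e] `|` `]e, b]) (EFin \o (fun s => complex.Im (F s))).
  by rewrite -(itv_split ae eb); exact: cL1_Im.
rewrite /complex_integral (itv_split ae eb) !Rintegral_setU//.
have sub : `]e, b]%classic `<=` `[a, e] `|` `]e, b] by move=> s; right.
rewrite !(Rintegral_itv_obnd_cbnd (r := e))//.
- by apply: integrableS iI => //; exact: measurableU.
- by apply: integrableS iR => //; exact: measurableU.
Qed.

Lemma fine_leb_itv (a b : R) : a <= b -> fine (leb `[a, b]) = b - a.
Proof.
by move=> ab; rewrite lebesgue_measure_itv /= lte_fin; case: ltgtP ab => // -> _; rewrite subrr.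
Qed.

Lemma leb_itv_fin (a b : R) : (leb `[a, b] < +oo)%E.
Proof. by rewrite lebesgue_measure_itv /=; case: ifP => _; rewrite -?EFinD ltry. Qed.

Lemma cint_seg_le F (a b M : R) : a <= b -> cL1 leb `[a, b] F ->
  (forall s, a <= s <= b -> normc (F s) <= M) ->
  normc (complex_integral leb `[a, b] F) <= 2 * (M * (b - a)).
Proof.
move=> ab FL FM; rewrite -fine_leb_itv//; apply: cint_le_cst => //.
exact: leb_itv_fin.
Qed.

Lemma cint_affine (c0 c1 : R[i]) (a b : R) : a <= b ->
  complex_integral leb `[a, b] (fun s => c0 + c1 * s%:C) =
  c0 * (b - a)%:C + c1 * ((b ^+ 2 - a ^+ 2) / 2)%:C.
Proof.
move=> ab.
have cid s : ccont (fun s => s%:C) s.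
  by move=> e e0; exists e => // t te; rewrite -rmorphB normc_real ltW.
have cL1id : cL1 leb `[a, b] (fun s : R => s%:C) by apply: ccont_cL1.
have cL1c c : cL1 leb `[a, b] (fun=> c).
  by apply: ccont_cL1 => s _ e e0; exists 1 => // t _; rewrite subrr normc0 ltW.
have -> : (fun s : R => c0 + c1 * s%:C) = (fun s => c0 * 1 + c1 * s%:C).
  by apply/funext => s; rewrite mulr1.
have mI : measurable (`[a, b]%classic : set (measurableTypeR R)) by exact: measurable_itv.
rewrite (cintD mI (cL1Z mI c0 (cL1c 1)) (cL1Z mI c1 cL1id)).
rewrite !cintZ//; congr (c0 * _ + c1 * _).
  rewrite [LHS](cint_real leb mI (fun=> 1)); congr (_%:C).
  by rewrite Rintegral_cst// mul1r fine_leb_itv.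
rewrite [LHS](cint_real leb mI (fun s => s)); congr (_%:C).
move: ab; rewrite le_eqVlt => /orP[/eqP <-|ab].
  by rewrite subrr mul0r set_itv1 Rintegral_set1.
have dF (s : R) : is_derive s (1 : R) (fun s => s ^+ 2 / 2) s.
  by apply: drv_eq (drvM (drvX 2 (drv_id s)) (drv_cst 2^-1 s)) _; rewrite /= expr1; field.
rewrite /Rintegral (continuous_FTC ab (fun s _ => dF s)) /=; first by field.
by move=> s _; exact: cvg_id.
Qed.

End segment_integrals.

Section Goursat.
Context {R : realType}.
Local Notation leb := (@lebesgue_measure R).
Implicit Types (G : R[i] -> R[i]) (a b c d s t : R).

Definition hseg G a b t := complex_integral leb `[a, b] (fun s => G (s +i* t)).
Definition vseg G c d s := complex_integral leb `[c, d] (fun t => G (s +i* t)).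
(** The integral of [G] along the boundary of the rectangle, counterclockwise. *)
Definition contour G a b c d :=
  hseg G a b c - hseg G a b d + 'i * (vseg G c d b - vseg G c d a).

Arguments contour : simpl never.

Definition rect a b c d : set R[i] :=
  [set z | (a <= complex.Re z <= b) && (c <= complex.Im z <= d)].

(** Continuity along horizontal and vertical segments, which is what integrals over the edges of
    subrectangles involve. *)
Definition cont_on_rect G a b c d :=
  (forall t, c <= t <= d -> forall s, a <= s <= b ->
     ccont (fun s => G (s +i* t)) s) /\
  (forall s, a <= s <= b -> forall t, c <= t <= d ->
     ccont (fun t => G (s +i* t)) t).

Lemma cont_on_rectS G a b c d a' b' c' d' : a <= a' -> b' <= b -> c <= c' -> d' <= d ->
  cont_on_rect G a b c d -> cont_on_rect G a' b' c' d'.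
Proof.
move=> aa bb cc dd [H1 H2]; split=> [t /andP[? ?] s /andP[? ?]|s /andP[? ?] t /andP[? ?]].
  by apply: H1; apply/andP; split; lra.
by apply: H2; apply/andP; split; lra.
Qed.

Lemma contour_split G a e b c f d : a <= e -> e <= b -> c <= f -> f <= d ->
  cont_on_rect G a b c d ->
  contour G a b c d = contour G a e c f + contour G e b c f +
                      (contour G a e f d + contour G e b f d).
Proof.
move=> ae eb cf fd [H1 H2].
have hs t : c <= t <= d -> hseg G a b t = hseg G a e t + hseg G e b t.
  by move=> td; apply: cint_split => //; apply: ccont_cL1; exact: H1.
have vs s : a <= s <= b -> vseg G c d s = vseg G c f s + vseg G f d s.
  by move=> sb; apply: cint_split => //; apply: ccont_cL1; exact: H2.
rewrite /contour (hs c) ?(hs d) ?(vs a) ?(vs b) ?lexx; first by ring.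
all: by lra.
Qed.

Lemma contour_affine (c0 c1 : R[i]) a b c d : a <= b -> c <= d ->
  contour (fun z => c0 + c1 * z) a b c d = 0.
Proof.
move=> ab cd.
have hE t : hseg (fun z => c0 + c1 * z) a b t =
    (c0 + c1 * (0 +i* t)) * (b - a)%:C + c1 * ((b ^+ 2 - a ^+ 2) / 2)%:C.
  rewrite -cint_affine//; apply: eq_cint => s _.
  rewrite -addrA -mulrDr; congr (_ + _ * _).
  by apply/eqP; rewrite eq_complex /= add0r addr0 !eqxx.
have vE s : vseg (fun z => c0 + c1 * z) c d s =
    (c0 + c1 * s%:C) * (d - c)%:C + c1 * 'i * ((d ^+ 2 - c ^+ 2) / 2)%:C.
  rewrite -cint_affine//; apply: eq_cint => t _.
  rewrite -addrA -mulrA -mulrDr; congr (_ + _ * _).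
  exact: (complexE (s +i* t)).
rewrite /contour !hE !vE; case: c0 c1 {hE vE} => [p q] [u v].
by apply/eqP; rewrite eq_complex /=; apply/andP; split; apply/eqP; field.
Qed.

Lemma contourB G H a b c d : a <= b -> c <= d ->
  cont_on_rect G a b c d -> cont_on_rect H a b c d ->
  contour (fun z => G z - H z) a b c d = contour G a b c d - contour H a b c d.
Proof.
move=> ab cd [G1 G2] [H1 H2].
have hB t : c <= t <= d ->
    hseg (fun z => G z - H z) a b t = hseg G a b t - hseg H a b t.
  by move=> td; apply: cintB => //; apply: ccont_cL1; [exact: G1|exact: H1].
have vB s : a <= s <= b ->
    vseg (fun z => G z - H z) c d s = vseg G c d s - vseg H c d s.
  by move=> sd; apply: cintB => //; apply: ccont_cL1; [exact: G2|exact: H2].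
by rewrite /contour (hB c) ?(hB d) ?(vB a) ?(vB b) ?lexx ?ab ?cd//; ring.
Qed.

Lemma contour_le G a b c d M : a <= b -> c <= d -> cont_on_rect G a b c d ->
  (forall z, rect a b c d z -> normc (G z) <= M) ->
  normc (contour G a b c d) <= 4 * M * ((b - a) + (d - c)).
Proof.
move=> ab cd [G1 G2] GM.
have hM t : c <= t <= d -> normc (hseg G a b t) <= 2 * (M * (b - a)).
  move=> td; apply: cint_seg_le => //; first by apply: ccont_cL1; exact: G1.
  by move=> s sd; apply: GM; rewrite /rect /= sd td.
have vM s : a <= s <= b -> normc (vseg G c d s) <= 2 * (M * (d - c)).
  move=> sd; apply: cint_seg_le => //; first by apply: ccont_cL1; exact: G2.
  by move=> t td; apply: GM; rewrite /rect /= sd td.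
have ni : normc ('i : R[i]) = 1 by rewrite /= expr0n expr1n add0r sqrtr1.
apply: le_trans (normcD _ _) _; rewrite normcM ni mul1r.
have := normcB (hseg G a b c) (hseg G a b d).
have := normcB (vseg G c d b) (vseg G c d a).
have := hM c; have := hM d; have := vM a; have := vM b.
rewrite !lexx ab cd => /(_ isT) h1 /(_ isT) h2 /(_ isT) h3 /(_ isT) h4 h5 h6.
lra.
Qed.

Lemma cdiff_cont_on_rect G a b c d :
  (forall z, rect a b c d z -> exists D, cdiff G z D) -> cont_on_rect G a b c d.
Proof.
move=> HD; split=> [t td s sb e e0|s sb t td e e0].
  have [|D /cdiff_continuous /(_ _ e0)[dl dl0 H]] := HD (s +i* t); first by rewrite /rect /= sb td.
  exists dl => // s' ss.
  have := H (s' - s)%:C; rewrite normc_real => /(_ ss).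
  by rewrite (_ : s +i* t + (s' - s)%:C = s' +i* t)//; congr (_ +i* _); rewrite /= ?addr0// addrC subrK.
have [|D /cdiff_continuous /(_ _ e0)[dl dl0 H]] := HD (s +i* t); first by rewrite /rect /= sb td.
exists dl => // t' tt.
have := H (0 +i* (t' - t)); rewrite /normc expr0n add0r sqrtr_sqr => /(_ tt).
by rewrite (_ : s +i* t + (0 +i* (t' - t)) = s +i* t')//; congr (_ +i* _); rewrite /= ?addr0// addrC subrK.
Qed.

Lemma normc_sum4 (z c1 c2 c3 c4 : R[i]) : z = c1 + c2 + (c3 + c4) ->
  [\/ normc z / 4 <= normc c1, normc z / 4 <= normc c2, normc z / 4 <= normc c3
    | normc z / 4 <= normc c4].
Proof.
move=> E; have H : normc z <= normc c1 + normc c2 + (normc c3 + normc c4).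
  by rewrite E; apply: le_trans (normcD _ _) (lerD (normcD _ _) (normcD _ _)).
have [?|l1] := leP (normc z / 4) (normc c1); first exact: Or41.
have [?|l2] := leP (normc z / 4) (normc c2); first exact: Or42.
have [?|l3] := leP (normc z / 4) (normc c3); first exact: Or43.
by have [?|l4] := leP (normc z / 4) (normc c4); [exact: Or44|clear E; lra].
Qed.

(** Bisection: some quarter always carries at least a quarter of the contour integral. At the point
    common to all the chosen rectangles [G] is affine up to an error [e |z - z0|]; affine functions
    have zero contour integral, so the n-th integral is at most [K / 2 / 4^n], against the lower
    bound [K / 4^n]. *)
Lemma goursat G a b c d : a < b -> c < d ->
  (forall z, rect a b c d z -> exists D, cdiff G z D) -> contour G a b c d = 0.
Proof.
move=> ab cd HD; apply/eqP; rewrite -normc_eq0; apply/eqP/le_anti.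
rewrite normc_ge0 andbT leNgt; apply/negP => K0.
set K := normc _ in K0; pose W := b - a; pose H := d - c.
have W0 : 0 < W by rewrite subr_gt0.
have H0 : 0 < H by rewrite subr_gt0.
have cG := cdiff_cont_on_rect HD.
pose w n : R := W / 2 ^+ n; pose h n : R := H / 2 ^+ n.
have pow2 n : 0 < (2 : R) ^+ n by rewrite exprn_gt0.
have w0 n : 0 < w n by rewrite divr_gt0.
have h0 n : 0 < h n by rewrite divr_gt0.
have wS n : w n.+1 = w n / 2 by rewrite /w exprS; field; rewrite gt_eqF.
have hS n : h n.+1 = h n / 2 by rewrite /h exprS; field; rewrite gt_eqF.
pose inv n (p : R * R) := [/\ a <= p.1, p.1 + w n <= b, c <= p.2, p.2 + h n <= d
  & K / 4 ^+ n <= normc (contour G p.1 (p.1 + w n) p.2 (p.2 + h n))].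
(* The invariant is a premise inside the existential, so that [choice] yields a successor function
   on all pairs. *)
have step (q : nat * (R * R)) : exists p : R * R, inv q.1 q.2 ->
    [/\ inv q.1.+1 p, q.2.1 <= p.1, p.1 + w q.1.+1 <= q.2.1 + w q.1,
        q.2.2 <= p.2 & p.2 + h q.1.+1 <= q.2.2 + h q.1].
  case: q => n [x y] /=; have [[/= ax xb cy yd HK]|ninv] := pselect (inv n (x, y)); last by exists (x, y).
  have wn := w0 n; have hn := h0 n.
  have rec : cont_on_rect G x (x + w n) y (y + h n) by exact: cont_on_rectS cG.
  have xe : x + w n.+1 + w n.+1 = x + w n by rewrite wS; field.
  have ye : y + h n.+1 + h n.+1 = y + h n by rewrite hS; field.
  have wn1 := w0 n.+1; have hn1 := h0 n.+1.
  have := @contour_split G x (x + w n.+1) (x + w n) y (y + h n.+1) (y + h n) _ _ _ _ rec.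
  rewrite -xe -ye => /(_ ltac:(clear -wn1; lra) ltac:(clear -wn1; lra) ltac:(clear -hn1; lra)
    ltac:(clear -hn1; lra)) E.
  rewrite -xe -ye in HK xb yd rec.
  have KE : K / 4 ^+ n.+1 = K / 4 ^+ n / 4 by rewrite exprS invfM mulrCA mulrC.
  have HK4 : K / 4 ^+ n.+1 <= normc (contour G x (x + w n.+1 + w n.+1) y (y + h n.+1 + h n.+1)) / 4.
    by rewrite KE ler_wpM2r.
  have A2 : a <= x + w n.+1 by clear -ax wn1; lra.
  have C2 : c <= y + h n.+1 by clear -cy hn1; lra.
  have B1 : x + w n.+1 <= b by clear -xb wn1; lra.
  have D1 : y + h n.+1 <= d by clear -yd hn1; lra.
  have X2 : x <= x + w n.+1 by clear -wn1; lra.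
  have Y2 : y <= y + h n.+1 by clear -hn1; lra.
  have X3 : x + w n.+1 <= x + w n.+1 + w n.+1 by clear -wn1; lra.
  have Y3 : y + h n.+1 <= y + h n.+1 + h n.+1 by clear -hn1; lra.
  case: (normc_sum4 E) => /(le_trans HK4) Hc;
    [exists (x, y)|exists (x + w n.+1, y)|exists (x, y + h n.+1)|
     exists (x + w n.+1, y + h n.+1)] => _; by split.
have /choice[nxt Hnxt] := step.
pose u := fix u n := if n is n'.+1 then nxt (n', u n') else (a, c).
have inv_u n : inv n (u n).
  elim: n => [|n ih]; last by have [] := Hnxt (n, u n) ih.
  have wE : a + w 0%N = b by rewrite /w expr0 divr1 addrC subrK.
  have hE : c + h 0%N = d by rewrite /h expr0 divr1 addrC subrK.
  by split; rewrite /= ?wE ?hE// expr0 divr1.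
have mono n : [/\ (u n).1 <= (u n.+1).1, (u n.+1).1 + w n.+1 <= (u n).1 + w n,
    (u n).2 <= (u n.+1).2 & (u n.+1).2 + h n.+1 <= (u n).2 + h n].
  by have [] := Hnxt (n, u n) (inv_u n).
have mono2 n m : (n <= m)%N -> [/\ (u n).1 <= (u m).1, (u m).1 + w m <= (u n).1 + w n,
    (u n).2 <= (u m).2 & (u m).2 + h m <= (u n).2 + h n].
  elim: m => [|m ih]; first by rewrite leqn0 => /eqP ->.
  rewrite leq_eqVlt => /orP[/eqP -> //|]; rewrite ltnS => /ih[h1 h2 h3 h4].
  by have [k1 k2 k3 k4] := mono m;
    clear -h1 h2 h3 h4 k1 k2 k3 k4; split; lra.
have bnd n m : (u n).1 <= (u m).1 + w m /\ (u n).2 <= (u m).2 + h m.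
  have wn := w0 n; have hn := h0 n; have wm := w0 m; have hm := h0 m.
  have [nm|/ltnW mn] := leqP n m; [have [] := mono2 _ _ nm|have [] := mono2 _ _ mn];
    by move=> p1 p2 p3 p4; clear -wn hn wm hm p1 p2 p3 p4; split; lra.
(* The suprema of the lower left corners give a point lying in every rectangle. *)
pose sx := sup (range (fun n => (u n).1)); pose sy := sup (range (fun n => (u n).2)).
have sxP n : (u n).1 <= sx <= (u n).1 + w n.
  apply/andP; split.
    by apply: ub_le_sup; [exists ((u 0%N).1 + w 0%N) => _ [m _ <-]; exact: (bnd m 0%N).1|exists n].
  apply: ge_sup; first by exists (u 0%N).1, 0%N.
  by move=> _ [m _ <-]; exact: (bnd m n).1.
have syP n : (u n).2 <= sy <= (u n).2 + h n.
  apply/andP; split.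
    by apply: ub_le_sup; [exists ((u 0%N).2 + h 0%N) => _ [m _ <-]; exact: (bnd m 0%N).2|exists n].
  apply: ge_sup; first by exists (u 0%N).2, 0%N.
  by move=> _ [m _ <-]; exact: (bnd m n).2.
have [|D HDz] := HD (sx +i* sy).
  have [] := inv_u 0%N; have /andP[] := sxP 0%N; have /andP[] := syP 0%N.
  move=> p1 p2 p3 p4 q1 q2 q3 q4 _; clear -p1 p2 p3 p4 q1 q2 q3 q4.
  by rewrite /rect /=; apply/andP; split; apply/andP; split; lra.
pose S := W + H; have S0 : 0 < S by rewrite addr_gt0.
(* [contour_le] gives [4 e S^2 / 4^n], which this choice makes half of [K / 4^n]. *)
pose e := K / (8 * S ^+ 2); have e0 : 0 < e by rewrite divr_gt0// mulr_gt0// exprn_gt0.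
have [dl dl0 Hdl] := HDz e e0.
pose n := Num.truncn (S / dl).
have Sn : S / 2 ^+ n < dl.
  rewrite ltr_pdivrMr// mulrC -ltr_pdivrMr//; apply: lt_le_trans (truncnS_gt _) _.
  by rewrite -natrX ler_nat ltn_expl.
have wh : w n + h n = S / 2 ^+ n by rewrite /w /h /S -mulrDl.
set x := (u n).1; set y := (u n).2.
have [ax xb cy yd HK] := inv_u n; rewrite -/x -/y in ax xb cy yd HK.
have wn := w0 n; have hn := h0 n.
have rec : cont_on_rect G x (x + w n) y (y + h n) by exact: cont_on_rectS cG.
pose z0 := sx +i* sy; pose aff := fun z : R[i] => (G z0 - D * z0) + D * z.
have recA : cont_on_rect aff x (x + w n) y (y + h n).
  apply: cdiff_cont_on_rect => z _; exists D => e' e'0; exists 1 => // k _.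
  rewrite (_ : aff (z + k) - aff z - k * D = 0) ?normc0 ?mulr_ge0 ?normc_ge0 ?ltW//.
  by rewrite /aff; ring.
have recB : cont_on_rect (fun z => G z - aff z) x (x + w n) y (y + h n).
  apply: cdiff_cont_on_rect => z zr.
  have [|D' HD'] := HD z.
    by move: zr; rewrite /rect /= => /andP[/andP[z1 z2] /andP[z3 z4]];
      clear -z1 z2 z3 z4 ax xb cy yd; apply/andP; split; apply/andP; split; lra.
  exists (D' - D) => e' /HD'[d' d'0 H']; exists d' => // k /H'.
  by apply: le_trans; rewrite le_eqVlt; apply/orP; left; apply/eqP; congr normc;
    rewrite /aff; ring.
have := @contourB G aff x (x + w n) y (y + h n) _ _ rec recA.
rewrite contour_affine ?lerDl ?ltW// subr0 => /(_ isT isT) cE.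
have : normc (contour G x (x + w n) y (y + h n)) <=
    4 * (e * (w n + h n)) * ((x + w n - x) + (y + h n - y)).
  rewrite -cE; apply: contour_le; rewrite ?lerDl ?(ltW wn) ?(ltW hn)//.
  move=> z; rewrite /rect /= => /andP[/andP[z1 z2] /andP[z3 z4]].
  have /andP[sx1 sx2] := sxP n; have /andP[sy1 sy2] := syP n.
  rewrite -/x -/y in sx1 sx2 sy1 sy2.
  have zn : normc (z - z0) <= w n + h n.
    apply: le_trans (normc_le_ReIm _) _; rewrite ReB ImB /=.
    clear -z1 z2 z3 z4 sx1 sx2 sy1 sy2.
    by apply: lerD; rewrite ler_norml; apply/andP; split; lra.
  apply: (@le_trans _ _ (e * normc (z - z0))); last by rewrite ler_wpM2l// ltW.
  have zz : z0 + (z - z0) = z by rewrite addrC subrK.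
  have := Hdl (z - z0); rewrite -/z0 zz.
  have -> : G z - aff z = G z - G z0 - (z - z0) * D by rewrite /aff; ring.
  by apply; apply: le_lt_trans zn _; rewrite wh.
rewrite (addrAC x) subrr add0r (addrAC y) subrr add0r wh leNgt => /negP; apply.
apply: lt_le_trans HK.
rewrite (_ : 4 * (e * (S / 2 ^+ n)) * (S / 2 ^+ n) = 4 * e * S ^+ 2 / 4 ^+ n); last first.
  rewrite (_ : (4 : R) ^+ n = 2 ^+ n * 2 ^+ n); last by rewrite -exprMn -natrM.
  by field; rewrite gt_eqF.
rewrite ltr_pM2r ?invr_gt0 ?exprn_gt0// /e.
rewrite (_ : 4 * (K / (8 * S ^+ 2)) * S ^+ 2 = K / 2); last by field; rewrite gt_eqF.
by rewrite ltr_pdivrMr// ltr_pMr// ltr1n.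
Qed.

End Goursat.

Section complex_exponential.
Context {R : realType}.
Implicit Types (x y t : R) (z h : R[i]).

Lemma drv_eps (f : R -> R) (x df : R) : is_derive x (1 : R) f df ->
  forall e : R, 0 < e -> exists2 d : R, 0 < d &
    forall h : R, `|h| < d -> `|f (x + h) - f x - h * df| <= e * `|h|.
Proof.
move=> [Df <-] e e0; move: Df; rewrite /derivable => Df.
have /cvgrPdist_le/(_ e e0) : h^-1 *: ((f \o shift x) (h *: (1 : R)) - f x) @[h --> 0^'] --> 'D_1 f x by [].
case=> d /= d0 H; exists d => // h hd; have [->|h0] := eqVneq h 0.
  by rewrite addr0 subrr mul0r subr0 normr0 mulr0.
have := H h; rewrite /ball_ /= sub0r normrN => /(_ hd h0).
rewrite /GRing.scale /= mulr1 (addrC h) distrC.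
rewrite -(ler_pM2r (_ : 0 < `|h|)) ?normr_gt0// -normrM.
by rewrite mulrBl mulrAC mulVf// mul1r (mulrC _ h).
Qed.

Definition cis t : R[i] := cos t +i* sin t.

Lemma normc_cis t : normc (cis t) = 1.
Proof. by rewrite /= cos2Dsin2 sqrtr1. Qed.

Lemma cisD x y : cis (x + y) = cis x * cis y.
Proof. by rewrite /cis cosD sinD; congr (_ +i* _); rewrite addrC. Qed.

Lemma cis0 : cis 0 = 1.
Proof. by rewrite /cis cos0 sin0. Qed.

Lemma cisN x : cis (- x) = (cis x)^*.
Proof. by rewrite /cis cosN sinN. Qed.

Lemma cis2pi : cis (2 * pi) = 1.
Proof. by rewrite mulr_natl /cis cos2pi sin2pi. Qed.

Lemma unit_conjV (u : R[i]) : normc u = 1 -> u * u^* = 1.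
Proof. by move=> u1; rewrite mulcJ u1 expr1n. Qed.

Lemma polar (u : R[i]) : normc u = 1 -> exists2 t : R, 0 <= t <= 2 * pi & u = cis t.
Proof.
case: u => a b u1; have ab : a ^+ 2 + b ^+ 2 = 1.
  by move: (congr1 (fun x => x ^+ 2) u1); rewrite normc2E expr1n.
have a1 : -1 <= a <= 1.
  by rewrite -ler_norml -(@ler_sqr _ _ 1) ?nnegrE// real_normK ?num_real// expr1n -ab lerDl sqr_ge0.
have bE : Num.sqrt (1 - a ^+ 2) = `|b| by rewrite -ab addrAC subrr add0r sqrtr_sqr.
have ac0 := acos_ge0 a1; have acpi := acos_lepi a1; have p0 := pi_gt0 R.
have [b0|b0] := leP 0 b.
  exists (acos a); first by apply/andP; split; lra.
  by rewrite /cis acosK ?in_itv// sin_acos// bE ger0_norm.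
exists (2 * pi - acos a); first by apply/andP; split; lra.
rewrite addrC cisD cis2pi mulr1 cisN /cis acosK ?in_itv// sin_acos// bE ltr0_norm//.
by apply/eqP; rewrite eq_complex ReJ ImJ /= opprK !eqxx.
Qed.

Definition cexp z : R[i] := (expR (complex.Re z))%:C * cis (complex.Im z).

Lemma cexpD z h : cexp (z + h) = cexp z * cexp h.
Proof. by rewrite /cexp ReD ImD expRD cisD rmorphM /= mulrACA. Qed.

Lemma cexpE x t : cexp (x +i* t) = (expR x)%:C * cis t.
Proof. by []. Qed.

Lemma cexpNE x t : cexp (- (x +i* t)) = (expR (- x))%:C * cis (- t).
Proof. by []. Qed.

Lemma normc_cexp z : normc (cexp z) = expR (complex.Re z).
Proof. by rewrite /cexp normcM normc_real normc_cis mulr1 ger0_norm ?expR_ge0. Qed.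

Lemma cexp_eps (e : R) : 0 < e -> exists2 d : R, 0 < d &
  forall h, normc h < d -> normc (cexp h - 1 - h) <= e * normc h.
Proof.
(* The four error terms below add up to at most [9 e' |h|], which 14 covers with some margin. *)
move=> e0; pose e' := Num.min (e / 14) 1.
have e'0 : 0 < e' by rewrite lt_min ltr01 divr_gt0.
have e'1 : e' <= 1 by rewrite ge_min lexx orbT.
have ee : 14 * e' <= e by rewrite mulrC -ler_pdivlMr// ge_min lexx.
clearbody e'.
have [d1 d10 H1] := drv_eps (is_derive_expR (0 : R)) e'0.
have [d2 d20 H2] := drv_eps (is_derive_cos (0 : R)) e'0.
have [d3 d30 H3] := drv_eps (is_derive_sin (0 : R)) e'0.
exists (Num.min (Num.min d1 d2) (Num.min d3 (Num.min 1 e'))).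
  by rewrite !lt_min d10 d20 d30 e'0 ltr01.
move=> [x y]; set n := normc _; rewrite !lt_min => /andP[/andP[h1 h2] /andP[h3 /andP[h4 h5]]].
have xn : `|x| <= n by exact: (normc_Re (x +i* y)).
have yn : `|y| <= n by exact: (normc_Im (x +i* y)).
have := H1 x (le_lt_trans xn h1); rewrite add0r expR0 mulr1 => E1.
have := H2 y (le_lt_trans yn h2); rewrite add0r cos0 sin0 oppr0 mulr0 subr0 => E2.
have := H3 y (le_lt_trans yn h3); rewrite add0r sin0 cos0 mulr1 subr0 => E3.
have n0 : 0 <= n by exact: normc_ge0.
have F1 : `|expR x - 1 - x| <= e' * n by apply: le_trans E1 _; rewrite ler_wpM2l// ltW.
have F2 : `|cos y - 1| <= e' * n by apply: le_trans E2 _; rewrite ler_wpM2l// ltW.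
have F3 : `|sin y - y| <= e' * n by apply: le_trans E3 _; rewrite ler_wpM2l// ltW.
have G1 : `|expR x - 1| <= 2 * n.
  rewrite -(subrK x (_ - 1)); apply: le_trans (ler_normD _ _) _.
  by have := ler_wpM2r n0 e'1; lra.
have G2 : `|expR x| <= 3.
  rewrite -(subrK 1 (expR x)); apply: le_trans (ler_normD _ _) _.
  by rewrite normr1; lra.
have G3 : `|sin y| <= 2 * n.
  rewrite -(subrK y (sin y)); apply: le_trans (ler_normD _ _) _.
  by have := ler_wpM2r n0 e'1; lra.
apply: le_trans (normc_le_ReIm _) _.
have -> : cexp (x +i* y) - 1 - (x +i* y) =
   ((expR x - 1 - x) + expR x * (cos y - 1)) +i* ((expR x - 1) * sin y + (sin y - y)).
  by rewrite cexpE /cis; apply/eqP; rewrite eq_complex /=; apply/andP; split; apply/eqP; ring.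
rewrite /=.
have K1 : `|expR x * (cos y - 1)| <= 3 * (e' * n) by rewrite normrM ler_pM.
have K2 : `|(expR x - 1) * sin y| <= 2 * n * (2 * n) by rewrite normrM ler_pM.
have K3 : 2 * n * (2 * n) <= 4 * (e' * n).
  by rewrite (_ : 2 * n * (2 * n) = 4 * (n * n)); [rewrite ler_wpM2l// ler_wpM2r// ltW|ring].
have L1 := ler_normD (expR x - 1 - x) (expR x * (cos y - 1)).
have L2 := ler_normD ((expR x - 1) * sin y) (sin y - y).
have L3 : 14 * e' * n <= e * n by rewrite ler_wpM2r.
have L4 : 0 <= e' * n by rewrite mulr_ge0// ltW.
clear -F1 F2 F3 K1 K2 K3 L1 L2 L3 L4; lra.
Qed.

Lemma differentiable_cexp z : differentiable (cexp : R[i]^o -> R[i]^o) (z : R[i]^o).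
Proof.
apply: (@cdiff_differentiable _ _ _ (cexp z)) => e e0.
have K0 : 0 < expR (complex.Re z) by exact: expR_gt0.
have [d d0 H] := cexp_eps (divr_gt0 e0 K0); exists d => // h /H hd.
rewrite cexpD (_ : _ - _ - _ = cexp z * (cexp h - 1 - h)); last by ring.
rewrite normcM normc_cexp mulrC -ler_pdivlMr//.
by rewrite mulrAC.
Qed.

End complex_exponential.

Section circle_average.
Context {R : realType}.
Local Notation leb := (@lebesgue_measure R).
Implicit Types (F g : R[i] -> R[i]) (u : R[i]).

Let pi2 : R := 2 * pi.
Let pi2_gt0 : 0 < pi2. Proof. by rewrite mulr_gt0// pi_gt0. Qed.
Let pi2_neq0 : (pi2%:C : R[i]) != 0.
Proof. by rewrite (inj_eq (@complexI R)) gt_eqF. Qed.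

Definition circle : set (measurableTypeR R) := `[0, 2 * pi]%classic.

Lemma measurable_circle : measurable circle. Proof. exact: measurable_itv. Qed.
Local Hint Resolve measurable_circle : core.

Lemma circle_fin : (leb circle < +oo)%E. Proof. exact: leb_itv_fin. Qed.

Lemma circle_len : fine (leb circle) = 2 * pi.
Proof. by rewrite fine_leb_itv ?subr0// ltW. Qed.

Definition circ_L1 F := cL1 leb circle (fun t => F (cis t)).

Definition cavg F : R[i] := complex_integral leb circle (fun t => F (cis t)) / (2 * pi)%:C.

Lemma eq_cavg F g : (forall u, normc u = 1 -> F u = g u) -> cavg F = cavg g.
Proof.
by move=> Fg; congr (_ / _); apply: eq_cint => t _; apply: Fg; exact: normc_cis.
Qed.

Lemma eq_circ_L1 F g : (forall u, normc u = 1 -> F u = g u) -> circ_L1 F -> circ_L1 g.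
Proof. by move=> Fg; apply: eq_cL1 => // t _; apply: Fg; exact: normc_cis. Qed.

Lemma cavgB F g : circ_L1 F -> circ_L1 g ->
  cavg (fun u => F u - g u) = cavg F - cavg g.
Proof. by move=> FL gL; rewrite /cavg cintB// mulrBl. Qed.

Lemma cavgZ c F : circ_L1 F -> cavg (fun u => c * F u) = c * cavg F.
Proof. by move=> FL; rewrite /cavg cintZ// mulrA. Qed.

Lemma cavg_sum (I : Type) (s : seq I) (P : pred I) (F : I -> R[i] -> R[i]) :
  (forall i, circ_L1 (F i)) ->
  cavg (fun u => \sum_(i <- s | P i) F i u) = \sum_(i <- s | P i) cavg (F i).
Proof. by move=> FL; rewrite /cavg cint_sum// mulr_suml. Qed.

Lemma cavg_cst c : cavg (fun=> c) = c.
Proof.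
rewrite /cavg /complex_integral !Rintegral_cst// !circle_len.
by case: c => a b /=; rewrite (_ : _ +i* _ = (a +i* b) * (2 * pi)%:C) ?mulfK//;
  apply/eqP; rewrite eq_complex /= !mulr0 subr0 add0r !eqxx.
Qed.

Lemma cavg_le F (h : R -> R) : circ_L1 F -> leb.-integrable circle (EFin \o h) ->
  (forall t, circle t -> normc (F (cis t)) <= h t) ->
  normc (cavg F) <= 2 * (\int[leb]_(t in circle) h t) / (2 * pi).
Proof.
move=> FL hI Fh; rewrite /cavg normcM normcV normc_real gtr0_norm//.
by rewrite ler_wpM2r ?invr_ge0 ?(ltW pi2_gt0)//; exact: cint_le.
Qed.

Lemma cavg_le_cst F (M : R) : circ_L1 F -> (forall u, normc u = 1 -> normc (F u) <= M) ->
  normc (cavg F) <= 2 * M.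
Proof.
move=> FL FM; apply: le_trans (cavg_le (h := fun=> M) FL _ _) _.
- apply: measurable_bounded_integrable => //; first exact: circle_fin.
  by exists `|M|; split; [exact: num_real|move=> x Mx y _ /=; exact: ltW].
- by move=> t _; apply: FM; exact: normc_cis.
- have -> : \int[leb]_(t in circle) M = M * fine (leb circle).
    exact: (Rintegral_cst _ measurable_circle).
  by rewrite circle_len (mulrA 2 M) mulfK// gt_eqF.
Qed.

(* Goursat's theorem for the exponential change of variable maps a rectangle to an annulus. *)
Lemma cavg_annulus g (p q : nat) (t : R) : 0 < t < 1 ->
  (forall u, t <= normc u <= 1 -> differentiable (g : R[i]^o -> R[i]^o) (u : R[i]^o)) ->
  cavg (fun u => g (t%:C * u) * u^* ^+ p * u ^+ q) * t%:C ^+ q =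
  t%:C ^+ p * cavg (fun u => g u * u^* ^+ p * u ^+ q).
Proof.
move=> /andP[t0 t1] dg.
(* On the unit circle [u^*] equals [u^-1]; it is replaced by the holomorphic factor [e^(-z)], and on
   a circle of radius [r] this change accounts for the powers of [r] in the statement. *)
pose G (z : R[i]) : R[i] := g (cexp z) * cexp (- z) ^+ p * cexp z ^+ q.
have lt0 : ln t < 0 by rewrite ln_lt0// t0.
have dG z : rect (ln t) 0 0 pi2 z -> exists D, cdiff G z D.
  rewrite /rect /= => /andP[/andP[z1 z2] _].
  apply: differentiable_cdiff.
  have dX (f : R[i]^o -> R[i]^o) n x : differentiable f x ->
      differentiable ((fun y => f y ^+ n) : R[i]^o -> R[i]^o) x.
    move=> df; elim: n => [|n ih]; first exact: differentiable_cst.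
    rewrite (_ : (fun y => f y ^+ n.+1) = (fun y => f y * f y ^+ n)); last first.
      by apply/funext => y; rewrite exprS.
    exact: (differentiableM df ih).
  have d1 : differentiable ((fun z => g (cexp z)) : R[i]^o -> R[i]^o) (z : R[i]^o).
    apply: (@differentiable_comp _ _ _ _ (cexp : R[i]^o -> R[i]^o) (g : R[i]^o -> R[i]^o)).
      exact: differentiable_cexp.
    apply: dg; rewrite normc_cexp; apply/andP; split; last by rewrite expR_le1.
    by rewrite -[leLHS]lnK ?posrE// ler_expR.
  have d2 : differentiable ((fun z => cexp (- z)) : R[i]^o -> R[i]^o) (z : R[i]^o).
    apply: (@differentiable_comp _ _ _ _ (-%R : R[i]^o -> R[i]^o) (cexp : R[i]^o -> R[i]^o)).
      apply: (@cdiff_differentiable _ _ _ (- 1)) => e e0; exists 1 => // h _.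
      rewrite (_ : _ - _ - _ = 0) ?normc0 ?mulr_ge0 ?normc_ge0 ?(ltW e0)//.
      by ring.
    exact: differentiable_cexp.
  exact: (differentiableM (differentiableM d1 (dX _ p _ d2)) (dX _ q _ (differentiable_cexp z))).
have := goursat lt0 pi2_gt0 dG; rewrite /contour.
(* The horizontal edges cancel by the period [2 pi i] of the exponential, so that Goursat equates
   the two vertical edges, which are the two circles. *)
have -> : hseg G (ln t) 0 pi2 = hseg G (ln t) 0 0.
  apply: eq_cint => s _; rewrite /G !cexpE.
  by rewrite !oppr0 cisN /pi2 cis2pi cis0 rmorph1.
have i0 : ('i : R[i]) != 0 by rewrite eq_complex /= oner_eq0 andbF.
have alg (a b c : R[i]) : a - a + 'i * (b - c) = 0 -> b = c.
  by rewrite subrr add0r => V0; apply/subr0_eq/(mulfI i0); rewrite V0 mulr0.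
move/alg => V.
have alg2 (P Q a b c : R[i]) : P != 0 -> Q != 0 ->
    a * b * c = P / Q * (a * (P^-1 * b) * (Q * c)).
  by move=> P0 Q0; field; rewrite P0 Q0.
have [_ Gv] := cdiff_cont_on_rect dG.
have vE (r : R) : 0 < r -> ln t <= ln r <= 0 ->
    complex_integral leb circle (fun th => g (r%:C * cis th) * (cis th)^* ^+ p * cis th ^+ q)
    * r%:C ^+ q = r%:C ^+ p * vseg G 0 pi2 (ln r).
  move=> r0 lr; have rn0 : (r%:C : R[i]) != 0 by rewrite (inj_eq (@complexI R)) gt_eqF.
  rewrite (_ : (fun th => _) =
      fun th => (r%:C ^+ p / r%:C ^+ q) * G (ln r +i* th)); last first.
    have rV : ((expR (- ln r))%:C : R[i]) = r%:C^-1.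
      rewrite expRN lnK ?posrE ?r0; [exact: real_complexV|by []].
    apply/funext => th; rewrite /G cexpNE cexpE rV (lnK r0) cisN !exprMn exprVn.
    by apply: alg2; rewrite expf_neq0.
  rewrite (cintZ measurable_circle); last by apply: ccont_cL1 => s s1; exact: Gv.
  rewrite mulrAC mulfVK; [by []|exact: expf_neq0].
have l0 : ln t <= 0 by exact: ltW.
have c1 : (1%:C : R[i]) = 1 by [].
have E1 : complex_integral leb circle (fun th => g (cis th) * (cis th)^* ^+ p * cis th ^+ q) =
    vseg G 0 pi2 (ln t).
  have := vE 1 ltr01; rewrite ln1 l0 lexx => /(_ isT).
  rewrite c1 (expr1n _ p) (expr1n _ q) (mulr1 (complex_integral _ _ _)) (mul1r (vseg _ _ _ _)) V => <-.
  by apply: eq_cint => th _; rewrite mul1r.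
have Et := vE t t0; rewrite lexx l0 -E1 in Et.
rewrite /cavg [LHS]mulrAC Et; [exact: esym (mulrA _ _ _)|by []].
Qed.

Definition circ_cont F := forall u, normc u = 1 -> forall e : R, 0 < e ->
  exists2 d : R, 0 < d &
     forall w, normc w = 1 -> normc (w - u) < d -> normc (F w - F u) <= e.

Lemma circ_cont_ccont F t : circ_cont F -> ccont (fun t => F (cis t)) t.
Proof.
move=> H e e0.
have [d d0 Hd] := H _ (normc_cis t) _ e0.
have d20 : 0 < d / 2 by rewrite divr_gt0.
have /cvgrPdist_lt/(_ _ d20) := @continuous_cos R t.
have /cvgrPdist_lt/(_ _ d20) := @continuous_sin R t.
move=> [e1 /= e10 H1] [e2 /= e20 H2].
exists (Num.min e1 e2); first by rewrite lt_min e10.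
move=> s; rewrite lt_min => /andP[s1 s2]; apply: Hd; first exact: normc_cis.
apply: le_lt_trans (normc_le_ReIm _) _; rewrite /cis /=.
rewrite [ltRHS](splitr d) ltrD// distrC; [apply: H2|apply: H1] => //=;
  by rewrite distrC.
Qed.

Lemma circ_cont_L1 F : circ_cont F -> circ_L1 F.
Proof. by move=> H; apply: ccont_cL1 => t _; exact: circ_cont_ccont. Qed.

Lemma circ_contM F g : circ_cont F -> circ_cont g -> circ_cont (fun u => F u * g u).
Proof.
move=> HF Hg u u1 e e0; pose K := 1 + normc (F u) + normc (g u).
have nF := normc_ge0 (F u); have ng := normc_ge0 (g u).
have K1 : 1 <= K by rewrite /K -addrA lerDl addr_ge0.
have K0 : 0 < K by exact: lt_le_trans K1.
have e'0 : 0 < Num.min 1 (e / K) by rewrite lt_min ltr01 divr_gt0.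
have [d1 d10 H1] := HF _ u1 _ e'0; have [d2 d20 H2] := Hg _ u1 _ e'0.
exists (Num.min d1 d2); first by rewrite lt_min d10.
move=> w w1; rewrite lt_min => /andP[/(H1 _ w1) h1 /(H2 _ w1) h2]; move: h1 h2.
rewrite !le_min => /andP[a1 a2] /andP[b1 b2].
rewrite (_ : _ - _ = (F w - F u) * (g w - g u) + F u * (g w - g u) + (F w - F u) * g u);
  last by ring.
apply: le_trans (normcD _ _) _; apply: le_trans (lerD (normcD _ _) (lexx _)) _.
rewrite !normcM; apply: (@le_trans _ _ (e / K * K)); last by rewrite mulfVK// gt_eqF.
rewrite /K !mulrDr mulr1 [in leRHS](mulrC _ (normc (F u))).
apply: lerD; first apply: lerD.
- by rewrite -[leRHS]mul1r ler_pM ?normc_ge0.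
- by rewrite ler_wpM2l.
- by rewrite ler_wpM2r.
Qed.

Lemma circ_contZ c F : circ_cont F -> circ_cont (fun u => c * F u).
Proof.
by move=> HF; apply: circ_contM => // u _ e e0; exists 1 => // w _ _; rewrite subrr normc0 ltW.
Qed.

Lemma circ_cont_id : circ_cont id.
Proof. by move=> u _ e e0; exists e => // w _ /ltW. Qed.

Lemma circ_cont_conj : circ_cont (fun u => u^*).
Proof.
move=> u _ e e0; exists e => // w _ /ltW; rewrite -conjcB.
by rewrite normcJ.
Qed.

Lemma circ_contX F k : circ_cont F -> circ_cont (fun u => F u ^+ k).
Proof.
move=> HF; elim: k => [|k ih].
  by move=> u _ e e0; exists 1 => // w _ _; rewrite !expr0 subrr normc0 ltW.
rewrite (_ : (fun u => _) = fun u => F u * F u ^+ k); last by apply/funext => u; rewrite exprS.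
exact: circ_contM.
Qed.

Lemma circ_cont_pow p q F : circ_cont F -> circ_cont (fun u => F u * u^* ^+ p * u ^+ q).
Proof.
move=> HF; apply: circ_contM; last exact/circ_contX/circ_cont_id.
by apply: circ_contM => //; exact/circ_contX/circ_cont_conj.
Qed.

Lemma circ_cont_bounded F : circ_cont F ->
  exists M : R, forall u, normc u = 1 -> normc (F u) <= M.
Proof.
move=> HF; have cF : {within `[0, pi2]%classic, continuous (fun t => normc (F (cis t)))}.
  apply: continuous_subspaceT => t; apply/cvgrPdist_le => e e0.
  have [d d0 H] := circ_cont_ccont t HF e0.
  exists d => //= s ds; rewrite /= distrC.
  apply: le_trans (H s _); last by rewrite distrC.
  rewrite ler_norml.
  have A := normcD (F (cis s) - F (cis t)) (F (cis t)); rewrite subrK in A.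
  have B := normcD (F (cis t) - F (cis s)) (F (cis s)); rewrite subrK normc_sub in B.
  by apply/andP; split; lra.
have [c _ Hc] := EVT_max (ltW pi2_gt0) cF.
exists (normc (F (cis c))) => u /polar[t t0 ->]; apply: Hc.
by rewrite in_itv.
Qed.

(** The part of [[s, s + 2 pi]] beyond [2 pi] is moved back to [[0, s]] by periodicity. *)
Lemma ge0_circle_shift (h : measurableTypeR R -> \bar R) (s : R) : 0 <= s <= pi2 ->
  measurable_fun setT h -> (forall x, 0 <= h x)%E -> (forall x, h (x + pi2) = h x) ->
  (\int[leb]_(t in circle) h (t + s)%R = \int[leb]_(t in circle) h t)%E.
Proof.
move=> /andP[s0 s1] mh h0 hp.
have mI (a b : R) : measurable (`[a, b]%classic : set (measurableTypeR R)).
  exact: measurable_itv.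
have shift (a b r : R) : (\int[leb]_(t in `[a, b]%classic) h (t + r)%R =
    \int[leb]_(t in `[(a + r)%R, (b + r)%R]%classic) h t)%E.
  rewrite integral_mkcond [RHS]integral_mkcond/= -[RHS](@ge0_integral_affine _ 1 r)//; last 2 first.
  - by apply/(measurable_restrictT _ _).1 => //; exact: measurable_funTS.
  - by move=> x; rewrite patchE; case: ifPn.
  rewrite mul1e; apply: eq_integral => x _; rewrite !patchE mul1r.
  by rewrite !mem_setE !in_itv /= !lerD2r.
have splt (a b c : R) : a <= b -> b <= c -> (\int[leb]_(t in `[a, c]%classic) h t =
    \int[leb]_(t in `[a, b]%classic) h t + \int[leb]_(t in `[b, c]%classic) h t)%E.
  move=> ab bc; rewrite (itv_split ab bc) ge0_integral_setU//=; last 2 first.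
  - exact: measurable_funTS.
  - apply/disj_setPS => x [] /=; rewrite !in_itv /= => /andP[_ h1] /andP[h2 _].
    by move: (lt_le_trans h2 h1); rewrite ltxx.
  congr (_ + _)%E; apply: integral_itv_obnd_cbnd; exact: measurable_funTS.
rewrite /circle shift add0r (splt s pi2)//; last by rewrite lerDl.
rewrite [RHS](splt 0 s pi2)// [RHS]addeC; congr (_ + _)%E.
rewrite (_ : `[pi2, (2 * pi + s)%R]%classic = `[(0 + pi2)%R, (s + pi2)%R]%classic); last by rewrite add0r addrC.
rewrite -(shift 0 s pi2).
by apply: eq_integral => x _; rewrite hp.
Qed.

Lemma cavg_shift F w : normc w = 1 -> circ_cont F -> cavg (fun u => F (u * w)) = cavg F.
Proof.
move=> /polar[s s0 ->] HF; rewrite /cavg; congr (_ / _).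
have part (k : measurableTypeR R -> R) : measurable_fun setT k -> (forall x, k (x + pi2) = k x) ->
    \int[leb]_(t in circle) k (t + s) = \int[leb]_(t in circle) k t.
  move=> mk kp; congr fine; rewrite integralE [RHS]integralE; congr (_ - _)%E.
  - rewrite -(@ge0_circle_shift (EFin \o k)^\+%E s)//; last 2 first.
    + exact/measurable_funepos/measurable_EFinP.
    + by move=> x; rewrite !funeposE /= kp.
    by apply: eq_integral => x _; rewrite !funeposE.
  - rewrite -(@ge0_circle_shift (EFin \o k)^\-%E s)//; last 2 first.
    + exact/measurable_funeneg/measurable_EFinP.
    + by move=> x; rewrite !funenegE /= kp.
    by apply: eq_integral => x _; rewrite !funenegE.
have per t : cis (t + pi2) = cis t by rewrite cisD cis2pi mulr1.
rewrite /complex_integral; congr (_ +i* _).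
- rewrite -(part (fun t => complex.Re (F (cis t)))); last by move=> t; rewrite per.
    by apply: eq_Rintegral => t _; rewrite cisD.
  by apply: continuous_measurable_fun => t; apply/ccont_Re/circ_cont_ccont.
- rewrite -(part (fun t => complex.Im (F (cis t)))); last by move=> t; rewrite per.
    by apply: eq_Rintegral => t _; rewrite cisD.
  by apply: continuous_measurable_fun => t; apply/ccont_Im/circ_cont_ccont.
Qed.

(** For [p != q], the annulus relation for the constant function 1 at [t = 1/2] says that the
    average is annihilated by [2^-q - 2^-p]. *)
Lemma cavg_orth (p q : nat) : cavg (fun u => u^* ^+ p * u ^+ q) = (p == q)%:R.
Proof.
have [<-|pq] := eqVneq p q.
  rewrite -[RHS](cavg_cst 1); apply: eq_cavg => u u1.
  by rewrite -exprMn mulrC unit_conjV// expr1n.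
have t1 : 0 < (2^-1 : R) < 1 by apply/andP; split; lra.
have := @cavg_annulus (fun=> 1) p q _ t1 (fun u _ => differentiable_cst _ _).
under [in LHS]eq_fun do rewrite mul1r; under [in RHS]eq_fun do rewrite mul1r.
rewrite mulrC => /eqP; rewrite -subr_eq0 -mulrBl mulf_eq0 => /orP[|/eqP//].
rewrite subr_eq0 -!rmorphXn (inj_eq (@complexI R)) => /eqP/(congr1 (fun x => x^-1)).
rewrite -!exprVn invrK => /eqP; rewrite -!natrX eqr_nat eqn_exp2l// eq_sym.
by rewrite (negPf pq).
Qed.

Definition dirichlet_kernel N u : R[i] := \sum_(k < N) u ^+ k.

Lemma cavg_sum_kernel N F : circ_cont F ->
  cavg (fun u => F u * (dirichlet_kernel N u)^* * dirichlet_kernel N u) =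
  \sum_(k < N) \sum_(l < N) cavg (fun u => F u * u^* ^+ k * u ^+ l).
Proof.
move=> HF.
have L1 k l : circ_L1 (fun u => F u * u^* ^+ k * u ^+ l) by exact/circ_cont_L1/circ_cont_pow.
under eq_bigr do rewrite -cavg_sum//.
rewrite -(@cavg_sum 'I_N (index_enum _) xpredT (fun k u => \sum_(l < N) F u * u^* ^+ (k : nat) * u ^+ l));
  last by move=> k; apply: (cL1_sum measurable_circle) => l; exact: L1.
apply: eq_cavg => u _; rewrite /dirichlet_kernel conjc_sum.
transitivity (\sum_(k < N) F u * (u ^+ k)^* * \sum_(l < N) u ^+ l).
  by rewrite -mulr_suml -mulr_sumr.
by apply: eq_bigr => k _; rewrite mulr_sumr; apply: eq_bigr => l _; rewrite conjcX.
Qed.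

(* The kernel [|D_N|^2 / N] is Fejer's. *)
Lemma fourier_unique F : circ_cont F ->
  (forall p q, cavg (fun u => F u * u^* ^+ p * u ^+ q) = 0) -> F 1 = 0.
Proof.
move=> HF F0; apply/eqP; rewrite -normc_eq0 eq_le normc_ge0 andbT.
apply/ler_addgt0Pr => e e0; rewrite add0r.
have e40 : 0 < e / 4 by rewrite divr_gt0.
have [d d0 Hd] := HF _ normc1 _ e40.
have [M FM] := circ_cont_bounded HF.
have M0 : 0 <= M by exact: le_trans (normc_ge0 _) (FM _ normc1).
(* Away from the arc [|u - 1| < d] the crude bound [2 M] is at most [C |u - 1|^2], a weight that
   compensates the growth of the kernel. *)
pose C := 2 * M / d ^+ 2.
have C0 : 0 <= C by rewrite divr_ge0 ?sqr_ge0// mulr_ge0.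
have FC u : normc u = 1 -> normc (F 1 - F u) <= e / 4 + C * normc (u - 1) ^+ 2.
  move=> u1; have [ud|du] := ltP (normc (u - 1)) d.
    rewrite normc_sub; apply: le_trans (Hd _ u1 ud) _.
    by rewrite lerDl mulr_ge0 ?sqr_ge0.
  apply: le_trans (normcB _ _) _; apply: (@le_trans _ _ (2 * M)).
    by rewrite mulr_natl mulr2n lerD// FM// normc1.
  rewrite -[leLHS]add0r lerD// ?(ltW e40)// /C mulrAC -mulrA ler_peMr ?mulr_ge0//.
  by rewrite ler_pdivlMr ?exprn_gt0// mul1r ler_sqr ?nnegrE ?normc_ge0// ltW.
have kc : circ_cont (fun=> 1) by move=> u _ e' e'0; exists 1 => // w _ _; rewrite subrr normc0 ltW.
(* The average of [F |D_N|^2] vanishes with the Fourier coefficients of [F], and that of [|D_N|^2]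
   is [N]; hence [N F(1)] is the average of [(F(1) - F(u)) |D_N(u)|^2]. *)
have key N : (0 < N)%N -> N%:R * normc (F 1) <= 2 * (e / 4 * N%:R + 4 * C).
  move=> N0; pose D := dirichlet_kernel N.
  have DJ u : (D u)^* * D u = (normc (D u) ^+ 2)%:C by rewrite mulrC mulcJ.
  have Dsum F' : circ_cont F' -> circ_cont (fun u => F' u * (D u)^* * D u).
    have cD : circ_cont D.
      rewrite /D /dirichlet_kernel; elim: (N) => [|k ih].
        by move=> u _ e' e'0; exists 1 => // w _ _; rewrite !big_ord0 subrr normc0 ltW.
      move=> u u1 e' e'0; have e'2 : 0 < e' / 2 by rewrite divr_gt0.
      have [d1 d10 H1] := ih u u1 _ e'2; have [d2 d20 H2] := circ_contX k circ_cont_id u1 e'2.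
      exists (Num.min d1 d2); first by rewrite lt_min d10.
      move=> w w1; rewrite lt_min => /andP[h1 h2]; have a := H1 _ w1 h1; have b := H2 _ w1 h2.
      rewrite !big_ord_recr /= opprD addrACA; apply: le_trans (normcD _ _) _.
      by rewrite (splitr e') lerD.
    move=> HF'; apply: circ_contM => //; apply: circ_contM => // u u1 e' e'0.
    have [d1 d10 H1] := cD u u1 _ e'0; exists d1 => // w w1 /(H1 _ w1).
    by rewrite -conjcB normcJ.
  have A1 : cavg (fun u => (normc (D u) ^+ 2)%:C) = N%:R%:C.
    rewrite (_ : (fun u => _) = fun u => (fun=> 1) u * (D u)^* * D u); last first.
      by apply/funext => u; rewrite mul1r DJ.
    rewrite cavg_sum_kernel//.
    under eq_bigr do under eq_bigr do under eq_fun do rewrite mul1r.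
    under eq_bigr => k _.
      under eq_bigr do rewrite cavg_orth.
      rewrite (bigD1 k)//= eqxx big1 ?addr0; last first.
        by move=> l lk; rewrite eq_sym (inj_eq val_inj) (negPf lk).
      over.
    by rewrite sumr_const card_ord; exact/esym/real_complex_nat.
  have A2 : \int[leb]_(t in circle) normc (D (cis t)) ^+ 2 / (2 * pi) = N%:R.
    have : complex_integral leb circle (fun t => (normc (D (cis t)) ^+ 2)%:C) = N%:R%:C * pi2%:C.
      by rewrite -A1 mulfVK.
    have aux (a b x : R) : x%:C = a%:C * b%:C :> R[i] -> x = a * b.
      by move=> E; apply: (@complexI R); exact: etrans E (esym (real_complexM a b)).
    by rewrite (cint_real _ measurable_circle) => /aux ->; rewrite mulfK// gt_eqF.
  have K1 : circ_L1 (fun u => 1 * (D u)^* * D u) := circ_cont_L1 (Dsum _ kc).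
  have K2 : circ_L1 (fun u => F u * (D u)^* * D u) := circ_cont_L1 (Dsum _ HF).
  have K3 : circ_L1 (fun u => F 1 * (1 * (D u)^* * D u)) := cL1Z measurable_circle (F 1) K1.
  have E0 u : F 1 * (1 * (D u)^* * D u) - F u * (D u)^* * D u =
      (F 1 - F u) * (normc (D u) ^+ 2)%:C by rewrite -DJ; ring.
  have L1 : circ_L1 (fun u => (F 1 - F u) * (normc (D u) ^+ 2)%:C).
    by apply: eq_circ_L1 (cL1B measurable_circle K3 K2) => u _; exact: E0.
  have A3 : cavg (fun u => (F 1 - F u) * (normc (D u) ^+ 2)%:C) = N%:R%:C * F 1.
    rewrite -(@eq_cavg _ _ (fun u _ => E0 u)) (cavgB K3 K2) (cavgZ _ K1).
    rewrite (cavg_sum_kernel _ HF) [X in _ - X]big1 ?subr0; last first.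
      by move=> k _; rewrite big1.
    rewrite mulrC -A1; congr (_ * _); apply: eq_cavg => u _.
    by rewrite mul1r DJ.
  have DI : leb.-integrable circle (EFin \o (fun t => normc (D (cis t)) ^+ 2)).
    have := cL1_Re measurable_circle (circ_cont_L1 (Dsum _ kc)).
    by apply: eq_integrable => // t _ /=; rewrite mul1r DJ.
  have cI : leb.-integrable circle (EFin \o (fun=> 4 * C)).
    apply: measurable_bounded_integrable => //; first exact: circle_fin.
    by exists `|4 * C|; split; [exact: num_real|move=> x Mx y _ /=; exact: ltW].
  have hI : leb.-integrable circle (EFin \o (fun t => e / 4 * normc (D (cis t)) ^+ 2 + 4 * C)).
    have := integrableD measurable_circle (integrableZ_fin measurable_circle (e / 4) DI) cI.
    by apply: eq_integrable.
  (* The geometric sum gives [(u - 1) D_N(u) = u^N - 1], of modulus at most 2, whence the constant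
     4. *)
  have hle t : circle t -> normc ((F 1 - F (cis t)) * (normc (D (cis t)) ^+ 2)%:C) <=
      e / 4 * normc (D (cis t)) ^+ 2 + 4 * C.
    move=> _; rewrite normcM normc_real ger0_norm ?sqr_ge0//.
    apply: le_trans (ler_wpM2r (sqr_ge0 _) (FC _ (normc_cis t))) _.
    rewrite mulrDl lerD2l -mulrA [leRHS]mulrC ler_wpM2l//.
    rewrite -exprMn -normcM /D /dirichlet_kernel -(subrX1).
    rewrite (_ : 4 = 2 ^+ 2); last by ring.
    rewrite ler_sqr ?nnegrE ?normc_ge0// ; apply: le_trans (normcB _ _) _.
    by rewrite normcX normc_cis expr1n normc1.
  have := cavg_le L1 hI hle; rewrite A3 normcM normc_real ger0_norm//.
  rewrite (RintegralD _ (integrableZ_fin measurable_circle (e / 4) DI) cI)//=.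
  rewrite (RintegralZl _ _ DI)// (_ : \int[leb]_(t in circle) (4 * C) = 4 * C * pi2); last first.
    have -> : \int[leb]_(t in circle) (4 * C) = 4 * C * fine (leb circle).
      exact: (Rintegral_cst _ measurable_circle).
    by rewrite circle_len.
  move=> /le_trans -> //; rewrite -A2 -/pi2 le_eqVlt; apply/orP; left; apply/eqP.
  by field; rewrite gt_eqF.
(* This threshold makes [8 C / N] smaller than [e / 2]. *)
have C1 : 0 < 16 * C + 1 by apply: ltr_wpDl => //; rewrite mulr_ge0.
have [N HN] : exists N, (0 : R) + N.+1%:R^-1 < e / (16 * C + 1).
  by apply: ltr_add_invr; exact: divr_gt0.
rewrite add0r in HN.
have N1 : 0 < N.+1%:R :> R by rewrite ltr0n.
have K2 := key N.+1 isT; move: HN.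
rewrite -div1r ltr_pdivrMr// mulrAC ltr_pdivlMr// mul1r => K1.
rewrite -(ler_pM2l N1); clear -K1 K2; lra.
Qed.

End circle_average.

(** Compactness of the segment, in the form that turns a radius found near each angle into one valid
    for all rotations. *)
Lemma segment_uniform {R : realType} (P : R -> R -> Prop) (a b : R) :
  (forall d d' t, d' <= d -> P d t -> P d' t) ->
  (forall t, exists2 r : R, 0 < r & exists2 d : R, 0 < d & forall s, `|s - t| < r -> P d s) ->
  exists2 d : R, 0 < d & forall t, a <= t <= b -> P d t.
Proof.
move=> Pdec HP.
have /compact_near_coveringP/(_ R (0 : R)^'+ P _) := @segment_compact R a b.
case=> [t _|e /= e0 He].
  have [r r0 [d d0 H]] := HP t.
  exists (ball t r, [set x | 0 < x < d]); [split => /=|].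
  - exact: nbhsx_ballx.
  - by exists d => // x /=; rewrite sub0r normrN => xd x0; rewrite x0 -(gtr0_norm x0).
  - by case=> s d' /= [sr /andP[d'0 /ltW d'd]]; apply: Pdec d'd _; apply: H; rewrite distrC.
have e20 : 0 < e / 2 by rewrite divr_gt0.
exists (e / 2) => // t tab; apply: He => //=.
by rewrite sub0r normrN gtr0_norm// ltr_pdivrMr// ltr_pMr// ltr1n.
Qed.

(** * Rotations of the coordinates and uniqueness of coefficients *)

Section row_vectors.
Context {R : realType} {n : nat}.
Implicit Types (z h : 'rV[R[i]]_n) (u v : R[i]) (i j : 'I_n).

Lemma normc_coord_le z i : normc (z 0 i) <= rnorm z.
Proof.
rewrite -lecR -rnormE -normcE {2}/Num.norm /= mx_normE.
by rewrite -[leLHS]nngE num_le; apply: (le_bigmax _ (fun x : 'I_1 * 'I_n => `|z x.1 x.2|%:nng) (0, i)).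
Qed.

Lemma rnorm_le z (M : R) : 0 <= M -> (forall i, normc (z 0 i) <= M) -> rnorm z <= M.
Proof.
move=> M0 H; rewrite -lecR -rnormE.
have [->|] := eqVneq (`|z| : R[i]) 0; first by rewrite ler0c.
rewrite /Num.norm/= => /mx_norm_neq0[[k i] ->] /=.
by rewrite (ord1 k) -/(Num.norm _) normcE lecR.
Qed.

Lemma coordD z h i : (z + h) 0 i = z 0 i + h 0 i. Proof. by rewrite mxE. Qed.

Lemma normc_coord_ball z i : ball1 z -> normc (z 0 i) < 1.
Proof.
rewrite /ball1 /= /norm2 => z1; rewrite -(@ltr_sqr _ _ 1) ?nnegrE ?normc_ge0// expr1n.
apply: le_lt_trans z1; rewrite (bigD1 i)//= lerDl.
by apply: sumr_ge0 => k _; exact: sqr_ge0.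
Qed.

Lemma norm2_ge0 z : 0 <= norm2 z.
Proof. by apply: sumr_ge0 => k _; exact: sqr_ge0. Qed.

Lemma ball1_nbhs z : ball1 z -> exists2 d : R, 0 < d & forall h, rnorm h < d -> ball1 (z + h).
Proof.
(* For [rnorm h < 1] each [|z_i + h_i|^2] exceeds [|z_i|^2] by at most [3 rnorm h]; [n.+1] keeps the
   denominator nonzero in dimension 0. *)
move=> z1; have H : (0 : R) < (1 - norm2 z) / (3 * n.+1%:R).
  by rewrite divr_gt0 ?subr_gt0// mulr_gt0.
exists (Num.min 1 ((1 - norm2 z) / (3 * n.+1%:R))); first by rewrite lt_min ltr01.
move=> h; rewrite lt_min => /andP[h1 h2]; rewrite /ball1 /=.
have hn := rnorm_ge0 h.
apply: (@le_lt_trans _ _ (norm2 z + \sum_(i < n) 3 * rnorm h)).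
  rewrite /norm2 -big_split /=; apply: ler_sum => i _; rewrite coordD.
  have A := normcD (z 0 i) (h 0 i); have B := normc_coord_le h i.
  have C := ltW (normc_coord_ball i z1).
  have D := normc_ge0 (z 0 i); have D' := normc_ge0 (h 0 i).
  apply: (@le_trans _ _ ((normc (z 0 i) + rnorm h) ^+ 2)).
    by rewrite ler_sqr ?nnegrE ?normc_ge0 ?addr_ge0//; apply: le_trans A _; rewrite lerD2l.
  rewrite sqrrD -addrA lerD2l.
  have E : rnorm h ^+ 2 <= rnorm h by rewrite expr2 ler_piMl// ltW.
  have G : normc (z 0 i) * rnorm h <= rnorm h by rewrite ler_piMl.
  by clear -E G; lra.
rewrite sumr_const card_ord -mulr_natl -ltrBrDl.
move: h2; rewrite ltr_pdivlMr; last by rewrite mulr_gt0.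
apply: le_lt_trans; rewrite -natr1; have n0 : 0 <= n%:R :> R by rewrite ler0n.
by have := mulr_ge0 n0 hn; clear -hn; lra.
Qed.

Definition scale1 j u z : 'rV[R[i]]_n := \row_i (if i == j then u * z 0 i else z 0 i).

Lemma scale1E j u z i : scale1 j u z 0 i = if i == j then u * z 0 i else z 0 i.
Proof. by rewrite mxE. Qed.

Lemma scale1M j u v z : scale1 j u (scale1 j v z) = scale1 j (u * v) z.
Proof. by apply/rowP => i; rewrite !scale1E; case: eqP => // _; rewrite mulrA. Qed.

Lemma scale1C i j u v z : scale1 i u (scale1 j v z) = scale1 j v (scale1 i u z).
Proof. by apply/rowP => k; rewrite !scale1E; do 2 case: eqP => // _; rewrite mulrCA. Qed.

Lemma scale11 j z : scale1 j 1 z = z.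
Proof. by apply/rowP => i; rewrite scale1E; case: eqP => // _; rewrite mul1r. Qed.

Lemma norm2_scale1 j u z : normc u <= 1 -> norm2 (scale1 j u z) <= norm2 z.
Proof.
move=> u1; apply: ler_sum => i _; rewrite scale1E; case: eqP => // _.
rewrite normcM exprMn ler_piMl ?sqr_ge0// -(expr1n _ 2).
by rewrite ler_sqr ?nnegrE ?normc_ge0.
Qed.

Lemma norm2_scale1_unit j u z : normc u = 1 -> norm2 (scale1 j u z) = norm2 z.
Proof.
move=> u1; apply: eq_bigr => i _; rewrite scale1E; case: eqP => // _.
by rewrite normcM u1 mul1r.
Qed.

Lemma ball1_scale1 j u z : normc u <= 1 -> ball1 z -> ball1 (scale1 j u z).
Proof. by move=> u1; apply: le_lt_trans; exact: norm2_scale1. Qed.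

Lemma rnorm_scale1D j u v z h : normc v <= 1 ->
  rnorm (scale1 j v (z + h) - scale1 j u z) <= normc (v - u) * rnorm z + rnorm h.
Proof.
move=> v1; apply: rnorm_le => [|i].
  by rewrite addr_ge0 ?mulr_ge0 ?normc_ge0 ?rnorm_ge0.
rewrite coordD [X in _ + X]mxE !scale1E coordD.
have hi := normc_coord_le h i; have zi := normc_coord_le z i.
case: eqP => _; last first.
  rewrite addrAC subrr add0r; apply: le_trans hi _.
  by rewrite lerDr mulr_ge0 ?normc_ge0 ?rnorm_ge0.
rewrite (_ : _ - _ = (v - u) * z 0 i + v * h 0 i); last by ring.
apply: le_trans (normcD _ _) _; rewrite !normcM; apply: lerD.
  by rewrite ler_wpM2l ?normc_ge0.
by apply: le_trans hi; rewrite ler_piMl ?normc_ge0.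
Qed.

End row_vectors.

(** * Invariance of integrals over a stable set, for rotations and permutations alike *)

Section measure_preserving.
Context {R : realType} d (T : measurableType d) (mu : {measure set T -> \bar R}).
Variables (phi : T -> T) (D : set T).
Hypotheses (mphi : measurable_fun setT phi) (mD : measurable D).
Hypothesis phiD : forall t, D (phi t) <-> D t.
Hypothesis ge0phi : forall F : T -> \bar R, measurable_fun setT F ->
  (forall t, 0 <= F t)%E -> (\int[mu]_t F (phi t) = \int[mu]_t F t)%E.

Lemma ge0_integral_preserving (F : T -> \bar R) : measurable_fun D F ->
  (forall t, D t -> 0 <= F t)%E ->
  (\int[mu]_(t in D) F (phi t) = \int[mu]_(t in D) F t)%E.
Proof.
move=> mF F0; rewrite integral_mkcond [RHS]integral_mkcond -[RHS]ge0phi; last 2 first.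
- exact/(measurable_restrictT _ _).1.
- by move=> t; rewrite patchE; case: ifPn => // /set_mem; exact: F0.
apply: eq_integral => t _; rewrite !patchE.
by rewrite (_ : (phi t \in D) = (t \in D)) //; apply/idP/idP => /set_mem /phiD /mem_set.
Qed.

Lemma Rintegral_preserving (F : T -> R) : measurable_fun D F ->
  \int[mu]_(t in D) F (phi t) = \int[mu]_(t in D) F t.
Proof.
move=> mF; rewrite /Rintegral integralE [in RHS]integralE; congr (fine (_ - _)).
- rewrite -(@ge0_integral_preserving (fun t => (EFin \o F)^\+%E t))//.
    by apply: eq_integral => t _; rewrite !funeposE.
  exact/measurable_funepos/measurable_EFinP.
- rewrite -(@ge0_integral_preserving (fun t => (EFin \o F)^\-%E t))//.
    by apply: eq_integral => t _; rewrite !funenegE.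
  exact/measurable_funeneg/measurable_EFinP.
Qed.

Lemma cmeas_preserving (f : T -> R[i]) : complex_measurable D f ->
  complex_measurable D (f \o phi).
Proof.
move=> mf; apply: (cmeas_comp (D := D) mD) => //; last exact: measurable_funTS.
by move=> t /phiD.
Qed.

Lemma cL1_preserving (f : T -> R[i]) : cL1 mu D f -> cL1 mu D (f \o phi).
Proof.
move=> [mf foo]; split; first exact: cmeas_preserving.
rewrite (@ge0_integral_preserving (fun t => (normc (f t))%:E))//.
- exact/measurable_EFinP/measurable_normc.
- by move=> t _; rewrite lee_fin normc_ge0.
Qed.

Lemma cint_preserving (f : T -> R[i]) : complex_measurable D f ->
  complex_integral mu D (f \o phi) = complex_integral mu D f.
Proof.
move=> [m1 m2]; congr (_ +i* _).
- exact: (@Rintegral_preserving (fun t => complex.Re (f t))).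
- exact: (@Rintegral_preserving (fun t => complex.Im (f t))).
Qed.

End measure_preserving.

Section coordinates.
Context {R : realType} {n : nat}.
Local Notation CC := (measurableTypeR R * measurableTypeR R)%type.
Local Notation lebC := (@lebesgue_C R n).
Local Notation B := (@ball_coords R n).
Implicit Types (z h : 'rV[R[i]]_n) (u v : R[i]) (i j : 'I_n) (t : n.-tuple CC).

Definition coords z : n.-tuple CC := [tuple (complex.Re (z 0 i), complex.Im (z 0 i)) | i < n].

Lemma coordsK z : of_coords (coords z) = z.
Proof. by apply/rowP => i; rewrite mxE tnth_mktuple /=; case: (z 0 i). Qed.

Definition trot j u t : n.-tuple CC :=
  tmap (fun k => rot (if k == j :> nat then u else 1)) t.

Lemma of_coords_trot j u t : of_coords (trot j u t) = scale1 j u (of_coords t).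
Proof.
apply/rowP => i; rewrite scale1E !mxE tnth_mktuple -(inj_eq val_inj) /=.
case: eqP => _.
  by case: u => c s; apply/eqP; rewrite eq_complex ReM ImM /=; apply/andP; split; apply/eqP; ring.
by rewrite /rot /= !mul1r !mul0r subr0 add0r.
Qed.

Lemma rot_unit (i : nat) (j : nat) u : normc u = 1 -> normc (if i == j then u else 1) = 1.
Proof. by case: ifP => _ // _; exact: normc1. Qed.

Lemma measurable_trot j u : measurable_fun setT (trot j u).
Proof. by apply: measurable_tmap => i; exact: measurable_rot. Qed.

Lemma ge0_integral_trot j u (F : n.-tuple CC -> \bar R) : normc u = 1 ->
  measurable_fun setT F -> (forall t, 0 <= F t)%E ->
  (\int[lebC]_t F (trot j u t) = \int[lebC]_t F t)%E.
Proof. by move=> u1; apply: ge0_integral_rotC => k; exact: rot_unit. Qed.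

Lemma trot_ball j u t : normc u = 1 -> B (trot j u t) <-> B t.
Proof.
by move=> u1; rewrite /ball_coords /= of_coords_trot /ball1 /= norm2_scale1_unit.
Qed.

(** Fubini for averages over rotations requires measurability in the angle and the point
    together. *)
Lemma measurable_trot_joint d (S : measurableType d) (a : S -> measurableTypeR R)
    (b : S -> n.-tuple CC) j : measurable_fun setT a -> measurable_fun setT b ->
  measurable_fun setT (fun x => trot j (cis (a x)) (b x)).
Proof.
move=> ma mb; apply/measurable_fun_tnthP => i.
rewrite (_ : _ \o _ = fun x => rot (if i == j then cis (a x) else 1) (tnth (b x) i)); last first.
  by apply/funext => x; rewrite /= tnth_mktuple.
have mt : measurable_fun setT (fun x => tnth (b x) i).
  exact: measurableT_comp (measurable_tnth i) mb.
case: eqP => _; last exact: measurableT_comp (measurable_rot 1) mt.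
have m1 := measurableT_comp measurable_fst mt; have m2 := measurableT_comp measurable_snd mt.
have mc : measurable_fun setT (fun x => cos (a x)).
  apply: measurableT_comp ma.
  by apply: continuous_measurable_fun; exact: continuous_cos.
have ms : measurable_fun setT (fun x => sin (a x)).
  apply: measurableT_comp ma.
  by apply: continuous_measurable_fun; exact: continuous_sin.
apply/measurable_fun_pairP; split; rewrite /comp /rot /=.
  by apply: measurable_funB; exact: measurable_funM.
by apply: measurable_funD; exact: measurable_funM.
Qed.

End coordinates.

Section circle_operators.
Context {R : realType} {n : nat}.
Local Notation CC := (measurableTypeR R * measurableTypeR R)%type.
Local Notation leb := (@lebesgue_measure R).
Local Notation lebC := (@lebesgue_C R n).
Local Notation B := (@ball_coords R n).
Implicit Types (z h : 'rV[R[i]]_n) (u v : R[i]) (i j : 'I_n) (t : n.-tuple CC)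
  (g : 'rV[R[i]]_n -> R[i]).

Definition cont_ball g := forall z, ball1 z -> forall e : R, 0 < e ->
  exists2 d : R, 0 < d & forall h, rnorm h < d -> normc (g (z + h) - g z) <= e.

(* The Fourier component of frequency [p - q] for the rotations of the [j]-th coordinate. *)
Definition proj j (p q : nat) g z : R[i] :=
  cavg (fun u => g (scale1 j u z) * u^* ^+ p * u ^+ q).

Lemma cont_ball_circle g j z : cont_ball g -> ball1 z -> circ_cont (fun u => g (scale1 j u z)).
Proof.
move=> cg Bz u u1 e e0.
have [|d d0 H] := cg (scale1 j u z) _ e e0; first by apply: ball1_scale1 => //; rewrite u1.
have rz := rnorm_ge0 z.
exists (d / (rnorm z + 1)) => [|w w1].
  by rewrite divr_gt0// ltr_wpDl.
rewrite ltr_pdivlMr; last by rewrite ltr_wpDl.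
move=> wu; rewrite -[scale1 j w z](subrK (scale1 j u z)) (addrC (scale1 j w z - _)); apply: H.
rewrite -[in scale1 j w z](addr0 z); apply: le_lt_trans (rnorm_scale1D _ _ _ _ _) _; first by rewrite w1.
have -> : rnorm (0 : 'rV[R[i]]_n) = 0 by apply/eqP; rewrite rnorm_eq0.
rewrite addr0; apply: le_lt_trans wu.
by rewrite ler_wpM2l ?normc_ge0// lerDl.
Qed.

Lemma circ_cont_proj g j p q z : cont_ball g -> ball1 z ->
  circ_cont (fun u => g (scale1 j u z) * u^* ^+ p * u ^+ q).
Proof. by move=> cg Bz; apply: circ_cont_pow; exact: cont_ball_circle. Qed.

(** The orbit of [z] under rotations is compact, so continuity along it is uniform. *)
Lemma cont_ball_uniform g j z (e : R) : cont_ball g -> ball1 z -> 0 < e ->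
  exists2 d : R, 0 < d & forall h u, normc u = 1 -> rnorm h < d ->
    normc (g (scale1 j u (z + h)) - g (scale1 j u z)) <= e.
Proof.
move=> cg Bz e0; pose P d s := forall h, rnorm h < d ->
  normc (g (scale1 j (cis s) (z + h)) - g (scale1 j (cis s) z)) <= e.
have e20 : 0 < e / 2 by rewrite divr_gt0.
have rz := rnorm_ge0 z.
have [||d d0 Hd] := @segment_uniform R P 0 (2 * pi).
- by move=> d d' s d'd H h hd; apply: H; exact: lt_le_trans d'd.
- move=> s; have [|d d0 Hd] := cg (scale1 j (cis s) z) _ _ e20.
    by apply: ball1_scale1 => //; rewrite normc_cis.
  have [r r0 Hr] := circ_cont_ccont s circ_cont_id (divr_gt0 (divr_gt0 d0 (ltr0n _ 2)) (ltr_wpDl rz ltr01)).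
  exists r => //; exists (d / 2); first by rewrite divr_gt0.
  move=> s' ss h hd.
  have key k : rnorm k < d / 2 -> normc (g (scale1 j (cis s') (z + k)) - g (scale1 j (cis s) z)) <= e / 2.
    move=> kd; rewrite -[scale1 j (cis s') _](subrK (scale1 j (cis s) z)).
    rewrite (addrC (scale1 j (cis s') _ - _)); apply: Hd.
    apply: le_lt_trans (rnorm_scale1D _ _ _ _ _) _; first by rewrite normc_cis.
    rewrite (splitr d); apply: ler_ltD => //.
    apply: le_trans (ler_wpM2r rz (Hr _ ss)) _.
    by rewrite mulrAC -mulrA ler_piMr ?divr_ge0 ?(ltW d0)// ler_pdivrMr ?mul1r ?lerDl// ltr_wpDl.
  rewrite (splitr e); apply: le_trans (normc_tri _ (g (scale1 j (cis s) z)) _) _.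
  apply: lerD; first exact: key.
  rewrite normc_sub; have := key 0; rewrite addr0; apply.
  rewrite (_ : rnorm _ = 0) ?divr_gt0//.
  by apply/eqP; rewrite rnorm_eq0.
exists d => // h u /polar[s s0 ->] hd; exact: Hd.
Qed.

(** Increments that are small uniformly on the circle have a small average, up to the factor 2 of
    [cavg_le_cst]. *)
Lemma cont_ball_proj g j p q : cont_ball g -> cont_ball (proj j p q g).
Proof.
move=> cg z Bz e e0; have e20 : 0 < e / 2 by rewrite divr_gt0.
have [d1 d10 H1] := ball1_nbhs Bz.
have [d2 d20 H2] := cont_ball_uniform j cg Bz e20.
exists (Num.min d1 d2); first by rewrite lt_min d10.
move=> h; rewrite lt_min => /andP[h1 h2].
have L1 := circ_cont_L1 (circ_cont_proj j p q cg (H1 _ h1)).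
have L2 := circ_cont_L1 (circ_cont_proj j p q cg Bz).
rewrite /proj -(cavgB L1 L2) (_ : e = 2 * (e / 2)); last by field.
apply: cavg_le_cst; first exact: (cL1B measurable_circle L1 L2).
move=> u u1; rewrite -!mulrBl !normcM !normcX normcJ u1 !expr1n !mulr1.
exact: H2.
Qed.

(** The substitution of [u w] for [u]. As [w^*] is [w^-1], a rotation by [w] multiplies the
    component by [w^(p-q)]; keeping two exponents avoids negative powers. *)
Lemma proj_shift g j p q z w : cont_ball g -> ball1 z -> normc w = 1 ->
  proj j p q g (scale1 j w z) * w^* ^+ p * w ^+ q = proj j p q g z.
Proof.
move=> cg Bz w1; have Bw : ball1 (scale1 j w z) by apply: ball1_scale1 => //; rewrite w1.
rewrite /proj -[RHS](cavg_shift w1); last exact: circ_cont_proj.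
rewrite -mulrA mulrC -cavgZ; last exact/circ_cont_L1/circ_cont_proj.
by apply: eq_cavg => u u1; rewrite scale1M rmorphM !exprMn; ring.
Qed.

End circle_operators.

(** * The weighted measure of the ball and its moments *)

Section weight.
Context {R : realType} {n : nat} (alpha : R) (alpha_gtN1 : -1 < alpha).
Local Notation CC := (measurableTypeR R * measurableTypeR R)%type.
Local Notation lebC := (@lebesgue_C R n).
Local Notation B := (@ball_coords R n).
Implicit Types (z : 'rV[R[i]]_n) (t : n.-tuple CC) (m : 'I_n -> nat).

Definition dv t : R := dv_alpha alpha (of_coords t).

Lemma sqnormE t : sqnorm t = norm2 (of_coords t).
Proof. by apply: eq_bigr => j _; rewrite mxE. Qed.

Lemma ge0_integral_ball_powR (b : R) m : -1 < b ->
  (\int[lebC]_(t in B) ((1 - norm2 (of_coords t)) `^ b *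
     \prod_(j < n) normc (of_coords t 0 j) ^+ (2 * m j))%:E = (dirichlet_cst b m)%:E)%E.
Proof.
move=> b1; have := @ge0_integral_dirichlet R n 1 b m b1; rewrite ltr01 powR1 mulr1 => <-.
rewrite integral_mkcond; apply: eq_integral => t _.
rewrite patchE /dirichlet_fun sqnormE (_ : (t \in B) = (norm2 (of_coords t) < 1)); last first.
  by apply/idP/idP => [/set_mem//|/mem_set].
case: ifP => // _; congr (_ * _)%:E; apply: eq_bigr => j _; rewrite mxE.
by case: (tnth t j).
Qed.

Lemma disc_area_gt0' : 0 < @disc_area R ^+ n. Proof. by rewrite exprn_gt0// disc_area_gt0. Qed.

Lemma ball_volume : lebC B = (@disc_area R ^+ n / n`!%:R)%:E.
Proof.
have b1 : -1 < (0 : R) by lra.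
have := ge0_integral_ball_powR (fun=> 0%N) b1.
rewrite (eq_integral (cst 1%E)); last first.
  by move=> t _; rewrite powRr0 mul1r big1// => j _; rewrite muln0 expr0.
rewrite integral_cst ?mul1e; last exact: measurable_ball_coords.
move=> ->; congr EFin; rewrite /dirichlet_cst big1// mulr1 add0r.
have -> : (n + \sum_(j < n) 0)%N = n by rewrite big1// addn0.
have -> : Gamma (1 + n%:R) = n`!%:R * Gamma (1 : R).
  elim: (n) => [|k ih]; first by rewrite addr0 fact0 mul1r.
  rewrite -natr1 addrA GammaS ?ih; last by rewrite ltr_wpDr.
  by rewrite factS natrM mulrA -natr1 (addrC 1).
have : Gamma (1 : R) != 0 by rewrite gt_eqF// Gamma_gt0.
have : n`!%:R != 0 :> R by rewrite pnatr_eq0 -lt0n fact_gt0.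
by move=> h1 h2; field; rewrite h1 h2.
Qed.

Let a1_gt0 : 0 < alpha + 1. Proof. by rewrite -ltrBlDr sub0r. Qed.

Let arg_gt0 (x : R) : 0 <= x -> 0 < x + alpha + 1.
Proof. by move=> x0; rewrite -addrA ltr_wpDl. Qed.

Lemma c_alpha_gt0 : 0 < @c_alpha R n alpha.
Proof.
by rewrite /c_alpha divr_gt0 ?mulr_gt0 ?Gamma_gt0 ?arg_gt0 ?ltr0n ?fact_gt0.
Qed.

Lemma ball_volume_gt0 : 0 < fine (lebC B).
Proof. by rewrite ball_volume divr_gt0 ?disc_area_gt0' ?ltr0n ?fact_gt0. Qed.

Lemma dv_gt0 t : B t -> 0 < dv t.
Proof.
move=> Bt; rewrite /dv /dv_alpha divr_gt0 ?ball_volume_gt0// mulr_gt0 ?c_alpha_gt0//.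
by rewrite powR_gt0// subr_gt0.
Qed.

Lemma dv_ge0 t : 0 <= dv t. Proof. exact: dv_alpha_ge0. Qed.

Lemma measurable_dv : measurable_fun setT dv. Proof. exact: measurable_dv_alpha. Qed.

Lemma dv_trot j u t : normc u = 1 -> dv (trot j u t) = dv t.
Proof. by move=> u1; rewrite /dv /dv_alpha of_coords_trot norm2_scale1_unit. Qed.

(** The squared norm of the unnormalized monomial [z^m] for the measure [v_alpha]. *)
Definition moment m : R :=
  Gamma (n%:R + alpha + 1) * (\prod_(j < n) (m j)`!%:R) /
  Gamma (n%:R + (\sum_(j < n) m j)%:R + alpha + 1).

Lemma moment_gt0 m : 0 < moment m.
Proof.
rewrite /moment divr_gt0 ?mulr_gt0 ?Gamma_gt0 ?arg_gt0 ?addr_ge0 ?prodr_gt0//.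
Qed.

Lemma ge0_integral_moment m :
  (\int[lebC]_(t in B) (\prod_(j < n) normc (of_coords t 0 j) ^+ (2 * m j) * dv t)%:E =
   (moment m)%:E)%E.
Proof.
have K0 : 0 <= @c_alpha R n alpha / fine (lebC B).
  by rewrite divr_ge0 ?(ltW c_alpha_gt0) ?(ltW ball_volume_gt0).
transitivity ((c_alpha alpha (n := n) / fine (lebC B))%:E *
  \int[lebC]_(t in B) ((1 - norm2 (of_coords t)) `^ alpha *
     \prod_(j < n) normc (of_coords t 0 j) ^+ (2 * m j))%:E)%E.
  rewrite -ge0_integralZl//; last 3 first.
  - exact: measurable_ball_coords.
  - apply/measurable_EFinP; apply: measurable_funTS; apply: measurable_funM.
      apply: (measurableT_comp (measurable_powR alpha)).
      by apply: measurable_funB => //; exact: measurable_norm2_coords.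
    apply: measurable_prod => j _; apply: measurable_funX.
    rewrite (_ : (fun t => _) = fun t => plane_norm (tnth t j)).
      exact: measurable_plane_norm_tnth.
    by apply/funext => t; rewrite mxE; case: (tnth t j).
  - move=> t _; rewrite lee_fin mulr_ge0 ?powR_ge0// prodr_ge0// => j _.
    by rewrite exprn_ge0 ?normc_ge0.
  apply: eq_integral => t _; rewrite -EFinM; congr EFin; rewrite /dv /dv_alpha.
  by ring.
rewrite ge0_integral_ball_powR// -EFinM; congr EFin.
rewrite /moment /c_alpha /dirichlet_cst ball_volume [fine _]/= natrD.
rewrite (_ : alpha + 1 + (n%:R + (\sum_(j < n) m j)%:R) = n%:R + (\sum_(j < n) m j)%:R + alpha + 1); last by ring.
have h1 : n`!%:R != 0 :> R by rewrite pnatr_eq0 -lt0n fact_gt0.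
have h2 : @disc_area R ^+ n != 0 by rewrite gt_eqF// disc_area_gt0'.
have h3 : Gamma (alpha + 1) != 0 by rewrite gt_eqF// Gamma_gt0.
have h4 : Gamma (n%:R + (\sum_(j < n) m j)%:R + alpha + 1) != 0.
  by rewrite gt_eqF// Gamma_gt0// arg_gt0// addr_ge0.
move: (Gamma (n%:R + alpha + 1)) h1 h2 h3 h4 => G1.
move: (n`!%:R : R) (disc_area ^+ n) (Gamma (alpha + 1)) (Gamma _) (\prod_(j < n) _) => a b c d e h1 h2 h3 h4.
by field; rewrite h1 h2 h3 h4.
Qed.

Lemma integrable_dv : lebC.-integrable B (EFin \o dv).
Proof.
apply/integrableP; split.
  by apply/measurable_EFinP/measurable_funTS; exact: measurable_dv.
rewrite (eq_integral (fun t => (\prod_(j < n) normc (of_coords t 0 j) ^+ (2 * 0) * dv t)%:E)).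
  by rewrite (ge0_integral_moment (fun=> 0%N)) ltry.
move=> t _; rewrite big1 ?mul1r; last by move=> j _; rewrite muln0 expr0.
by rewrite /= ger0_norm ?dv_ge0.
Qed.

End weight.

Section weighted_operators.
Context {R : realType} {n : nat} (alpha : R) (alpha_gtN1 : -1 < alpha).
Local Notation CC := (measurableTypeR R * measurableTypeR R)%type.
Local Notation leb := (@lebesgue_measure R).
Local Notation lebC := (@lebesgue_C R n).
Local Notation B := (@ball_coords R n).
Local Notation dv := (dv alpha).
Local Notation mB := (@measurable_ball_coords R n).
Local Notation mC := (@measurable_circle R).
Implicit Types (z h : 'rV[R[i]]_n) (u v : R[i]) (i j : 'I_n) (t : n.-tuple CC)
  (g : 'rV[R[i]]_n -> R[i]).

Definition wfun g t : R[i] := g (of_coords t) * (dv t)%:C.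

(** The regularity that survives averaging over rotations: continuity makes the averages meaningful
    at each point, weighted integrability makes the coefficients meaningful. *)
Definition good g := cont_ball g /\ cL1 lebC B (wfun g).

(** The weight is positive on the ball and can be divided out. *)
Lemma good_measurable g : good g -> complex_measurable B (g \o @of_coords R n).
Proof.
move=> [_ [mg _]].
apply: (@eq_cmeas _ _ _ _ (fun t => wfun g t * (dv t `^ (-1))%:C)).
  move=> t /set_mem Bt; have d0 := dv_gt0 alpha_gtN1 Bt.
  rewrite /wfun /= -mulrA -real_complexM powR_inv1 ?(ltW d0)// mulfV ?gt_eqF//.
  exact: mulr1.
apply: cmeasM; [exact: mg|]; apply: cmeas_real; apply: measurable_funTS.
exact: (measurableT_comp (measurable_powR _) (measurable_dv alpha)).
Qed.

Lemma cL1M_bounded (f k : n.-tuple CC -> R[i]) (M : R) : cL1 lebC B f ->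
  complex_measurable B k -> (forall t, B t -> normc (k t) <= M) ->
  cL1 lebC B (fun t => f t * k t).
Proof.
move=> fL mk kM; apply: (@cL1_le _ _ _ _ _ mB _ (fun t => M * normc (f t))).
- by apply: cmeasM => //; exact: fL.1.
- have H1 := cL1_normc fL. have H := integrableZ_fin mB M H1. exact H.
- by move=> t Bt; rewrite normcM mulrC ler_wpM2r ?normc_ge0// kM.
Qed.

Section fubini.
Variables (g : 'rV[R[i]]_n -> R[i]) (j : 'I_n) (p q : nat) (psi : 'rV[R[i]]_n -> R[i]) (M : R).
Hypotheses (gg : good g) (mpsi : complex_measurable B (psi \o @of_coords R n))
  (psiM : forall z, ball1 z -> normc (psi z) <= M).

Let f (x : n.-tuple CC * measurableTypeR R) : R[i] :=
  wfun g (trot j (cis x.2) x.1) * psi (of_coords x.1) * (cis x.2)^* ^+ p * cis x.2 ^+ q.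

Let mf : complex_measurable (B `*` circle) f.
Proof.
have mcis : complex_measurable (B `*` @circle R) (fun x => cis x.2).
  split; apply: measurable_funTS; apply: measurableT_comp measurable_snd;
    apply: continuous_measurable_fun; [exact: continuous_cos|exact: continuous_sin].
apply: cmeasM; last exact: cmeasX.
apply: cmeasM; last by apply: cmeasX; exact: cmeasJ.
apply: cmeasM.
  apply: (cmeas_comp mB _ gg.2.1).
    by move=> x [Bx _]; apply/trot_ball => //; exact: normc_cis.
  apply: measurable_funTS.
  by apply: measurable_trot_joint; [exact: measurable_snd|exact: measurable_fst].
apply: (cmeas_comp mB _ mpsi) => //; first by move=> x [].
by apply: measurable_funTS; exact: measurable_fst.
Qed.

Let f1 th : circle th -> cL1 lebC B (fun t => f (t, th)).
Proof.
move=> _; have u1 := normc_cis th.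
rewrite /f /=; apply: (cL1Zr mB); apply: (cL1Zr mB).
apply: (cL1M_bounded (M := M)) => //; last by move=> t Bt; exact: psiM.
apply: (cL1_preserving (measurable_trot j (cis th)) mB) => //.
- by move=> t; exact: trot_ball.
- by move=> F mF F0; exact: ge0_integral_trot.
- exact: gg.2.
Qed.

Let f2 t : B t -> cL1 leb circle (fun th => f (t, th)).
Proof.
move=> Bt; have Bz : ball1 (of_coords t) by [].
have H : circ_cont (fun u => (dv t)%:C * psi (of_coords t) *
    (g (scale1 j u (of_coords t)) * u^* ^+ p * u ^+ q)).
  exact/circ_contZ/circ_cont_proj/Bz/gg.1.
apply: eq_cL1 (circ_cont_L1 H) => // th _.
rewrite /f /wfun /= of_coords_trot dv_trot ?normc_cis//; ring.
Qed.

(** Tonelli puts the ball inside, where rotation invariance of the measure and the weight bounds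
    every inner integral by the same constant. *)
Let foo : (\int[lebC]_(t in B) \int[leb]_(th in circle) (normc (f (t, th)))%:E < +oo)%E.
Proof.
pose h (x : measurableTypeR R * n.-tuple CC) := (normc (f (x.2, x.1)))%:E.
have mh : measurable_fun (circle `*` B) h.
  apply/measurable_EFinP/measurable_normc.
  apply: (cmeas_comp _ _ mf) => //; first by apply: measurableX; [exact: mB|exact: mC].
    by move=> x [].
  by apply: measurable_funTS; exact: measurable_swap.
have h0 x : (circle `*` B) x -> (0 <= h x)%E by move=> _; rewrite lee_fin normc_ge0.
have -> := esym (tonelli_rect leb lebC mC mB mh h0).
have K1 : (`|M|%:E * \int[lebC]_(t in B) (normc (wfun g t))%:E < +oo)%E.
  by rewrite lte_mul_pinfty// gg.2.2.
have [_ K2] := gg.2.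
apply: (@le_lt_trans _ _ (\int[leb]_(th in circle)
    (cst (`|M|%:E * \int[lebC]_(t in B) (normc (wfun g t))%:E) th))%E).
  apply: ge0_le_integral.
  - exact: mC.
  - by move=> th _; apply: integral_ge0 => t _; rewrite lee_fin normc_ge0.
  - exact: (measurable_tonelli_rect lebC mC mB mh h0).
  - exact: measurable_cst.
  - move=> th Cth; have u1 := normc_cis th.
    rewrite /= -(@ge0_integral_preserving _ _ _ lebC _ B mB
      (fun t => trot_ball j t u1) (fun F mF F0 => ge0_integral_trot j u1 mF F0)
      (fun t => (normc (wfun g t))%:E)); last 2 first.
    + by apply/measurable_EFinP/measurable_normc; exact: gg.2.1.
    + by move=> t _; rewrite lee_fin normc_ge0.
    have mG : measurable_fun B (fun t => (normc (wfun g (trot j (cis th) t)))%:E).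
      apply/measurable_EFinP/measurable_normc.
      apply: (cmeas_preserving (measurable_trot j (cis th)) mB _ gg.2.1).
      by move=> t; exact: trot_ball.
    rewrite -ge0_integralZl//; last 2 first.
    + exact: mB.
    + by move=> t _; rewrite lee_fin normc_ge0.
    apply: ge0_le_integral.
    + exact: mB.
    + by move=> t _; rewrite lee_fin normc_ge0.
    + by apply/measurable_EFinP/measurable_normc; exact: (f1 Cth).1.
    + exact: measurable_funeM.
    + move=> t Bt; rewrite -EFinM lee_fin /f /=; move: (wfun _ _) => W.
      rewrite !normcM !normcX normcJ u1 !expr1n !mulr1.
      rewrite mulrC ler_wpM2r ?normc_ge0//; apply: le_trans (psiM Bt) _.
      exact: ler_norm.
rewrite integral_cst; last exact: mC.
have K3 : (0 <= `|M|%:E * \int[lebC]_(t in B) (normc (wfun g t))%:E)%E.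
  by apply: mule_ge0 => //; apply: integral_ge0 => t _; rewrite lee_fin normc_ge0.
apply: lte_mul_pinfty => //; last exact: circle_fin.
by rewrite ge0_fin_numE.
Qed.

Let proj_wfun t : B t -> wfun (proj j p q g) t * psi (of_coords t) =
  complex_integral leb circle (fun th => f (t, th)) / (2 * pi)%:C.
Proof.
move=> Bt; have Bz : ball1 (of_coords t) by [].
have HL := circ_cont_L1 (circ_cont_proj j p q gg.1 Bz).
have -> : complex_integral leb circle (fun th => f (t, th)) =
    ((dv t)%:C * psi (of_coords t)) * complex_integral leb circle (fun th =>
      g (scale1 j (cis th) (of_coords t)) * (cis th)^* ^+ p * cis th ^+ q).
  rewrite -(cintZ mC _ HL); apply: eq_cint => th _.
  rewrite /f /wfun /= of_coords_trot dv_trot ?normc_cis//.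
  move: (g _) (psi _) (_ ^+ p) (_ ^+ q) ((dv t)%:C) => a b c d e.
  by rewrite mulrA; congr (_ * d); rewrite !mulrA; congr (_ * c); rewrite [RHS]mulrC mulrA.
rewrite /wfun /proj /cavg -mulrA.
move: (complex_integral _ _ _) (psi _) ((dv t)%:C) (_^-1) => a b c d.
by rewrite [LHS]mulrC mulrA.
Qed.

Lemma cL1_proj : cL1 lebC B (fun t => wfun (proj j p q g) t * psi (of_coords t)).
Proof.
have H := cL1_cint_rect mB mC mf foo f2.
apply: (eq_cL1 _ (cL1Zr mB (2 * pi)%:C^-1 H)) => t /set_mem Bt.
by rewrite proj_wfun.
Qed.

(** Fubini and rotation invariance move the average from [g] to the test function, which is rotated
    backwards. *)
Lemma cint_proj : complex_integral lebC B (fun t => wfun (proj j p q g) t * psi (of_coords t)) =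
  cavg (fun u => complex_integral lebC B
    (fun t => wfun g t * psi (scale1 j u^* (of_coords t))) * u^* ^+ p * u ^+ q).
Proof.
have H := cL1_cint_rect mB mC mf foo f2.
rewrite (@eq_cint _ _ _ _ _ _ (fun t => complex_integral leb circle (fun th => f (t, th)) * (2 * pi)%:C^-1));
  last by move=> t /set_mem Bt; rewrite proj_wfun.
rewrite (cintZr mB _ H) (cFubini mB mC mf foo f2 f1) /cavg; congr (_ / _).
apply: eq_cint => th _; have u1 := normc_cis th.
have fL : cL1 lebC B (fun t => wfun g (trot j (cis th) t) * psi (of_coords t)).
  apply: (cL1M_bounded (M := M)) => //; last by move=> t Bt; exact: psiM.
  apply: (cL1_preserving (measurable_trot j (cis th)) mB) => //.
  - by move=> t; exact: trot_ball.
  - by move=> F mF F0; exact: ge0_integral_trot.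
  - exact: gg.2.
rewrite /f /= (cintZr mB _ (cL1Zr mB _ fL)) (cintZr mB _ fL).
have un : normc (cis th)^* = 1 by rewrite normcJ.
congr (_ * _ * _); rewrite -[RHS](cint_preserving (phi := trot j (cis th)) mB).
- by apply: eq_cint => t _; rewrite /= of_coords_trot scale1M (mulrC (cis th)^*) unit_conjV// scale11.
- by move=> t; exact: trot_ball.
- by move=> F mF F0; exact: ge0_integral_trot.
- apply: cmeasM; first exact: gg.2.1.
  rewrite (_ : (fun t => _) = (psi \o @of_coords R n) \o trot j (cis th)^*); last first.
    by apply/funext => t; rewrite /= of_coords_trot.
  apply: (cmeas_preserving _ mB _ mpsi); first exact: measurable_trot.
  by move=> t; exact: trot_ball.
Qed.

End fubini.

Lemma good_proj g j p q : good g -> good (proj j p q g).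
Proof.
move=> gg; split; first exact/cont_ball_proj/gg.1.
have H := @cL1_proj g j p q (fun=> 1) 1 gg (cmeas_cst _ _) _.
apply: eq_cL1 (H _) => [t _|z _]; first by rewrite mulr1.
by rewrite normc1.
Qed.

Definition cmon (m : 'I_n -> nat) z : R[i] := \prod_(i < n) (z 0 i)^* ^+ m i.

Lemma cmeas_cmon m : complex_measurable B (cmon m \o @of_coords R n).
Proof.
apply: cmeas_prod => i; apply: cmeasX; apply: cmeasJ.
rewrite (_ : (fun t => _) = fun t => (tnth t i).1 +i* (tnth t i).2); last first.
  by apply/funext => t; rewrite mxE.
split; apply: measurable_funTS.
- exact: measurableT_comp measurable_fst (measurable_tnth i).
- exact: measurableT_comp measurable_snd (measurable_tnth i).
Qed.

Lemma normc_cmon m z : ball1 z -> normc (cmon m z) <= 1.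
Proof.
move=> Bz; rewrite normc_prod; apply: (@le_trans _ _ (\prod_(i < n) 1)); last by rewrite big1_eq.
apply: ler_prod => i _; rewrite normcX normcJ exprn_ge0 ?normc_ge0//=.
by rewrite exprn_ile1 ?normc_ge0// ltW// normc_coord_ball.
Qed.

Lemma cmon_scale1 m j u z : cmon m (scale1 j u^* z) = u ^+ m j * cmon m z.
Proof.
rewrite /cmon (bigD1 j)//= [in RHS](bigD1 j)//= scale1E eqxx conjcM exprMn -!mulrA.
congr (_ * (_ * _)); first by congr (_ ^+ _); exact: conjCK.
 apply: eq_bigr => i ij; by rewrite scale1E (negPf ij).
Qed.

Definition coef m g : R[i] := complex_integral lebC B (fun t => wfun g t * cmon m (of_coords t)).

Lemma coef_L1 m g : good g -> cL1 lebC B (fun t => wfun g t * cmon m (of_coords t)).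
Proof.
move=> gg; apply: (cL1M_bounded (M := 1)) (gg.2) (cmeas_cmon m) _ => t Bt.
exact: normc_cmon.
Qed.

(** Moving the rotation onto the conjugate monomial produces [u^(m j)], which the factor
    [u^* ^+ m j] of the projection cancels. *)
Lemma coef_proj m j g : good g -> coef m (proj j (m j) 0 g) = coef m g.
Proof.
move=> gg; rewrite /coef (cint_proj _ _ _ gg (cmeas_cmon m) (@normc_cmon m)).
rewrite -[RHS](cavg_cst); apply: eq_cavg => u u1.
have -> : complex_integral lebC B (fun t => wfun g t * cmon m (scale1 j u^* (of_coords t))) =
    coef m g * u ^+ m j.
  rewrite -(cintZr mB _ (coef_L1 m gg)); apply: eq_cint => t _.
  by rewrite cmon_scale1 mulrCA mulrC.
by rewrite expr0 mulr1 -mulrA -exprMn unit_conjV// expr1n mulr1.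
Qed.

Lemma measurable_coords d (T : measurableType d) (F : T -> 'rV[R[i]]_n) :
  (forall i, complex_measurable setT (fun x => F x 0 i)) ->
  measurable_fun setT (fun x => coords (F x)).
Proof.
move=> mF; apply/measurable_fun_tnthP => i.
rewrite (_ : _ \o _ = fun x => (complex.Re (F x 0 i), complex.Im (F x 0 i))); last first.
  by apply/funext => x; rewrite /= tnth_mktuple.
by apply/measurable_fun_pairP; split; [exact: (mF i).1|exact: (mF i).2].
Qed.

Lemma cmeas_cis d (T : measurableType d) (a : T -> measurableTypeR R) :
  measurable_fun setT a -> complex_measurable setT (fun x => cis (a x)).
Proof.
by move=> ma; split; apply: measurableT_comp ma; apply: continuous_measurable_fun;
  [exact: continuous_cos|exact: continuous_sin].
Qed.

Lemma torus_bounded g i j z : cont_ball g -> ball1 z -> exists M : R,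
  forall u v, normc u = 1 -> normc v = 1 -> normc (g (scale1 i v (scale1 j u z))) <= M.
Proof.
move=> cg Bz; have rz := rnorm_ge0 z.
(* The bound is written [d^-1], so that the property becomes weaker as [d] decreases. *)
have [||d d0 Hd] := @segment_uniform R (fun d s => 0 < d -> forall v, normc v = 1 ->
    normc (g (scale1 i v (scale1 j (cis s) z))) <= d^-1) 0 (2 * pi).
- move=> d d' s d'd H d'0 v v1; have d0 := lt_le_trans d'0 d'd.
  by apply: le_trans (H d0 v v1) _; rewrite lef_pV2// posrE.
- move=> s; have Bs : ball1 (scale1 j (cis s) z) by apply: ball1_scale1; rewrite ?normc_cis.
  have [d1 d10 H1] := cont_ball_uniform i cg Bs ltr01.
  have [M0 HM] := circ_cont_bounded (cont_ball_circle i cg Bs).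
  have M0ge : 0 <= M0 by exact: le_trans (normc_ge0 _) (HM _ normc1).
  have [r r0 Hr] := circ_cont_ccont s circ_cont_id (divr_gt0 (divr_gt0 d10 (ltr0n _ 2)) (ltr_wpDl rz ltr01)).
  exists r => //; exists (M0 + 1)^-1; first by rewrite invr_gt0 ltr_wpDl.
  move=> s' ss _ v v1; rewrite invrK.
  have hd : rnorm (scale1 j (cis s') z - scale1 j (cis s) z) < d1.
    rewrite -[in scale1 j (cis s') z](addr0 z).
    apply: le_lt_trans (rnorm_scale1D _ _ _ _ _) _; first by rewrite normc_cis.
    have -> : rnorm (0 : 'rV[R[i]]_n) = 0 by apply/eqP; rewrite rnorm_eq0.
    rewrite addr0; apply: le_lt_trans (ler_wpM2r rz (Hr _ ss)) _.
    rewrite mulrAC -mulrA; apply: (@le_lt_trans _ _ (d1 / 2)).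
      by rewrite ler_piMr ?divr_ge0 ?(ltW d10)// ler_pdivrMr ?mul1r ?lerDl// ltr_wpDl.
    by rewrite ltr_pdivrMr// ltr_pMr// ltr1n.
  have := H1 _ v v1 hd; rewrite (addrC (scale1 j (cis s) z)) subrK => A.
  rewrite -[g _](subrK (g (scale1 i v (scale1 j (cis s) z)))).
  by apply: le_trans (normcD _ _) _; rewrite addrC lerD// HM.
by exists d^-1 => u v /polar[s s0 ->] v1; exact: Hd.
Qed.

Section swap.
Variables (g : 'rV[R[i]]_n -> R[i]) (i j : 'I_n) (p q k l : nat) (z : 'rV[R[i]]_n).
Hypotheses (gg : good g) (Bz : ball1 z).

Let f (x : measurableTypeR R * measurableTypeR R) : R[i] :=
  g (scale1 i (cis x.2) (scale1 j (cis x.1) z)) *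
  ((cis x.2)^* ^+ k * cis x.2 ^+ l) * ((cis x.1)^* ^+ p * cis x.1 ^+ q).

Let Bzz u v : normc u = 1 -> normc v = 1 -> ball1 (scale1 i v (scale1 j u z)).
Proof. by move=> u1 v1; apply: ball1_scale1; rewrite ?v1//; apply: ball1_scale1; rewrite ?u1. Qed.

Let mf : complex_measurable (circle `*` circle) f.
Proof.
have mcis1 := cmeas_cis (@measurable_fst _ _ (measurableTypeR R) (measurableTypeR R)).
have mcis2 := cmeas_cis (@measurable_snd _ _ (measurableTypeR R) (measurableTypeR R)).
apply: (@cmeasS _ _ _ setT); [exact: measurableT|exact: subsetT|].
apply: cmeasM; last by exact: (cmeasM (cmeasX _ (cmeasJ mcis1)) (cmeasX _ mcis1)).
apply: cmeasM; last by exact: (cmeasM (cmeasX _ (cmeasJ mcis2)) (cmeasX _ mcis2)).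
rewrite (_ : (fun x => _) = fun x => (g \o @of_coords R n)
    (coords (scale1 i (cis x.2) (scale1 j (cis x.1) z)))); last first.
  by apply/funext => x; rewrite /= coordsK.
apply: (cmeas_comp mB _ (good_measurable gg)).
  by move=> x _; rewrite /ball_coords /= coordsK; apply: Bzz; exact: normc_cis.
apply: measurable_coords => r.
rewrite (_ : (fun x => _) = fun x => (if r == i then cis x.2 else 1) *
   ((if r == j then cis x.1 else 1) * z 0 r)); last first.
  by apply/funext => x; rewrite !scale1E; do 2 case: eqP => _; rewrite ?mul1r.
apply: cmeasM; first by case: eqP => _; [exact: mcis2|exact: cmeas_cst].
by apply: cmeasM; [case: eqP => _; [exact: mcis1|exact: cmeas_cst]|exact: cmeas_cst].
Qed.

Let f2 s : circle s -> cL1 leb circle (fun th => f (s, th)).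
Proof.
move=> _; rewrite /f /=; apply: (cL1Zr mC).
have Bs : ball1 (scale1 j (cis s) z) by apply: ball1_scale1; rewrite ?normc_cis.
apply: eq_cL1 (circ_cont_L1 (circ_cont_proj i k l gg.1 Bs)) => th _.
by rewrite mulrA.
Qed.

Let f1 th : circle th -> cL1 leb circle (fun s => f (s, th)).
Proof.
move=> _; rewrite /f /=.
have Bs : ball1 (scale1 i (cis th) z) by apply: ball1_scale1; rewrite ?normc_cis.
have := cL1Zr mC ((cis th)^* ^+ k * cis th ^+ l) (circ_cont_L1 (circ_cont_proj j p q gg.1 Bs)).
apply: eq_cL1 => s _; rewrite scale1C.
have alg (a b c d e : R[i]) : a * b * c * (d * e) = a * (d * e) * (b * c) by ring.
exact: alg.
Qed.

Let foo : (\int[leb]_(s in circle) \int[leb]_(th in circle) (normc (f (s, th)))%:E < +oo)%E.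
Proof.
have [M HM] := torus_bounded i j gg.1 Bz.
have mh : measurable_fun (circle `*` circle) (fun x => (normc (f x))%:E).
  exact/measurable_EFinP/measurable_normc.
have h0 x : (circle `*` circle) x -> (0 <= (normc (f x))%:E)%E by rewrite lee_fin normc_ge0.
have M0 : 0 <= M by exact: le_trans (normc_ge0 _) (HM _ _ normc1 normc1).
have K0 : (0 <= M%:E * leb circle)%E by rewrite mule_ge0// lee_fin.
apply: (@le_lt_trans _ _ (\int[leb]_(s in circle) cst (M%:E * leb circle)%E s)%E).
  apply: ge0_le_integral.
  - exact: mC.
  - by move=> s _; apply: integral_ge0 => t _; rewrite lee_fin normc_ge0.
  - exact: (measurable_tonelli_rect leb mC mC mh h0).
  - exact: measurable_cst.
  - move=> s Cs; rewrite -(integral_cst _ mC); apply: ge0_le_integral.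
    + exact: mC.
    + by move=> t _; rewrite lee_fin normc_ge0.
    + by apply/measurable_EFinP/measurable_normc; exact: (f2 Cs).1.
    + exact: measurable_cst.
    + move=> th _; rewrite lee_fin /f /= !normcM !normcX !normcJ !normc_cis !expr1n !mulr1.
      exact: HM (normc_cis _) (normc_cis _).
rewrite integral_cst; last exact: mC.
apply: lte_mul_pinfty; [exact: K0| |exact: circle_fin].
rewrite ge0_fin_numE//; apply: lte_mul_pinfty; [by rewrite lee_fin|by []|exact: circle_fin].
Qed.

Let pi2n0 : ((2 * pi)%:C : R[i]) != 0.
Proof. by rewrite (inj_eq (@complexI R)) gt_eqF// mulr_gt0// pi_gt0. Qed.

Let cavgE F : complex_integral leb circle (fun s => F (cis s)) = cavg F * (2 * pi)%:C.
Proof. by rewrite /cavg mulfVK. Qed.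

Let cavg2 (G : R[i] -> R[i] -> R[i]) : circ_L1 (fun u => cavg (G u)) ->
  complex_integral leb circle (fun s => complex_integral leb circle (fun th => G (cis s) (cis th))) =
  cavg (fun u => cavg (G u)) * (2 * pi)%:C * (2 * pi)%:C.
Proof.
move=> GL; rewrite -(cavgE (fun u => cavg (G u))) -(cintZr mC _ GL).
by apply: eq_cint => s _; exact: cavgE.
Qed.

(** Fubini on the product of two circles. This is what transports the scaling relation in one
    coordinate through a projection in another. *)
Lemma proj_swap : proj j p q (proj i k l g) z = proj i k l (proj j p q g) z.
Proof.
pose G u v := g (scale1 i v (scale1 j u z)) * (v^* ^+ k * v ^+ l) * (u^* ^+ p * u ^+ q).
have L1 := circ_cont_L1 (circ_cont_proj j p q (cont_ball_proj i k l gg.1) Bz).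
have L2 := circ_cont_L1 (circ_cont_proj i k l (cont_ball_proj j p q gg.1) Bz).
have alg (a b c d e : R[i]) : (d * e) * (a * b * c) = a * (b * c) * (d * e) by ring.
have alg2 (a b c d e : R[i]) : a * (d * e) * (b * c) = (d * e) * (a * b * c) by ring.
have E1 u : normc u = 1 -> proj i k l g (scale1 j u z) * u^* ^+ p * u ^+ q = cavg (G u).
  move=> u1; have Bs : ball1 (scale1 j u z) by apply: ball1_scale1; rewrite ?u1.
  rewrite -mulrA mulrC /proj -cavgZ; last exact/circ_cont_L1/circ_cont_proj/Bs/gg.1.
  by apply: eq_cavg => v _; exact: alg.
have E2 v : normc v = 1 -> proj j p q g (scale1 i v z) * v^* ^+ k * v ^+ l = cavg (G^~ v).
  move=> v1; have Bs : ball1 (scale1 i v z) by apply: ball1_scale1; rewrite ?v1.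
  rewrite -mulrA mulrC /proj -cavgZ; last exact/circ_cont_L1/circ_cont_proj/Bs/gg.1.
  by apply: eq_cavg => u _; rewrite -alg2 /G scale1C.
have -> : proj j p q (proj i k l g) z = cavg (fun u => cavg (G u)).
  by rewrite [LHS]/proj; apply: eq_cavg => u u1; exact: E1.
have -> : proj i k l (proj j p q g) z = cavg (fun v => cavg (G^~ v)).
  by rewrite [LHS]/proj; apply: eq_cavg => u u1; exact: E2.
have F1 := cavg2 (eq_circ_L1 E1 L1).
have F2 := cavg2 (eq_circ_L1 E2 L2).
have F3 := cFubini mC mC mf foo f2 f1.
apply: (mulIf pi2n0); apply: (mulIf pi2n0).
exact: etrans (esym F1) (etrans F3 F2).
Qed.

End swap.

End weighted_operators.

(** * Functions homogeneous in each coordinate *)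

Section homogeneous.
Context {R : realType} {n : nat}.
Implicit Types (z : 'rV[R[i]]_n) (u : R[i]) (i j : 'I_n) (m : 'I_n -> nat)
  (h : 'rV[R[i]]_n -> R[i]).

Definition homog j (k : nat) h := forall u z, ball1 z -> normc u <= 1 ->
  h (scale1 j u z) = u ^+ k * h z.

Lemma rnorm_scale1_0 j u z : normc u <= 1 ->
  rnorm (scale1 j u z - scale1 j 0 z) <= normc u * rnorm z.
Proof.
move=> u1; rewrite -[in scale1 j u z](addr0 z).
apply: le_trans (rnorm_scale1D _ _ _ _ u1) _.
have -> : rnorm (0 : 'rV[R[i]]_n) = 0 by apply/eqP; rewrite rnorm_eq0.
by rewrite addr0 subr0.
Qed.

(** A nonzero [u] is a dilation times a rotation; [u = 0] is the limit of the dilations [t] tending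
    to 0, reached by continuity. *)
Lemma homog_of j k h : cont_ball h ->
  (forall z t, ball1 z -> 0 < t < 1 -> h (scale1 j t%:C z) = t%:C ^+ k * h z) ->
  (forall z u, ball1 z -> normc u = 1 -> h (scale1 j u z) = u ^+ k * h z) ->
  homog j k h.
Proof.
move=> ch Ht Hu u z Bz u1.
have Ht' (y : 'rV[R[i]]_n) (t : R) : ball1 y -> 0 < t <= 1 -> h (scale1 j t%:C y) = t%:C ^+ k * h y.
  move=> By /andP[t0]; rewrite le_eqVlt => /orP[/eqP ->|t1]; last by rewrite Ht ?t0.
  by rewrite scale11 expr1n mul1r.
have [->|u0] := eqVneq u 0; last first.
  have nu0 : 0 < normc u by rewrite normc_gt0.
  pose w := u / (normc u)%:C.
  have nuC : ((normc u)%:C : R[i]) != 0 by rewrite (inj_eq (@complexI R)) gt_eqF.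
  have w1 : normc w = 1 by rewrite normcM normcV normc_real gtr0_norm// mulfV ?gt_eqF.
  have uE : u = (normc u)%:C * w by rewrite /w mulrCA mulfV ?mulr1.
  rewrite [in LHS]uE -scale1M Ht' ?nu0//; last by apply: ball1_scale1; rewrite ?w1.
  by rewrite Hu// mulrA -exprMn -uE.
have B0 : ball1 (scale1 j 0 z) by apply: ball1_scale1; rewrite ?normc0.
apply/eqP; rewrite -subr_eq0 -normc_eq0 eq_le normc_ge0 andbT.
apply/ler_addgt0Pr => e e0; rewrite add0r.
have e20 : 0 < e / 2 by rewrite divr_gt0.
have [d d0 Hd] := ch _ B0 _ e20.
have rz := rnorm_ge0 z; have hz := normc_ge0 (h z).
pose t := Num.min (Num.min 1 (d / 2 / (rnorm z + 1))) (e / 2 / (normc (h z) + 1)).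
have t0 : 0 < t by rewrite !lt_min ltr01 !divr_gt0// ltr_wpDl.
have t1 : t <= 1 by rewrite !ge_min lexx.
have td : t * rnorm z < d.
  apply: (@le_lt_trans _ _ (d / 2 / (rnorm z + 1) * (rnorm z + 1))).
    by apply: ler_pM => //; rewrite ?(ltW t0)// ?lerDl// !ge_min lexx orbT.
  by rewrite mulfVK ?gt_eqF ?ltr_wpDl// ltr_pdivrMr// ltr_pMr// ltr1n.
have te : t * normc (h z) <= e / 2.
  apply: (@le_trans _ _ (e / 2 / (normc (h z) + 1) * (normc (h z) + 1))).
    by apply: ler_pM => //; rewrite ?(ltW t0)// ?lerDl// ge_min lexx orbT.
  by rewrite mulfVK ?gt_eqF ?ltr_wpDl.
have near : normc (h (scale1 j t%:C z) - h (scale1 j 0 z)) <= e / 2.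
  rewrite -[scale1 j t%:C z](subrK (scale1 j 0 z)) (addrC (scale1 j t%:C z - _)); apply: Hd.
  by apply: le_lt_trans (rnorm_scale1_0 _ _ _) _; rewrite normc_real gtr0_norm.
rewrite normc_sub; apply: le_trans (normc_tri _ (h (scale1 j t%:C z)) _) _.
rewrite (splitr e); apply: lerD near.
rewrite Ht' ?t0// -mulrBl normcM; apply: le_trans te; rewrite ler_wpM2r ?normc_ge0//.
case: k {Ht Hu Ht'} => [|k]; first by rewrite !expr0 subrr normc0 ltW.
rewrite expr0n sub0r normcN normcX normc_real gtr0_norm// exprS ler_piMr ?(ltW t0)//.
by rewrite exprn_ile1// ltW.
Qed.

Definition scale (U : 'I_n -> R[i]) (s : seq 'I_n) z : 'rV[R[i]]_n :=
  \row_i (if i \in s then U i * z 0 i else z 0 i).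

Lemma homog_scale m h (U : 'I_n -> R[i]) (s : seq 'I_n) z : uniq s ->
  (forall j, homog j (m j) h) -> (forall j, normc (U j) <= 1) -> ball1 z ->
  h (scale U s z) = (\prod_(j <- s) U j ^+ m j) * h z.
Proof.
move=> + hh U1 Bz; elim: s => [_|j s ih /= /andP[js us]].
  by rewrite big_nil mul1r; congr h; apply/rowP => i; rewrite mxE.
have Bs : ball1 (scale U s z).
  apply: le_lt_trans Bz; apply: ler_sum => i _; rewrite mxE; case: ifP => // _.
  by rewrite normcM exprMn ler_piMl ?sqr_ge0// exprn_ile1 ?normc_ge0.
have -> : scale U (j :: s) z = scale1 j (U j) (scale U s z).
  apply/rowP => i; rewrite !mxE inE; case: eqP => [->|]//=.
  by rewrite (negPf js).
by rewrite hh// ih// big_cons mulrA.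
Qed.

(** The point with coordinates [e z_j] is obtained from [z] by the factors [e], and also from
    [(e, ..., e)] by the factors [z_j]. Comparing the two gives the constant [h(e, ..., e) / e^|m|],
    where [e = 1/(n+1)] is nonzero and puts that point in the ball. *)
Lemma homog_monomial m h : (forall j, homog j (m j) h) ->
  exists c : R[i], forall z, ball1 z -> h z = c * \prod_j z 0 j ^+ m j.
Proof.
move=> hh; pose e : R := (n.+1%:R)^-1.
have e0 : 0 < e by rewrite invr_gt0.
have e1 : e <= 1 by rewrite invf_le1// ler1n.
have eC : (e%:C : R[i]) != 0 by rewrite (inj_eq (@complexI R)) gt_eqF.
pose z1 : 'rV[R[i]]_n := \row__ e%:C.
have B1 : ball1 z1.
  rewrite /ball1 /= /norm2; under eq_bigr do rewrite mxE normc_real (gtr0_norm e0).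
  rewrite sumr_const card_ord -mulr_natl; apply: (@le_lt_trans _ _ (n%:R * e)).
    by rewrite ler_wpM2l// expr2 ler_piMr// ltW.
  by rewrite ltr_pdivrMr// mul1r ltr_nat.
pose E : R[i] := \prod_(j <- index_enum 'I_n) (e%:C ^+ m j).
have En0 : E != 0 by rewrite prodf_seq_neq0; apply/allP => j _; rewrite expf_neq0.
exists (h z1 / E) => z Bz.
have U1 j : normc (z 0 j) <= 1 by rewrite ltW// normc_coord_ball.
have ne (j : 'I_n) : normc (e%:C : R[i]) <= 1 by rewrite normc_real gtr0_norm.
have := @homog_scale m h (fun=> e%:C) _ z (index_enum_uniq 'I_n) hh ne Bz.
have <- : scale (fun j => z 0 j) (index_enum 'I_n) z1 = scale (fun=> e%:C) (index_enum 'I_n) z.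
  by apply/rowP => i; rewrite !mxE mem_index_enum mulrC.
rewrite (homog_scale (index_enum_uniq 'I_n) hh U1 B1) -/E => H.
by apply: (mulfI En0); rewrite -H mulrA mulrCA mulfV// mulr1 mulrC.
Qed.

End homogeneous.

Section uniqueness.
Context {R : realType} {n : nat} (alpha : R) (alpha_gtN1 : -1 < alpha).
Local Notation lebC := (@lebesgue_C R n).
Local Notation B := (@ball_coords R n).
Local Notation dv := (dv alpha).
Local Notation good := (@good R n alpha).
Local Notation mB := (@measurable_ball_coords R n).
Implicit Types (z y : 'rV[R[i]]_n) (u v w : R[i]) (i j : 'I_n) (m : 'I_n -> nat)
  (f g h : 'rV[R[i]]_n -> R[i]) (s : seq 'I_n).

(** The trace of holomorphy that is retained: the annulus relation in the coordinates of [s]. A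
    projection in one coordinate preserves it in the others. *)
Definition hol_on s g := good g /\ forall j p q (t : R) z, j \in s -> 0 < t < 1 -> ball1 z ->
  proj j p q g (scale1 j t%:C z) * t%:C ^+ q = t%:C ^+ p * proj j p q g z.

(** Factors are allowed on both sides so that the scaling relation fits with [a = t^q] and
    [b = t^p], without negative exponents. *)
Lemma proj_equivariant g i j p q w a b : cont_ball g -> normc w <= 1 ->
  (forall y, ball1 y -> g (scale1 i w y) * a = b * g y) ->
  forall z, ball1 z -> proj j p q g (scale1 i w z) * a = b * proj j p q g z.
Proof.
move=> cg w1 H z Bz; have Bw := ball1_scale1 i w1 Bz.
rewrite mulrC /proj -cavgZ; last exact/circ_cont_L1/circ_cont_proj.
rewrite -cavgZ; last exact/circ_cont_L1/circ_cont_proj.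
apply: eq_cavg => u u1; rewrite scale1C !mulrA -H; last by apply: ball1_scale1; rewrite ?u1.
by rewrite (mulrC a).
Qed.

Lemma hol_proj j k s g : j \notin s -> hol_on (j :: s) g -> hol_on s (proj j k 0 g).
Proof.
move=> js [gg H]; split; first exact: good_proj.
move=> i p q t z si t01 Bz; have t1 : normc (t%:C : R[i]) <= 1.
  by case/andP: t01 => t0 t1; rewrite normc_real gtr0_norm// ltW.
have S y : ball1 y -> proj i p q (proj j k 0 g) y = proj j k 0 (proj i p q g) y.
  by move=> By; exact: (proj_swap alpha_gtN1 _ _ _ _ _ _ gg By).
rewrite (S _ Bz) (S _ (ball1_scale1 i t1 Bz)).
apply: proj_equivariant => //; first exact/cont_ball_proj/gg.1.
by move=> y By; apply: H => //; rewrite inE si orbT.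
Qed.

Fixpoint projs s m g := if s is j :: s' then projs s' m (proj j (m j) 0 g) else g.

Lemma good_projs s m g : good g -> good (projs s m g).
Proof. by elim: s g => //= j s ih g gg; apply: ih; exact: good_proj. Qed.

Lemma coef_projs s m g : good g -> coef alpha m (projs s m g) = coef alpha m g.
Proof.
by elim: s g => //= j s ih g gg; rewrite ih; [exact: coef_proj|exact: good_proj].
Qed.

Lemma projs_equivariant s m g i w b : good g -> normc w <= 1 ->
  (forall y, ball1 y -> g (scale1 i w y) = b * g y) ->
  forall z, ball1 z -> projs s m g (scale1 i w z) = b * projs s m g z.
Proof.
move=> + w1; elim: s g => //= j s ih g gg H; apply: ih; first exact: good_proj.
move=> y By; rewrite -[LHS]mulr1; apply: (proj_equivariant _ _ _ gg.1 w1) => //.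
by move=> y' By'; rewrite mulr1; exact: H.
Qed.

(** The projection in coordinate [j] creates the homogeneity, under dilations by [hol_on] and under
    rotations by [proj_shift]; projections in the other coordinates preserve it. *)
Lemma homog_projs s m g j : uniq s -> j \in s -> hol_on s g -> homog j (m j) (projs s m g).
Proof.
move=> us js hg; apply: homog_of; first exact/(good_projs s m hg.1).1.
- elim: s g us js hg => //= i s ih g /andP[nis us] js hg z t Bz t01.
  have t1 : normc (t%:C : R[i]) <= 1.
    by case/andP: t01 => t0 t1; rewrite normc_real gtr0_norm// ltW.
  have [ji|ji] := eqVneq j i; last first.
    by apply: ih => //; [move: js; rewrite inE (negPf ji)|exact: hol_proj].
  apply: projs_equivariant => //; first exact/good_proj/hg.1.
  move=> y By; rewrite -[LHS]mulr1 -[X in _ * X](expr0 (t%:C : R[i])) ji.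
  by apply: hg.2 => //; rewrite inE eqxx.
- elim: s g us js hg => //= i s ih g /andP[nis us] js hg z u Bz u1.
  have [ji|ji] := eqVneq j i; last first.
    by apply: ih => //; [move: js; rewrite inE (negPf ji)|exact: hol_proj].
  apply: projs_equivariant => //; [exact/good_proj/hg.1|by rewrite u1|].
  move=> y By; rewrite ji -(proj_shift i (m i) 0 hg.1.1 By u1) expr0 mulr1 mulrCA.
  by rewrite -exprMn unit_conjV// expr1n mulr1.
Qed.

Lemma unit_pow u (p q : nat) : normc u = 1 -> (q <= p)%N ->
  u^* ^+ p * u ^+ q = u^* ^+ (p - q) /\ u^* ^+ q * u ^+ p = u ^+ (p - q).
Proof.
move=> u1 qp; have uq : u^* ^+ q * u ^+ q = 1 by rewrite mulrC -exprMn unit_conjV// expr1n.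
by rewrite -{1 3}(subnK qp) !exprD -mulrA uq mulrCA uq !mulr1.
Qed.

(** By Fourier uniqueness on the orbit it suffices that all components vanish. Nonnegative
    frequencies do by hypothesis. A component [G] of frequency [-r < 0] satisfies
    [G(z) = t^r G(t z)], dilating coordinate [j] only, and stays bounded as [t] tends to 0. *)
Lemma hol_unique_coord j s g : j \in s -> hol_on s g ->
  (forall k z, ball1 z -> proj j k 0 g z = 0) -> forall z, ball1 z -> g z = 0.
Proof.
move=> js [gg H] P0 z Bz; rewrite -(scale11 j z).
apply: (fourier_unique (F := fun u => g (scale1 j u z))); first exact: cont_ball_circle gg.1 Bz.
move=> p q; rewrite -/(proj j p q g z).
have [qp|pq] := leqP q p.
  rewrite -(P0 (p - q)%N z Bz); apply: eq_cavg => u u1.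
  by rewrite expr0 mulr1 -mulrA (unit_pow u1 qp).1.
have -> : proj j p q g z = proj j 0 (q - p) g z.
  by apply: eq_cavg => u u1; rewrite expr0 mulr1 -mulrA (unit_pow u1 (ltnW pq)).2.
have r0 : (0 < q - p)%N by rewrite subn_gt0.
move: (q - p)%N r0 => r r0; pose G := proj j 0 r g.
have B0 : ball1 (scale1 j 0 z) by apply: ball1_scale1; rewrite ?normc0.
have [d d0 Hd] := cont_ball_proj j 0 r gg.1 B0 ltr01.
have rz := rnorm_ge0 z; pose K := normc (G (scale1 j 0 z)) + 1.
have K0 : 0 < K by rewrite ltr_wpDl ?normc_ge0.
apply/eqP; rewrite -normc_eq0 eq_le normc_ge0 andbT.
apply/ler_addgt0Pr => e e0; rewrite add0r.
pose t := Num.min (Num.min 2^-1 (d / 2 / (rnorm z + 1))) (e / K).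
have t0 : 0 < t by rewrite !lt_min invr_gt0 ltr0n !divr_gt0// ltr_wpDl.
have t12 : t <= 2^-1 by rewrite !ge_min lexx.
have t1 : t < 1 by apply: le_lt_trans t12 _; rewrite invf_lt1// ltr1n.
have tK : t * K <= e by rewrite -ler_pdivlMr// ge_min lexx orbT.
have td : t * rnorm z < d.
  apply: (@le_lt_trans _ _ (d / 2 / (rnorm z + 1) * (rnorm z + 1))).
    by apply: ler_pM => //; rewrite ?(ltW t0)// ?lerDl// !ge_min lexx orbT.
  by rewrite mulfVK ?gt_eqF ?ltr_wpDl// ltr_pdivrMr// ltr_pMr// ltr1n.
have GK : normc (G (scale1 j t%:C z)) <= K.
  rewrite -[G _](subrK (G (scale1 j 0 z))); apply: le_trans (normcD _ _) _.
  rewrite [leRHS]addrC lerD2r -[scale1 j t%:C z](subrK (scale1 j 0 z)).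
  rewrite (addrC (scale1 j t%:C z - _)); apply: Hd.
  by apply: le_lt_trans (rnorm_scale1_0 _ _ _) _; rewrite normc_real gtr0_norm// ltW.
have t01 : 0 < t < 1 by rewrite t0.
rewrite -[proj j 0 r g z]mul1r -(H j 0%N r t z js t01 Bz) normcM normcX normc_real gtr0_norm//.
apply: le_trans tK; rewrite mulrC; apply: ler_pM => //; rewrite ?normc_ge0 ?exprn_ge0 ?(ltW t0)//.
by rewrite -(prednK r0) exprS ler_piMr ?exprn_ile1 ?(ltW t0) ?(ltW t1).
Qed.

Lemma hol_unique s g : uniq s -> hol_on s g ->
  (forall m z, ball1 z -> projs s m g z = 0) -> forall z, ball1 z -> g z = 0.
Proof.
elim: s g => [|j s ih] g; first by move=> _ _ /(_ (fun=> 0%N)).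
move=> /= /andP[js us] hg P0; apply: (@hol_unique_coord j (j :: s)) => //.
  by rewrite inE eqxx.
move=> k; apply: ih => //; first exact: hol_proj.
(* The exponent of [j] was fixed before those of the remaining coordinates; [m'] joins them into one
   multi-index. *)
move=> m z Bz; pose m' i := if i == j then k else m i.
have m'j : m' j = k by rewrite /m' eqxx.
have := P0 m' z Bz; rewrite m'j => <-.
elim: s js (proj j k 0 g) {us hg P0} => //= i s ih; rewrite inE negb_or => /andP[ij js] h.
by rewrite (ih js) /m' eq_sym (negPf ij).
Qed.

(** The full projection is [c z^m] and keeps the coefficient of index [m], which is thus both 0 and
    [c] times a positive moment. *)
Lemma hol_coef0 g : hol_on (index_enum 'I_n) g -> (forall m, coef alpha m g = 0) ->
  forall z, ball1 z -> g z = 0.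
Proof.
move=> hg g0; apply: (hol_unique (index_enum_uniq _) hg) => m.
pose h := projs (index_enum 'I_n) m g.
have [c hc] : exists c : R[i], forall z, ball1 z -> h z = c * \prod_j z 0 j ^+ m j.
  apply: homog_monomial => j; apply: homog_projs hg; first exact: index_enum_uniq.
  exact: mem_index_enum.
suff c0 : c = 0 by move=> z Bz; rewrite -/h hc// c0 mul0r.
have := coef_projs (index_enum 'I_n) m hg.1; rewrite g0 -/h /coef.
rewrite (@eq_cint _ _ _ _ _ _ (fun t =>
   c * (\prod_(j < n) normc (of_coords t 0 j) ^+ (2 * m j) * dv t)%:C)); last first.
  move=> t /set_mem Bt; rewrite /wfun hc//; move: (dv t) => d; rewrite real_complexM -!mulrA; congr (_ * _).
  rewrite mulrCA mulrC; congr (_ * _); rewrite /cmon -big_split /=.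
  rewrite (big_morph _ (fun a b : R => @real_complexM R a b) (erefl (1%:C : R[i]))).
  by apply: eq_bigr => j _; rewrite -exprMn mulcJ -real_complexX exprM.
have I0 := ge0_integral_moment alpha_gtN1 m.
have mI : measurable_fun B (fun t => \prod_(j < n) normc (of_coords t 0 j) ^+ (2 * m j) * dv t).
  apply: measurable_funTS; apply: measurable_funM; last exact: measurable_dv.
  apply: measurable_prod => j _; apply: measurable_funX.
  rewrite (_ : (fun t => _) = fun t => plane_norm (tnth t j)); first exact: measurable_plane_norm_tnth.
  by apply/funext => t; rewrite mxE; case: (tnth t j).
have p0 t : 0 <= \prod_(j < n) normc (of_coords t 0 j) ^+ (2 * m j) * dv t.
  rewrite mulr_ge0 ?dv_ge0// prodr_ge0// => j _.
  by rewrite exprn_ge0 ?normc_ge0.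
rewrite (cintZ mB); last first.
  split; first exact: cmeas_real.
  under eq_integral do rewrite normc_real ger0_norm//.
  by rewrite I0 ltry.
rewrite (cint_real _ mB) /Rintegral I0 /= => /eqP; rewrite mulf_eq0 => /orP[/eqP //|].
by rewrite (inj_eq (@complexI R)) gt_eqF// moment_gt0.
Qed.

(** The bound on the differential is the sum of its moduli on the unit vectors. *)
Lemma holomorphic_eps f z : holomorphic f -> ball1 z ->
  exists (L : {linear 'rV[R[i]]_n -> R[i]^o}) (K : R), [/\ 0 <= K,
    forall h : 'rV[R[i]]_n, normc (L h) <= K * rnorm h &
    forall e : R, 0 < e -> exists2 d : R, 0 < d &
    forall h : 'rV[R[i]]_n, rnorm h < d -> normc (f (z + h) - f z - L h) <= e * rnorm h].
Proof.
move=> hf Bz; have [L HL] := differentiable_eps (hf z Bz).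
pose K := \sum_(i < n) normc (L (delta_mx 0 i)).
exists L, K; split=> //; first by apply: sumr_ge0 => i _; exact: normc_ge0.
move=> h; rewrite {1}(row_sum_delta h) linear_sum /K mulr_suml.
apply: le_trans (normc_sum _ _ _) _; apply: ler_sum => i _.
by rewrite linearZ /= normcM mulrC ler_wpM2l ?normc_ge0// normc_coord_le.
Qed.

Lemma holomorphic_cont_ball f : holomorphic f -> cont_ball f.
Proof.
move=> hf z Bz e e0; have [L [K [K0 LK HL]]] := holomorphic_eps hf Bz.
have [d d0 Hd] := HL _ ltr01.
have K1 : 0 < 1 + K by rewrite ltr_pwDl.
exists (Num.min d (e / (1 + K))); first by rewrite lt_min d0 divr_gt0.
move=> h; rewrite lt_min => /andP[hd he].
rewrite -(subrK (L h) (_ - _)); apply: le_trans (normcD _ _) _.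
apply: (@le_trans _ _ ((1 + K) * rnorm h)); first by rewrite mulrDl lerD// Hd.
by rewrite mulrC -ler_pdivlMr// ltW.
Qed.

Lemma holomorphic_coord f j z (u : R[i]^o) : holomorphic f -> ball1 (scale1 j u z) ->
  differentiable ((fun u => f (scale1 j u z)) : R[i]^o -> R[i]^o) u.
Proof.
move=> hf Bu; have [L [K [K0 LK HL]]] := holomorphic_eps hf Bu.
pose y : 'rV[R[i]]_n := z 0 j *: delta_mx 0 j.
have E v : scale1 j (u + v) z = scale1 j u z + v *: y.
  apply/rowP => i; rewrite !mxE eqxx; case: eqP => [->|] /=.
    by rewrite mulr1 mulrDl.
  by move=> _; rewrite !mulr0 addr0.
have y0 := rnorm_ge0 y; have y1 : 0 < rnorm y + 1 by rewrite ltr_wpDl.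
apply: (@cdiff_differentiable _ _ _ (L y)) => e e0.
have [d d0 Hd] := HL _ (divr_gt0 e0 y1).
exists (d / (rnorm y + 1)); first by rewrite divr_gt0.
move=> v; rewrite ltr_pdivlMr// => vd; rewrite E.
have vy : rnorm (v *: y) <= normc v * (rnorm y + 1).
  by rewrite rnormZ ler_wpM2l ?normc_ge0// lerDl.
have A := Hd (v *: y) (le_lt_trans vy vd).
have LE : L (v *: y) = v * L y by rewrite linearZ.
rewrite LE in A; apply: le_trans A _.
apply: (@le_trans _ _ (e / (rnorm y + 1) * (normc v * (rnorm y + 1)))).
  by rewrite ler_wpM2l// ltW// divr_gt0.
by rewrite [normc v * _]mulrC mulrA mulfVK ?gt_eqF.
Qed.

Lemma holomorphic_hol_on s f : holomorphic f -> cL1 lebC B (wfun alpha f) -> hol_on s f.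
Proof.
move=> hf fL; split; first by split=> //; exact: holomorphic_cont_ball.
move=> j p q t z _ t01 Bz.
rewrite -(cavg_annulus p q (g := fun u => f (scale1 j u z)) t01).
  by congr (_ * _); apply: eq_cavg => u _; rewrite scale1M (mulrC u).
by move=> u /andP[_ u1]; apply: holomorphic_coord => //; exact: ball1_scale1.
Qed.

Lemma holomorphic_unique f : holomorphic f -> cL1 lebC B (wfun alpha f) ->
  (forall m, coef alpha m f = 0) -> forall z, ball1 z -> f z = 0.
Proof. by move=> hf fL; apply: hol_coef0; exact: holomorphic_hol_on. Qed.

End uniqueness.

(** * Unordered sums and square-summable families *)

Section unordered_sums.
Context {R : realType} {I : choiceType}.
Implicit Types (x y : I -> R) (z w : I -> R[i]) (F : {fset I}).

Lemma fsbig_fset_sum x F : (\sum_(i \in [set` F]) (x i)%:E = (\sum_(i <- F) x i)%:E)%E.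
Proof. by rewrite -(fsbig_seq _ _ (fset_uniq F)) sumEFin. Qed.

Lemma esum_ge_fset x F : ((\sum_(i <- F) x i)%:E <= \esum_(i in [set: I]) (x i)%:E)%E.
Proof.
apply: esum_ge; exists [set` F]; last by rewrite fsbig_fset_sum.
by split; [exact: finite_fset|exact: subsetT].
Qed.

Lemma esum_le_fset x (M : \bar R) : (forall F, (\sum_(i <- F) x i)%:E <= M)%E ->
  (\esum_(i in [set: I]) (x i)%:E <= M)%E.
Proof.
move=> H; apply: ge_ereal_sup => _ [A [fA _] <-].
by rewrite (fsbig_finite _ _ fA) /= sumEFin; exact: H.
Qed.

Lemma sum_fset_split (V : zmodType) (f : I -> V) F0 F : (F0 `<=` F)%fset ->
  \sum_(i <- F) f i = \sum_(i <- F0) f i + \sum_(i <- (F `\` F0)%fset) f i.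
Proof.
move=> F0F; rewrite -big_cat /=; apply: perm_big; apply: uniq_perm.
- exact: fset_uniq.
- rewrite cat_uniq !fset_uniq /= andbT; apply/hasPn => i.
  by rewrite in_fsetD => /andP[].
- move=> i; rewrite mem_cat in_fsetD; case: (boolP (i \in F0)) => //= iF0.
  by rewrite (fsubsetP F0F).
Qed.

Definition has_sum x (s : R) := forall e : R, 0 < e -> exists F0, forall F,
  (F0 `<=` F)%fset -> `|s - \sum_(i <- F) x i| <= e.

Definition has_csum z (s : R[i]) := forall e : R, 0 < e -> exists F0, forall F,
  (F0 `<=` F)%fset -> normc (s - \sum_(i <- F) z i) <= e.

Lemma ge0_has_sum x : (forall i, 0 <= x i) ->
  (\esum_(i in [set: I]) (x i)%:E < +oo)%E ->
  has_sum x (fine (\esum_(i in [set: I]) (x i)%:E)).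
Proof.
move=> x0 xoo e e0; set S := esum _ _; have S0 : (0 <= S)%E by apply: esum_ge0 => i _; rewrite lee_fin.
have Sfin : S \is a fin_num by rewrite ge0_fin_numE.
have [F0 HF0] : exists F0, fine S - e < \sum_(i <- F0) x i.
  apply: contrapT => /forallNP H.
  have : (S <= (fine S - e)%:E)%E.
    by apply: esum_le_fset => F; rewrite lee_fin leNgt; apply/negP; exact: H.
  by rewrite -[leLHS](fineK Sfin) lee_fin lerBrDl gerDr leNgt e0.
exists F0 => F F0F.
have A : \sum_(i <- F) x i <= fine S.
  by rewrite -lee_fin (fineK Sfin); exact: esum_ge_fset.
rewrite ger0_norm ?subr_ge0// lerBlDr -lerBlDl; apply: le_trans (ltW HF0) _.
by rewrite (sum_fset_split x F0F) lerDl sumr_ge0.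
Qed.

Lemma has_csumD z w s t : has_csum z s -> has_csum w t ->
  has_csum (fun i => z i + w i) (s + t).
Proof.
move=> zs wt e e0; have e20 : 0 < e / 2 by rewrite divr_gt0.
have [F1 H1] := zs _ e20; have [F2 H2] := wt _ e20.
exists (F1 `|` F2)%fset => F; rewrite fsubUset => /andP[/H1 h1 /H2 h2].
rewrite big_split /= opprD addrACA (splitr e).
by apply: le_trans (normcD _ _) _; exact: lerD.
Qed.

Lemma has_csumZ c z s : has_csum z s -> has_csum (fun i => c * z i) (c * s).
Proof.
move=> zs e e0; have c1 : 0 < normc c + 1 by rewrite ltr_wpDl ?normc_ge0.
have [F0 H] := zs _ (divr_gt0 e0 c1); exists F0 => F /H h.
rewrite -mulr_sumr -mulrBr normcM.
apply: (@le_trans _ _ ((normc c + 1) * (e / (normc c + 1)))).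
  by apply: ler_pM; rewrite ?normc_ge0// lerDl.
by rewrite mulrCA mulfV ?mulr1// gt_eqF.
Qed.

Lemma has_csum_unique z s t : has_csum z s -> has_csum z t -> s = t.
Proof.
move=> zs zt; apply/eqP; rewrite -subr_eq0 -normc_eq0 eq_le normc_ge0 andbT.
apply/ler_addgt0Pr => e e0; rewrite add0r.
have e20 : 0 < e / 2 by rewrite divr_gt0.
have [F1 H1] := zs _ e20; have [F2 H2] := zt _ e20; pose F := (F1 `|` F2)%fset.
apply: le_trans (normc_tri _ (\sum_(i <- F) z i) _) _; rewrite (splitr e).
by apply: lerD; [|rewrite normc_sub]; [apply: H1; exact: fsubsetUl|apply: H2; exact: fsubsetUr].
Qed.

Lemma has_csum_le z s (M : R) (F1 : {fset I}) : has_csum z s ->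
  (forall F, (F1 `<=` F)%fset -> normc (\sum_(i <- F) z i) <= M) -> normc s <= M.
Proof.
move=> zs H; apply/ler_addgt0Pr => e e0; have [F0 HF] := zs _ e0.
rewrite -(subrK (\sum_(i <- (F0 `|` F1)%fset) z i) s); apply: le_trans (normcD _ _) _.
by rewrite addrC; apply: lerD; [apply: H; exact: fsubsetUr|apply: HF; exact: fsubsetUl].
Qed.

Definition abs_summable z := (\esum_(i in [set: I]) (normc (z i))%:E < +oo)%E.

(** The bridge from [complex_sum], built on suprema for positive and negative parts, to limits over
    finite subsets, the form in which sums are handled. *)
Lemma abs_summable_has_csum z : abs_summable z -> has_csum z (complex_sum z).
Proof.
move=> zoo.
have part x : (forall i, 0 <= x i <= normc (z i)) -> has_sum x (fine (\esum_(i in [set: I]) (x i)%:E)).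
  move=> H; apply: ge0_has_sum; first by move=> i; case/andP: (H i).
  by apply: le_lt_trans zoo; apply: le_esum => i _; rewrite lee_fin; case/andP: (H i).
have real x : (forall i, `|x i| <= normc (z i)) -> has_sum x (real_sum x).
  move=> H e e0; have e20 : 0 < e / 2 by rewrite divr_gt0.
  have [|F1 H1] := part (fun i => Num.max (x i) 0) _ _ e20.
    move=> i; rewrite le_max lexx orbT /=; apply: le_trans (H i).
    by rewrite ge_max ler_norm normr_ge0.
  have [|F2 H2] := part (fun i => Num.max (- x i) 0) _ _ e20.
    move=> i; rewrite le_max lexx orbT /=; apply: le_trans (H i).
    by rewrite ge_max -normrN ler_norm normr_ge0.
  exists (F1 `|` F2)%fset => F; rewrite fsubUset => /andP[/H1 h1 /H2 h2].
  have -> : \sum_(i <- F) x i = \sum_(i <- F) Num.max (x i) 0 - \sum_(i <- F) Num.max (- x i) 0.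
    rewrite -sumrB; apply: eq_bigr => i _; have [x0|x0] := leP (x i) 0.
      by rewrite max_l ?oppr_ge0// opprK add0r.
    by rewrite max_r ?subr0// oppr_le0 ltW.
  rewrite /real_sum (_ : forall a b c d : R, a - b - (c - d) = (a - c) - (b - d)); last by move=> *; ring.
  by apply: le_trans (ler_normB _ _) _; rewrite (splitr e) lerD.
move=> e e0; have e20 : 0 < e / 2 by rewrite divr_gt0.
have [F1 H1] := real _ (fun i => normc_Re (z i)) _ e20.
have [F2 H2] := real _ (fun i => normc_Im (z i)) _ e20.
exists (F1 `|` F2)%fset => F; rewrite fsubUset => /andP[/H1 h1 /H2 h2].
apply: le_trans (normc_le_ReIm _) _; rewrite ReB ImB Re_sum Im_sum (splitr e).
exact: lerD.
Qed.

Lemma complex_sumE z s : abs_summable z -> has_csum z s -> complex_sum z = s.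
Proof. by move=> /abs_summable_has_csum zs; exact: has_csum_unique. Qed.

Lemma abs_summable_le z x : (forall i, normc (z i) <= x i) ->
  (\esum_(i in [set: I]) (x i)%:E < +oo)%E -> abs_summable z.
Proof. by move=> H; apply: le_lt_trans; apply: le_esum => i _; rewrite lee_fin. Qed.

Lemma esum_bounded x (M : R) : (forall F, \sum_(i <- F) x i <= M) ->
  (\esum_(i in [set: I]) (x i)%:E < +oo)%E.
Proof.
move=> H; apply: (@le_lt_trans _ _ M%:E); last exact: ltry.
by apply: esum_le_fset => F; rewrite lee_fin.
Qed.

Lemma ge0_tail x (e : R) : (forall i, 0 <= x i) -> (\esum_(i in [set: I]) (x i)%:E < +oo)%E ->
  0 < e -> exists F0, forall F, [disjoint F0 & F]%fset -> \sum_(i <- F) x i <= e.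
Proof.
move=> x0 xoo e0; have e20 : 0 < e / 2 by rewrite divr_gt0.
have [F0 H] := ge0_has_sum x0 xoo e20; exists F0 => F dF.
have h1 := H F0 (fsubset_refl _); have h2 := H (F0 `|` F)%fset (fsubsetUl _ _).
have E : \sum_(i <- (F0 `|` F)%fset) x i = \sum_(i <- F0) x i + \sum_(i <- F) x i.
  rewrite (sum_fset_split x (fsubsetUl F0 F)); congr (_ + _); congr (\sum_(i <- _) _).
  by rewrite fsetDUl fsetDv fset0U (fsetDidPl _ _ _)// fdisjoint_sym.
rewrite E in h2; move: h1 h2; rewrite !ler_norml; move: (fine _) (\sum_(i <- F0) x i) (\sum_(i <- F) x i) => a b c.
by move=> /andP[A1 A2] /andP[A3 A4]; clear -A1 A2 A3 A4; lra.
Qed.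

End unordered_sums.

Section ell2_theory.
Context {R : realType} {I : choiceType}.
Implicit Types (x y : ell2 R I) (F : {fset I}).

Lemma ell2P x : (\esum_(i in [set: I]) (normc (x i) ^+ 2)%:E < +oo)%E.
Proof. by have := valP x; rewrite inE. Qed.

Definition ell2_of (f : I -> R[i]) (H : (\esum_(i in [set: I]) (normc (f i) ^+ 2)%:E < +oo)%E) :
  ell2 R I := @Ell2 R I f (mem_set H).

Lemma ell2_ext x y : (forall i, x i = y i) -> x = y.
Proof. by move=> H; apply: val_inj; apply/funext. Qed.

Lemma ell2D c x y i : (c *: x + y : ell2 R I) i = c * x i + y i.
Proof. by []. Qed.

Lemma ell2_sumE (J : Type) (s : seq J) (P : pred J) (y : J -> ell2 R I) i :
  (\sum_(j <- s | P j) y j : ell2 R I) i = \sum_(j <- s | P j) y j i.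
Proof.
elim: s => [|j s ih]; first by rewrite !big_nil.
rewrite !big_cons; case: ifP => // _; rewrite -ih.
by [].
Qed.

Lemma normcM_le (a b : R[i]) : normc (a * b^*) <= normc a ^+ 2 + normc b ^+ 2.
Proof.
rewrite normcM normcJ; have ha := normc_ge0 a; have hb := normc_ge0 b.
have := sqr_ge0 (normc a - normc b); rewrite sqrrB => H.
have := mulr_ge0 ha hb; rewrite -mulr_natr in H.
by move: H; move: (normc a * normc b) (normc a ^+ 2) (normc b ^+ 2) => p q r *; lra.
Qed.

Lemma ell2_summable x y : abs_summable (fun i => x i * (y i)^*).
Proof.
apply: (@abs_summable_le _ _ _ (fun i => normc (x i) ^+ 2 + normc (y i) ^+ 2)).
  by move=> i; exact: normcM_le.
under eq_esum do rewrite EFinD.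
rewrite esumD; last 2 first.
- by move=> i _; rewrite lee_fin sqr_ge0.
- by move=> i _; rewrite lee_fin sqr_ge0.
by rewrite lte_add_pinfty// ell2P.
Qed.

Lemma ell2_ip_has_csum x y : has_csum (fun i => x i * (y i)^*) (ell2_ip x y).
Proof. exact/abs_summable_has_csum/ell2_summable. Qed.

Lemma ell2_ipxx x : ell2_ip x x = (fine (\esum_(i in [set: I]) (normc (x i) ^+ 2)%:E))%:C.
Proof.
apply: complex_sumE (ell2_summable x x) _ => e e0.
have [F0 H] := ge0_has_sum (fun i => sqr_ge0 (normc (x i))) (ell2P x) e0.
exists F0 => F /H h; rewrite (eq_bigr (fun i => (normc (x i) ^+ 2)%:C)); last first.
  by move=> i _; exact: mulcJ.
rewrite -(big_morph _ (fun a b : R => rmorphD (real_complex R) a b) (erefl (0%:C : R[i]))).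
by rewrite -[X in normc X](rmorphB (real_complex R)) normc_real.
Qed.

Local Notation norml x := (hnorm (@ell2_ip R I) x).

Lemma ell2_norm2 x : norml x ^+ 2 = fine (\esum_(i in [set: I]) (normc (x i) ^+ 2)%:E).
Proof.
by rewrite /hnorm ell2_ipxx /= sqr_sqrtr// fine_ge0// esum_ge0// => i _; rewrite lee_fin sqr_ge0.
Qed.

Lemma ell2_norm2_sup x F : \sum_(i <- F) normc (x i) ^+ 2 <= norml x ^+ 2.
Proof.
rewrite ell2_norm2 -lee_fin fineK; first exact: esum_ge_fset.
by rewrite ge0_fin_numE ?ell2P// esum_ge0// => i _; rewrite lee_fin sqr_ge0.
Qed.

Lemma ell2_norm2_le x (M : R) : (forall F, \sum_(i <- F) normc (x i) ^+ 2 <= M) ->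
  norml x ^+ 2 <= M.
Proof.
move=> H; rewrite ell2_norm2 -lee_fin fineK.
  by apply: esum_le_fset => F; rewrite lee_fin.
by rewrite ge0_fin_numE ?ell2P// esum_ge0// => i _; rewrite lee_fin sqr_ge0.
Qed.

Lemma ell2_norm_ge0 x : 0 <= norml x. Proof. exact: sqrtr_ge0. Qed.

Lemma ell2_coord_le x i : normc (x i) <= norml x.
Proof.
rewrite -ler_sqr ?nnegrE ?normc_ge0 ?ell2_norm_ge0//.
by have := ell2_norm2_sup x [fset i]%fset; rewrite big_seq_fset1.
Qed.

Lemma ell2_tail x (e : R) : 0 < e ->
  exists F0, forall F, [disjoint F0 & F]%fset -> \sum_(i <- F) normc (x i) ^+ 2 <= e.
Proof. by apply: ge0_tail (ell2P x) => i; exact: sqr_ge0. Qed.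

Lemma ell2_norm_lt x (e : R) : 0 < e -> norml x ^+ 2 <= (e / 2) ^+ 2 -> norml x < e.
Proof.
move=> e0; have e20 : 0 < e / 2 by rewrite divr_gt0.
rewrite ler_sqr ?nnegrE ?ell2_norm_ge0 ?(ltW e20)// => /le_lt_trans; apply.
by rewrite ltr_pdivrMr// ltr_pMr// ltr1n.
Qed.

End ell2_theory.

(** * The reproducing kernel as a sum of monomials *)

Section multinomial.
Context {R : realType} {n : nat}.
Implicit Types (u : 'I_n -> R[i]) (m : {ffun 'I_n -> nat}).

(** The exponential series of [x X], truncated. The coefficient of degree [k < N] in a product of
    such polynomials, computed in two ways, is the multinomial formula. *)
Definition trunc_exp (N : nat) (x : R[i]) : {poly R[i]} := \poly_(i < N) (x ^+ i / i`!%:R).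

Lemma fact_neq0 k : (k`!%:R : R[i]) != 0.
Proof. by rewrite pnatr_eq0 -lt0n fact_gt0. Qed.

Lemma coef_prod_trunc_exp N (r : seq 'I_n) u k : (k < N)%N ->
  (\prod_(j <- r) trunc_exp N (u j))`_k = (\sum_(j <- r) u j) ^+ k / k`!%:R.
Proof.
elim: r k => [|j r ih] k kN.
  rewrite !big_nil coef1 expr0n; case: k kN => [|k] _; last by rewrite mul0r.
  by rewrite fact0 divr1.
rewrite !big_cons coefM addrC exprDn mulr_suml; apply: eq_bigr => i _.
have ik : (i <= k)%N by rewrite -ltnS.
rewrite ih ?(leq_ltn_trans _ kN) ?leq_subr// coef_poly (leq_ltn_trans ik kN).
rewrite -mulr_natr -(bin_fact ik) !natrM.
have b0 : ('C(k, i)%:R : R[i]) != 0 by rewrite pnatr_eq0 -lt0n bin_gt0.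
by field; rewrite !fact_neq0 b0.
Qed.

Lemma multinomial_expansion N u k : (k < N)%N ->
  \sum_(f : {ffun 'I_n -> 'I_N} | (\sum_(j < n) f j == k)%N)
     \prod_(j < n) (u j ^+ f j / (f j)`!%:R) = (\sum_(j < n) u j) ^+ k / k`!%:R.
Proof.
move=> kN; rewrite -(coef_prod_trunc_exp _ _ kN).
have -> : \prod_(j < n) trunc_exp N (u j) =
    \sum_(f : {ffun 'I_n -> 'I_N}) (\prod_(j < n) (u j ^+ f j / (f j)`!%:R)) *: 'X^(\sum_(j < n) f j).
  under eq_bigr do rewrite /trunc_exp poly_def.
  rewrite bigA_distr_bigA /=; apply: eq_bigr => f _.
  by rewrite scaler_prod (big_morph _ (fun a b : nat => exprD 'X a b) (expr0 _)).
rewrite coef_sum [LHS]big_mkcond /=; apply: eq_bigr => f _.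
by rewrite coefZ coefXn eq_sym; case: eqP => _; rewrite ?mulr1 ?mulr0.
Qed.

(** Total degree below [N] forces each exponent below [N], so these indices come from the finite
    type of maps into ['I_N]. *)
Definition degree_lt_seq (N : nat) : seq {ffun 'I_n -> nat} :=
  [seq [ffun j => f j : nat] | f : {ffun 'I_n -> 'I_N} <-
     [seq f : {ffun 'I_n -> 'I_N} <- enum {ffun 'I_n -> 'I_N} | (\sum_(j < n) f j < N)%N]].

Definition degree_lt (N : nat) : {fset {ffun 'I_n -> nat}} := [fset m in degree_lt_seq N]%fset.

Lemma mem_degree_lt N m : (m \in degree_lt N) = (mdeg m < N)%N.
Proof.
rewrite !inE /=; apply/mapP/idP => [[f]|mN].
  by rewrite mem_filter => /andP[fN _] ->; rewrite /mdeg; under eq_bigr do rewrite ffunE.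
have mj j : (m j < N)%N.
  by apply: leq_ltn_trans mN; rewrite /mdeg (bigD1 j)//= leq_addr.
exists [ffun j => Ordinal (mj j)]; last by apply/ffunP => j; rewrite !ffunE.
by rewrite mem_filter mem_enum andbT; under eq_bigr do rewrite ffunE /=.
Qed.

Lemma sum_degree_lt (V : zmodType) N (G : {ffun 'I_n -> nat} -> V) :
  \sum_(m <- degree_lt N) G m =
  \sum_(f : {ffun 'I_n -> 'I_N} | (\sum_(j < n) f j < N)%N) G [ffun j => f j : nat].
Proof.
have us : uniq (degree_lt_seq N).
  rewrite map_inj_in_uniq; first exact/filter_uniq/enum_uniq.
  move=> f g _ _ /ffunP fg; apply/ffunP => j.
  by apply: val_inj; have := fg j; rewrite !ffunE.
rewrite (perm_big (degree_lt_seq N)) /=; last first.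
  by apply: uniq_perm; [exact: fset_uniq|exact: us|move=> m; rewrite !inE].
by rewrite /degree_lt_seq big_map big_filter big_enum_cond.
Qed.

Lemma sum_degree_multinomial N (A : nat -> R[i]) u :
  \sum_(m <- degree_lt N) A (mdeg m) * \prod_(j < n) (u j ^+ m j / (m j)`!%:R) =
  \sum_(k < N) A k * ((\sum_(j < n) u j) ^+ k / k`!%:R).
Proof.
rewrite sum_degree_lt.
transitivity (\sum_(k < N) \sum_(f : {ffun 'I_n -> 'I_N} | (\sum_(j < n) f j == k)%N)
    A k * \prod_(j < n) (u j ^+ f j / (f j)`!%:R)).
  rewrite (exchange_big_dep (fun f : {ffun 'I_n -> 'I_N} => (\sum_(j < n) f j < N)%N)) /=; last first.
    by move=> k f _ /eqP ->.
  apply: eq_bigr => f fN; rewrite (big_pred1 (Ordinal fN)); last first.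
    by move=> k /=; apply/eqP/eqP => [fk|->//]; exact: val_inj.
  rewrite /mdeg /=; congr (A _ * _); first by apply: eq_bigr => j _; rewrite ffunE.
  by apply: eq_bigr => j _; rewrite ffunE.
apply: eq_bigr => k _; rewrite -mulr_sumr; congr (_ * _).
by rewrite -(multinomial_expansion _ (ltn_ord k)).
Qed.

End multinomial.

Section binomial_coefficients.
Context {R : realType}.
Implicit Types (s x : R).

(** The coefficient of [v^k] in [(1 - v)^(-s)]. *)
Definition binc s k : R := Gamma (s + k%:R) / (Gamma s * k`!%:R).

Lemma binc_gt0 s k : 0 < s -> 0 < binc s k.
Proof.
by move=> s0; rewrite /binc divr_gt0 ?mulr_gt0 ?Gamma_gt0 ?ltr0n ?fact_gt0// ltr_wpDr.
Qed.

Lemma binc_ge0 s k : 0 < s -> 0 <= binc s k.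
Proof. by move=> s0; exact/ltW/binc_gt0. Qed.

Lemma binc0 s : 0 < s -> binc s 0 = 1.
Proof. by move=> s0; rewrite /binc addr0 fact0 mulr1 mulfV// gt_eqF// Gamma_gt0. Qed.

Let facn0 k : (k`!%:R : R) != 0. Proof. by rewrite pnatr_eq0 -lt0n fact_gt0. Qed.

(** The differential equation [f' = s f + v f'] of [f(v) = (1 - v)^(-s)], coefficient by
    coefficient. *)
Lemma bincS s k : 0 < s -> k.+1%:R * binc s k.+1 = (s + k%:R) * binc s k.
Proof.
move=> s0; have sk : 0 < s + k%:R by rewrite ltr_wpDr.
rewrite /binc factS natrM -natr1 addrA (GammaS sk).
have g0 : Gamma s != 0 by rewrite gt_eqF// Gamma_gt0.
have k0 : (k%:R + 1 : R) != 0 by rewrite natr1 pnatr_eq0.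
move: (Gamma s) (Gamma _) (k`!%:R : R) g0 (facn0 k) => a b c g0 c0.
by field; rewrite c0 g0 k0.
Qed.

(** The derivative of [(1 - v)^(-s)] is [s (1 - v)^(-s-1)]; so the differentiated series are again
    binomial and converge on the same disc. *)
Lemma bincS_shift s k : 0 < s -> k.+1%:R * binc s k.+1 = s * binc (s + 1) k.
Proof.
move=> s0; have sk : 0 < s + k%:R by rewrite ltr_wpDr.
rewrite (bincS _ s0) /binc (GammaS s0) (_ : s + 1 + k%:R = s + k%:R + 1); last by ring.
rewrite (GammaS sk); have g0 : Gamma s != 0 by rewrite gt_eqF// Gamma_gt0.
move: (Gamma s) (Gamma _) (k`!%:R : R) g0 (facn0 k) => a b c g0 c0.
by field; rewrite c0 g0 gt_eqF.
Qed.

Lemma binc_sum_bounded s x : 0 < s -> 0 <= x < 1 ->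
  exists C : R, forall N, \sum_(k < N) binc s k * x ^+ k <= C.
Proof.
move=> s0 /andP[x0 x1]; pose rho := (1 + x) / 2.
have xr : x < rho by rewrite /rho; lra.
have r1 : rho < 1 by rewrite /rho; lra.
have r0 : 0 <= rho by apply: le_trans (ltW xr).
(* From this index on, the ratio of consecutive terms is at most [rho], the midpoint of [x] and
   1. *)
pose k0 := (Num.truncn (s * x / (rho - x))).+1.
have Hk0 k : (k0 <= k)%N -> (s + k%:R) * x <= rho * k.+1%:R.
  move=> k0k; have : s * x / (rho - x) < k%:R.
    by apply: lt_le_trans (truncnS_gt _) _; rewrite ler_nat.
  rewrite ltr_pdivrMr ?subr_gt0// -natr1 => h.
  by clear -h r0 r1 x0; lra.
pose t k := binc s k * x ^+ k.
have t0 k : 0 <= t k by rewrite mulr_ge0 ?exprn_ge0// binc_ge0.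
have tS k : (k0 <= k)%N -> t k.+1 <= rho * t k.
  move=> /Hk0 h; have k1 : 0 < k.+1%:R :> R by rewrite ltr0n.
  rewrite -(ler_pM2l k1) /t [leLHS]mulrA (bincS _ s0) exprS.
  have -> : (s + k%:R) * binc s k * (x * x ^+ k) = (s + k%:R) * x * (binc s k * x ^+ k) by ring.
  have -> : k.+1%:R * (rho * (binc s k * x ^+ k)) = rho * k.+1%:R * (binc s k * x ^+ k) by ring.
  by apply: ler_wpM2r h; exact: t0.
have r1' : 0 < 1 - rho by rewrite subr_gt0.
(* The partial sum plus the geometric majorant of the tail does not increase. *)
have inv j : \sum_(k0 <= k < k0 + j) t k + t (k0 + j)%N / (1 - rho) <= t k0 / (1 - rho).
  elim: j => [|j ih]; first by rewrite addn0 big_geq// add0r.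
  apply: le_trans ih; rewrite addnS big_nat_recr ?leq_addr//= -addrA lerD2l.
  rewrite -lerBrDl; have := tS (k0 + j)%N (leq_addr _ _); have := t0 (k0 + j)%N => h1 h2.
  have -> : t (k0 + j)%N / (1 - rho) - t (k0 + j)%N = rho * t (k0 + j)%N / (1 - rho).
    by field; rewrite gt_eqF.
  by rewrite ler_pM2r ?invr_gt0.
exists (\sum_(0 <= k < k0) t k + t k0 / (1 - rho)) => N.
rewrite -(big_mkord xpredT t); apply: (@le_trans _ _ (\sum_(0 <= k < k0 + N) t k)).
  rewrite [leRHS](big_cat_nat (n := N)) ?leq_addl//= lerDl.
  by apply: sumr_ge0 => k _; exact: t0.
rewrite (big_cat_nat (n := k0)) ?leq_addr//= lerD2l; apply: le_trans (inv N).
by rewrite lerDl divr_ge0// ltW.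
Qed.

Lemma binc_series_cvg s x : 0 < s -> 0 <= x < 1 -> cvgn (series (fun k => binc s k * x ^+ k)).
Proof.
move=> s0 x01; have /andP[x0 x1] := x01; have [C HC] := binc_sum_bounded s0 x01.
apply: nondecreasing_is_cvgn.
  by apply: nondecreasing_series => k _ _; rewrite mulr_ge0 ?exprn_ge0// binc_ge0.
by exists C => _ [N _ <-]; rewrite /series /= big_mkord.
Qed.

Lemma binc_pseries_cvg (c : nat -> R) s (D r K : R) : 0 < s -> 0 <= D -> 0 <= r -> 0 <= K ->
  r * K < 1 -> (forall k, `|c k| <= D * (binc s k * r ^+ k)) -> cvgn (pseries c K).
Proof.
move=> s0 D0 r0 K0 rK Hc; apply: normed_cvg.
apply: (@series_le_cvg _ _ (fun k => D * (binc s k * (r * K) ^+ k))).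
- by move=> k; exact: normr_ge0.
- move=> k; apply: mulr_ge0 => //; apply: mulr_ge0; [exact: binc_ge0|by rewrite exprn_ge0 ?mulr_ge0].
- move=> k /=; rewrite normrM normrX (ger0_norm K0) exprMn.
  have -> : D * (binc s k * (r ^+ k * K ^+ k)) = D * (binc s k * r ^+ k) * K ^+ k by ring.
  by rewrite ler_wpM2r ?exprn_ge0.
- apply: (is_cvg_seriesZ (f := fun k => binc s k * (r * K) ^+ k)).
  by apply: binc_series_cvg => //; rewrite mulr_ge0.
Qed.

End binomial_coefficients.

(** On the right half-plane, where [1 - t v] stays for [0 <= t <= 1], this form of the argument can
    be differentiated. *)
Lemma complex_argE (R : realType) (u : R[i]) : 0 < complex.Re u ->
  complex_arg u = atan (complex.Im u / complex.Re u).
Proof.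
case: u => x y /= x0; rewrite /complex_arg /=; set n := Num.sqrt _.
have xn : x != 0 by rewrite gt_eqF.
have cE : x / n = cos (atan (y / x)).
  rewrite cos_atan /n; have -> : x ^+ 2 + y ^+ 2 = x ^+ 2 * (1 + (y / x) ^+ 2) by field.
  by rewrite sqrtrM ?sqr_ge0// sqrtr_sqr gtr0_norm// invfM mulrA mulfV// mul1r.
have pi0 := pi_gt0 R; have H1 := atan_gtNpi2 (y / x); have H2 := atan_ltpi2 (y / x).
rewrite cE; case: ifPn => [y0|]; last rewrite -ltNge => y0.
  rewrite cosK// in_itv /=; apply/andP; split; last by lra.
  by rewrite -(@atan0 R); apply: le_atan; rewrite divr_ge0// ltW.
rewrite cosKN ?opprK//; apply/andP; split; first by lra.
by rewrite -(@atan0 R); apply: le_atan; rewrite ltW// ltr_pdivrMr// mul0r.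
Qed.

Section binomial_series.
Context {R : realType} (s : R) (s0 : 0 < s) (v : R[i]) (v1 : normc v < 1).
Implicit Types (t : R).

Definition cdrv (f : R -> R[i]) t (df : R[i]) :=
  is_derive t (1 : R) (fun x => complex.Re (f x)) (complex.Re df) /\
  is_derive t (1 : R) (fun x => complex.Im (f x)) (complex.Im df).

Lemma cdrvM f g t df dg : cdrv f t df -> cdrv g t dg ->
  cdrv (fun x => f x * g x) t (df * g t + f t * dg).
Proof.
move=> [f1 f2] [g1 g2]; split.
- rewrite (_ : (fun x => _) = fun x => complex.Re (f x) * complex.Re (g x) -
      complex.Im (f x) * complex.Im (g x)); last by apply/funext => x; rewrite ReM.
  by apply: drv_eq (drvB (drvM f1 g1) (drvM f2 g2)) _; rewrite ReD !ReM; ring.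
- rewrite (_ : (fun x => _) = fun x => complex.Re (f x) * complex.Im (g x) +
      complex.Im (f x) * complex.Re (g x)); last by apply/funext => x; rewrite ImM.
  by apply: drv_eq (drvD (drvM f1 g2) (drvM f2 g1)) _; rewrite ImD !ImM; ring.
Qed.

Lemma cdrv0_cst (f : R -> R[i]) : (forall t, 0 <= t <= 1 -> cdrv f t 0) -> f 1 = f 0.
Proof.
move=> H; have E (k : R -> R) : (forall t, 0 <= t <= 1 -> is_derive t (1 : R) k 0) -> k 1 = k 0.
  move=> Hk; have := @continuous_FTC _ (fun=> 0) k 0 1 ltr01 Hk (fun x _ => @cst_continuous _ _ _ _).
  by rewrite integral0 => -[] /esym/eqP; rewrite subr_eq0 => /eqP.
have E1 : complex.Re (f 1) = complex.Re (f 0) by apply: (E (fun x => complex.Re (f x))) => t /H[].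
have E2 : complex.Im (f 1) = complex.Im (f 0) by apply: (E (fun x => complex.Im (f x))) => t /H[].
by apply/eqP; rewrite eq_complex E1 E2 !eqxx.
Qed.

Let r := normc v.
Let r0 : 0 <= r. Proof. exact: normc_ge0. Qed.

(** Termwise differentiation on the closed segment [[0, 1]] requires convergence at a point beyond
    1. *)
Lemma exists_radius : exists2 K : R, 1 < K & r * K < 1.
Proof.
move: r0 (v1 : r < 1); move: r => x x0 x1; have p : 0 < 1 + x by lra.
exists (2 / (1 + x)); first by rewrite ltr_pdivlMr ?mul1r//; lra.
by rewrite mulrA ltr_pdivrMr// mul1r; lra.
Qed.

(** With [h] the real or the imaginary part, these are the coefficients of a real power series in
    [t], to which termwise differentiation applies. *)
Definition series_part (h : R[i] -> R) k : R := binc s k * h (v ^+ k).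

Section one_part.
Variable h : R[i] -> R.
Hypothesis h1 : forall z, `|h z| <= normc z.
Let c := series_part h.

Let diffsE k : pseries_diffs c k = s * binc (s + 1) k * h (v ^+ k.+1).
Proof. by rewrite /pseries_diffs /c /series_part mulrA bincS_shift. Qed.

Let diffs2E k : pseries_diffs (pseries_diffs c) k = s * (s + 1) * binc (s + 2) k * h (v ^+ k.+2).
Proof.
have s1 : 0 < s + 1 by rewrite ltr_wpDr.
transitivity (s * (k.+1%:R * binc (s + 1) k.+1) * h (v ^+ k.+2)).
  rewrite [LHS](_ : _ = k.+1%:R * pseries_diffs c k.+1)// diffsE.
  by move: (binc _ _) (h _) => a b; ring.
rewrite (bincS_shift _ s1) (_ : s + 1 + 1 = s + 2); last by ring.
by rewrite !mulrA.
Qed.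

Let hX k : `|h (v ^+ k)| <= r ^+ k. Proof. by apply: le_trans (h1 _) _; rewrite normcX. Qed.

Lemma part_cvg K : 0 <= K -> r * K < 1 -> cvgn (pseries c K).
Proof.
move=> K0 rK; apply: (@binc_pseries_cvg _ c s 1 r K) => // k.
by rewrite mul1r normrM ger0_norm ?binc_ge0// ler_wpM2l ?binc_ge0.
Qed.

Lemma part_diffs_cvg K : 0 <= K -> r * K < 1 -> cvgn (pseries (pseries_diffs c) K).
Proof.
move=> K0 rK; apply: (@binc_pseries_cvg _ _ (s + 1) (s * r) r K) => //.
- by rewrite ltr_wpDr.
- by rewrite mulr_ge0// ltW.
move=> k; rewrite diffsE normrM ger0_norm; last by rewrite mulr_ge0 ?binc_ge0 ?ltr_wpDr// ltW.
have -> : s * r * (binc (s + 1) k * r ^+ k) = s * binc (s + 1) k * r ^+ k.+1 by rewrite exprS; ring.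
by rewrite ler_wpM2l// mulr_ge0 ?binc_ge0 ?ltr_wpDr// ltW.
Qed.

Lemma part_diffs2_cvg K : 0 <= K -> r * K < 1 ->
  cvgn (pseries (pseries_diffs (pseries_diffs c)) K).
Proof.
move=> K0 rK; apply: (@binc_pseries_cvg _ _ (s + 2) (s * (s + 1) * r ^+ 2) r K) => //.
- by rewrite ltr_wpDr.
- by rewrite !mulr_ge0 ?exprn_ge0 ?addr_ge0// ltW.
have s1 : 0 <= s * (s + 1) by rewrite mulr_ge0 ?addr_ge0// ltW.
move=> k; rewrite diffs2E normrM ger0_norm; last by rewrite mulr_ge0 ?binc_ge0 ?ltr_wpDr.
have -> : s * (s + 1) * r ^+ 2 * (binc (s + 2) k * r ^+ k) =
    s * (s + 1) * binc (s + 2) k * r ^+ k.+2 by rewrite !exprS; ring.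
by rewrite ler_wpM2l// mulr_ge0 ?binc_ge0 ?ltr_wpDr.
Qed.

Definition part_sum t := limn (pseries c t).
Definition part_dsum t := limn (pseries (pseries_diffs c) t).

Lemma part_drv t : 0 <= t <= 1 -> is_derive t (1 : R) part_sum (part_dsum t).
Proof.
move=> /andP[t0 t1]; have [K K1 rK] := exists_radius.
have K0 : 0 <= K by apply: le_trans (ltW K1).
apply: (pseries_snd_diffs (part_cvg K0 rK) (part_diffs_cvg K0 rK) (part_diffs2_cvg K0 rK)).
by rewrite !ger0_norm//; exact: le_lt_trans K1.
Qed.

Lemma part_sum0 : part_sum 0 = h 1.
Proof.
apply: cvg_lim => //; rewrite -(cvg_shiftS) /=.
apply: (@cvg_trans _ (cst (h 1) @ \oo)); last exact: cvg_cst.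
apply: near_eq_cvg; apply: nearW => N; rewrite /pseries /series /= big_nat_recl//= big1.
  by rewrite expr0 mulr1 addr0 /c /series_part binc0// expr0 mul1r.
by move=> i _; rewrite expr0n mulr0.
Qed.

End one_part.

(** The coefficient recurrence, summed. Multiplication by [v] acts on either part as [a h + b h2],
    so that the two cases together express [f' = s v f + t v f'] for [f(t) = (1 - t v)^(-s)]. *)
Lemma part_dsum_rel (h h2 : R[i] -> R) (a b t : R) : (forall z, `|h z| <= normc z) ->
  (forall z, `|h2 z| <= normc z) -> (forall z, h (v * z) = a * h z + b * h2 z) -> 0 <= t <= 1 ->
  part_dsum h t = s * (a * part_sum h t + b * part_sum h2 t) + t * (a * part_dsum h t + b * part_dsum h2 t).
Proof.
move=> h1 h21 hv /andP[t0 t1].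
have rt : r * t < 1 by apply: le_lt_trans v1; rewrite ler_piMr.
pose P c N := \sum_(0 <= k < N) c k * t ^+ k.
have shift (c : nat -> R) N : \sum_(0 <= k < N.+1) k%:R * c k * t ^+ k = t * P (pseries_diffs c) N.
  rewrite big_nat_recl//= mul0r mul0r add0r /P mulr_sumr; apply: eq_bigr => k _.
  by rewrite /pseries_diffs exprS mulrCA !mulrA.
have dE k : pseries_diffs (series_part h) k =
    (s + k%:R) * (a * series_part h k + b * series_part h2 k).
  rewrite /pseries_diffs /series_part exprS hv mulrA bincS//.
  by move: (binc s k) (h _) (h2 _) => x y z; ring.
have key N : P (pseries_diffs (series_part h)) N.+1 =
    s * (a * P (series_part h) N.+1 + b * P (series_part h2) N.+1) +
    t * (a * P (pseries_diffs (series_part h)) N + b * P (pseries_diffs (series_part h2)) N).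
  have -> : t * (a * P (pseries_diffs (series_part h)) N + b * P (pseries_diffs (series_part h2)) N) =
    a * (t * P (pseries_diffs (series_part h)) N) + b * (t * P (pseries_diffs (series_part h2)) N) by ring.
  rewrite -!shift /P !mulr_sumr -big_split /= mulr_sumr -!big_split /=.
  apply: eq_bigr => k _; rewrite dE.
  by move: (series_part h k) (series_part h2 k) (t ^+ k) => x y z; ring.
have C1 : P (series_part h) N.+1 @[N --> \oo] --> part_sum h t.
  by rewrite (cvg_shiftS (P (series_part h))); exact: (part_cvg h1 t0 rt).
have C2 : P (series_part h2) N.+1 @[N --> \oo] --> part_sum h2 t.
  by rewrite (cvg_shiftS (P (series_part h2))); exact: (part_cvg h21 t0 rt).
have C3 : P (pseries_diffs (series_part h)) N @[N --> \oo] --> part_dsum h t.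
  exact: (part_diffs_cvg h1 t0 rt).
have C4 : P (pseries_diffs (series_part h2)) N @[N --> \oo] --> part_dsum h2 t.
  exact: (part_diffs_cvg h21 t0 rt).
have C5 : P (pseries_diffs (series_part h)) N.+1 @[N --> \oo] --> part_dsum h t.
  by rewrite (cvg_shiftS (P (pseries_diffs (series_part h)))).
have C6 : P (pseries_diffs (series_part h)) N.+1 @[N --> \oo] -->
    s * (a * part_sum h t + b * part_sum h2 t) + t * (a * part_dsum h t + b * part_dsum h2 t).
  rewrite (_ : (fun N => _) = fun N => s * (a * P (series_part h) N.+1 + b * P (series_part h2) N.+1) +
    t * (a * P (pseries_diffs (series_part h)) N + b * P (pseries_diffs (series_part h2)) N)); last first.
    by apply/funext => N; exact: key.
  by apply: cvgD; apply: cvgMl_tmp; apply: cvgD; exact: cvgMl_tmp.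
exact: (cvg_unique _ C5 C6).
Qed.

Definition binser t : R[i] := part_sum (@complex.Re R) t +i* part_sum (@complex.Im R) t.
Definition dbinser t : R[i] := part_dsum (@complex.Re R) t +i* part_dsum (@complex.Im R) t.

Lemma binser_drv t : 0 <= t <= 1 -> cdrv binser t (dbinser t).
Proof. by move=> t01; split; apply: part_drv => //; [exact: normc_Re|exact: normc_Im]. Qed.

Lemma dbinserE t : 0 <= t <= 1 -> dbinser t * (1 - t%:C * v) = s%:C * v * binser t.
Proof.
move=> t01.
have E1 := @part_dsum_rel (@complex.Re R) (@complex.Im R) (complex.Re v) (- complex.Im v) t
  (@normc_Re R) (@normc_Im R) _ t01.
have E2 := @part_dsum_rel (@complex.Im R) (@complex.Re R) (complex.Re v) (complex.Im v) t
  (@normc_Im R) (@normc_Re R) _ t01.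
have H1 z : complex.Re (v * z) = complex.Re v * complex.Re z + - complex.Im v * complex.Im z.
  by rewrite ReM; ring.
have H2 z : complex.Im (v * z) = complex.Re v * complex.Im z + complex.Im v * complex.Re z.
  by rewrite ImM; ring.
move: {E1 E2} (E1 H1) (E2 H2) => E1 E2.
apply/eqP; rewrite eq_complex !ReM !ImM !ReB !ImB !ReM !ImM /=.
apply/andP; split; apply/eqP; clear -E1 E2; lra.
Qed.

Lemma binser0 : binser 0 = 1.
Proof. by rewrite /binser !part_sum0. Qed.

Lemma re_gt0 t : 0 <= t <= 1 -> 0 < complex.Re (1 - t%:C * v).
Proof.
move=> /andP[t0 t1]; rewrite ReB ReM /= mul0r subr0 subr_gt0.
apply: le_lt_trans (ler_norm _) _; rewrite normrM ger0_norm//.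
apply: le_lt_trans v1; apply: le_trans (ler_wpM2l t0 (normc_Re v)) _.
by rewrite ler_piMl ?normc_ge0.
Qed.

Let a := complex.Re v.
Let b := complex.Im v.
Let X t := 1 - t * a.
Let Y t := - (t * b).
Let rho t := X t ^+ 2 + Y t ^+ 2.

Let uE t : 1 - t%:C * v = X t +i* Y t.
Proof. by apply/eqP; rewrite eq_complex ReB ImB ReM ImM /= /X /Y !mul0r subr0 addr0 sub0r !eqxx. Qed.

Let X_gt0 t : 0 <= t <= 1 -> 0 < X t.
Proof. by move=> /re_gt0; rewrite uE. Qed.

Let rho_gt0 t : 0 <= t <= 1 -> 0 < rho t.
Proof. by move=> /X_gt0 x0; rewrite /rho ltr_pwDl ?sqr_ge0// exprn_gt0. Qed.

(* The principal value of [(1 - t v)^s], whose product with the binomial series has zero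
   derivative in [t]. *)
Definition invpow t : R[i] := (expR (s * (ln (rho t) / 2)))%:C * cis (s * atan (Y t / X t)).

Lemma invpow_drv t : 0 <= t <= 1 ->
  cdrv invpow t (invpow t * (s%:C * (- v / (1 - t%:C * v)))).
Proof.
move=> t01; have x0 := X_gt0 t01; have p0 := rho_gt0 t01.
have DX : is_derive t (1 : R) X (- a).
  by apply: drv_eq (drvB (drv_cst 1 t) (drvM (drv_id t) (drv_cst a t))) _; ring.
have DY : is_derive t (1 : R) Y (- b).
  by apply: drv_eq (drvN (drvM (drv_id t) (drv_cst b t))) _; ring.
have Drho : is_derive t (1 : R) rho (- (2 * (a * X t + b * Y t))).
  by apply: drv_eq (drvD (drvX 2 DX) (drvX 2 DY)) _; rewrite /= !expr1; ring.
have xn0 : X t != 0 by rewrite gt_eqF.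
have pn0 : rho t != 0 by rewrite gt_eqF.
have DL : is_derive t (1 : R) (fun t => s * (ln (rho t) / 2)) (s * - ((a * X t + b * Y t) / rho t)).
  apply: drv_eq (drvZ s (drvM (drv_comp (f := @ln R) Drho (is_derive1_ln p0)) (drv_cst 2^-1 t))) _.
  by move: (rho t) pn0 (ln _) => p pn l; field.
have DXi : is_derive t (1 : R) (fun t => (X t)^-1) (a / X t ^+ 2).
  apply: drv_eq (@is_deriveV R X t (- a) 1 xn0 DX) _.
  by rewrite /GRing.scale /=; move: (X t) xn0 => x xn; field.
have DA : is_derive t (1 : R) (fun t => s * atan (Y t / X t)) (s * ((a * Y t - b * X t) / rho t)).
  apply: drv_eq (drvZ s (drv_comp (f := @atan R) (drvM DY DXi) (is_derive1_atan _))) _.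
  move: pn0; rewrite /rho; move: (X t) (Y t) xn0 => x y xn pn; field.
  by rewrite pn xn.
have w : s%:C * (- v / (1 - t%:C * v)) =
    (s * - ((a * X t + b * Y t) / rho t)) +i* (s * ((a * Y t - b * X t) / rho t)).
  have un0 : 1 - t%:C * v != 0.
    by rewrite uE eq_complex /= negb_and xn0.
  apply: (mulIf un0); rewrite -!mulrA mulVf// mulr1.
  rewrite uE /rho; apply/eqP; rewrite eq_complex !ReM !ImM /= /a /b.
  move: pn0; rewrite /rho; case: (v) => p q /=; move: (X t) (Y t) => x y pn.
  by apply/andP; split; apply/eqP; field.
have DE := drv_expR DL.
have DC := drv_comp (f := @cos R) DA (is_derive_cos _).
have DS := drv_comp (f := @sin R) DA (is_derive_sin _).
rewrite w; split.
- rewrite (_ : (fun x => _) = fun t => expR (s * (ln (rho t) / 2)) * cos (s * atan (Y t / X t))).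
    by apply: drv_eq (drvM DE DC) _; rewrite /invpow !ReM !ImM /=; ring.
  by apply/funext => y; rewrite /invpow ReM /= mul0r subr0.
- rewrite (_ : (fun x => _) = fun t => expR (s * (ln (rho t) / 2)) * sin (s * atan (Y t / X t))).
    by apply: drv_eq (drvM DE DS) _; rewrite /invpow !ImM !ReM /=; ring.
  by apply/funext => y; rewrite /invpow ImM /= mul0r addr0.
Qed.

Lemma binser_invpow : binser 1 * invpow 1 = 1.
Proof.
have I0 : invpow 0 = 1.
  rewrite /invpow /rho /X /Y !mul0r subr0 oppr0 expr1n expr0n addr0 ln1 !mul0r atan0 !mulr0 expR0 cis0.
  by rewrite mulr1.
rewrite (@cdrv0_cst (fun t => binser t * invpow t)) ?binser0 ?I0 ?mulr1// => t t01.
have := cdrvM (binser_drv t01) (invpow_drv t01).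
have un0 : 1 - t%:C * v != 0 by rewrite uE eq_complex /= negb_and gt_eqF ?X_gt0.
have -> : dbinser t = s%:C * v * binser t / (1 - t%:C * v).
  by rewrite -(dbinserE t01) mulfK.
rewrite (_ : _ + _ = 0)//; move: (invpow t) (binser t) (s%:C) (v) (_^-1) => p q c w k.
by ring.
Qed.

Lemma binser_powR : binser 1 = complex_powR (1 - v) (- s).
Proof.
have t01 : 0 <= (1 : R) <= 1 by rewrite ler01 lexx.
have x0 : 0 < complex.Re (1 - v) by have := re_gt0 t01; rewrite mul1r.
have E : complex_powR (1 - v) (- s) * invpow 1 = 1.
  rewrite /complex_powR complex_argE// /invpow.
  have u1 : 1 - v = X 1 +i* Y 1 by rewrite -uE mul1r.
  have n0 : 0 < normc (1 - v) by rewrite normc_gt0; apply/eqP => e; move: x0; rewrite e ltxx.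
  have -> : rho 1 = normc (1 - v) ^+ 2 by rewrite normc2E u1.
  have -> : expR (s * (ln (normc (1 - v) ^+ 2) / 2)) = normc (1 - v) `^ s.
    by rewrite lnXn// /powR gt_eqF//; congr expR; rewrite mulr2n; field.
  have -> : complex.Im (1 - v) / complex.Re (1 - v) = Y 1 / X 1 by rewrite u1.
  rewrite powRN -/(cis _); move: (atan _) => th.
  rewrite mulrACA -real_complexM mulVf ?gt_eqF ?powR_gt0// mul1r.
  by rewrite -cisD mulNr addNr cis0.
have En0 : invpow 1 != 0 by apply/eqP => e; move: E; rewrite e mulr0 => /esym/eqP; rewrite oner_eq0.
by apply: (mulIf En0); rewrite binser_invpow E.
Qed.

Lemma binser_cvg (e : R) : 0 < e -> exists N0, forall N, (N0 <= N)%N ->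
  normc (complex_powR (1 - v) (- s) - \sum_(k < N) (binc s k)%:C * v ^+ k) <= e.
Proof.
move=> e0; have e20 : 0 < e / 2 by rewrite divr_gt0.
have r1 : r * 1 < 1 by rewrite mulr1.
have /cvgrPdist_le/(_ _ e20)[N1 _ H1] := part_cvg (@normc_Re R) ler01 r1.
have /cvgrPdist_le/(_ _ e20)[N2 _ H2] := part_cvg (@normc_Im R) ler01 r1.
exists (maxn N1 N2) => N; rewrite geq_max => /andP[/H1 h1 /H2 h2].
rewrite -binser_powR; apply: le_trans (normc_le_ReIm _) _.
rewrite ReB ImB Re_sum Im_sum (splitr e); apply: lerD.
- apply: le_trans h1; rewrite le_eqVlt; apply/orP; left; apply/eqP; congr `|_ - _|.
  rewrite /pseries /series /= big_mkord; apply: eq_bigr => k _.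
  by rewrite ReM /= mul0r subr0 expr1n mulr1.
- apply: le_trans h2; rewrite le_eqVlt; apply/orP; left; apply/eqP; congr `|_ - _|.
  rewrite /pseries /series /= big_mkord; apply: eq_bigr => k _.
  by rewrite ImM /= mul0r addr0 expr1n mulr1.
Qed.

End binomial_series.

Lemma conj_real {R : realType} (r : R) : (r%:C)^* = r%:C :> R[i].
Proof. by apply/eqP; rewrite eq_complex /= oppr0 !eqxx. Qed.
Lemma real_complex_sum {R : realType} (I : Type) (s : seq I) (P : pred I) (F : I -> R) :
  (\sum_(i <- s | P i) F i)%:C = \sum_(i <- s | P i) (F i)%:C :> R[i].
Proof. exact: (rmorph_sum (real_complex R)). Qed.
Lemma real_complex_prod {R : realType} (I : Type) (s : seq I) (P : pred I) (F : I -> R) :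
  (\prod_(i <- s | P i) F i)%:C = \prod_(i <- s | P i) (F i)%:C :> R[i].
Proof. exact: (rmorph_prod (real_complex R)). Qed.

Section kernel_expansion.
Context {R : realType} {n : nat} (alpha : R) (alpha_gtN1 : -1 < alpha).
Local Notation s := (n%:R + alpha + 1).
Local Notation e_ := (@monomial R n alpha).
Implicit Types (z w : 'rV[R[i]]_n) (m : {ffun 'I_n -> nat}).

Lemma exponent_gt0 : 0 < s.
Proof. by rewrite -addrA ltr_wpDl//; move: alpha_gtN1; lra. Qed.

(** The squared normalization is a multinomial coefficient times [binc]; hence the terms of degree
    [k] of the kernel add up to [binc s k] times the k-th power of the scalar product. *)
Lemma monomial_coef2 m : (Num.sqrt (Gamma (n%:R + (mdeg m)%:R + alpha + 1) /
    ((mfact m)%:R * Gamma s))) ^+ 2 = binc s (mdeg m) * (mdeg m)`!%:R / (mfact m)%:R.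
Proof.
have s0 := exponent_gt0.
have -> : n%:R + (mdeg m)%:R + alpha + 1 = s + (mdeg m)%:R by ring.
have sk : 0 < s + (mdeg m)%:R by rewrite ltr_wpDr.
have gm : (mfact m)%:R != 0 :> R by rewrite pnatr_eq0 -lt0n prodn_gt0// => j; rewrite fact_gt0.
have gd : (mdeg m)`!%:R != 0 :> R by rewrite pnatr_eq0 -lt0n fact_gt0.
rewrite sqr_sqrtr; last by rewrite divr_ge0 ?mulr_ge0// Gamma_ge0.
rewrite /binc; move: (Gamma_gt0 s0) => /lt0r_neq0.
by move: (Gamma s) (Gamma _) (mfact m)%:R (mdeg m)`!%:R gm gd => a b c d c0 d0 a0; field; rewrite a0 c0 d0.
Qed.

Lemma sum_monomial_kernel N z w : \sum_(m <- degree_lt N) e_ m z * (e_ m w)^* =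
  \sum_(k < N) (binc s k)%:C * dotc z w ^+ k.
Proof.
transitivity (\sum_(m <- @degree_lt n N) (binc s (mdeg m) * (mdeg m)`!%:R)%:C *
    \prod_(j < n) ((z 0 j * (w 0 j)^*) ^+ m j / (m j)`!%:R)).
  apply: eq_bigr => m _; rewrite /monomial conjcM mulrACA mulcJ normc_real.
  rewrite ger0_norm ?sqrtr_ge0// monomial_coef2.
  have -> : (binc s (mdeg m) * (mdeg m)`!%:R / (mfact m)%:R)%:C =
      (binc s (mdeg m) * (mdeg m)`!%:R)%:C * (\prod_(j < n) (m j)`!%:R)^-1 :> R[i].
    by rewrite real_complexM real_complexV real_complex_nat /mfact natr_prod.
  rewrite -mulrA; congr (_ * _); rewrite conjc_prod -prodfV -!big_split /=.
  by apply: eq_bigr => j _; rewrite conjcX exprMn mulrC.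
rewrite (sum_degree_multinomial N (fun k => (binc s k * k`!%:R)%:C) (fun j => z 0 j * (w 0 j)^*)).
apply: eq_bigr => k _; rewrite real_complexM real_complex_nat -mulrA; congr (_ * _).
by rewrite mulrCA mulfV ?mulr1// fact_neq0.
Qed.

Definition absdot z w : R := \sum_(j < n) normc (z 0 j) * normc (w 0 j).

Lemma normc_dotc z w : normc (dotc z w) <= absdot z w.
Proof.
apply: le_trans (normc_sum _ _ _) _; apply: ler_sum => j _.
by rewrite normcM normcJ.
Qed.

Lemma absdot_ge0 z w : 0 <= absdot z w.
Proof. by apply: sumr_ge0 => j _; rewrite mulr_ge0 ?normc_ge0. Qed.

(** Cauchy-Schwarz with [|w| < 1], from the inequality [2 a b <= a^2 / x + x b^2] with [x = |z|];
    the case [z = 0] is apart. *)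
Lemma absdot_le z w : ball1 w -> absdot z w <= Num.sqrt (norm2 z).
Proof.
rewrite /ball1 /= => w1; set x := Num.sqrt _; have x0 : 0 <= x := sqrtr_ge0 _.
have x2 : x ^+ 2 = norm2 z by rewrite sqr_sqrtr ?norm2_ge0.
have [xz|xn] := eqVneq x 0.
  rewrite xz /absdot big1// => j _; suff -> : normc (z 0 j) = 0 by rewrite mul0r.
  apply/eqP; rewrite -sqrf_eq0 eq_le sqr_ge0 andbT.
  have : norm2 z <= 0 by rewrite -x2 xz expr0n.
  by apply: le_trans; rewrite /norm2 (bigD1 j)//= lerDl sumr_ge0// => i _; rewrite sqr_ge0.
have xp : 0 < x by rewrite lt0r xn.
apply: (@le_trans _ _ (\sum_(j < n) (x^-1 / 2 * normc (z 0 j) ^+ 2 + x / 2 * normc (w 0 j) ^+ 2))).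
  apply: ler_sum => j _; move: (normc (z 0 j)) (normc (w 0 j)) => a b.
  rewrite -subr_ge0 (_ : _ - _ = (a - x * b) ^+ 2 / (2 * x)); last by field.
  by rewrite divr_ge0 ?sqr_ge0 ?mulr_ge0.
rewrite big_split /= -!mulr_sumr -/(norm2 z) -/(norm2 w) -x2.
have -> : x^-1 / 2 * x ^+ 2 = x / 2 by field.
have : x / 2 * norm2 w <= x / 2 * 1 by rewrite ler_wpM2l ?divr_ge0// ltW.
by move: (_ * norm2 w) => q; lra.
Qed.

Lemma sqrt_norm2_lt1 z : ball1 z -> 0 <= Num.sqrt (norm2 z) < 1.
Proof.
by rewrite /ball1 /= => z1; rewrite sqrtr_ge0 /= -sqrtr1 ltr_sqrt.
Qed.

Lemma normc_monomial m z : (normc (e_ m z))%:C = e_ m (modulus z).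
Proof.
rewrite /monomial normcM normc_real ger0_norm ?sqrtr_ge0// real_complexM; congr (_ * _).
rewrite normc_prod real_complex_prod.
by apply: eq_bigr => j _; rewrite normcX real_complexX mxE.
Qed.

(** The kernel expansion at the points of moduli, where all terms are nonnegative. *)
Lemma sum_normc_monomial N z w :
  \sum_(m <- degree_lt N) normc (e_ m z) * normc (e_ m w) = \sum_(k < N) binc s k * absdot z w ^+ k.
Proof.
apply: complexI; rewrite !real_complex_sum.
transitivity (\sum_(m <- @degree_lt n N) e_ m (modulus z) * (e_ m (modulus w))^*).
  apply: eq_bigr => m _; rewrite -!normc_monomial real_complexM; congr (_ * _).
  by rewrite conj_real.
rewrite sum_monomial_kernel; apply: eq_bigr => k _; rewrite real_complexM real_complexX.
congr (_ * _ ^+ _); rewrite /dotc /absdot real_complex_sum.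
by apply: eq_bigr => j _; rewrite !mxE real_complexM conj_real.
Qed.

Lemma fset_degree_lt (F : {fset {ffun 'I_n -> nat}}) : exists N0, forall N, (N0 <= N)%N ->
  (F `<=` @degree_lt n N)%fset.
Proof.
exists (\max_(m <- F) (mdeg m).+1)%N => N NF; apply/fsubsetP => m mF.
rewrite mem_degree_lt; apply: leq_trans NF.
by rewrite (big_rem m)//= leq_maxl.
Qed.

Lemma sum_fset_le (x : {ffun 'I_n -> nat} -> R) (F G : {fset {ffun 'I_n -> nat}}) :
  (forall m, 0 <= x m) -> (F `<=` G)%fset -> \sum_(m <- F) x m <= \sum_(m <- G) x m.
Proof.
by move=> x0 FG; rewrite (sum_fset_split x FG) lerDl sumr_ge0.
Qed.

Lemma monomial_sum_bounded z w : ball1 z -> ball1 w -> exists C : R, forall F : {fset _},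
  \sum_(m <- F) normc (e_ m z) * normc (e_ m w) <= C.
Proof.
move=> z1 w1.
have d1 : 0 <= absdot z w < 1.
  rewrite absdot_ge0 /=; apply: le_lt_trans (absdot_le z w1) _.
  by case/andP: (sqrt_norm2_lt1 z1).
have [C HC] := binc_sum_bounded exponent_gt0 d1; exists C => F.
have [N /(_ _ (leqnn _)) FN] := fset_degree_lt F.
apply: le_trans (HC N); rewrite -sum_normc_monomial; apply: sum_fset_le => // m.
by rewrite mulr_ge0 ?normc_ge0.
Qed.

Lemma monomial_square_sum z : ball1 z -> exists2 C : R, 0 <= C & forall F : {fset _},
  \sum_(m <- F) normc (e_ m z) ^+ 2 <= C.
Proof.
move=> z1; have [C HC] := monomial_sum_bounded z1 z1; exists C => //.
by apply: le_trans (HC fset0); rewrite big_seq_fset0.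
Qed.

(** Since [|<z, w>| <= |z| < 1] for every [w] in the ball, all tails are dominated by that of the
    binomial series at [|z|]. *)
Lemma kernel_uniform z (e : R) : ball1 z -> 0 < e -> exists N0, forall N w, (N0 <= N)%N -> ball1 w ->
  normc (complex_powR (1 - dotc z w) (- s) - \sum_(m <- degree_lt N) e_ m z * (e_ m w)^*) <= e.
Proof.
move=> z1 e0; have s0 := exponent_gt0; have x01 := sqrt_norm2_lt1 z1.
set x := Num.sqrt (norm2 z) in x01; have /andP[x0 x1] := x01.
have e20 : 0 < e / 2 by rewrite divr_gt0.
have cv := binc_series_cvg s0 x01.
have /cvgrPdist_le/(_ _ e20)[N0 _ H0] := cv.
exists N0 => N w N0N w1; rewrite sum_monomial_kernel; set v := dotc z w.
have vx : normc v <= x := le_trans (normc_dotc z w) (absdot_le z w1).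
have v1 : normc v < 1 by apply: le_lt_trans x1.
have [N1 H1] := binser_cvg s0 v1 e20.
pose M := maxn N N1.
apply: le_trans (normc_tri _ (\sum_(k < M) (binc s k)%:C * v ^+ k) _) _.
rewrite (splitr e); apply: lerD; first by apply: H1; rewrite leq_maxr.
have NM : (N <= M)%N by rewrite leq_maxl.
rewrite -(big_mkord xpredT (fun k => (binc s k)%:C * v ^+ k)) -(big_mkord xpredT (fun k => (binc s k)%:C * v ^+ k)).
rewrite (big_cat_nat _ NM)//= addrAC subrr add0r.
apply: le_trans (normc_sum _ _ _) _.
apply: (@le_trans _ _ (\sum_(N <= k < M) binc s k * x ^+ k)).
  apply: ler_sum => k _; rewrite normcM normc_real ger0_norm ?binc_ge0//.
  by rewrite ler_wpM2l ?binc_ge0// normcX lerXn2r ?nnegrE ?normc_ge0.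
have SE : \sum_(N <= k < M) binc s k * x ^+ k =
    series (fun k => binc s k * x ^+ k) M - series (fun k => binc s k * x ^+ k) N.
  by rewrite sub_series_geq.
rewrite SE.
have up : series (fun k => binc s k * x ^+ k) M <= limn (series (fun k => binc s k * x ^+ k)).
  apply: nondecreasing_cvgn_le => //; apply: nondecreasing_series => k _ _.
  by rewrite mulr_ge0 ?exprn_ge0// binc_ge0.
have := H0 N N0N; move: up; move: (series _ M) (series _ N) (limn _) => p q l pl.
by move/(le_trans (ler_norm _)); lra.
Qed.

End kernel_expansion.

(** * Orthonormal expansions in the Bergman space *)

Section weighted_L2.
Context {R : realType} {n : nat} (alpha : R) (alpha_gtN1 : -1 < alpha).
Local Notation CC := (measurableTypeR R * measurableTypeR R)%type.
Local Notation lebC := (@lebesgue_C R n).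
Local Notation B := (@ball_coords R n).
Local Notation dv := (dv alpha).
Local Notation mB := (@measurable_ball_coords R n).
Local Notation e_ := (@monomial R n alpha).
Local Notation ip := (@ip_alpha R n alpha).
Local Notation L2 := (@L2_alpha R n alpha).
Implicit Types (z : 'rV[R[i]]_n) (t : n.-tuple CC) (f g h : 'rV[R[i]]_n -> R[i]^o)
  (m : {ffun 'I_n -> nat}) (c : R[i]) (F : {fset {ffun 'I_n -> nat}}).

Definition ip_fun f g t : R[i] := f (of_coords t) * (g (of_coords t))^* * (dv t)%:C.

Definition sq_fun f t : R := normc (f (of_coords t)) ^+ 2 * dv t.

Definition nsq f : R := \int[lebC]_(t in B) sq_fun f t.

Lemma sq_fun_ge0 f t : 0 <= sq_fun f t.
Proof. by rewrite mulr_ge0 ?sqr_ge0 ?dv_ge0. Qed.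

Lemma measurable_sq_fun f : ball_measurable f -> measurable_fun B (sq_fun f).
Proof.
move=> mf; apply: measurable_funM; first exact: measurable_normc2.
exact: measurable_funTS (measurable_dv alpha).
Qed.

Lemma L2_integrable f : L2 f -> lebC.-integrable B (EFin \o sq_fun f).
Proof.
move=> [mf foo]; apply/integrableP; split.
  by apply/measurable_EFinP; exact: measurable_sq_fun.
by under eq_integral do rewrite /= ger0_norm ?sq_fun_ge0//.
Qed.

Lemma nsqE f : L2 f -> (\int[lebC]_(t in B) (sq_fun f t)%:E = (nsq f)%:E)%E.
Proof.
by move=> fL; rewrite /nsq /Rintegral fineK//; exact: (integrable_fin_num mB (L2_integrable fL)).
Qed.

Lemma nsq_ge0 f : 0 <= nsq f.
Proof. by apply: Rintegral_ge0 => t _; exact: sq_fun_ge0. Qed.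

Lemma ip_L1 f g : L2 f -> L2 g -> cL1 lebC B (ip_fun f g).
Proof.
move=> fL gL; apply: (@cL1_le _ _ _ _ _ mB _ (fun t => sq_fun f t + sq_fun g t)).
- apply: cmeasM; first by apply: cmeasM; [exact: fL.1|apply: cmeasJ; exact: gL.1].
  by apply: cmeas_real; exact: measurable_funTS (measurable_dv alpha).
- by have := integrableD mB (L2_integrable fL) (L2_integrable gL).
- move=> t _; rewrite /ip_fun /sq_fun normcM normc_real ger0_norm ?dv_ge0// -mulrDl.
  by apply: ler_wpM2r; [exact: dv_ge0|exact: normcM_le].
Qed.

Lemma ip_alphaE f g : ip f g = complex_integral lebC B (ip_fun f g).
Proof. by []. Qed.

Lemma ip_lin c f g h : L2 f -> L2 g -> L2 h ->
  ip (fun z => c * f z + g z) h = c * ip f h + ip g h.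
Proof.
move=> fL gL hL; rewrite !ip_alphaE -(cintZ mB _ (ip_L1 fL hL)) -cintD; last 3 first.
- exact: mB.
- exact: (cL1Z mB c (ip_L1 fL hL)).
- exact: ip_L1.
apply: eq_cint => t _; rewrite /ip_fun.
have alg (a b d e x : R[i]) : (a * b + d) * e * x = a * (b * e * x) + d * e * x by ring.
exact: alg.
Qed.

Lemma ip_conj f g : L2 f -> L2 g -> ip g f = (ip f g)^*.
Proof.
move=> fL gL; rewrite !ip_alphaE -(cintJ mB (ip_L1 fL gL)); apply: eq_cint => t _.
rewrite /ip_fun !conjcM conjCK conj_real (mulrC _ (g _)).
by [].
Qed.

Lemma ip_xx f : ip f f = (nsq f)%:C.
Proof.
rewrite ip_alphaE /nsq -(cint_real _ mB); apply: eq_cint => t _.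
by rewrite /sq_fun [RHS]real_complexM -mulcJ.
Qed.

Lemma L2_0 : L2 (fun=> 0).
Proof.
split; first exact: cmeas_cst.
by rewrite integral0_eq ?ltry// => t _; rewrite normc0 expr0n mul0r.
Qed.

Lemma L2_lin c f g : L2 f -> L2 g -> L2 (fun z => c * f z + g z).
Proof. exact: L2_alpha_lin. Qed.

Lemma L2_sum (I : Type) (s : seq I) (a : I -> R[i]) (F : I -> 'rV[R[i]]_n -> R[i]^o) :
  (forall i, L2 (F i)) -> L2 (fun z => \sum_(i <- s) a i * F i z).
Proof.
move=> FL; elim: s => [|i s ih].
  have -> : (fun z => \sum_(i <- [::]) a i * F i z) = (fun=> 0) by apply/funext => z; rewrite big_nil.
  exact: L2_0.
rewrite (_ : (fun z => _) = fun z => a i * F i z + \sum_(i <- s) a i * F i z); first exact: L2_lin.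
by apply/funext => z; rewrite big_cons.
Qed.

Lemma ip0l h : ip (fun=> 0) h = 0.
Proof.
rewrite ip_alphaE -[RHS](cint0 lebC mB); apply: eq_cint => t _.
by rewrite /ip_fun mul0r; exact: mul0r.
Qed.

Lemma ip_suml (I : Type) (s : seq I) (a : I -> R[i]) (F : I -> 'rV[R[i]]_n -> R[i]^o) h :
  (forall i, L2 (F i)) -> L2 h ->
  ip (fun z => \sum_(i <- s) a i * F i z) h = \sum_(i <- s) a i * ip (F i) h.
Proof.
move=> FL hL; elim: s => [|i s ih].
  have -> : (fun z => \sum_(i <- [::]) a i * F i z) = (fun=> 0) by apply/funext => z; rewrite big_nil.
  by rewrite ip0l big_nil.
rewrite (_ : (fun z => _) = fun z => a i * F i z + \sum_(i <- s) a i * F i z); last first.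
  by apply/funext => z; rewrite big_cons.
by rewrite ip_lin//; [rewrite ih big_cons|exact: L2_sum].
Qed.

Lemma ip_sumr (I : Type) (s : seq I) (a : I -> R[i]) (F : I -> 'rV[R[i]]_n -> R[i]^o) h :
  (forall i, L2 (F i)) -> L2 h ->
  ip h (fun z => \sum_(i <- s) a i * F i z) = \sum_(i <- s) (a i)^* * ip h (F i).
Proof.
move=> FL hL; rewrite (ip_conj (L2_sum s a FL) hL) ip_suml// conjc_sum.
by apply: eq_bigr => i _; rewrite conjcM -(ip_conj (FL i) hL).
Qed.

Lemma monomialE m z : e_ m z = (Num.sqrt (Gamma (n%:R + (mdeg m)%:R + alpha + 1) /
    ((mfact m)%:R * Gamma (n%:R + alpha + 1))))%:C * (cmon m z)^*.
Proof.
rewrite /monomial /cmon conjc_prod; congr (_ * _); apply: eq_bigr => j _.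
by rewrite conjcX conjCK.
Qed.

Lemma monomial_measurable m : ball_measurable (e_ m).
Proof.
rewrite /ball_measurable (_ : _ \o _ = fun t => e_ m (of_coords t))//.
under eq_fun do rewrite monomialE.
by apply: cmeasM; [exact: cmeas_cst|apply: cmeasJ; exact: cmeas_cmon].
Qed.

Lemma monomial_scale1 m j u z : e_ m (scale1 j u z) = u ^+ m j * e_ m z.
Proof.
rewrite !monomialE -[u in scale1 j u z](conjCK u) cmon_scale1 conjcM conjcX conjCK.
by rewrite mulrCA.
Qed.

Lemma monomial_bounded m : exists M : R, forall z, ball1 z -> normc (e_ m z) <= M.
Proof.
eexists => z z1; rewrite monomialE normcM normcJ; apply: ler_wpM2l (normc_cmon m z1).
exact: normc_ge0.
Qed.

Lemma integral_sq_monomial m : (\int[lebC]_(t in B) (sq_fun (e_ m) t)%:E = 1)%E.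
Proof.
have s0 := exponent_gt0 (n := n) alpha_gtN1.
transitivity (((binc (n%:R + alpha + 1) (mdeg m) * (mdeg m)`!%:R / (mfact m)%:R)%:E *
    \int[lebC]_(t in B) (\prod_(j < n) normc (of_coords t 0 j) ^+ (2 * m j) * dv t)%:E)%E).
  rewrite -ge0_integralZl//; last 4 first.
  - exact: mB.
  - apply/measurable_EFinP; apply: measurable_funM; last exact: measurable_funTS (measurable_dv alpha).
    apply: measurable_prod => j _; apply: measurable_funX; apply: measurable_normc.
    split; apply: measurable_funTS; under eq_fun do rewrite mxE /=.
      exact: measurableT_comp measurable_fst (measurable_tnth j).
    exact: measurableT_comp measurable_snd (measurable_tnth j).
  - by move=> t _; rewrite lee_fin mulr_ge0 ?dv_ge0// prodr_ge0// => j _; rewrite exprn_ge0 ?normc_ge0.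
  - by rewrite lee_fin divr_ge0// mulr_ge0// binc_ge0.
  apply: eq_integral => t _; rewrite -EFinM mulrA; congr (_ * _)%:E.
  rewrite /monomial normcM exprMn normc_real ger0_norm ?sqrtr_ge0// (monomial_coef2 alpha_gtN1).
  congr (_ * _); rewrite normc_prod -prodrXl; apply: eq_bigr => j _.
  by rewrite normcX -exprM mulnC.
rewrite (ge0_integral_moment alpha_gtN1) -EFinM; congr EFin.
rewrite /moment /binc -/(mdeg m).
have -> : \prod_(j < n) (m j)`!%:R = (mfact m)%:R :> R by rewrite /mfact natr_prod.
have -> : n%:R + (mdeg m)%:R + alpha + 1 = n%:R + alpha + 1 + (mdeg m)%:R by ring.
have g0 := lt0r_neq0 (Gamma_gt0 s0).
have g1 : Gamma (n%:R + alpha + 1 + (mdeg m)%:R) != 0.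
  by rewrite gt_eqF// Gamma_gt0// ltr_wpDr.
have gm : (mfact m)%:R != 0 :> R by rewrite pnatr_eq0 -lt0n prodn_gt0// => j; rewrite fact_gt0.
have gd : (mdeg m)`!%:R != 0 :> R by rewrite pnatr_eq0 -lt0n fact_gt0.
move: (Gamma _) (Gamma _) (mfact m)%:R (mdeg m)`!%:R g0 g1 gm gd => a b c d a0 b0 c0 d0.
by field; rewrite a0 b0 c0 d0.
Qed.

Lemma monomial_L2 m : L2 (e_ m).
Proof. by split; [exact: monomial_measurable|rewrite integral_sq_monomial ltry]. Qed.

Lemma ip_monomial_same m : ip (e_ m) (e_ m) = 1.
Proof. by rewrite ip_xx /nsq /Rintegral integral_sq_monomial. Qed.

(** For [p != q] some unit [u] has [u^(p-q) = -1], and rotating by it shows that the integral equals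
    its opposite. *)
Lemma cint_rotation0 (F : n.-tuple CC -> R[i]) j p q : cL1 lebC B F -> p != q ->
  (forall u t, normc u = 1 -> B t -> F (trot j u t) = u ^+ p * u^* ^+ q * F t) ->
  complex_integral lebC B F = 0.
Proof.
move=> FL pq HF.
have [u u1 uN] : exists2 u : R[i], normc u = 1 & u ^+ p * u^* ^+ q = -1.
  have cisX x k : (cis x : R[i]) ^+ k = cis (x *+ k).
    by elim: k => [|k ih]; rewrite ?expr0 ?mulr0n ?cis0// exprS ih -cisD mulrS.
  have cispi : cis pi = -1 :> R[i] by rewrite /cis cospi sinpi; apply/eqP; rewrite eq_complex /= oppr0 !eqxx.
  wlog qp : p q {HF} pq / (q < p)%N.
    move=> H; move: pq; rewrite neq_ltn => /orP[pq|qp]; last by apply: H => //; rewrite gtn_eqF.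
    have [|u u1 uE] := H q p _ pq; first by rewrite gtn_eqF.
    by exists u^*; rewrite ?normcJ// conjCK mulrC.
  pose x : R := pi / (p - q)%:R; exists (cis x); first exact: normc_cis.
  have -> : cis x ^+ p = cis x ^+ (p - q) * cis x ^+ q by rewrite -exprD subnK// ltnW.
  rewrite -mulrA -exprMn unit_conjV ?normc_cis// expr1n mulr1 cisX -cispi; congr cis.
  by rewrite -(mulr_natr x) /x divfK// pnatr_eq0 subn_eq0 -ltnNge.
have E : complex_integral lebC B F = - complex_integral lebC B F.
  rewrite -[LHS](cint_preserving (phi := trot j u) mB).
  - rewrite -(cintN mB FL); apply: eq_cint => t /set_mem Bt.
    by rewrite /= HF// uN mulN1r.
  - by move=> t; exact: trot_ball.
  - by move=> G mG G0; exact: ge0_integral_trot.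
  - exact: FL.1.
by apply/eqP; rewrite -eqNr -E.
Qed.

Definition torus_invariant (b : 'rV[R[i]]_n -> R[i]) :=
  forall j u z, normc u = 1 -> ball1 z -> b (scale1 j u z) = b z.

(** A rotation in a coordinate where [k] and [m] differ changes the integrand by a nontrivial
    character. The case [b = 1] is orthogonality, the case [a \o modulus] gives the off-diagonal
    entries of [T_a]. *)
Lemma ip_monomial_radial b k m : torus_invariant b -> k != m -> L2 (fun z => b z * e_ k z) ->
  ip (fun z => b z * e_ k z) (e_ m) = 0.
Proof.
move=> bT km bL.
have [j kj] : exists j, k j != m j.
  apply/existsP; apply: contraR km; rewrite negb_exists => /forallP H.
  by apply/eqP/ffunP => j; have := H j; rewrite negbK => /eqP.
rewrite ip_alphaE; apply: (cint_rotation0 (j := j) (p := k j) (q := m j)) => //.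
  by apply: ip_L1 => //; exact: monomial_L2.
move=> u t u1 Bt; rewrite /ip_fun (dv_trot _ _ _ u1) of_coords_trot bT// !monomial_scale1 conjcM conjcX.
move: (b _) (e_ k _) (e_ m _)^* (u ^+ _) (u^* ^+ _) (dv t)%:C => x y z v w d.
have alg : x * (v * y) * (w * z) * d = v * w * (x * y * z * d) by ring.
exact: alg.
Qed.

Lemma ip_monomial k m : ip (e_ k) (e_ m) = (k == m)%:R.
Proof.
have [->|km] := eqVneq k m; first exact: ip_monomial_same.
have E : (fun z => 1 * e_ k z) = e_ k by apply/funext => z; rewrite mul1r.
rewrite -E; apply: (ip_monomial_radial (b := fun=> 1)) => //.
by rewrite E; exact: monomial_L2.
Qed.

Definition partial_sum (x : {ffun 'I_n -> nat} -> R[i]) (F : {fset {ffun 'I_n -> nat}}) z : R[i] :=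
  \sum_(m <- F) x m * e_ m z.

Lemma partial_sum_L2 x F : L2 (partial_sum x F).
Proof. by apply: L2_sum => m; exact: monomial_L2. Qed.

Lemma ip_partial_sum x F k : ip (partial_sum x F) (e_ k) = if k \in F then x k else 0.
Proof.
rewrite ip_suml; [|by move=> m; exact: monomial_L2|exact: monomial_L2].
under eq_bigr do rewrite ip_monomial.
case: ifPn => kF; last first.
  rewrite big_seq big1// => m mF; case: eqP => [mk|_]; last by rewrite mulr0.
  by move: kF; rewrite -mk mF.
rewrite (big_fsetD1 k)//= eqxx mulr1 big_seq big1 ?addr0// => m.
by rewrite in_fsetD1 => /andP[/negPf-> _]; rewrite mulr0.
Qed.

Lemma nsq_partial_sum x F : nsq (partial_sum x F) = \sum_(m <- F) normc (x m) ^+ 2.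
Proof.
apply: complexI; rewrite -ip_xx real_complex_sum.
rewrite {2}/partial_sum ip_sumr; [|by move=> m; exact: monomial_L2|exact: partial_sum_L2].
rewrite big_seq [RHS]big_seq; apply: eq_bigr => m mF.
by rewrite ip_partial_sum mF mulrC mulcJ.
Qed.

Lemma bessel f F : L2 f -> \sum_(m <- F) normc (ip f (e_ m)) ^+ 2 <= nsq f.
Proof.
move=> fL; pose x m := ip f (e_ m); pose S := partial_sum x F.
have SL : L2 S := partial_sum_L2 x F.
pose h : 'rV[R[i]]_n -> R[i]^o := fun z => (-1) * S z + f z.
have hL : L2 h by exact: L2_lin.
have SS : ip S S = (\sum_(m <- F) normc (x m) ^+ 2)%:C by rewrite ip_xx nsq_partial_sum.
have fS : ip f S = ip S S.
  rewrite SS {1}/S /partial_sum ip_sumr//; last by move=> m; exact: monomial_L2.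
  rewrite real_complex_sum; apply: eq_bigr => m _; rewrite -/(x m) mulrC; exact: mulcJ.
have Sf : ip S f = ip S S by rewrite (ip_conj fL SL) fS SS conj_real.
have : 0 <= nsq h := nsq_ge0 h.
have hE : ip h h = ip f f - ip S S.
  rewrite {1}/h ip_lin// (ip_conj hL SL) (ip_conj hL fL) {1 2}/h !ip_lin//.
  rewrite fS Sf !conjcD !conjcM SS ip_xx !conj_real.
  move: (_%:C) (_%:C) => p q.
  have -> : (-1 : R[i])^* = -1 by rewrite rmorphN rmorph1.
  by ring.
have -> : nsq h = nsq f - \sum_(m <- F) normc (x m) ^+ 2.
  by apply: complexI; rewrite -ip_xx hE SS ip_xx rmorphB.
by rewrite subr_ge0.
Qed.

Lemma normc_ip_le f m : L2 f -> normc (ip f (e_ m)) ^+ 2 <= nsq f.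
Proof. by move=> fL; have := bessel [fset m]%fset fL; rewrite big_seq_fset1. Qed.

End weighted_L2.

(** * First-order expansions of monomials with summable majorants *)

Section jets.
Context {R : realType} {n : nat} (z : 'rV[R[i]]_n) (b : R) (b0 : 0 < b).
Implicit Types (h : 'rV[R[i]]_n) (p q : 'rV[R[i]]_n -> R[i]).

(* A first-order Taylor expansion at [z] whose bounds are multiplicative in [T]:
   [T] majorizes [p] on the polydisc of radius [b]. *)
Definition jet p (T : R) := exists (L : 'rV[R[i]]_n -> R[i]) (P0 P1 P2 : R),
  [/\ (forall c u v, L (c *: u + v) = c * L u + L v), [/\ 0 <= P0, 0 <= P1, 0 <= P2 & P0 + P1 + P2 = T],
    normc (p z) <= P0, forall h, normc (L h) <= rnorm h / b * P1
  & forall h, rnorm h <= b -> normc (p (z + h) - p z - L h) <= (rnorm h / b) ^+ 2 * P2].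

Lemma jet_cst c : jet (fun=> c) (normc c).
Proof.
exists (fun=> 0), (normc c), 0, 0; split=> //.
- by move=> *; rewrite mulr0 addr0.
- by rewrite normc_ge0 !addr0.
- by move=> h; rewrite normc0 mulr0.
- by move=> h _; rewrite subrr subr0 normc0 mulr0.
Qed.

Lemma jet_coord j : jet (fun z => z 0 j) (normc (z 0 j) + b).
Proof.
exists (fun h => h 0 j), (normc (z 0 j)), b, 0; split=> //.
- by move=> c u v; rewrite !mxE.
- by rewrite normc_ge0 (ltW b0) addr0.
- by move=> h; rewrite divfK ?gt_eqF// normc_coord_le.
- move=> h _; rewrite mulr0 mxE.
  have alg (a d : R[i]) : a + d - a - d = 0 by ring.
  by rewrite alg normc0.
Qed.

(** The nine products of terms of orders 0, 1, 2 are distributed over the new bounds, whose sum is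
    [T * S]. Those of order three and four join the second-order bound because
    [rnorm h / b <= 1]. *)
Lemma jetM p q T S : jet p T -> jet q S -> jet (fun z => p z * q z) (T * S).
Proof.
move=> [L [P0 [P1 [P2 [Ll [P00 P10 P20 PT] p0 LP rP]]]]].
move=> [M [Q0 [Q1 [Q2 [Ml [Q00 Q10 Q20 QS] q0 MQ rQ]]]]].
exists (fun h => p z * M h + q z * L h), (P0 * Q0), (P0 * Q1 + P1 * Q0),
  (P1 * Q1 + P0 * Q2 + P2 * Q0 + P1 * Q2 + P2 * Q1 + P2 * Q2); split.
- move=> c u v; rewrite Ll Ml.
  have alg (a d x y x' y' : R[i]) : a * (c * x + y) + d * (c * x' + y') =
    c * (a * x + d * x') + (a * y + d * y') by ring.
  exact: alg.
- by rewrite ?addr_ge0 ?mulr_ge0// -PT -QS; split=> //; ring.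
- by rewrite normcM; apply: ler_pM => //; exact: normc_ge0.
- move=> h; have t0 : 0 <= rnorm h / b by rewrite divr_ge0 ?rnorm_ge0 ?ltW.
  apply: le_trans (normcD _ _) _; rewrite !normcM mulrDr.
  have -> : rnorm h / b * (P0 * Q1) = P0 * (rnorm h / b * Q1) by ring.
  have -> : rnorm h / b * (P1 * Q0) = Q0 * (rnorm h / b * P1) by ring.
  by apply: lerD; apply: ler_pM => //; exact: normc_ge0.
- move=> h hb; set t := rnorm h / b.
  have t0 : 0 <= t by rewrite divr_ge0 ?rnorm_ge0 ?ltW.
  have t1 : t <= 1 by rewrite ler_pdivrMr// mul1r.
  have := rP h hb; have := rQ h hb; have := LP h; have := MQ h; rewrite -/t.
  set r := p (z + h) - p z - L h; set s := q (z + h) - q z - M h.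
  have -> : p (z + h) * q (z + h) - p z * q z - (p z * M h + q z * L h) =
     L h * M h + p z * s + r * q z + L h * s + r * M h + r * s by rewrite /r /s; ring.
  move: (L h) (M h) r s p0 q0 => l m r s p0 q0 Hm Hl Hs Hr.
  have tt : t ^+ 2 <= 1 by rewrite exprn_ile1.
  have bd (x y : R[i]) (X Y k : R) : normc x <= X -> normc y <= Y -> X * Y <= t ^+ 2 * k ->
      normc (x * y) <= t ^+ 2 * k.
    by move=> hx hy; apply: le_trans; rewrite normcM; apply: ler_pM => //; exact: normc_ge0.
  have lt2 (k : R) : 0 <= k -> t * (t ^+ 2 * k) <= t ^+ 2 * k.
    by move=> k0; rewrite ler_piMl// mulr_ge0// sqr_ge0.
  rewrite !mulrDr; do ?[apply: le_trans (normcD _ _) _; apply: lerD].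
  + by apply: bd Hl Hm _; rewrite le_eqVlt; apply/orP; left; apply/eqP; ring.
  + by apply: bd p0 Hs _; rewrite le_eqVlt; apply/orP; left; apply/eqP; ring.
  + by apply: bd Hr q0 _; rewrite le_eqVlt; apply/orP; left; apply/eqP; ring.
  + apply: bd Hl Hs _; apply: le_trans (lt2 _ (mulr_ge0 P10 Q20)).
    by rewrite le_eqVlt; apply/orP; left; apply/eqP; ring.
  + apply: bd Hr Hm _; apply: le_trans (lt2 _ (mulr_ge0 P20 Q10)).
    by rewrite le_eqVlt; apply/orP; left; apply/eqP; ring.
  + apply: bd Hr Hs _; apply: (@le_trans _ _ (t ^+ 2 * (t ^+ 2 * (P2 * Q2)))).
      by rewrite le_eqVlt; apply/orP; left; apply/eqP; ring.
    by rewrite ler_piMl// mulr_ge0 ?sqr_ge0 ?mulr_ge0.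
Qed.

Lemma jetX p T k : jet p T -> jet (fun z => p z ^+ k) (T ^+ k).
Proof.
move=> pT; elim: k => [|k ih].
  by have := jet_cst 1; rewrite normc1.
by rewrite exprS; under eq_fun do rewrite exprS; exact: jetM.
Qed.

Lemma jet_prod (I : Type) (s : seq I) (p : I -> 'rV[R[i]]_n -> R[i]) (T : I -> R) :
  (forall i, jet (p i) (T i)) -> jet (fun z => \prod_(i <- s) p i z) (\prod_(i <- s) T i).
Proof.
move=> H; elim: s => [|i s ih].
  rewrite big_nil (_ : (fun z => _) = fun=> 1); last by apply/funext => w; rewrite big_nil.
  by have := jet_cst 1; rewrite normc1.
rewrite big_cons (_ : (fun z => _) = fun z => p i z * \prod_(i <- s) p i z); first exact: jetM.
by apply/funext => w; rewrite big_cons.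
Qed.

(** The majorant is the monomial at the point of coordinates [|z_j| + b]. When that point is in the
    ball these values are square summable in [m], which permits termwise differentiation. *)
Lemma jet_monomial alpha m : jet (monomial alpha m)
  (normc (monomial alpha m (\row_j (normc (z 0 j) + b)%:C))).
Proof.
rewrite {2}/monomial normcM normc_prod; apply: jetM; first exact: jet_cst.
under [X in jet _ X]eq_bigr do rewrite normcX mxE normc_real ger0_norm ?addr_ge0 ?normc_ge0 ?(ltW b0)//.
by apply: jet_prod => j; apply: jetX; exact: jet_coord.
Qed.

End jets.

Section bergman_series.
Context {R : realType} {n : nat} (alpha : R) (alpha_gtN1 : -1 < alpha).
Local Notation e_ := (@monomial R n alpha).
Local Notation index := {ffun 'I_n -> nat}.
Implicit Types (z h : 'rV[R[i]]_n) (x : index -> R[i]).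

Definition ell2_summable_fun x := (\esum_(m in [set: index]) (normc (x m) ^+ 2)%:E < +oo)%E.

Definition bergman_sum x : 'rV[R[i]]_n -> R[i]^o := fun z =>
  if z \in ball1 then complex_sum (fun m => x m * e_ m z) else 0.

Lemma esum_dominated x (y : index -> R[i]) (T : index -> R) (K C : R) : ell2_summable_fun x ->
  (forall F : {fset index}, \sum_(m <- F) T m ^+ 2 <= C) -> 0 <= K ->
  (forall m, normc (y m) <= normc (x m) * (K * T m)) -> abs_summable y.
Proof.
move=> xoo TC K0 H; pose z m := K * T m.
apply: (@abs_summable_le _ _ _ (fun m => normc (x m) ^+ 2 + (K * T m) ^+ 2)).
  move=> m; apply: le_trans (H m) _.
  rewrite -subr_ge0; move: (normc _) (K * T m) => a c.
  have -> : a ^+ 2 + c ^+ 2 - a * c = ((a - c) ^+ 2 + a ^+ 2 + c ^+ 2) / 2 by field.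
  by rewrite divr_ge0 ?addr_ge0 ?sqr_ge0.
under eq_esum do rewrite EFinD.
rewrite esumD; last 2 first.
- by move=> m _; rewrite lee_fin sqr_ge0.
- by move=> m _; rewrite lee_fin sqr_ge0.
rewrite lte_add_pinfty//; apply: (@esum_bounded _ _ _ (K ^+ 2 * C)) => F.
under eq_bigr do rewrite exprMn.
by rewrite -mulr_sumr ler_wpM2l ?sqr_ge0.
Qed.

Lemma bergman_sum_summable x z : ell2_summable_fun x -> ball1 z -> abs_summable (fun m => x m * e_ m z).
Proof.
move=> xoo z1; have [C _ HC] := monomial_square_sum alpha_gtN1 z1.
apply: (@esum_dominated x _ (fun m => normc (e_ m z)) 1 C) => // m.
by rewrite normcM mul1r.
Qed.

Lemma bergman_sum_has_csum x z : ell2_summable_fun x -> ball1 z ->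
  has_csum (fun m => x m * e_ m z) (bergman_sum x z).
Proof.
move=> xoo z1; rewrite /bergman_sum mem_set//.
by apply: abs_summable_has_csum; exact: bergman_sum_summable.
Qed.

Lemma bergman_sum_out x z : ~ ball1 z -> bergman_sum x z = 0.
Proof. by move=> z1; rewrite /bergman_sum memNset. Qed.

Lemma ball1_enlarge z : ball1 z -> exists2 b : R, 0 < b &
  ball1 (\row_j (normc (z 0 j) + b)%:C) /\ forall h, rnorm h <= b -> ball1 (z + h).
Proof.
move=> z1; have m1 : ball1 (modulus z).
  by move: z1; rewrite /ball1 /norm2 /=; under [X in _ -> X < 1]eq_bigr do
    rewrite mxE normc_real ger0_norm ?normc_ge0//.
have [d d0 Hd] := ball1_nbhs m1; have d20 : 0 < d / 2 by rewrite divr_gt0.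
have B : ball1 (\row_j (normc (z 0 j) + d / 2)%:C : 'rV[R[i]]_n).
  have -> : \row_j (normc (z 0 j) + d / 2)%:C = modulus z + const_mx (d / 2)%:C.
    by apply/rowP => j; rewrite !mxE rmorphD.
  apply: Hd; apply: (@le_lt_trans _ _ (d / 2)); last by rewrite ltr_pdivrMr// ltr_pMr// ltr1n.
  by apply: rnorm_le => [|i]; [exact: ltW|rewrite mxE normc_real gtr0_norm].
exists (d / 2) => //; split=> // h hb.
move: B; rewrite /ball1 /norm2 /=; apply: le_lt_trans; apply: ler_sum => j _.
rewrite !mxE lerXn2r ?nnegrE ?normc_ge0//.
have p0 : 0 <= normc (z 0 j) + d / 2 by rewrite addr_ge0 ?normc_ge0// ltW.
rewrite normc_real ger0_norm//; apply: le_trans (normcD _ _) _; rewrite lerD2l.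
exact: le_trans (normc_coord_le h j) hb.
Qed.

(** The differentials of the terms sum to a linear map, and the remainders to at most
    [(|h| / b)^2 S], where [S] bounds the sums of [|x_m| T_m]. *)
Lemma bergman_sum_holomorphic x : ell2_summable_fun x -> holomorphic (bergman_sum x).
Proof.
move=> xoo z z1; have [b b0 [Bb Bh]] := ball1_enlarge z1.
set zb := (\row_j _) in Bb; have [C C0 HC] := monomial_square_sum alpha_gtN1 Bb.
pose T m := normc (e_ m zb).
have /choice[L HL] m : exists L : 'rV[R[i]]_n -> R[i], [/\
    forall c u v, L (c *: u + v) = c * L u + L v,
    forall h, normc (L h) <= rnorm h / b * T m
  & forall h, rnorm h <= b -> normc (e_ m (z + h) - e_ m z - L h) <= (rnorm h / b) ^+ 2 * T m].
  have [L [P0 [P1 [P2 [Ll [P00 P10 P20 PT] _ LP rP]]]]] := jet_monomial z b0 alpha m.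
  exists L; rewrite /T /zb -PT; split=> // h.
    apply: le_trans (LP h) _; apply: ler_wpM2l; first by rewrite divr_ge0 ?rnorm_ge0// ltW.
    by rewrite addrAC lerDr addr_ge0.
  move=> /rP/le_trans; apply; apply: ler_wpM2l; first exact: sqr_ge0.
  by rewrite lerDr addr_ge0.
have bi h : 0 <= rnorm h / b by rewrite divr_ge0 ?rnorm_ge0// ltW.
have Ls h : abs_summable (fun m => x m * L m h).
  apply: (@esum_dominated x _ T (rnorm h / b) C) => // m.
  have [_ Lb _] := HL m.
  by rewrite normcM ler_wpM2l ?normc_ge0.
pose Lf h : R[i]^o := complex_sum (fun m => x m * L m h).
have Lc h : has_csum (fun m => x m * L m h) (Lf h) by exact: abs_summable_has_csum.
have Llin : linear Lf.
  move=> c u v; apply: has_csum_unique (Lc _) _.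
  have H := has_csumD (has_csumZ c (Lc u)) (Lc v).
  rewrite (_ : (fun m => x m * L m (c *: u + v)) = fun m => c * (x m * L m u) + x m * L m v); first exact: H.
  by apply/funext => m; have [Ll _ _] := HL m; rewrite Ll mulrDr mulrCA.
pose S := C + fine (\esum_(m in [set: index]) (normc (x m) ^+ 2)%:E).
have S0 : 0 <= S by rewrite addr_ge0// fine_ge0// esum_ge0// => m _; rewrite lee_fin sqr_ge0.
have HS (F : {fset index}) : \sum_(m <- F) normc (x m) * T m <= S.
  apply: (@le_trans _ _ (\sum_(m <- F) (T m ^+ 2 + normc (x m) ^+ 2))).
    apply: ler_sum => m _; rewrite -subr_ge0; move: (normc (x m)) (T m) => a c.
    have -> : c ^+ 2 + a ^+ 2 - a * c = ((a - c) ^+ 2 + a ^+ 2 + c ^+ 2) / 2 by field.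
    by rewrite divr_ge0 ?addr_ge0 ?sqr_ge0.
  rewrite big_split /=; apply: lerD => //.
  rewrite -lee_fin fineK; first exact: (esum_ge_fset (fun m => normc (x m) ^+ 2)).
  by rewrite ge0_fin_numE// esum_ge0// => m _; rewrite lee_fin sqr_ge0.
have Sb (y : index -> R[i]) (s : R[i]) (k : R) : 0 <= k -> has_csum (fun m => x m * y m) s ->
    (forall m, normc (y m) <= k * T m) -> normc s <= k * S.
  move=> k0 hs hy; apply: (has_csum_le (F1 := fset0) hs) => F _.
  apply: le_trans (normc_sum _ _ _) _; apply: (@le_trans _ _ (k * \sum_(m <- F) normc (x m) * T m)).
    rewrite mulr_sumr; apply: ler_sum => m _; rewrite normcM mulrCA.
    by rewrite ler_wpM2l ?normc_ge0.
  by rewrite ler_wpM2l.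
pose LL : {linear 'rV[R[i]]_n -> R[i]^o} := HB.pack Lf (GRing.isLinear.Build _ _ _ _ _ Llin).
apply: (@eps_differentiable _ _ _ _ LL (S / b)) => [h|e e0].
  rewrite (_ : S / b * rnorm h = rnorm h / b * S); last by ring.
  by apply: (Sb (fun m => L m h)) => // m; have [_ Lb _] := HL m.
have S1 : 0 < S + 1 by rewrite ltr_wpDl.
exists (Num.min b (e * b ^+ 2 / (S + 1))).
  by rewrite lt_min b0 divr_gt0 ?mulr_gt0 ?exprn_gt0.
move=> h; rewrite lt_min => /andP[hb he].
have zh1 := Bh h (ltW hb).
apply: (@le_trans _ _ ((rnorm h / b) ^+ 2 * S)).
  apply: (Sb (fun m => e_ m (z + h) - e_ m z - L m h)).
  - exact: sqr_ge0.
  - have H1 := bergman_sum_has_csum xoo zh1; have H0 := has_csumZ (-1) (bergman_sum_has_csum xoo z1).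
    have H := has_csumD (has_csumD H1 H0) (has_csumZ (-1) (Lc h)).
    rewrite !mulN1r in H; rewrite (_ : (fun m => _) = fun m =>
      x m * e_ m (z + h) + -1 * (x m * e_ m z) + -1 * (x m * L m h)); first exact: H.
    by apply/funext => m; rewrite !mulN1r !mulrBr.
  - by move=> m; have [_ _ Lr] := HL m; apply: Lr; exact: ltW.
have r0 := rnorm_ge0 h; have bn0 : b != 0 by rewrite gt_eqF.
have -> : (rnorm h / b) ^+ 2 * S = rnorm h * (rnorm h * S / b ^+ 2).
  have alg (r s : R) : (r / b) ^+ 2 * s = r * (r * s / b ^+ 2) by field.
  exact: alg.
rewrite (mulrC e) ler_wpM2l// ler_pdivrMr ?exprn_gt0//.
move: he; rewrite ltr_pdivlMr// => /ltW; apply: le_trans.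
by rewrite ler_wpM2l// lerDl.
Qed.

End bergman_series.

(** * Series of monomials in mean square, and completeness *)

Section bergman_expansion.
Context {R : realType} {n : nat} (alpha : R) (alpha_gtN1 : -1 < alpha).
Local Notation CC := (measurableTypeR R * measurableTypeR R)%type.
Local Notation lebC := (@lebesgue_C R n).
Local Notation B := (@ball_coords R n).
Local Notation dv := (dv alpha).
Local Notation mB := (@measurable_ball_coords R n).
Local Notation e_ := (@monomial R n alpha).
Local Notation ip := (@ip_alpha R n alpha).
Local Notation L2 := (@L2_alpha R n alpha).
Local Notation nsq := (@nsq R n alpha).
Local Notation index := {ffun 'I_n -> nat}.
Local Notation partial_sum := (@partial_sum R n alpha).
Local Notation bergman_sum := (@bergman_sum R n alpha).
Implicit Types (z : 'rV[R[i]]_n) (t : n.-tuple CC) (f g : 'rV[R[i]]_n -> R[i]^o)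
  (m : index) (c : R[i]) (F : {fset index}) (x : index -> R[i]).

Lemma cvg_parts (u : nat -> R[i]) (l : R[i]) :
  (forall e : R, 0 < e -> exists N, forall k, (N <= k)%N -> normc (l - u k) <= e) ->
  (complex.Re (u k) @[k --> \oo] --> complex.Re l) /\ (complex.Im (u k) @[k --> \oo] --> complex.Im l).
Proof.
move=> H; split; apply/cvgrPdist_le => e e0; have [N HN] := H e e0; exists N => // k /= Nk.
- by rewrite -ReB; apply: le_trans (normc_Re _) (HN k Nk).
- by rewrite -ImB; apply: le_trans (normc_Im _) (HN k Nk).
Qed.

(** Fatou's lemma turns bounds on partial sums into membership in [L^2] and a norm bound for the
    pointwise sum. *)
Lemma L2_fatou (G : nat -> 'rV[R[i]]_n -> R[i]^o) g (M : R) : (forall k, L2 (G k)) ->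
  (forall k, nsq (G k) <= M) -> (forall z, ball1 z -> forall e : R, 0 < e ->
     exists N, forall k, (N <= k)%N -> normc (g z - G k z) <= e) ->
  L2 g /\ nsq g <= M.
Proof.
move=> GL GM Gg.
have cv t (Bt : B t) := cvg_parts (Gg _ Bt).
have mg : ball_measurable g.
  split.
  - apply: (@measurable_fun_cvg _ _ _ _ (fun k t => complex.Re (G k (of_coords t)))) => [k|t /cv[]//].
    exact: (GL k).1.1.
  - apply: (@measurable_fun_cvg _ _ _ _ (fun k t => complex.Im (G k (of_coords t)))) => [k|t /cv[]//].
    exact: (GL k).1.2.
have le : (\int[lebC]_(t in B) (sq_fun alpha g t)%:E <= M%:E)%E.
  have -> : (\int[lebC]_(t in B) (sq_fun alpha g t)%:E =
      \int[lebC]_(t in B) limn_einf (fun k => (sq_fun alpha (G k) t)%:E))%E.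
    apply: eq_integral => t /set_mem /cv[cR cI].
    have cv2 : (sq_fun alpha (G k) t)%:E @[k --> \oo] --> (sq_fun alpha g t)%:E.
      apply: cvg_EFin; first by apply: nearW.
      apply: cvgM; last exact: cvg_cst.
      rewrite (_ : (fun k => normc (G k (of_coords t)) ^+ 2) = fun k =>
        complex.Re (G k (of_coords t)) * complex.Re (G k (of_coords t)) +
        complex.Im (G k (of_coords t)) * complex.Im (G k (of_coords t))); last first.
        by apply/funext => k; rewrite normc2E !expr2.
      by rewrite normc2E !expr2; apply: cvgD; exact: cvgM.
    by rewrite (cvg_limn_einf_sup cv2).1.
  apply: le_trans (fatou _ _ _ _) _.
  - exact: mB.
  - by move=> k; apply/measurable_EFinP; apply: measurable_sq_fun; exact: (GL k).1.
  - by move=> k t _; rewrite lee_fin sq_fun_ge0.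
  rewrite limn_einf_lim; apply: lime_le; first exact: is_cvg_einfs.
  apply: nearW => k; apply: (@le_trans _ _ (nsq (G k))%:E); last by rewrite lee_fin.
  by rewrite -(nsqE (GL k)); apply: ereal_inf_lbound; exists k => /=.
have gL : L2 g by split=> //; exact: le_lt_trans le (ltry M).
by split=> //; rewrite -lee_fin -(nsqE gL).
Qed.

Lemma has_csum_degree (z_ : index -> R[i]) s (e : R) : has_csum z_ s -> 0 < e ->
  exists N0, forall N, (N0 <= N)%N -> normc (s - \sum_(m <- degree_lt N) z_ m) <= e.
Proof.
move=> zs e0; have [F0 H] := zs e e0; have [N0 HN] := fset_degree_lt F0.
by exists N0 => N /HN; exact: H.
Qed.

Lemma bergman_sum_bound x (M : R) : ell2_summable_fun x ->
  (forall F, \sum_(m <- F) normc (x m) ^+ 2 <= M) -> L2 (bergman_sum x) /\ nsq (bergman_sum x) <= M.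
Proof.
move=> xoo HM; apply: (@L2_fatou (fun N => partial_sum x (degree_lt N))).
- by move=> N; exact: partial_sum_L2.
- by move=> N; rewrite nsq_partial_sum.
- by move=> z z1 e; apply: has_csum_degree; exact: bergman_sum_has_csum.
Qed.

Lemma bergman_sum_L2 x : ell2_summable_fun x -> L2 (bergman_sum x).
Proof. by move=> xoo; have [] := bergman_sum_bound xoo (ell2_norm2_sup (ell2_of xoo)). Qed.

(** The remainder is the pointwise limit of the blocks of degrees from [N] to [N + k], whose norms
    are tails of the square sum. *)
Lemma nsq_bergman_sum_tail x (e : R) : ell2_summable_fun x -> 0 < e ->
  exists N0, forall N, (N0 <= N)%N -> nsq (fun z => -1 * partial_sum x (degree_lt N) z + bergman_sum x z) <= e.
Proof.
move=> xoo e0.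
have [F0 HF0] := ge0_tail (fun m => sqr_ge0 (normc (x m))) xoo e0.
have [N0 HN0] := fset_degree_lt F0; exists N0 => N NN0.
have sub k : (@degree_lt n N `<=` @degree_lt n (N + k))%fset.
  by apply/fsubsetP => m; rewrite !mem_degree_lt => /leq_trans; apply; rewrite leq_addr.
have [|||_ //] := @L2_fatou (fun k => partial_sum x (degree_lt (N + k) `\` degree_lt N)%fset)
  (fun z => -1 * partial_sum x (degree_lt N) z + bergman_sum x z) e.
- by move=> k; exact: partial_sum_L2.
- move=> k; rewrite nsq_partial_sum//; apply: HF0.
  apply/fdisjointP => m /(fsubsetP (HN0 N NN0)) mN.
  by rewrite in_fsetD mN.
- move=> z z1 d d0.
  have [K HK] := has_csum_degree (bergman_sum_has_csum alpha_gtN1 xoo z1) d0.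
  exists K => k Kk; apply: le_trans (HK (N + k)%N (leq_trans Kk (leq_addl _ _))).
  rewrite le_eqVlt; apply/orP; left; apply/eqP; congr normc.
  rewrite (sum_fset_split _ (sub k)) mulN1r opprD addrA (addrC (- _)).
  by [].
Qed.

(** Once [N] exceeds the degree of [m], the partial sum has coefficient exactly [x m], and that of
    the remainder is bounded by its norm. *)
Lemma ip_bergman_sum x m : ell2_summable_fun x -> ip (bergman_sum x) (e_ m) = x m.
Proof.
move=> xoo; have bL := bergman_sum_L2 xoo; apply/eqP; rewrite -subr_eq0 -normc_eq0 eq_le normc_ge0 andbT.
rewrite -(@ler_sqr _ _ 0) ?nnegrE ?normc_ge0// expr0n; apply/ler_addgt0Pr => e e0; rewrite add0r.
have [N0 HN0] := nsq_bergman_sum_tail xoo e0; pose N := maxn N0 (mdeg m).+1.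
have SL := partial_sum_L2 alpha_gtN1 x (degree_lt N).
have eL := monomial_L2 alpha_gtN1 m.
have := normc_ip_le alpha_gtN1 m (L2_lin (-1) SL bL).
rewrite (ip_lin (-1) SL bL eL) ip_partial_sum// mem_degree_lt leq_maxr mulN1r addrC.
by move/le_trans; apply; apply: HN0; rewrite leq_maxl.
Qed.

Lemma L2_wfun_L1 f : L2 f -> cL1 lebC B (wfun alpha f).
Proof.
move=> fL; apply: (@cL1_le _ _ _ _ _ mB _ (fun t => sq_fun alpha f t + dv t)).
- apply: cmeasM; first exact: fL.1.
  by apply: cmeas_real; exact: measurable_funTS (measurable_dv alpha).
- by have := integrableD mB (L2_integrable fL) (@integrable_dv R n alpha alpha_gtN1).
- move=> t _; rewrite /wfun normcM normc_real ger0_norm ?dv_ge0//.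
  rewrite -[X in _ <= _ + X]mul1r -mulrDl; apply: ler_wpM2r; first exact: dv_ge0.
  move: (normc _) => a; have := sqr_ge0 (a - 2^-1); rewrite sqrrB.
  by move: (a ^+ 2) => b; lra.
Qed.

Lemma L2_coefficients_zero f : holomorphic f -> L2 f -> (forall m, ip f (e_ m) = 0) ->
  forall z, ball1 z -> f z = 0.
Proof.
move=> hf fL H0; apply: (holomorphic_unique alpha_gtN1 hf (L2_wfun_L1 fL)) => m.
(* [coef] is indexed by plain functions, [monomial] by finite functions. *)
pose m' : index := [ffun j => m j].
have := H0 m'; rewrite ip_alphaE; set c := Num.sqrt (Gamma (n%:R + (mdeg m')%:R + alpha + 1) /
    ((mfact m')%:R * Gamma (n%:R + alpha + 1))).
have cE t : ip_fun alpha f (e_ m') t = c%:C * (wfun alpha f t * cmon m (of_coords t)).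
  rewrite /ip_fun monomialE conjcM conj_real conjCK -/c /wfun (_ : cmon m' = cmon m); last first.
    by apply/funext => z; apply: eq_bigr => j _; rewrite ffunE.
  move: (f _) (cmon _ _) (dv t)%:C => a b d; have alg : a * (c%:C * b) * d = c%:C * (a * d * b) by ring.
  exact: alg.
have -> : ip_fun alpha f (e_ m') = fun t => c%:C * (wfun alpha f t * cmon m (of_coords t)) by exact/funext.
rewrite (cintZ mB); last first.
  apply: (cL1M_bounded (M := 1) (L2_wfun_L1 fL) (cmeas_cmon m)) => t.
  exact: normc_cmon.
move/eqP; rewrite mulf_eq0 (inj_eq (@complexI R)) => /orP[|/eqP//].
rewrite sqrtr_eq0 => /le_gtF; rewrite divr_gt0// ?mulr_gt0 ?Gamma_gt0//.
- rewrite (_ : n%:R + _ + alpha + 1 = n%:R + alpha + 1 + (mdeg m')%:R); last by ring.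
  by rewrite ltr_wpDr// exponent_gt0.
- by rewrite ltr0n prodn_gt0// => j; rewrite fact_gt0.
- exact: exponent_gt0.
Qed.

Lemma bessel_ell2 f : L2 f -> ell2_summable_fun (fun m => ip f (e_ m)).
Proof. by move=> fL; apply: esum_bounded => F; exact: bessel. Qed.

Lemma bergman_sum_coefficients f : (forall z, ~ ball1 z -> f z = 0) -> holomorphic f -> L2 f ->
  bergman_sum (fun m => ip f (e_ m)) = f.
Proof.
move=> f0 hf fL; set x := fun m => _; have xoo : ell2_summable_fun x := bessel_ell2 fL.
have bL := bergman_sum_L2 xoo.
apply/funext => z; have [z1|z1] := pselect (ball1 z); last by rewrite f0// bergman_sum_out.
apply/eqP; rewrite -subr_eq0 addrC -mulN1r; apply/eqP.
apply: (@L2_coefficients_zero (fun z => -1 * f z + bergman_sum x z)) z1.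
- move=> w w1; apply: differentiableD; last exact: bergman_sum_holomorphic.
  by apply: (@differentiableZ _ _ _ f); exact: hf.
- exact: L2_lin.
- move=> m; rewrite ip_lin//; last exact: monomial_L2.
  by rewrite ip_bergman_sum// mulN1r addNr.
Qed.

End bergman_expansion.

Section coefficient_map.
Context {R : realType} {n : nat} (alpha : R) (alpha_gtN1 : -1 < alpha).
Local Notation CC := (measurableTypeR R * measurableTypeR R)%type.
Local Notation lebC := (@lebesgue_C R n).
Local Notation B := (@ball_coords R n).
Local Notation dv := (dv alpha).
Local Notation mB := (@measurable_ball_coords R n).
Local Notation e_ := (@monomial R n alpha).
Local Notation ip := (@ip_alpha R n alpha).
Local Notation L2 := (@L2_alpha R n alpha).
Local Notation nsq := (@nsq R n alpha).
Local Notation index := {ffun 'I_n -> nat}.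
Local Notation partial_sum := (@partial_sum R n alpha).
Local Notation bergman_sum := (@bergman_sum R n alpha).
Local Notation norml x := (hnorm (@ell2_ip R index) x).
Local Notation U := (coefficients (n := n) alpha).
Local Notation H := (bergman n alpha).
Implicit Types (z : 'rV[R[i]]_n) (t : n.-tuple CC) (f g : H)
  (m : index) (c : R[i]) (F : {fset index}) (x : ell2 R index).

Lemma bergmanP f : [/\ forall z, ~ ball1 z -> f z = 0, holomorphic f & L2 f].
Proof. exact: (set_mem (valP f)). Qed.

Lemma bergman_L2 f : L2 f. Proof. by have [] := bergmanP f. Qed.

(** Bessel's inequality makes the sequence square summable, so [insubd] does not take its default
    value. *)
Lemma coefficientsE f m : U f m = ip f (e_ m).
Proof.
rewrite /coefficients /= val_insubd ifT//; apply: mem_set.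
exact: (bessel_ell2 alpha_gtN1 (bergman_L2 f)).
Qed.

Local Opaque coefficients.

Lemma bergman_sum_bergman (x : index -> R[i]) : ell2_summable_fun x -> bergman_sum x \in bergman_fun alpha.
Proof.
move=> xoo; apply: mem_set; split.
- exact: bergman_sum_out.
- exact: bergman_sum_holomorphic.
- exact: bergman_sum_L2.
Qed.

Definition bergman_of x : H := Bergman (bergman_sum_bergman (ell2P x)).

Lemma bergman_ofK x : U (bergman_of x) = x.
Proof.
apply: ell2_ext => m; rewrite coefficientsE; apply: ip_bergman_sum => //; exact: ell2P.
Qed.

Lemma bergman_ext f g : (forall z, f z = g z) -> f = g.
Proof. by move=> fg; apply: val_inj; exact/funext. Qed.

Lemma coefficientsK f : bergman_of (U f) = f.
Proof.
have [f0 hf fL] := bergmanP f; apply: bergman_ext => z /=.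
rewrite -[RHS](congr1 (@^~ z) (bergman_sum_coefficients alpha_gtN1 f0 hf fL)).
by congr bergman_sum; apply/funext => m; exact: coefficientsE.
Qed.

Lemma coefficients_inj : injective U. Proof. exact: can_inj coefficientsK. Qed.

Lemma coefficients_linear : linear U.
Proof.
move=> c f g; apply: ell2_ext => m; apply: etrans (coefficientsE _ m) _.
apply: etrans _ (esym (ell2D c (U f) (U g) m)).
apply: etrans (ip_lin c (bergman_L2 f) (bergman_L2 g) (monomial_L2 alpha_gtN1 m)) _.
by congr (c * _ + _); rewrite coefficientsE.
Qed.

Lemma nsq_coefficients f : nsq f = norml (U f) ^+ 2.
Proof.
apply/eqP; rewrite eq_le; apply/andP; split; last first.
  apply: ell2_norm2_le => F; under eq_bigr do rewrite coefficientsE.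
  exact: bessel (bergman_L2 f).
rewrite -{1}(coefficientsK f).
by have [] := bergman_sum_bound alpha_gtN1 (ell2P (U f)) (ell2_norm2_sup (U f)).
Qed.

Lemma hnorm_bergman f : hnorm (bergman_ip alpha) f = norml (U f).
Proof.
rewrite /hnorm /bergman_ip ip_xx /= nsq_coefficients sqrtr_sqr ger0_norm ?ell2_norm_ge0//.
Qed.

(** Plays the role of Cauchy-Schwarz: a large [k] makes the term in [g] small, after which [h] is
    taken small compared with [1 / k]. *)
Lemma normc_ip_weighted (h g : 'rV[R[i]]_n -> R[i]^o) (k : R) : 0 < k -> L2 h -> L2 g ->
  normc (ip h g) <= 2 * (k * nsq h + nsq g / k).
Proof.
move=> k0 hL gL; have hI := L2_integrable hL; have gI := L2_integrable gL.
have -> : k * nsq h + nsq g / k =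
    \int[lebC]_(t in B) (k * sq_fun alpha h t + k^-1 * sq_fun alpha g t).
  rewrite RintegralD//; last 3 first.
  - exact: mB.
  - exact: (integrableZ_fin mB k hI).
  - exact: (integrableZ_fin mB k^-1 gI).
  by rewrite (RintegralZl _ mB hI) (RintegralZl _ mB gI) (mulrC _ k^-1).
apply: cint_le.
- exact: mB.
- exact: ip_L1.
- by have := integrableD mB (integrableZ_fin mB k hI) (integrableZ_fin mB k^-1 gI).
move=> t _; rewrite /ip_fun /sq_fun normcM normc_real ger0_norm ?dv_ge0//.
rewrite -/(dv t); move: (dv t) (dv_ge0 alpha t) => d d0; rewrite !mulrA -mulrDl; apply: ler_wpM2r => //.
rewrite -!(mulrA _ (normc _) (normc _)) -!expr2 normcM normcJ; move: (normc_ge0 (h (of_coords t))) (normc_ge0 (g (of_coords t))).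
move: (normc _) (normc _) => q p q0 p0.
have E : k * p ^+ 2 + k^-1 * q ^+ 2 - p * q = ((k * p - q) ^+ 2 / k + k * p ^+ 2 + q ^+ 2 / k) / 2.
  by field; rewrite gt_eqF.
have k1 : 0 <= k^-1 by rewrite invr_ge0 ltW.
rewrite -subr_ge0 E; apply: divr_ge0 => //; apply: addr_ge0; first apply: addr_ge0.
- by apply: mulr_ge0 k1; exact: sqr_ge0.
- by apply: mulr_ge0; [exact: ltW|exact: sqr_ge0].
- by apply: mulr_ge0 k1; exact: sqr_ge0.
Qed.

Lemma coefficients_ip f g : ell2_ip (U f) (U g) = ip f g.
Proof.
have fL := bergman_L2 f; have gL := bergman_L2 g.
apply/eqP; rewrite -subr_eq0 -normc_eq0 eq_le normc_ge0 andbT; apply/ler_addgt0Pr => e e0.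
rewrite add0r; have e20 : 0 < e / 2 by rewrite divr_gt0.
have [N1 H1] := has_csum_degree (ell2_ip_has_csum (U f) (U g)) e20.
have g1 : 0 < nsq g + 1 by rewrite ltr_wpDl ?nsq_ge0.
(* Makes [nsq g / k] at most [e / 8]; the choice of [N2] does the same for [k * nsq h], and the
   factor 2 gives [e / 2] in all. *)
pose k := 8 * (nsq g + 1) / e; have k0 : 0 < k by rewrite !divr_gt0 ?mulr_gt0.
have k8 : 0 < 8 * k by rewrite mulr_gt0.
have d0 : 0 < e / (8 * k) by rewrite divr_gt0.
have [N2 H2] := nsq_bergman_sum_tail alpha_gtN1 (ell2P (U f)) d0.
pose N := maxn N1 N2; have := H2 N (leq_maxr _ _).
have -> : bergman_sum (U f) = f by rewrite -[in RHS](coefficientsK f).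
set S := partial_sum _ _; set h : 'rV[R[i]]_n -> R[i]^o := (fun z => _) => hd.
have SL : L2 S by exact: partial_sum_L2.
have hL : L2 h by exact: L2_lin.
have hE : ip h g = - \sum_(m <- degree_lt N) U f m * (U g m)^* + ip f g.
  rewrite /h (ip_lin (-1) SL fL gL) mulN1r; congr (- _ + _).
  rewrite /S /partial_sum ip_suml//; last by move=> m; exact: monomial_L2.
  apply: eq_bigr => m _; congr (_ * _).
  by apply: etrans (ip_conj gL (monomial_L2 alpha_gtN1 m)) _; rewrite -coefficientsE.
have -> : ell2_ip (U f) (U g) - ip f g =
    ell2_ip (U f) (U g) - \sum_(m <- degree_lt N) U f m * (U g m)^* - ip h g.
  by rewrite hE opprD opprK addrA subrK.
apply: le_trans (normcB _ _) _; rewrite (splitr e); apply: lerD.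
  by apply: H1; rewrite leq_maxl.
apply: le_trans (normc_ip_weighted k0 hL gL) _.
have gb : nsq g / k <= e / 8.
  rewrite ler_pdivrMr// (_ : e / 8 * k = nsq g + 1) ?lerDl// /k.
  by move: (nsq g) => q; field; rewrite gt_eqF.
have hb : k * nsq h <= e / 8.
  move: hd; rewrite ler_pdivlMr//; move: (nsq h) => q; rewrite ler_pdivlMr//.
  by apply: le_trans; rewrite (mulrC 8) mulrA (mulrC k).
by move: gb hb; move: (_ / k) (k * _) => p q; lra.
Qed.

Lemma coefficients_unitary : unitary (bergman_ip (n := n) alpha) (@ell2_ip R index) U.
Proof.
split; first exact: coefficients_linear.
- exact: Bijective coefficientsK bergman_ofK.
- exact: coefficients_ip.
Qed.

End coefficient_map.

(** * Toeplitz operators and their symbols *)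

Section toeplitz_operators.
Context {R : realType} {n : nat} (alpha : R) (alpha_gtN1 : -1 < alpha).
Local Notation CC := (measurableTypeR R * measurableTypeR R)%type.
Local Notation lebC := (@lebesgue_C R n).
Local Notation B := (@ball_coords R n).
Local Notation dv := (dv alpha).
Local Notation mB := (@measurable_ball_coords R n).
Local Notation e_ := (@monomial R n alpha).
Local Notation ip := (@ip_alpha R n alpha).
Local Notation L2 := (@L2_alpha R n alpha).
Local Notation nsq := (@nsq R n alpha).
Local Notation index := {ffun 'I_n -> nat}.
Local Notation bergman_sum := (@bergman_sum R n alpha).
Local Notation norml x := (hnorm (@ell2_ip R index) x).
Local Notation U := (coefficients (n := n) alpha).
Local Notation H := (bergman n alpha).
Local Notation kernel z w := (complex_powR (1 - dotc z w) (- (n%:R + alpha + 1))).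
Implicit Types (z w : 'rV[R[i]]_n) (t : n.-tuple CC) (g : 'rV[R[i]]_n -> R[i]^o) (f : H)
  (a : 'rV[R[i]]_n -> R[i]) (m : index).

Lemma L2_mul_bounded a (M : R) g : ball_measurable a ->
  {ae lebC, forall t, B t -> normc (a (of_coords t)) <= M} -> L2 g ->
  L2 (fun z => a z * g z) /\ nsq (fun z => a z * g z) <= M ^+ 2 * nsq g.
Proof.
move=> ma aM gL; have mag : ball_measurable (fun z => a z * g z : R[i]^o) by apply: cmeasM => //; exact: gL.1.
have le : (\int[lebC]_(t in B) (sq_fun alpha (fun z => a z * g z) t)%:E <= (M ^+ 2 * nsq g)%:E)%E.
  rewrite EFinM -(nsqE gL) -ge0_integralZl//; last 4 first.
  - exact: mB.
  - by apply/measurable_EFinP; apply: measurable_sq_fun; exact: gL.1.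
  - by move=> t _; rewrite lee_fin sq_fun_ge0.
  - by rewrite lee_fin sqr_ge0.
  apply: ae_ge0_le_integral.
  - exact: mB.
  - by move=> t _; rewrite lee_fin sq_fun_ge0.
  - by apply/measurable_EFinP; exact: measurable_sq_fun.
  - by move=> t _; rewrite mule_ge0 ?lee_fin ?sqr_ge0 ?sq_fun_ge0.
  - by apply: measurable_funeM; apply/measurable_EFinP; apply: measurable_sq_fun; exact: gL.1.
  apply: filterS aM => t aM Bt; have {}aM := aM Bt; rewrite -EFinM lee_fin /sq_fun normcM exprMn.
  move: (dv t) (dv_ge0 alpha t) => d d0; rewrite [leRHS]mulrA; apply: ler_wpM2r => //.
  apply: ler_wpM2r; first exact: sqr_ge0.
  by rewrite lerXn2r ?nnegrE ?normc_ge0// (le_trans (normc_ge0 _) aM).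
have agL : L2 (fun z => a z * g z) by split=> //; exact: le_lt_trans le (ltry _).
by split=> //; rewrite -lee_fin -(nsqE agL).
Qed.

Lemma Linfty_mul_L2 a g : Linfty a -> L2 g -> L2 (fun z => a z * g z).
Proof. by move=> [ma [M aM]] gL; have [] := L2_mul_bounded ma aM gL. Qed.

(** The kernel is a pointwise limit of finite sums of monomials, whose measurability is
    immediate. *)
Lemma kernel_measurable z : ball1 z -> complex_measurable B (fun t => kernel z (of_coords t)).
Proof.
move=> z1; pose K N t := \sum_(m <- degree_lt N) e_ m z * (e_ m (of_coords t))^*.
have mK N : complex_measurable B (K N).
  apply: cmeas_sum => m; apply: cmeasM; first exact: cmeas_cst.
  by apply: cmeasJ; exact: (monomial_measurable alpha m).
have cv t (Bt : B t) : forall e : R, 0 < e -> exists N, forall k, (N <= k)%N ->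
    normc (kernel z (of_coords t) - K k t) <= e.
  move=> e e0; have [N HN] := kernel_uniform alpha_gtN1 z1 e0.
  by exists N => k Nk; exact: HN.
split.
- apply: (@measurable_fun_cvg _ _ _ _ (fun k t => complex.Re (K k t))) => [k|t /cv/cvg_parts[]//].
  exact: (mK k).1.
- apply: (@measurable_fun_cvg _ _ _ _ (fun k t => complex.Im (K k t))) => [k|t /cv/cvg_parts[]//].
  exact: (mK k).2.
Qed.

Lemma kernel_bounded z : ball1 z -> exists C : R, forall w, ball1 w -> normc (kernel z w) <= C.
Proof.
move=> z1; have [N /(_ N _ (leqnn _))HN] := kernel_uniform alpha_gtN1 z1 ltr01.
have /choice[M HM] := @monomial_bounded R n alpha.
exists (1 + \sum_(m <- degree_lt N) normc (e_ m z) * M m) => w w1.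
rewrite -(subrK (\sum_(m <- degree_lt N) e_ m z * (e_ m w)^*) (kernel z w)).
apply: le_trans (normcD _ _) _; apply: lerD; first exact: HN.
apply: le_trans (normc_sum _ _ _) _; apply: ler_sum => m _.
by rewrite normcM normcJ ler_wpM2l ?normc_ge0// HM.
Qed.

(** Uniform convergence of the kernel series on the ball, against an integrable function, exchanges
    sum and integral. No holomorphy of [g] is assumed, so [g = a f] is allowed. *)
Lemma kernel_integral g z : L2 g -> ball1 z ->
  complex_integral lebC B (fun t => wfun alpha g t * kernel z (of_coords t)) =
  bergman_sum (fun m => ip g (e_ m)) z.
Proof.
move=> gL z1; have GL := L2_wfun_L1 alpha_gtN1 gL.
have [C HC] := kernel_bounded z1.
have KL : cL1 lebC B (fun t => wfun alpha g t * kernel z (of_coords t)).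
  by apply: (cL1M_bounded (M := C) GL (kernel_measurable z1)) => t; exact: HC.
have eL m : cL1 lebC B (fun t => wfun alpha g t * (e_ m z * (e_ m (of_coords t))^*)).
  have [M HM] := monomial_bounded alpha m.
  apply: (cL1M_bounded (M := normc (e_ m z) * M) GL) => [|t Bt].
    apply: cmeasM; first exact: cmeas_cst.
    by apply: cmeasJ; exact: (monomial_measurable alpha m).
  by rewrite normcM normcJ ler_wpM2l ?normc_ge0// HM.
have SE N : complex_integral lebC B (fun t => wfun alpha g t *
      \sum_(m <- degree_lt N) e_ m z * (e_ m (of_coords t))^*) =
    \sum_(m <- degree_lt N) ip g (e_ m) * e_ m z.
  under eq_fun do rewrite mulr_sumr.
  rewrite (cint_sum mB _ _ eL); apply: eq_bigr => m _.
  rewrite ip_alphaE -(cintZr mB _ (ip_L1 gL (monomial_L2 alpha_gtN1 m))).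
  apply: eq_cint => t _; rewrite /wfun /ip_fun.
  move: (g _) (e_ m _) (e_ m _)^* (dv t)%:C => p q r d.
  have alg : p * d * (q * r) = p * r * d * q by ring.
  exact: alg.
have sL N : cL1 lebC B (fun t => wfun alpha g t * \sum_(m <- degree_lt N) e_ m z * (e_ m (of_coords t))^*).
  under eq_fun do rewrite mulr_sumr.
  exact: (cL1_sum mB _ _ eL).
set I := \int[lebC]_(t in B) normc (wfun alpha g t).
have I0 : 0 <= I by apply: Rintegral_ge0 => t _; exact: normc_ge0.
apply/eqP; rewrite -subr_eq0 -normc_eq0 eq_le normc_ge0 andbT; apply/ler_addgt0Pr => e e0.
rewrite add0r; have e20 : 0 < e / 2 by rewrite divr_gt0.
have I1 : 0 < I + 1 by rewrite ltr_wpDl.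
have d0 : 0 < e / 4 / (I + 1) by rewrite !divr_gt0.
have [N1 H1] := kernel_uniform alpha_gtN1 z1 d0.
have [N2 H2] := has_csum_degree (bergman_sum_has_csum alpha_gtN1 (bessel_ell2 alpha_gtN1 gL) z1) e20.
pose N := maxn N1 N2.
apply: le_trans (normc_tri _ (\sum_(m <- degree_lt N) ip g (e_ m) * e_ m z) _) _.
rewrite (splitr e); apply: lerD; last first.
  by rewrite normc_sub; apply: H2; rewrite leq_maxr.
rewrite -SE -(cintB mB KL (sL N)).
apply: le_trans (cint_le mB (g := fun t => e / 4 / (I + 1) * normc (wfun alpha g t)) _ _ _) _.
- exact: (cL1B mB KL (sL N)).
- exact: (integrableZ_fin mB _ (cL1_normc GL)).
- move=> t Bt; rewrite -mulrBr normcM mulrC; apply: ler_wpM2r; first exact: normc_ge0.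
  by apply: H1 => //; rewrite leq_maxl.
rewrite (RintegralZl _ mB (cL1_normc GL)) -/I.
have : e / 4 / (I + 1) * I <= e / 4.
  by rewrite -mulrA ler_piMr ?divr_ge0 ?(ltW e0)// mulrC ler_pdivrMr// mul1r lerDl.
by move: (_ * I) => p; lra.
Qed.

Lemma toeplitz_fun_series a f : Linfty a ->
  toeplitz_fun alpha a f = bergman_sum (fun m => ip (fun z => a z * f z) (e_ m)).
Proof.
move=> aL; have afL := Linfty_mul_L2 aL (bergman_L2 f).
apply/funext => z; rewrite /toeplitz_fun; have [z1|z1] := pselect (ball1 z).
  rewrite (mem_set z1).
  rewrite -(kernel_integral afL z1); apply: eq_cint => t _; rewrite /wfun.
  move: (a _) (f _) (kernel _ _) (dv t)%:C => p q r d.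
  have alg : p * q * r * d = p * q * d * r by ring.
  exact: alg.
by rewrite bergman_sum_out// memNset.
Qed.

(** The integral is a series of monomials with square-summable coefficients, hence an element of the
    space, and the default of [insubd] does not occur. *)
Lemma toeplitzE a f z : Linfty a -> toeplitz alpha a f z = toeplitz_fun alpha a f z.
Proof.
move=> aL; rewrite /toeplitz /= val_insubd ifT// toeplitz_fun_series//.
apply: bergman_sum_bergman => //; apply: bessel_ell2 => //.
by apply: Linfty_mul_L2 => //; exact: bergman_L2.
Qed.

Lemma coefficients_toeplitz a f m : Linfty a ->
  U (toeplitz alpha a f) m = ip (fun z => a z * f z) (e_ m).
Proof.
move=> aL; rewrite coefficientsE//.
have -> : (toeplitz alpha a f : 'rV[R[i]]_n -> R[i]^o) = bergman_sum (fun m => ip (fun z => a z * f z) (e_ m)).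
  by rewrite -toeplitz_fun_series//; apply/funext => z; exact: toeplitzE.
apply: ip_bergman_sum => //; apply: bessel_ell2 => //.
by apply: Linfty_mul_L2 => //; exact: bergman_L2.
Qed.

Local Opaque coefficients toeplitz.

Lemma toeplitz_bounded a : Linfty a ->
  bounded_operator (bergman_ip alpha) (bergman_ip alpha) (toeplitz (n := n) alpha a).
Proof.
move=> aL; have afL f := Linfty_mul_L2 aL (bergman_L2 f); split.
  move=> c f g; apply: (coefficients_inj alpha_gtN1); apply: ell2_ext => m.
  rewrite (coefficients_linear alpha_gtN1); apply: etrans _ (esym (ell2D _ _ _ _)).
  apply: etrans (coefficients_toeplitz _ m aL) _.
  have E : (fun z => a z * (c *: f + g : H) z) = (fun z => c * (a z * f z) + a z * g z) :> ('rV[R[i]]_n -> R[i]^o).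
    apply/funext => z; rewrite -[(c *: f + g : H) z]/(c * f z + g z).
    have alg (p q r : R[i]) : p * (c * q + r) = c * (p * q) + p * r by ring.
    exact: alg.
  rewrite E; apply: etrans (ip_lin c (afL f) (afL g) (monomial_L2 alpha_gtN1 m)) _.
  exact: (congr2 (fun p q : R[i] => c * p + q) (esym (coefficients_toeplitz f m aL))
    (esym (coefficients_toeplitz g m aL))).
have [ma [M aM]] := aL; exists `|M| => f; rewrite !hnorm_bergman//.
rewrite -ler_sqr ?nnegrE ?mulr_ge0 ?ell2_norm_ge0// exprMn real_normK ?num_real//.
apply: ell2_norm2_le => F; under eq_bigr do rewrite coefficients_toeplitz//.
apply: le_trans (bessel alpha_gtN1 F (afL f)) _.
rewrite -nsq_coefficients//.
by have [] := L2_mul_bounded ma aM (bergman_L2 f).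
Qed.

End toeplitz_operators.

(** * From the ball to the moduli of its points *)

Section modulus_transfer.
Context {R : realType} {n : nat}.
Local Notation CC := (measurableTypeR R * measurableTypeR R)%type.
Local Notation RR := (measurableTypeR R).
Local Notation lebC := (@lebesgue_C R n).
Local Notation lebR := (@lebesgue_R R n).
Local Notation B := (@ball_coords R n).
Local Notation mB := (@measurable_ball_coords R n).
Local Notation tau := (@tau_ball R n).
Implicit Types (z : 'rV[R[i]]_n) (t : n.-tuple CC) (r : n.-tuple RR).

Definition radii t : n.-tuple RR := tmap (fun=> @plane_norm R) t.

Definition real_point r : 'rV[R[i]]_n := \row_j (tnth r j)%:C.

Lemma tnth_radii t j : tnth (radii t) j = normc (of_coords t 0 j).
Proof. by rewrite tnth_mktuple mxE; case: (tnth t j). Qed.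

Lemma modulus_of_coords t : modulus (of_coords t) = real_point (radii t).
Proof. by apply/rowP => j; rewrite [LHS]mxE [RHS]mxE tnth_radii. Qed.

Lemma tau_ballP r : tau r <-> (forall j, 0 <= tnth r j) /\ \sum_(j < n) tnth r j ^+ 2 < 1.
Proof.
split=> [[z z1 rz]|[r0 r1]].
  split=> [j|]; first by rewrite rz normc_ge0.
  by under eq_bigr do rewrite rz.
exists (real_point r) => [|j]; last by rewrite mxE normc_real ger0_norm.
rewrite /ball1 /norm2 /=; under eq_bigr do rewrite mxE normc_real real_normK ?num_real//.
by [].
Qed.

Lemma ball_radii t : B t <-> tau (radii t).
Proof.
split=> [Bt|/tau_ballP[_]].
  by exists (of_coords t) => // j; exact: tnth_radii.
rewrite /ball_coords /ball1 /norm2 /=; under eq_bigr do rewrite tnth_radii.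
by [].
Qed.

Lemma measurable_radii : measurable_fun setT radii.
Proof. by apply: measurable_tmap => i; exact: measurable_plane_norm. Qed.

Lemma measurable_tau_ball : measurable tau.
Proof.
have -> : tau = (\bigcap_(j in [set: 'I_n]) (fun r => tnth r j) @^-1` `[0, +oo[) `&`
    (fun r => \sum_(j < n) tnth r j ^+ 2) @^-1` `]-oo, 1[.
  apply/seteqP; split => r.
    by move=> /tau_ballP[r0 r1]; split => /=; [move=> j _ /=; rewrite in_itv /= r0|rewrite in_itv].
  by move=> [r0 /=]; rewrite in_itv /= => r1; apply/tau_ballP; split=> // j;
    have := r0 j I; rewrite /= in_itv /= andbT.
have mt j : measurable_fun setT (fun r : n.-tuple RR => tnth r j) := measurable_tnth j.
apply: measurableI.
  apply: fin_bigcap_measurable => // j _; rewrite -[X in measurable X]setTI.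
  by apply: mt.
rewrite -[X in measurable X]setTI.
have ms : measurable_fun setT (fun r : n.-tuple RR => \sum_(j < n) tnth r j ^+ 2).
  by apply: measurable_sum => j; apply: measurable_funX; exact: mt.
exact: ms.
Qed.

Definition radial_weight r : R := \prod_(j < n) radial_density (tnth r j).

Lemma radial_weight_ge0 r : 0 <= radial_weight r.
Proof. by apply: prodr_ge0 => j _; exact: radial_density_ge0. Qed.

Lemma measurable_radial_weight : measurable_fun setT radial_weight.
Proof.
apply: measurable_prod => j _.
exact: (measurableT_comp (@measurable_radial_density R) (measurable_tnth j)).
Qed.

Lemma ge0_integral_radii (F : n.-tuple RR -> \bar R) : measurable_fun tau F ->
  (forall r, tau r -> 0 <= F r)%E ->
  (\int[lebC]_(t in B) F (radii t) = \int[lebR]_(r in tau) (F r * (radial_weight r)%:E))%E.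
Proof.
move=> mF F0.
have mFr : measurable_fun setT (F \_ tau) by apply/(measurable_restrictT _ _).1 => //; exact: measurable_tau_ball.
have F0r r : (0 <= (F \_ tau) r)%E by rewrite patchE; case: ifPn => // /set_mem; exact: F0.
rewrite integral_mkcond [RHS]integral_mkcond.
transitivity (\int[lebC]_t (F \_ tau) (radii t))%E.
  apply: eq_integral => t _; rewrite !patchE.
  by rewrite (_ : (t \in B) = (radii t \in tau)) //; apply/idP/idP => /set_mem /ball_radii /mem_set.
rewrite [LHS](ge0_integral_modulus mFr F0r); apply: eq_integral => r _.
by rewrite !patchE; case: ifP => // _; rewrite mul0e.
Qed.

Lemma Rintegral_radii (F : n.-tuple RR -> R) : measurable_fun tau F ->
  \int[lebC]_(t in B) F (radii t) = \int[lebR]_(r in tau) (F r * radial_weight r).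
Proof.
move=> mF; rewrite /Rintegral integralE [in RHS]integralE; congr (fine (_ - _)).
- transitivity (\int[lebC]_(t in B) (EFin \o F)^\+%E (radii t))%E.
    by apply: eq_integral => t _; rewrite !funeposE.
  rewrite ge0_integral_radii//; last exact/measurable_funepos/measurable_EFinP.
  apply: eq_integral => r _; rewrite !funeposE /= EFinM maxeMl ?lee_fin ?radial_weight_ge0// ?mul0e//.
- transitivity (\int[lebC]_(t in B) (EFin \o F)^\-%E (radii t))%E.
    by apply: eq_integral => t _; rewrite !funenegE.
  rewrite ge0_integral_radii//; last exact/measurable_funeneg/measurable_EFinP.
  apply: eq_integral => r _; rewrite !funenegE /= -mulNr EFinM maxeMl ?lee_fin ?radial_weight_ge0// ?mul0e//.
Qed.

Lemma cint_radii (F : n.-tuple RR -> R[i]) : complex_measurable tau F ->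
  complex_integral lebC B (fun t => F (radii t)) =
  complex_integral lebR tau (fun r => F r * (radial_weight r)%:C).
Proof.
move=> [m1 m2]; apply/eqP; rewrite eq_complex /=; apply/andP; split; apply/eqP.
- rewrite (@Rintegral_radii (fun r => complex.Re (F r)))//.
  by apply: eq_Rintegral => r _; rewrite ReM /= mulr0 subr0.
- rewrite (@Rintegral_radii (fun r => complex.Im (F r)))//.
  by apply: eq_Rintegral => r _; rewrite ImM /= mulr0 add0r.
Qed.

Lemma cL1_radii (F : n.-tuple RR -> R[i]) : complex_measurable tau F ->
  cL1 lebC B (fun t => F (radii t)) -> cL1 lebR tau (fun r => F r * (radial_weight r)%:C).
Proof.
move=> mF [_ Foo]; split.
  by apply: cmeasM => //; apply: cmeas_real; exact: measurable_funTS measurable_radial_weight.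
move: Foo; rewrite (@ge0_integral_radii (fun r => (normc (F r))%:E)).
- apply: le_lt_trans; rewrite le_eqVlt; apply/orP; left; apply/eqP; apply: eq_integral => r _.
  by rewrite normcM normc_real ger0_norm ?radial_weight_ge0.
- by apply/measurable_EFinP; exact: measurable_normc.
- by move=> r _; rewrite lee_fin normc_ge0.
Qed.

(** Real points form a null set, yet measurability restricts to them: it refers to the product of
    Borel sigma-algebras, and the embedding of real points is measurable. *)
Lemma cmeas_real_point (a : 'rV[R[i]]_n -> R[i]) : ball_measurable a ->
  complex_measurable tau (fun r => a (real_point r)).
Proof.
move=> ma; pose j0 (r : n.-tuple RR) : n.-tuple CC := tmap (fun=> fun x : RR => (x, 0 : RR)) r.
have E r : of_coords (j0 r) = real_point r.
  by apply/rowP => j; rewrite !mxE tnth_mktuple.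
have mj : measurable_fun setT j0.
  by apply: measurable_tmap => i; apply/measurable_fun_pairP; split; [exact: measurable_id|exact: measurable_cst].
rewrite (_ : (fun r => _) = fun r => (a \o @of_coords R n) (j0 r)).
  apply: (cmeas_comp mB _ ma) => [r /tau_ballP[r0 r1]|]; last exact: measurable_funTS.
  rewrite /ball_coords /ball1 /= E /norm2.
  by under eq_bigr do rewrite mxE normc_real real_normK ?num_real//.
by apply/funext => r; rewrite /= E.
Qed.

End modulus_transfer.

Section symmetric_symbols.
Context {R : realType} {n : nat} (alpha : R) (alpha_gtN1 : -1 < alpha).
Local Notation CC := (measurableTypeR R * measurableTypeR R)%type.
Local Notation lebC := (@lebesgue_C R n).
Local Notation lebR := (@lebesgue_R R n).
Local Notation B := (@ball_coords R n).
Local Notation dv := (dv alpha).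
Local Notation mB := (@measurable_ball_coords R n).
Local Notation e_ := (@monomial R n alpha).
Local Notation ip := (@ip_alpha R n alpha).
Local Notation L2 := (@L2_alpha R n alpha).
Local Notation nsq := (@nsq R n alpha).
Local Notation index := {ffun 'I_n -> nat}.
Local Notation partial_sum := (@partial_sum R n alpha).
Local Notation U := (coefficients (n := n) alpha).
Local Notation H := (bergman n alpha).
Local Notation tau := (@tau_ball R n).
Implicit Types (z w : 'rV[R[i]]_n) (t : n.-tuple CC) (g h : 'rV[R[i]]_n -> R[i]^o) (f : H)
  (a b : 'rV[R[i]]_n -> R[i]) (m k : index).

Lemma ae_eq_cint (F G : n.-tuple CC -> R[i]) : complex_measurable B F -> complex_measurable B G ->
  {ae lebC, forall t, B t -> F t = G t} -> complex_integral lebC B F = complex_integral lebC B G.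
Proof.
move=> [F1 F2] [G1 G2] FG; congr (_ +i* _); rewrite /Rintegral; congr fine;
  apply: ae_eq_integral => //; try exact/measurable_EFinP; try exact: mB.
- by apply: filterS FG => t FG Bt; rewrite FG.
- by apply: filterS FG => t FG Bt; rewrite FG.
Qed.

Lemma ip_fun_measurable g h : ball_measurable g -> ball_measurable h -> complex_measurable B (ip_fun alpha g h).
Proof.
move=> mg mh; apply: cmeasM; last by apply: cmeas_real; exact: measurable_funTS (measurable_dv alpha).
by apply: cmeasM => //; exact: cmeasJ.
Qed.

Lemma ip_ae a b g h : ball_measurable a -> ball_measurable b -> ball_measurable g -> ball_measurable h ->
  {ae lebC, forall t, B t -> a (of_coords t) = b (of_coords t)} ->
  ip (fun z => a z * g z) h = ip (fun z => b z * g z) h.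
Proof.
move=> ma mb mg mh ab; rewrite !ip_alphaE; apply: ae_eq_cint.
- exact: (ip_fun_measurable (cmeasM ma mg) mh).
- exact: (ip_fun_measurable (cmeasM mb mg) mh).
- by apply: filterS ab => t ab Bt; rewrite /ip_fun ab.
Qed.

Lemma modulus_scale1 j u z : normc u = 1 -> modulus (scale1 j u z) = modulus z.
Proof.
move=> u1; apply/rowP => i; rewrite mxE scale1E [RHS]mxE; case: eqP => // _.
by rewrite normcM u1 mul1r.
Qed.

Lemma modulus_measurable a : ball_measurable a -> ball_measurable (a \o modulus).
Proof.
move=> ma; rewrite /ball_measurable (_ : _ \o _ = fun t => a (real_point (radii t))).
  apply: (cmeas_comp (@measurable_tau_ball R n) _ (cmeas_real_point ma)).
    by move=> t /ball_radii.
  exact: measurable_funTS (@measurable_radii R n).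
by apply/funext => t; rewrite /= modulus_of_coords.
Qed.

Lemma perm_of_coords s t : of_coords (permute s t) = col_perm s (of_coords t).
Proof. by apply/rowP => j; rewrite !mxE tnth_mktuple. Qed.

Lemma norm2_col_perm (s : 'S_n) z : norm2 (col_perm s z) = norm2 z.
Proof.
rewrite [RHS](reindex_inj (@perm_inj _ s)); apply: eq_bigr => j _.
by rewrite mxE.
Qed.

Lemma monomial_perm (s : 'S_n) m z : e_ m (col_perm s z) = e_ [ffun j => m (s^-1%g j)] z.
Proof.
rewrite /monomial.
have -> : mdeg [ffun j => m (s^-1%g j)] = mdeg m.
  rewrite /mdeg [RHS](reindex_inj (@perm_inj _ s^-1%g)); apply: eq_bigr => j _; by rewrite ffunE.
have -> : mfact [ffun j => m (s^-1%g j)] = mfact m.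
  rewrite /mfact [RHS](reindex_inj (@perm_inj _ s^-1%g)); apply: eq_bigr => j _; by rewrite ffunE.
congr (_ * _); rewrite [RHS](reindex_inj (@perm_inj _ s)); apply: eq_bigr => j _.
by rewrite mxE ffunE permK.
Qed.

Section symbol.
Variables (a : 'rV[R[i]]_n -> R[i]) (sa : symmetric_separately_radial a).

Let aL : Linfty a := sa.1.
Let ma : ball_measurable a := aL.1.

Lemma symbol_modulus : {ae lebC, forall t, B t -> a (of_coords t) = (a \o modulus) (of_coords t)}.
Proof. by apply: filterS sa.2 => t Ht /Ht[]. Qed.

Lemma symbol_perm (s : 'S_n) : {ae lebC, forall t, B t -> a (col_perm s (of_coords t)) = a (of_coords t)}.
Proof. by apply: filterS sa.2 => t Ht /Ht[_]. Qed.

Lemma Linfty_modulus : Linfty (a \o modulus).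
Proof.
have [_ [M aM]] := aL; split; first exact: modulus_measurable.
exists M; apply: filterS2 symbol_modulus aM => t E aM Bt.
by rewrite -E//; exact: aM.
Qed.

(** Replaces [a], radial only almost everywhere, by a function that is rotation invariant at every
    point of the ball. *)
Lemma ip_symbol_modulus g h : ball_measurable g -> ball_measurable h ->
  ip (fun z => a z * g z) h = ip (fun z => (a \o modulus) z * g z) h.
Proof.
by move=> mg mh; apply: ip_ae => //; [exact: modulus_measurable|exact: symbol_modulus].
Qed.

Lemma symbol_monomial_L2 k : L2 (fun z => a z * e_ k z).
Proof. by apply: Linfty_mul_L2 => //; exact: monomial_L2. Qed.

Lemma ip_symbol_offdiag k m : k != m -> ip (fun z => a z * e_ k z) (e_ m) = 0.
Proof.
move=> km; rewrite ip_symbol_modulus; [|exact: monomial_measurable|exact: monomial_measurable].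
apply: ip_monomial_radial => //.
  by move=> j u z u1 _ /=; rewrite modulus_scale1.
by apply: Linfty_mul_L2; [exact: Linfty_modulus|exact: monomial_L2].
Qed.

(** Only the m-th term of a partial sum of [f] contributes. Multiplication by [a] enlarges the
    squared norm of the remainder by at most [M^2], so its coefficient tends to 0. *)
Lemma ip_symbol f m : ip (fun z => a z * f z) (e_ m) = U f m * ip (fun z => a z * e_ m z) (e_ m).
Proof.
have [_ [M aM]] := aL; have fL := bergman_L2 f.
apply/eqP; rewrite -subr_eq0 -normc_eq0 eq_le normc_ge0 andbT.
rewrite -(@ler_sqr _ _ 0) ?nnegrE ?normc_ge0// expr0n; apply/ler_addgt0Pr => e e0; rewrite add0r.
have M1 : 0 < M ^+ 2 + 1 by rewrite ltr_wpDl ?sqr_ge0.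
have d0 : 0 < e / (M ^+ 2 + 1) by rewrite divr_gt0.
have [N0 HN0] := nsq_bergman_sum_tail alpha_gtN1 (ell2P (U f)) d0.
pose N := maxn N0 (mdeg m).+1; have := HN0 N (leq_maxl _ _).
have -> : bergman_sum alpha (U f) = f by rewrite -[in RHS](coefficientsK alpha_gtN1 f).
set S := partial_sum _ _; set h : 'rV[R[i]]_n -> R[i]^o := (fun z => _) => hd.
have SL : L2 S by exact: partial_sum_L2.
have hL : L2 h by exact: L2_lin.
have [ahL ahN] := L2_mul_bounded ma aM hL.
have aSL := Linfty_mul_L2 aL SL; have afL := Linfty_mul_L2 aL fL.
have eL := monomial_L2 alpha_gtN1 m.
have E : ip (fun z => a z * h z) (e_ m) =
    ip (fun z => a z * f z) (e_ m) - U f m * ip (fun z => a z * e_ m z) (e_ m).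
  have -> : (fun z => a z * h z) = (fun z => -1 * (a z * S z) + a z * f z) :> ('rV[R[i]]_n -> R[i]^o).
    apply/funext => z; rewrite /h; have alg (p q r : R[i]) : p * (-1 * q + r) = -1 * (p * q) + p * r by ring.
    exact: alg.
  rewrite (ip_lin (-1) aSL afL eL) mulN1r addrC; congr (_ - _).
  have -> : (fun z => a z * S z) = (fun z => \sum_(k <- degree_lt N) U f k * (a z * e_ k z)) :> ('rV[R[i]]_n -> R[i]^o).
    apply/funext => z; rewrite /S /partial_sum mulr_sumr; apply: eq_bigr => k _.
    by rewrite mulrCA.
  rewrite (ip_suml _ _ symbol_monomial_L2 eL) (big_fsetD1 m) ?mem_degree_lt ?leq_maxr//=.
  rewrite big_seq big1 ?addr0// => k; rewrite in_fsetD1 => /andP[km _].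
  by rewrite ip_symbol_offdiag ?mulr0.
rewrite -E; apply: le_trans (normc_ip_le alpha_gtN1 m ahL) _.
apply: le_trans ahN _; apply: (@le_trans _ _ (M ^+ 2 * (e / (M ^+ 2 + 1)))).
  by rewrite ler_wpM2l ?sqr_ge0.
by rewrite mulrA ler_pdivrMr// mulrC ler_wpM2l ?(ltW e0)// lerDl.
Qed.

(** A permutation of the coordinates preserves the measure and the weight, fixes [a] almost
    everywhere, and permutes the exponents of the monomial. *)
Lemma ip_symbol_perm (s : 'S_n) m :
  ip (fun z => a z * e_ m z) (e_ m) =
  ip (fun z => a z * e_ [ffun j => m (s^-1%g j)] z) (e_ [ffun j => m (s^-1%g j)]).
Proof.
set m' : index := [ffun j => _].
have mF k : complex_measurable B (ip_fun alpha (fun z => a z * e_ k z : R[i]^o) (e_ k)).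
  by apply: ip_fun_measurable; [apply: cmeasM => //|]; exact: monomial_measurable.
have pB t : B (permute s t) <-> B t.
  by rewrite /ball_coords /ball1 /= perm_of_coords norm2_col_perm.
have mp := measurable_permute (T := CC) s.
have E := cint_preserving (phi := permute s) mB pB (@ge0_integral_permC R n s) (mF m).
rewrite !ip_alphaE; apply: etrans (esym E) _; apply: ae_eq_cint.
- exact: (cmeas_preserving mp mB pB (mF m)).
- exact: mF.
apply: filterS (symbol_perm s) => t at_ Bt.
have dvE : dv (permute s t) = dv t by rewrite /dv /dv_alpha perm_of_coords norm2_col_perm.
by rewrite /comp /ip_fun dvE perm_of_coords (at_ Bt) (monomial_perm s m (of_coords t)).
Qed.

(** The integrand depends on the moduli alone. Polar coordinates contribute [(2 disc_area)^n]; the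
    volume of the ball cancels [disc_area^n] and leaves the [2^n] of [gamma]. *)
Lemma ip_symbol_gamma m : ip (fun z => a z * e_ m z) (e_ m) = gamma alpha a m.
Proof.
have eM := monomial_measurable alpha m; rewrite ip_symbol_modulus//.
have amL : L2 (fun z => (a \o modulus) z * e_ m z).
  by apply: Linfty_mul_L2; [exact: Linfty_modulus|exact: monomial_L2].
pose p r : R := \prod_(j < n) tnth r j ^+ (2 * m j) * (1 - \sum_(j < n) tnth r j ^+ 2) `^ alpha.
pose Psi r : R[i] := a (real_point r) * (p r)%:C.
pose G r : R[i] := a (real_point r) * (p r * \prod_(j < n) tnth r j)%:C.
pose c2 : R := Num.sqrt (Gamma (n%:R + (mdeg m)%:R + alpha + 1) /
    ((mfact m)%:R * Gamma (n%:R + alpha + 1))) ^+ 2.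
(* The squared normalization of the monomial times the constant of the density [dv_alpha]. *)
pose Q : R := c2 * (@c_alpha R n alpha / fine (lebC B)).
pose K : R := (2 * @disc_area R) ^+ n.
have fE t : ip_fun alpha (fun z => (a \o modulus) z * e_ m z) (e_ m) t = Q%:C * Psi (radii t).
  have dE : dv t = @c_alpha R n alpha * (1 - \sum_(j < n) tnth (radii t) j ^+ 2) `^ alpha / fine (lebC B).
    rewrite /dv /dv_alpha /norm2; congr (_ * (1 - _) `^ _ / _).
    by apply: eq_bigr => j _; rewrite tnth_radii.
  have eE : normc (e_ m (of_coords t)) ^+ 2 = c2 * \prod_(j < n) tnth (radii t) j ^+ (2 * m j).
    rewrite {1}/monomial normcM exprMn normc_real real_normK ?num_real// -/c2 normc_prod -prodrXl.
    by congr (_ * _); apply: eq_bigr => j _; rewrite normcX -exprM mulnC -tnth_radii.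
  have H : normc (e_ m (of_coords t)) ^+ 2 * dv t = Q * p (radii t).
    have alg (x y u v c : R) : c * x * (u * y * v) = c * (u * v) * (x * y) by ring.
    rewrite dE eE /Q /p; exact: alg.
  rewrite /ip_fun /Psi /comp modulus_of_coords -(mulrA (a _)) mulcJ -mulrA -real_complexM H.
  by rewrite real_complexM mulrCA.
have Q0 : Q != 0.
  rewrite mulf_neq0//; last by rewrite gt_eqF// divr_gt0 ?c_alpha_gt0 ?ball_volume_gt0.
  have s0 := exponent_gt0 (n := n) alpha_gtN1.
  rewrite /c2 (monomial_coef2 alpha_gtN1) gt_eqF//; apply: divr_gt0.
    by apply: mulr_gt0; [exact: binc_gt0|rewrite ltr0n fact_gt0].
  by rewrite ltr0n prodn_gt0// => j; rewrite fact_gt0.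
have K0 : 0 < K by rewrite exprn_gt0// mulr_gt0// disc_area_gt0.
have mp : measurable_fun tau p.
  apply: measurable_funTS; apply: measurable_funM.
    by apply: measurable_prod => j _; apply: measurable_funX; exact: measurable_tnth.
  apply: (measurableT_comp (measurable_powR alpha)); apply: measurable_funB => //.
  by apply: measurable_sum => j; apply: measurable_funX; exact: measurable_tnth.
have mPsi : complex_measurable tau Psi.
  by apply: cmeasM; [exact: cmeas_real_point|exact: cmeas_real].
have PL : cL1 lebC B (fun t => Psi (radii t)).
  have := cL1Z mB (Q^-1)%:C (ip_L1 amL (monomial_L2 alpha_gtN1 m)).
  apply: eq_cL1 => t _; rewrite fE mulrA -real_complexM mulVf// mul1r.
  by [].
have wE r : tau r -> Psi r * (radial_weight r)%:C = K%:C * G r.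
  move=> /tau_ballP[r0 _]; rewrite /Psi /G mulrCA -mulrA -!real_complexM; congr (_ * _%:C).
  have -> : radial_weight r = K * \prod_(j < n) tnth r j.
    rewrite /radial_weight /K -[n in _ ^+ n]card_ord -prodr_const -big_split /=.
    by apply: eq_bigr => j _; rewrite /radial_density max_l.
  by rewrite mulrCA.
have GL : cL1 lebR tau G.
  have := cL1Z (@measurable_tau_ball R n) (K^-1)%:C (cL1_radii mPsi PL).
  apply: eq_cL1 => r /set_mem tr; rewrite wE// mulrA -real_complexM mulVf ?gt_eqF// mul1r.
  by [].
rewrite ip_alphaE (_ : ip_fun _ _ _ = fun t => Q%:C * Psi (radii t)); last exact/funext.
rewrite (cintZ mB _ PL) cint_radii//.
have -> : complex_integral lebR tau (fun r => Psi r * (radial_weight r)%:C) =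
    K%:C * complex_integral lebR tau G.
  rewrite -(cintZ (@measurable_tau_ball R n) _ GL); apply: eq_cint => r /set_mem; exact: wE.
rewrite mulrA -real_complexM /gamma; congr (_%:C * _).
rewrite /Q /K /c2 sqr_sqrtr; last by rewrite divr_ge0 ?mulr_ge0 ?Gamma_ge0.
rewrite ball_volume [fine _]/= /c_alpha exprMn.
have h1 : n`!%:R != 0 :> R by rewrite pnatr_eq0 -lt0n fact_gt0.
have h2 : @disc_area R ^+ n != 0 by rewrite gt_eqF// disc_area_gt0'.
have h3 : Gamma (alpha + 1) != 0 by rewrite gt_eqF// Gamma_gt0//; move: alpha_gtN1; lra.
have h4 : Gamma (n%:R + alpha + 1) != 0 by rewrite gt_eqF// Gamma_gt0// exponent_gt0.
have h5 : (mfact m)%:R != 0 :> R by rewrite pnatr_eq0 -lt0n prodn_gt0// => j; rewrite fact_gt0.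
move: (Gamma (n%:R + alpha + 1)) h4 (Gamma (alpha + 1)) h3 (Gamma _) => d h4 c h3 e.
move: (n`!%:R : R) (disc_area ^+ n) (mfact m)%:R (2 ^+ n) h1 h2 h5 => x y u v h1 h2 h5.
by field; rewrite h1 h2 h3 h4 h5.
Qed.

End symbol.

Lemma gamma_rearrangement a iota m : symmetric_separately_radial a -> rearrangements iota m ->
  gamma alpha a m = gamma alpha a iota.
Proof.
move=> sa [s ->]; apply: etrans (esym (ip_symbol_gamma sa _)) _.
apply: etrans _ (ip_symbol_gamma sa iota); apply: etrans _ (esym (ip_symbol_perm sa s^-1%g iota)).
by rewrite invgK.
Qed.

Lemma coefficients_toeplitz_gamma a f m : symmetric_separately_radial a ->
  U (toeplitz alpha a f) m = gamma alpha a m * U f m.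
Proof.
move=> sa; apply: etrans (coefficients_toeplitz alpha_gtN1 f m sa.1) _.
by rewrite (ip_symbol sa) (ip_symbol_gamma sa) mulrC.
Qed.

End symmetric_symbols.

(** * Diagonal operators and direct sums *)

Section diagonal_sequences.
Context {R : realType} {I : choiceType}.
Local Notation norml x := (hnorm (@ell2_ip R I) x).
Implicit Types (x y : ell2 R I) (i : I) (b : I -> R[i]).

Lemma sum_normc2_delta i (F : {fset I}) (c : R[i]) :
  \sum_(k <- F) normc (if k == i then c else 0) ^+ 2 <= normc c ^+ 2.
Proof.
have [iF|iF] := boolP (i \in F).
  rewrite (big_fsetD1 i)//= eqxx big_seq big1 ?addr0// => k.
  by rewrite in_fsetD1 => /andP[/negPf-> _]; rewrite normc0 expr0n.
rewrite big_seq big1 ?sqr_ge0// => k kF; case: eqP => [ki|_]; last by rewrite normc0 expr0n.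
by move: iF; rewrite -ki kF.
Qed.

Lemma delta_summable i : (\esum_(k in [set: I]) (normc (if k == i then 1 else 0 : R[i]) ^+ 2)%:E < +oo)%E.
Proof. by apply: esum_bounded => F; exact: sum_normc2_delta. Qed.

Definition delta i : ell2 R I := ell2_of (delta_summable i).

Lemma deltaE i k : delta i k = if k == i then 1 else 0. Proof. by []. Qed.

Lemma norm_delta i : norml (delta i) <= 1.
Proof.
rewrite -ler_sqr ?nnegrE ?ell2_norm_ge0// expr1n.
by apply: ell2_norm2_le => F; apply: le_trans (sum_normc2_delta _ _ _) _; rewrite normc1 expr1n.
Qed.

Lemma ell2_ip_single x y i : (forall k, k != i -> x k = 0) -> ell2_ip x y = x i * (y i)^*.
Proof.
move=> x0; apply: has_csum_unique (ell2_ip_has_csum x y) _ => e e0.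
exists [fset i]%fset => F; rewrite fsub1set => iF.
rewrite (big_fsetD1 i)//= big_seq big1 ?addr0 ?subrr ?normc0 ?ltW// => k.
by rewrite in_fsetD1 => /andP[/x0-> _]; rewrite mul0r.
Qed.

Lemma ell2_norm_diagonal x y (M : R) : 0 <= M -> (forall i, normc (y i) <= M * normc (x i)) ->
  norml y <= M * norml x.
Proof.
move=> M0 H; rewrite -ler_sqr ?nnegrE ?mulr_ge0 ?ell2_norm_ge0// exprMn.
apply: ell2_norm2_le => F; apply: (@le_trans _ _ (M ^+ 2 * \sum_(i <- F) normc (x i) ^+ 2)).
  rewrite mulr_sumr; apply: ler_sum => i _; rewrite -exprMn.
  by rewrite lerXn2r ?nnegrE ?normc_ge0// mulr_ge0 ?normc_ge0.
by rewrite ler_wpM2l ?sqr_ge0// ell2_norm2_sup.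
Qed.

(** A triangle inequality with a spare factor 2, sufficient to bound the set whose supremum is
    [opnorm]. *)
Lemma ell2_normB x y : norml (x - y) <= 2 * (norml x + norml y).
Proof.
have p0 : 0 <= norml x + norml y by rewrite addr_ge0 ?ell2_norm_ge0.
rewrite -ler_sqr ?nnegrE ?mulr_ge0 ?ell2_norm_ge0//.
apply: ell2_norm2_le => F.
apply: (@le_trans _ _ (2 * \sum_(i <- F) normc (x i) ^+ 2 + 2 * \sum_(i <- F) normc (y i) ^+ 2)).
  rewrite !mulr_sumr -big_split; apply: ler_sum => i _ /=.
  apply: (@le_trans _ _ ((normc (x i) + normc (y i)) ^+ 2)).
    by rewrite lerXn2r ?nnegrE ?addr_ge0 ?normc_ge0//; exact: normcB.
  have := sqr_ge0 (normc (x i) - normc (y i)); rewrite sqrrB => h; rewrite sqrrD; move: h.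
  by move: (normc (x i) * _) (normc (x i) ^+ 2) (normc (y i) ^+ 2) => p q r; lra.
have hx := ell2_norm2_sup x F; have hy := ell2_norm2_sup y F.
have xy := mulr_ge0 (ell2_norm_ge0 x) (ell2_norm_ge0 y).
have alg (a b : R) : (2 * (a + b)) ^+ 2 = 4 * (a ^+ 2 + b ^+ 2) + 8 * (a * b) by ring.
rewrite alg; have sx := sqr_ge0 (norml x); have sy := sqr_ge0 (norml y).
move: (norml x * norml y) (norml x ^+ 2) (norml y ^+ 2) hx hy xy sx sy => p q r.
by move: (\sum_(i <- F) normc (x i) ^+ 2) (\sum_(i <- F) normc (y i) ^+ 2) => u v; lra.
Qed.

Lemma ell2_scale_coord c x i : (c *: x : ell2 R I) i = c * x i. Proof. by []. Qed.

End diagonal_sequences.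

Section diagonal_operators.
Context {R : realType} {I : choiceType} (H : lmodType R[i]) (ipH : H -> H -> R[i]).
Local Notation norml x := (hnorm (@ell2_ip R I) x).
Variables (U : H -> ell2 R I) (V : ell2 R I -> H).
Hypotheses (Ulinear : linear U) (UK : cancel U V) (VK : cancel V U)
  (Uip : forall f g, ell2_ip (U f) (U g) = ipH f g).
Implicit Types (f g : H) (m : I) (S T : H -> H) (b : I -> R[i]).

Let Uinj : injective U := can_inj UK.
Let Ulin c f g m : U (c *: f + g) m = c * U f m + U g m.
Proof. by rewrite Ulinear ell2D. Qed.
Let U0 m : U 0 m = 0.
Proof. by have := Ulin 1 0 0 m; rewrite scale1r addr0 mul1r => /eqP; rewrite -subr_eq subrr eq_sym => /eqP. Qed.
Let Unorm f : hnorm ipH f = norml (U f). Proof. by rewrite /hnorm Uip. Qed.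

Definition diagonal_by S b (M : R) :=
  [/\ 0 <= M, forall m, normc (b m) <= M & forall f m, U (S f) m = b m * U f m].

Definition diagonal S := exists b M, diagonal_by S b M.

Lemma diagonal_bounded S : diagonal S -> bounded_operator ipH ipH S.
Proof.
move=> [b [M [M0 bM Sb]]]; split.
  move=> c f g; apply: Uinj; apply: ell2_ext => m.
  by rewrite Ulin !Sb Ulin mulrDr mulrCA.
exists M => f; rewrite !Unorm; apply: ell2_norm_diagonal => // m.
by rewrite Sb normcM ler_wpM2r ?normc_ge0.
Qed.

Lemma diagonal_conjugate S : diagonal S ->
  bounded_operator (@ell2_ip R I) (@ell2_ip R I) (fun x => U (S (V x))).
Proof.
move=> [b [M [M0 bM Sb]]]; split.
  move=> c x y; apply: ell2_ext => m.
  by rewrite ell2D !Sb !VK ell2D mulrDr mulrCA.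
exists M => x; apply: ell2_norm_diagonal => // m.
by rewrite Sb VK normcM ler_wpM2r ?normc_ge0.
Qed.

(** The bound on the entries is read off from the unit vectors [delta m], which [S] multiplies by
    [b m]. *)
Lemma diagonal_of S b : bounded_operator ipH ipH S -> (forall f m, U (S f) m = b m * U f m) -> diagonal S.
Proof.
move=> [_ [M SM]] Sb; exists b, `|M|; split=> // m.
have := SM (V (delta m)); rewrite !Unorm VK => Hm.
have E : U (S (V (delta m))) m = b m by rewrite Sb VK deltaE eqxx mulr1.
rewrite -E; apply: le_trans (ell2_coord_le _ _) (le_trans Hm _).
apply: (@le_trans _ _ (`|M| * norml (delta m))).
  by rewrite ler_wpM2r ?ell2_norm_ge0// ler_norm.
by rewrite ler_piMr// norm_delta.
Qed.

(** Pairing with the preimage of [delta m] isolates the m-th coordinate of [T f]. *)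
Lemma diagonal_adjoint S T : diagonal S -> adjoint ipH ipH S T -> diagonal T.
Proof.
move=> [b [M [M0 bM Sb]]] ST; exists (fun m => (b m)^*), M; split=> [//|m|f m].
  by rewrite normcJ.
have := ST (V (delta m)) f; rewrite -!Uip VK.
have SE k : U (S (V (delta m))) k = if k == m then b m else 0.
  by rewrite Sb VK deltaE; case: eqP => [->|_]; rewrite ?mulr1 ?mulr0.
rewrite (@ell2_ip_single _ _ _ _ m); last by move=> k km; rewrite SE (negPf km).
rewrite (@ell2_ip_single _ _ _ _ m); last by move=> k km; rewrite deltaE (negPf km).
rewrite SE deltaE eqxx mul1r => E; rewrite -[LHS]conjCK -E conjcM conjCK.
by [].
Qed.

Lemma opnorm_le T S (e : R) f : bounded_operator ipH ipH T -> bounded_operator ipH ipH S ->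
  opnorm ipH ipH (fun x => T x - S x) < e -> norml (U (T f) - U (S f)) <= e * norml (U f).
Proof.
move=> [Tl [M TM]] [Sl [K SK]] De.
have UB g h : U (g - h) = U g - U h.
  by apply: ell2_ext => m; rewrite addrC -scaleN1r Ulin mulN1r addrC.
have Dn g : hnorm ipH (T g - S g) = norml (U (T g) - U (S g)) by rewrite Unorm UB.
have [f0|fn0] := eqVneq (norml (U f)) 0.
  have z0 : U (T f) - U (S f) = 0.
    have hz g : hnorm ipH g <= 0 -> U g = 0.
      rewrite Unorm => g0; apply: ell2_ext => m; apply/eqP; rewrite -normc_eq0 eq_le normc_ge0 andbT.
      exact: le_trans (ell2_coord_le _ _) g0.
    by rewrite !hz ?subrr//; [have := SK f|have := TM f]; rewrite (Unorm f) f0 mulr0.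
  rewrite z0 f0 mulr0 -(mulr0 0) -[X in _ <= 0 * X](f0).
  by apply: ell2_norm_diagonal => // m; rewrite normc0 mul0r.
have fp : 0 < norml (U f) by rewrite lt0r fn0 ell2_norm_ge0.
(* [g] is [f] normalized; the summand 0 gives it the shape to which [linear] applies. *)
pose c : R[i] := ((norml (U f))^-1)%:C; pose g : H := c *: f + 0.
have Ug m : U g m = c * U f m.
  by rewrite /g Ulin U0 addr0.
have g1 : hnorm ipH g <= 1.
  rewrite Unorm -(mulVf fn0); apply: ell2_norm_diagonal; first by rewrite invr_ge0 ltW.
  by move=> m; rewrite Ug normcM normc_real ger0_norm// invr_ge0 ltW.
have Dg : norml (U (T g) - U (S g)) <= opnorm ipH ipH (fun x => T x - S x).
  rewrite -Dn; apply: sup_ubound; last by exists g.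
  (* [sup] is an upper bound only of a set that is bounded, hence the boundedness of both
     operators. *)
  exists (2 * (`|M| + `|K|)) => _ [h h1 <-]; rewrite Dn; apply: le_trans (ell2_normB _ _) _.
  rewrite ler_wpM2l// -!Unorm; apply: lerD.
    apply: le_trans (TM h) _; apply: (@le_trans _ _ (`|M| * hnorm ipH h)).
      by rewrite ler_wpM2r ?ler_norm// Unorm ell2_norm_ge0.
    by rewrite ler_piMr.
  apply: le_trans (SK h) _; apply: (@le_trans _ _ (`|K| * hnorm ipH h)).
    by rewrite ler_wpM2r ?ler_norm// Unorm ell2_norm_ge0.
  by rewrite ler_piMr.
have lin0 (L : H -> H) m : linear L -> U (L g) m = c * U (L f) m.
  move=> Ll; have L0 : L 0 = 0.
    by have := Ll 1 0 0; rewrite scale1r addr0 scale1r => /eqP; rewrite -subr_eq subrr eq_sym => /eqP.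
  by rewrite /g Ll L0 Ulin U0 addr0.
have : norml (U (T f) - U (S f)) <= norml (U f) * norml (U (T g) - U (S g)).
  apply: ell2_norm_diagonal; first exact: ltW.
  move=> m; have -> : (U (T f) - U (S f)) m = (norml (U f))%:C * (U (T g) - U (S g)) m.
    transitivity ((norml (U f))%:C * (U (T g) m - U (S g) m)); last by [].
    rewrite -[LHS]/(U (T f) m - U (S f) m).
    by rewrite !lin0// -mulrBr mulrA -real_complexM mulfV// mul1r.
  by rewrite normcM normc_real gtr0_norm.
move/le_trans; apply; rewrite mulrC; apply: ler_wpM2r; first exact: ltW.
exact: le_trans Dg (ltW De).
Qed.

(** The candidate entries are the diagonal ones of [T] itself; approximation in norm by one diagonal
    operator controls both [T f] and these entries. *)
Lemma diagonal_closed T : bounded_operator ipH ipH T ->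
  (forall e : R, 0 < e -> exists2 S, diagonal S & opnorm ipH ipH (fun x => T x - S x) < e) ->
  diagonal T.
Proof.
move=> Tb HT; apply: (@diagonal_of T (fun m => U (T (V (delta m))) m)) => // f m.
apply/eqP; rewrite -subr_eq0 -normc_eq0 eq_le normc_ge0 andbT; apply/ler_addgt0Pr => e e0; rewrite add0r.
(* The operator and its entries each cost at most [d] times the norm of [U f]; the summand 1 keeps
   the denominator positive. *)
have K1 : 0 < 2 * norml (U f) + 1 by rewrite ltr_wpDl// mulr_ge0 ?ell2_norm_ge0.
have d0 : 0 < e / (2 * norml (U f) + 1) by rewrite divr_gt0.
have [S Sd TS] := HT _ d0; have Sbd := diagonal_bounded Sd; have [b [M [M0 bM Sb]]] := Sd.
set d := e / _ in d0 TS.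
have h1 : normc (U (T f) m - b m * U f m) <= d * norml (U f).
  rewrite -Sb; exact: le_trans (ell2_coord_le (U (T f) - U (S f)) m) (opnorm_le f Tb Sbd TS).
have h2 : normc (U (T (V (delta m))) m - b m) <= d.
  have -> : b m = U (S (V (delta m))) m by rewrite Sb VK deltaE eqxx mulr1.
  apply: le_trans (ell2_coord_le (U (T (V (delta m))) - U (S (V (delta m)))) m) _.
  apply: le_trans (opnorm_le (V (delta m)) Tb Sbd TS) _.
  by rewrite VK ler_piMr ?norm_delta// ltW.
move: h1 h2; set w := U (T (V (delta m))) m; set x := U (T f) m; set y := U f m => h1 h2.
have -> : x - w * y = (x - b m * y) - (w - b m) * y.
  have alg (p q r s : R[i]) : q - p * r = (q - s * r) - (p - s) * r by ring.
  exact: alg.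
apply: le_trans (normcB _ _) _; rewrite normcM.
have h3 : normc (w - b m) * normc y <= d * norml (U f).
  by apply: ler_pM => //; [exact: normc_ge0|exact: normc_ge0|exact: ell2_coord_le].
apply: le_trans (lerD h1 h3) _.
have E : d * (2 * norml (U f) + 1) = e by rewrite /d divfK// gt_eqF.
rewrite -E mulrDr; move: (norml (U f)) => q; rewrite mulr1.
have alg (p r : R) : 0 <= p -> p * r + p * r <= p * (2 * r) + p.
  by move=> p0; rewrite (_ : p * (2 * r) = p * r + p * r) ?lerDl//; ring.
exact: alg (ltW d0).
Qed.

Lemma diagonal_cstar : cstar_subalgebra ipH diagonal.
Proof.
split.
- by move=> S; exact: diagonal_bounded.
- by exists (fun=> 0), 0; split=> // [m|f m]; rewrite ?normc0// mul0r U0.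
split.
- move=> c S T [b [M [M0 bM Sb]]] [b' [M' [M0' bM' Tb]]].
  exists (fun m => c * b m + b' m), (normc c * M + M'); split.
  + by rewrite addr_ge0 ?mulr_ge0 ?normc_ge0.
  + move=> m; apply: le_trans (normcD _ _) _; apply: lerD => //.
    by rewrite normcM ler_wpM2l ?normc_ge0.
  + by move=> f m; rewrite Ulin Sb Tb mulrDl mulrA.
- move=> S T [b [M [M0 bM Sb]]] [b' [M' [M0' bM' Tb]]].
  exists (fun m => b m * b' m), (M * M'); split.
  + exact: mulr_ge0.
  + by move=> m; rewrite normcM; apply: ler_pM => //; exact: normc_ge0.
  + by move=> f m; rewrite /= Sb Tb mulrA.
- by move=> S T Sd _; exact: diagonal_adjoint.
- exact: diagonal_closed.
Qed.

Lemma diagonal_commute S T : diagonal S -> diagonal T -> S \o T = T \o S.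
Proof.
move=> [b [M [_ _ Sb]]] [b' [M' [_ _ Tb]]]; apply/funext => f; apply: Uinj; apply: ell2_ext => m.
by rewrite /comp !(Sb, Tb) mulrCA.
Qed.

End diagonal_operators.

Section rearrangement_sum.
Context {R : realType} {n : nat}.
Local Notation index := {ffun 'I_n -> nat}.
Local Notation norml x := (hnorm (@ell2_ip R index) x).
Local Notation P := (decreasing_indices n).
Local Notation V := (@ell2_rearrangements R n).
Implicit Types (x y : ell2 R index) (m iota : index).

Lemma exists_decreasing m : exists2 iota, P iota & rearrangements iota m.
Proof.
pose t : n.-tuple nat := [tuple m j | j < n]; pose s := [tuple of sort geq t].
have /tuple_permP[p tE] : perm_eq t s by rewrite perm_sym perm_sort.
exists [ffun j => tnth s j].
  move=> j k jk; rewrite !ffunE !(tnth_nth 0%N).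
  have tr : transitive geq by move=> a b c /= ba ac; exact: leq_trans ac ba.
  apply: (sorted_leq_nth tr _ 0%N) => //; try by rewrite inE size_tuple.
    by move=> a /=.
  by apply: sort_sorted => a b; exact: leq_total.
exists p; apply/ffunP => j; rewrite !ffunE.
have -> : m j = tnth t j by rewrite tnth_mktuple.
by rewrite (tnth_nth 0%N) tE -tnth_nth tnth_mktuple.
Qed.

(** Two sorted sequences that are permutations of one another coincide. *)
Lemma decreasing_unique iota iota' m : P iota -> P iota' -> rearrangements iota m ->
  rearrangements iota' m -> iota = iota'.
Proof.
pose t (k : index) : n.-tuple nat := [tuple k j | j < n].
have ts (k : index) : P k -> sorted geq (t k).
  move=> Pk; apply/(sortedP 0%N) => i; rewrite size_tuple => i1.
  have i0 : (i < n)%N by exact: ltnW.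
  have nthE l (ln : (l < n)%N) : nth 0%N (t k) l = k (Ordinal ln).
    by apply: etrans (esym (tnth_nth 0%N (t k) (Ordinal ln))) _; rewrite tnth_mktuple.
  by rewrite (nthE _ i0) (nthE _ i1) /=; apply: Pk => /=.
have tp (k : index) : rearrangements k m -> perm_eq (t m) (t k).
  move=> [s ->]; apply/tuple_permP; exists s; congr val; apply: eq_from_tnth => j.
  by rewrite !tnth_mktuple ffunE.
move=> Pi Pi' /tp mi /tp mi'.
have E : t iota = t iota'.
  apply/val_inj; apply: (@sorted_eq _ geq).
  - by move=> a b c /= ba ac; exact: leq_trans ac ba.
  - by move=> a b /andP[ab ba]; apply/eqP; rewrite eqn_leq; apply/andP.
  - exact: ts.
  - exact: ts.
  - by rewrite perm_sym in mi; exact: perm_trans mi mi'.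
apply/ffunP => j; have := congr1 (fun u => tnth u j) E.
by rewrite !tnth_mktuple.
Qed.

Lemma restrict_summable x iota : (\esum_(m in [set: index])
  (normc (if m \in rearrangements iota then x m else 0 : R[i]) ^+ 2)%:E < +oo)%E.
Proof.
apply: le_lt_trans (ell2P x); apply: le_esum => m _; rewrite lee_fin.
by case: ifP => // _; rewrite normc0 expr0n sqr_ge0.
Qed.

Definition restrict x iota : ell2 R index := ell2_of (restrict_summable x iota).

Lemma rearrangements_direct_sum : hilbert_direct_sum (@ell2_ip R index) P V.
Proof.
split.
- move=> iota _; split.
  + by move=> m _.
  + by move=> c x y Vx Vy m mN; rewrite ell2D Vx// Vy// mulr0 addr0.
  + move=> x H m mN; apply/eqP; rewrite -normc_eq0 eq_le normc_ge0 andbT; apply/ler_addgt0Pr => e e0.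
    rewrite add0r; have [y Vy xy] := H _ e0.
    have -> : x m = (x - y) m by rewrite -[RHS]/(x m - y m) Vy// subr0.
    exact: le_trans (ell2_coord_le _ _) (ltW xy).
- move=> i j x y Pi Pj ij Vx Vy; apply: has_csum_unique (ell2_ip_has_csum x y) _ => e e0.
  exists fset0 => F _; rewrite big1 ?subrr ?normc0 ?ltW// => m _.
  have [im|im] := pselect (rearrangements i m); last by rewrite Vx// mul0r.
  have [jm|jm] := pselect (rearrangements j m); last by rewrite (Vy m)// rmorph0 mulr0.
  by case: ij; exact: decreasing_unique im jm.
move=> x; exists (restrict x).
  by move=> iota _ m mN; rewrite /restrict /= memNset.
move=> e e0; have e20 : 0 < (e / 2) ^+ 2 by rewrite exprn_gt0// divr_gt0.
(* [G0] carries the square sum of [x] up to [(e/2)^2]. Once the index set contains the decreasing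
   representatives of [G0], the difference vanishes on [G0]. *)
have [G0 HG] := ell2_tail x e20.
have /choice[d Hd] m : exists iota, P iota /\ rearrangements iota m.
  by have [iota Pi im] := exists_decreasing m; exists iota.
exists [fset d m | m in G0]%fset; split.
  by move=> i /imfsetP[m /= _ ->]; have [] := Hd m.
move=> F FP F0F; apply: ell2_norm_lt => //; apply: ell2_norm2_le => K.
have coord m : (x - \sum_(i <- F) restrict x i) m = if d m \in F then 0 else x m.
  rewrite -[LHS]/(x m - (\sum_(i <- F) restrict x i : ell2 R index) m) ell2_sumE.
  have [Pd dm] := Hd m; case: ifPn => dF.
    rewrite (big_fsetD1 (d m))//= mem_set// big_seq big1 ?addr0 ?subrr// => i.
    rewrite in_fsetD1 => /andP[id iF]; rewrite memNset// => im.
    by move: id; rewrite (decreasing_unique (FP i iF) Pd im dm) eqxx.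
  rewrite big_seq big1 ?subr0// => i iF /=; rewrite memNset// => im.
  by move: dF; rewrite -(decreasing_unique (FP i iF) Pd im dm) iF.
apply: (@le_trans _ _ (\sum_(m <- (K `\` G0)%fset) normc (x m) ^+ 2)); last first.
  by apply: HG; apply/fdisjointP => m mG; rewrite in_fsetD mG.
have -> : \sum_(m <- K) normc ((x - \sum_(i <- F) restrict x i) m) ^+ 2 =
    \sum_(m <- K) normc (if d m \in F then 0 else x m) ^+ 2.
  by apply: eq_bigr => m _; congr (normc _ ^+ 2); exact: coord.
rewrite (bigID (fun m => m \in G0)) /= big1_seq ?add0r; last first.
  move=> m /andP[mG _]; rewrite ifT ?normc0 ?expr0n//.
  by apply: (fsubsetP F0F); apply/imfsetP; exists m.
have -> : \sum_(m <- (K `\` G0)%fset) normc (x m) ^+ 2 =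
    \sum_(m <- K | m \notin G0) normc (x m) ^+ 2.
  rewrite -[RHS]big_filter; apply: perm_big; apply: uniq_perm; rewrite ?filter_uniq ?fset_uniq//.
  by move=> m; rewrite mem_filter in_fsetD.
apply: ler_sum => m _.
by case: ifP => // _; rewrite normc0 expr0n sqr_ge0.
Qed.

(** On a finite sum of components the operator acts block by block, since [g] is constant on each
    block; its boundedness carries the convergence over. *)
Lemma rearrangements_operator (g : index -> R[i]) (S : ell2 R index -> ell2 R index) :
  bounded_operator (@ell2_ip R index) (@ell2_ip R index) S -> (forall x m, S x m = g m * x m) ->
  (forall iota m, P iota -> rearrangements iota m -> g m = g iota) ->
  direct_sum_operator (@ell2_ip R index) P V (fun iota x => g iota *: x) S.
Proof.
move=> Sb Sg gi; split=> //.
  by move=> i x _ Vx m mN; rewrite ell2_scale_coord Vx// mulr0.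
have [Sl [M SM]] := Sb.
move=> x y Vy xy e e0; have M1 : 0 < `|M| + 1 by rewrite ltr_wpDl.
have [F0 [F0P HF]] := xy _ (divr_gt0 e0 M1); exists F0; split=> // F FP F0F.
have := HF F FP F0F; rewrite ltr_pdivlMr// => /(le_lt_trans _); apply.
have -> : S x - \sum_(i <- F) g i *: y i = S (x - \sum_(i <- F) y i).
  apply: ell2_ext => m; rewrite Sg -[LHS]/(S x m - (\sum_(i <- F) g i *: y i : ell2 R index) m).
  rewrite -[X in _ = _ * X]/(x m - (\sum_(i <- F) y i : ell2 R index) m) !ell2_sumE Sg mulrBr; congr (_ - _).
  rewrite mulr_sumr big_seq [RHS]big_seq; apply: eq_bigr => i iF; rewrite ell2_scale_coord.
  have [im|im] := pselect (rearrangements i m); first by rewrite (gi i m (FP i iF) im).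
  by rewrite (Vy i (FP i iF) m im) !mulr0.
apply: le_trans (SM _) _; rewrite mulrC ler_wpM2l ?ell2_norm_ge0//.
by rewrite (le_trans (ler_norm M))// lerDl.
Qed.

End rearrangement_sum.

Section toeplitz_algebra_structure.
Context {R : realType} {n : nat} (alpha : R) (alpha_gtN1 : -1 < alpha).
Local Notation index := {ffun 'I_n -> nat}.
Local Notation U := (coefficients (n := n) alpha).
Local Notation H := (bergman n alpha).
Local Notation ipH := (bergman_ip (n := n) alpha).

Local Opaque coefficients toeplitz.

Lemma toeplitz_diagonal a : symmetric_separately_radial a -> diagonal U (toeplitz alpha a).
Proof.
move=> sa; have VU := bergman_ofK alpha_gtN1 (n := n); have Uip := coefficients_ip alpha_gtN1 (n := n).
apply: (diagonal_of VU Uip (b := gamma alpha a)); first exact: (toeplitz_bounded alpha_gtN1 sa.1).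
by move=> f m; exact: coefficients_toeplitz_gamma.
Qed.

Lemma toeplitz_algebra_diagonal S : toeplitz_algebra (n := n) alpha S -> diagonal U S.
Proof.
have lin := coefficients_linear alpha_gtN1 (n := n).
have UV := coefficientsK alpha_gtN1 (n := n); have VU := bergman_ofK alpha_gtN1 (n := n).
have Uip := coefficients_ip alpha_gtN1 (n := n).
apply: smallest_sub; first exact: (diagonal_cstar lin UV VU Uip).
by move=> _ [a sa <-]; exact: toeplitz_diagonal.
Qed.

End toeplitz_algebra_structure.

(** The adjoint is determined by [U], so the existential quantifier leaves no freedom. The clauses
    on the coordinates of [U f] and on [toeplitz_fun] certify that the default values in the two
    definitions do not occur. *)
Theorem theorem6 (R : realType) (n : nat) (alpha : R)
    (n_ge1 : (1 <= n)%N) (alpha_gtN1 : -1 < alpha) :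
  let ipH := bergman_ip (n := n) alpha in
  let ipl := @ell2_ip R {ffun 'I_n -> nat} in
  let U := coefficients (n := n) alpha in
  (forall S T, toeplitz_algebra (n := n) alpha S ->
     toeplitz_algebra (n := n) alpha T -> S \o T = T \o S) /\
  [/\ forall (f : bergman n alpha) m, U f m = ip_alpha alpha f (monomial alpha m),
      unitary ipH ipl U,
      hilbert_direct_sum ipl (decreasing_indices n) (ell2_rearrangements R)
    & exists2 Uadj : ell2 R {ffun 'I_n -> nat} -> bergman n alpha,
        adjoint ipH ipl U Uadj &
        forall a : 'rV[R[i]]_n -> R[i], symmetric_separately_radial a ->
          [/\ forall (f : bergman n alpha) z,
                toeplitz alpha a f z = toeplitz_fun alpha a f z,
              bounded_operator ipH ipH (toeplitz alpha a),
              direct_sum_operator ipl (decreasing_indices n) (ell2_rearrangements R)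
                (fun iota x => gamma alpha a iota *: x)
                (fun x => U (toeplitz alpha a (Uadj x))),
              forall x m, U (toeplitz alpha a (Uadj x)) m = gamma alpha a m * x m
            & forall iota m, decreasing_indices n iota -> rearrangements iota m ->
                gamma alpha a m = gamma alpha a iota]].
Proof.
move=> ipH ipl U; have UV := coefficientsK alpha_gtN1 (n := n).
have VU := bergman_ofK alpha_gtN1 (n := n); have Uip := coefficients_ip alpha_gtN1 (n := n).
split.
  move=> S T /(toeplitz_algebra_diagonal alpha_gtN1) Sd /(toeplitz_algebra_diagonal alpha_gtN1) Td.
  exact: (diagonal_commute UV Sd Td).
split.
- exact: coefficientsE.
- exact: coefficients_unitary.
- exact: rearrangements_direct_sum.
(* The inverse of a unitary map is its adjoint. *)
exists (bergman_of alpha_gtN1); first by move=> f x; rewrite -[RHS]Uip VU.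
move=> a sa; have E x m : U (toeplitz alpha a (bergman_of alpha_gtN1 x)) m = gamma alpha a m * x m.
  by apply: etrans (coefficients_toeplitz_gamma alpha_gtN1 _ _ sa) _; rewrite VU.
split.
- by move=> f z; exact: (toeplitzE alpha_gtN1 f z sa.1).
- exact: (toeplitz_bounded alpha_gtN1 sa.1).
- apply: (rearrangements_operator (diagonal_conjugate VU (toeplitz_diagonal alpha_gtN1 sa)) E) => iota m _.
  exact: gamma_rearrangement.
- exact: E.
- by move=> iota m _; exact: gamma_rearrangement.
Qed.
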